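(* Let $r\ge2$ and let $\omega_1,\dots,\omega_r\in\mathbf{C}$ lie in the open upper half plane with $\arg(\omega_j)<\arg(\omega_k)$ for $j<k$. Let $z\in D:=\{\sum_{k=1}^r a_k\omega_k : 0<a_1,\dots,a_r<1\}$. Put $z_k=z/\omega_k$, $\omega_{jk}=\omega_j/\omega_k$, and $\boldsymbol{\omega}=(\omega_1,\dots,\omega_r)$. Then for all $s\in\mathbf{C}$ (as an identity of meromorphic functions of $s$), $$\zeta_r(s,z\mid\boldsymbol{\omega})=\frac{1}{2i\sin(\pi s)}\Big\{\sum_{k=1}^r(-1)^{k-1}\xi_r\big(s,\textstyle\sum_{l=1}^{k-1}\omega_l-z\mid\omega_k;\boldsymbol{\omega}^{(k)}\big)-\sum_{k=1}^r(-1)^{r-k}e^{-\pi i s}\xi_r\big(s,z-\textstyle\sum_{l=k+1}^{r}\omega_l\mid\omega_k;\boldsymbol{\omega}^{(k)}\big)\Big\},$$ where $\boldsymbol{\omega}^{(k)}=(\omega_1,\dots,\omega_{k-1},-\omega_{k+1},\dots,-\omega_r)$, and moreover $$\zeta_r(s,z\mid\boldsymbol{\omega})=(2\pi)^{s-1}\Gamma(1-s)\Big\{e^{\frac{\pi}{2}i(s-1)}\sum_{k=1}^r\omega_k^{-s}\sum_{n=1}^\infty n^{s-1}e^{2\pi i n z_k}\prod_{j\ne k}(1-e^{2\pi i n\omega_{jk}})^{-1}+e^{-\frac{\pi}{2}i(s-1)}\sum_{k=1}^r\omega_k^{-s}\sum_{n=1}^\infty n^{s-1}e^{-2\pi i n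 z_k}\prod_{j\ne k}(1-e^{-2\pi i n\omega_{jk}})^{-1}\Big\},$$ where the products run over $1\le j\le r$, $j\ne k$.
   Context: Conventions: for $w\in\mathbf{C}\setminus\{0\}$, $\arg w\in(-\pi,\pi]$ and $w^{-s}=\exp(-s(\log|w|+i\arg w))$. Barnes zeta function: for nonzero $z,\omega_1,\dots,\omega_r$ whose arguments (including that of $z$) have maximum minus minimum $<\pi$, $\zeta_r(s,z\mid\omega_1,\dots,\omega_r)=\sum_{m_1,\dots,m_r\ge0}(z+m_1\omega_1+\cdots+m_r\omega_r)^{-s}$ for $\operatorname{Re}(s)>r$, continued meromorphically to $s\in\mathbf{C}$. Bilateral zeta function: let $r\ge0$, $0<\arg\omega_0\le\pi$, $\arg\omega_0-\pi\le\arg z\le\arg\omega_0$, and $\arg\omega_0-\pi<\arg\omega_j<\arg\omega_0$ for $1\le j\le r$. Then $$\xi_{r+1}(s,z\mid\omega_0;\omega_1,\dots,\omega_r)=\zeta_{r+1}(s,z+\omega_0\mid\omega_0,\omega_1,\dots,\omega_r)+\zeta_{r+1}(s,z\mid-\omega_0,\omega_1,\dots,\omega_r),$$ i.e. $\sum_{n\in\mathbf{Z}}\sum_{m_1,\dots,m_r\ge0}(z+n\omega_0+m_1\omega_1+\cdots+m_r\omega_r)^{-s}$ for $\operatorname{Re}(s)>r+1$; for other $s$ it is defined by analytic continuation in $s$. (In the claim $\omega_0$ is taken to be $\omega_k$, and there are $r-1$ further parameters.) *)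

(* Defs.v *)
From HB Require Import structures.
From mathcomp Require Import all_boot all_order all_algebra.
From mathcomp Require Import finmap complex.
From mathcomp Require Import all_classical all_reals all_analysis.
From mathcomp Require summability.

Set Implicit Arguments.
Unset Strict Implicit.
Unset Printing Implicit Defensive.

Import Order.TTheory GRing.Theory Num.Theory.
Import numFieldNormedType.Exports.

Local Open Scope classical_set_scope.
Local Open Scope ring_scope.
Local Open Scope complex_scope.

Section ComplexFunctions.
Variable R : realType.
Local Notation C := R[i].

Definition cexp (z : C) : C :=
  (expR (complex.Re z) * cos (complex.Im z))
  +i* (expR (complex.Re z) * sin (complex.Im z)).

Definition csin (z : C) : C := (cexp ('i * z) - cexp (- ('i * z))) / (2 * 'i).

Definition cabs (w : C) : R := complex.Re `|w|.

(* Principal argument, in ]-pi, pi], of a nonzero w. *)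
Definition carg (w : C) : R :=
  if 0 <= complex.Im w then acos (complex.Re w / cabs w)
  else - acos (complex.Re w / cabs w).

(* w ^ t for the principal branch; only meaningful for w != 0. *)
Definition cpow (w t : C) : C := cexp (t * (ln (cabs w) +i* carg w)).

(* The topology of R[i] is found by the library only on the alias C^o, which is
   R[i] as a normed space over itself. *)

(* Euler's limit n! n^s / (s (s + 1) ... (s + n)), which converges to Gamma(s)
   for every s other than 0, -1, -2, ... *)
Definition cGamma (s : C) : C :=
  limn (fun n : nat =>
    (n`!)%:R * cpow n%:R s / \prod_(0 <= j < n.+1) (s + j%:R) : C^o).

Definition series_from1 (u : nat -> C) : nat -> C^o :=
  fun N => \sum_(1 <= n < N) u n.

(* \sum_(n >= 1) u n, when it converges. *)
Definition sum_from1 (u : nat -> C) : C := limn (series_from1 u).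

(* Derivability over the scalar field C is complex differentiability. *)
Definition holomorphic_at (f : C -> C) (c : C) :=
  \forall s \near (c : C^o), derivable (f : C^o -> C^o) s 1.

(* Functions are total, so the value of a meromorphic function at an isolated
   point is arbitrary. *)
Definition meromorphic (f : C -> C) :=
  forall c : C, exists (n : nat) (g : C -> C),
    holomorphic_at g c /\
    \forall s \near (c : C^o)^', f s = g s / (s - c) ^+ n.

Definition mero_eq (f g : C -> C) :=
  [/\ meromorphic f, meromorphic g &
      forall c : C, \forall s \near (c : C^o)^', f s = g s].

(* F extends f from the half plane Re s > sigma to a meromorphic function whose
   removable singularities have been removed; the value at a pole is arbitrary. *)
Definition is_mero_continuation (sigma : R) (f F : C -> C) :=
  [/\ meromorphic F,
      forall c : C^o, cvg ((F s : C^o) @[s --> c^']) ->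
        {for c, continuous (F : C^o -> C^o)} &
      forall s : C, sigma < complex.Re s -> F s = f s].

Definition mero_continuation (sigma : R) (f : C -> C) : C -> C :=
  xget (fun=> 0) [set F | is_mero_continuation sigma f F].

(* The sum over m in N^r is unordered. *)
Definition barnes_series (r : nat) (z : C) (w : 'I_r -> C) (s : C) : C :=
  summability.sum (fun m : {ffun 'I_r -> nat} =>
    cpow (z + \sum_(j < r) (m j)%:R * w j) (- s) : C^o).

(* zeta_r(s, z | w); meaningful when z and the w j are nonzero and their
   arguments lie within an interval of length less than pi. *)
Definition barnes_zeta (r : nat) (z : C) (w : 'I_r -> C) : C -> C :=
  mero_continuation r%:R (barnes_series z w).

Definition fcons (n : nat) (w0 : C) (w : 'I_n -> C) : 'I_n.+1 -> C :=
  fun i => if unlift ord0 i is Some j then w j else w0.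

(* xi_{n+1}(s, z | w0; w) *)
Definition bilateral_zeta (n : nat) (z w0 : C) (w : 'I_n -> C) (s : C) : C :=
  barnes_zeta (z + w0) (fcons w0 w) s + barnes_zeta z (fcons (- w0) w) s.

(* The family (w_1, ..., w_{k-1}, - w_{k+1}, ..., - w_r). *)
Definition flip_from (r : nat) (w : 'I_r -> C) (k : 'I_r) : 'I_r.-1 -> C :=
  fun j => if (lift k j < k)%N then w (lift k j) else - w (lift k j).

(* The general term of the Fourier-type series, for t = 2 pi i or - 2 pi i. *)
Definition lambert_term (t : C) (r : nat) (z : C) (w : 'I_r -> C) (k : 'I_r)
    (s : C) (n : nat) : C :=
  cpow n%:R (s - 1) * cexp (t * n%:R * (z / w k)) *
  \prod_(j < r | j != k) (1 - cexp (t * n%:R * (w j / w k)))^-1.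

End ComplexFunctions.

(* Main.v *)
Require Import Defs.
From HB Require Import structures.
From mathcomp Require Import all_boot all_order all_algebra.
From mathcomp Require Import finmap complex.
From mathcomp Require Import all_classical all_reals all_analysis.
From mathcomp Require Import ring lra zify.
From mathcomp Require summability.

(* For Re s > r everything is a rearrangement of absolutely convergent sums. Let A_j be the Barnes
   series at sum_(l < j) w_l - z for the periods w_l (l < j) and - w_l (l >= j), and B_j the one at
   z - sum_(l >= j) w_l for the same periods. Splitting Z into n >= 0 and n < 0, the k-th bilateral
   series is A_(k+1) + A_k, respectively B_(k+1) + B_k, so that the alternating sums telescope to the
   corners A_0 and B_r, which are multiples of the Barnes series at z, and A_r and B_0, which cancel.
   Lipschitz's formula turns each bilateral series into a Lambert series. It is obtained by applying
   a roots of unity filter to the binomial series of (1 - q)^(- s), the N-th root of unity sums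
   converging to both sides as N grows; the reciprocal Gamma function appears as the limit of
   N^(1 - s) times the N-th binomial coefficient, and the reflection formula, which comes from the
   factorization of X^N - 1, yields the factor sin(pi s). The identities extend to all s by the
   identity theorem, the Barnes zeta function being continued by induction on r, one strip at a
   time, from the Taylor expansion of its difference equation. Complex analysis is developed from
   Goursat's theorem on rectangles: the bound for f at the centre of a square by its maximum on the
   boundary is enough for the identity theorem and for the holomorphy of dominated series. *)

Set Implicit Arguments.
Unset Strict Implicit.
Unset Printing Implicit Defensive.

Import Order.TTheory GRing.Theory Num.Theory.
Import numFieldNormedType.Exports.

Local Open Scope classical_set_scope.
Local Open Scope ring_scope.
Local Open Scope complex_scope.

(** * Complex numbers with real absolute values *)

(** Two constraints shape the argument. First, powers use the principal branch, so [cpow] is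
    multiplicative only when arguments add up within ]-pi, pi]. The Barnes series are therefore kept
    inside a half plane [halfplane u] whose normal has nonnegative real part, which misses the
    negative real axis. The periods [flip_from omega k] lie strictly on one side of the line through
    [omega k], and [omega k] lies on that line. Tilting the line one way or the other gives a half
    plane for either half of the bilateral series, but none serves both, so the two halves are
    continued separately. Secondly, the value of a meromorphic function at a pole is arbitrary, so
    equalities propagate through punctured neighbourhoods, from one point of the half plane of
    convergence where the sine does not vanish. Limits are handled as dominated limits of unordered
    sums: infinite products become telescoping series, and the passage from N-th roots of unity to
    sums over the integers rests on a majorant uniform in N. The values N = 2 n + 1 are used because
    the shifts -n, ..., n are then symmetric and the nontrivial roots of unity pair off. *)

Section ComplexBasics.
Variable R : realType.
Local Notation C := R[i].
Implicit Types (z w : C) (x y e : R).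

Lemma normC_cabs z : `|z| = (cabs z)%:C.
Proof. by []. Qed.

Lemma cabs_ge0 z : 0 <= cabs z.
Proof. by rewrite -ler0c -normC_cabs normr_ge0. Qed.

Lemma cabs0 : cabs (0 : C) = 0.
Proof. by apply: complexI; rewrite -normC_cabs normr0. Qed.

Lemma cabs1 : cabs (1 : C) = 1.
Proof. by apply: complexI; rewrite -normC_cabs normr1. Qed.

Lemma cabs_eq0 z : (cabs z == 0) = (z == 0).
Proof. by rewrite -(inj_eq (@complexI R)) -normC_cabs normr_eq0. Qed.

Lemma cabs_gt0 z : (0 < cabs z) = (z != 0).
Proof. by rewrite lt_def cabs_ge0 andbT cabs_eq0. Qed.

Lemma cabsM z w : cabs (z * w) = cabs z * cabs w.
Proof. by apply: complexI; rewrite rmorphM /= -!normC_cabs normrM. Qed.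

Lemma cabsV z : cabs z^-1 = (cabs z)^-1.
Proof. by apply: complexI; rewrite fmorphV /= -!normC_cabs normfV. Qed.

Lemma cabs_div z w : cabs (z / w) = cabs z / cabs w.
Proof. by rewrite cabsM cabsV. Qed.

Lemma cabsN z : cabs (- z) = cabs z.
Proof. by apply: complexI; rewrite -!normC_cabs normrN. Qed.

Lemma cabsBC z w : cabs (z - w) = cabs (w - z).
Proof. by rewrite -cabsN opprB. Qed.

Lemma cabsX z n : cabs (z ^+ n) = cabs z ^+ n.
Proof. by apply: complexI; rewrite rmorphXn /= -!normC_cabs normrX. Qed.

Lemma le_cabsD z w : cabs (z + w) <= cabs z + cabs w.
Proof. by rewrite -lecR rmorphD /= -!normC_cabs ler_normD. Qed.

Lemma le_cabsB z w : cabs (z - w) <= cabs z + cabs w.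
Proof. by rewrite -(cabsN w) le_cabsD. Qed.

Lemma le_cabs_tri u z w : cabs (z - w) <= cabs (z - u) + cabs (u - w).
Proof. by rewrite (le_trans _ (le_cabsD _ _))// addrA subrK. Qed.

Lemma le_cabs_dist z w : `|cabs z - cabs w| <= cabs (z - w).
Proof.
rewrite ler_norml; apply/andP; split.
  have := le_cabsB z (z - w); rewrite opprB addrC subrK; lra.
have := le_cabsD (z - w) w; rewrite subrK; lra.
Qed.

Lemma cabs_sum (I : Type) (r : seq I) (P : pred I) (F : I -> C) :
  cabs (\sum_(i <- r | P i) F i) <= \sum_(i <- r | P i) cabs (F i).
Proof.
elim/big_rec2: _ => [|i y x _ h]; first by rewrite cabs0.
by apply: le_trans (le_cabsD _ _) _; rewrite lerD2l.
Qed.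

Lemma cabs_prod (I : Type) (r : seq I) (P : pred I) (F : I -> C) :
  cabs (\prod_(i <- r | P i) F i) = \prod_(i <- r | P i) cabs (F i).
Proof. by elim/big_rec2: _ => [|i y x _ <-]; rewrite ?cabs1 ?cabsM. Qed.

Lemma cabs_real x : cabs x%:C = `|x|.
Proof. by apply: complexI; rewrite -normC_cabs normc_def /= expr0n addr0 sqrtr_sqr. Qed.

Lemma cabs_nat n : cabs (n%:R : C) = n%:R.
Proof. by rewrite -(rmorph_nat (real_complex R)) cabs_real ger0_norm. Qed.

Lemma cabs_i : cabs ('i : C) = 1.
Proof. by rewrite /cabs normc_def /= expr0n expr1n add0r sqrtr1. Qed.

Lemma le_cabs_Re z : `|complex.Re z| <= cabs z.
Proof. by rewrite -lecR -normC_cabs normc_ge_Re. Qed.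

Lemma le_Re_cabs z : complex.Re z <= cabs z.
Proof. exact: le_trans (ler_norm _) (le_cabs_Re z). Qed.

Lemma le_cabs_Im z : `|complex.Im z| <= cabs z.
Proof.
have := le_cabs_Re (z * 'i); rewrite cabsM cabs_i mulr1.
by rewrite ReiNIm normrN.
Qed.

Lemma cabs_le_ReIm z : cabs z <= `|complex.Re z| + `|complex.Im z|.
Proof.
rewrite {1}[z]complexE; apply: le_trans (le_cabsD _ _) _.
by rewrite cabsM cabs_i mul1r !cabs_real.
Qed.

Lemma sqr_cabs z : cabs z ^+ 2 = complex.Re z ^+ 2 + complex.Im z ^+ 2.
Proof. by apply: complexI; rewrite rmorphXn /= -normC_cabs add_Re2_Im2. Qed.

Lemma ReD z w : complex.Re (z + w) = complex.Re z + complex.Re w.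
Proof. by case: z; case: w. Qed.
Lemma ImD z w : complex.Im (z + w) = complex.Im z + complex.Im w.
Proof. by case: z; case: w. Qed.
Lemma ReN z : complex.Re (- z) = - complex.Re z.
Proof. by case: z. Qed.
Lemma ImN z : complex.Im (- z) = - complex.Im z.
Proof. by case: z. Qed.
Lemma ReM z w : complex.Re (z * w) =
  complex.Re z * complex.Re w - complex.Im z * complex.Im w.
Proof. by case: z; case: w. Qed.
Lemma ImM z w : complex.Im (z * w) =
  complex.Re z * complex.Im w + complex.Im z * complex.Re w.
Proof. by case: z; case: w. Qed.
Lemma ReV z : complex.Re z^-1 = complex.Re z / cabs z ^+ 2.
Proof. by rewrite sqr_cabs; case: z. Qed.
Lemma ImV z : complex.Im z^-1 = - complex.Im z / cabs z ^+ 2.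
Proof. by rewrite sqr_cabs; case: z => a b /=; rewrite mulNr. Qed.
Lemma Re_sum (I : Type) (r : seq I) (P : pred I) (F : I -> C) :
  complex.Re (\sum_(i <- r | P i) F i) = \sum_(i <- r | P i) complex.Re (F i).
Proof. by elim/big_rec2: _ => // i y x _ <-; rewrite ReD. Qed.
Lemma Im_sum (I : Type) (r : seq I) (P : pred I) (F : I -> C) :
  complex.Im (\sum_(i <- r | P i) F i) = \sum_(i <- r | P i) complex.Im (F i).
Proof. by elim/big_rec2: _ => // i y x _ <-; rewrite ImD. Qed.
Lemma ReZ x z : complex.Re (x%:C * z) = x * complex.Re z.
Proof. by rewrite ReM /= mul0r subr0. Qed.
Lemma ImZ x z : complex.Im (x%:C * z) = x * complex.Im z.
Proof. by rewrite ImM /= mul0r addr0. Qed.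

Lemma eqCP z w : complex.Re z = complex.Re w -> complex.Im z = complex.Im w -> z = w.
Proof. by case: z; case: w => a b c d /= -> ->. Qed.

Lemma lec_cabs z e : (`|z| < e%:C) = (cabs z < e).
Proof. by rewrite normC_cabs ltcR. Qed.

Lemma posC_real (e : C) : 0 < e -> e = (complex.Re e)%:C /\ 0 < complex.Re e.
Proof.
rewrite ltcE /= => /andP[/eqP he ->]; split=> //.
by apply: eqCP => //=; rewrite he.
Qed.

Lemma nearCP (c : C) (P : C -> Prop) :
  (\forall s \near (c : C^o), P s) <->
  exists2 e, 0 < e & forall s, cabs (s - c) < e -> P s.
Proof.
split=> [/nbhs_normP [e e0 h]|[e e0 h]].
  have [he e1] := posC_real e0.
  by exists (complex.Re e) => // s hs; apply: h; rewrite /= he lec_cabs cabsBC.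
apply/nbhs_normP; exists e%:C; first by rewrite /= ltcR.
by move=> s /=; rewrite lec_cabs cabsBC => /h.
Qed.

Lemma dnearCP (c : C) (P : C -> Prop) :
  (\forall s \near (c : C^o)^', P s) <->
  exists2 e, 0 < e & forall s, s != c -> cabs (s - c) < e -> P s.
Proof.
rewrite /dnbhs; split=> [/nearCP [e e0 h]|[e e0 h]].
  by exists e => // s sc hs; apply: h.
by apply/nearCP; exists e => // s hs sc; apply: h.
Qed.

Lemma cvgCP (T : Type) (F : set_system T) (FF : Filter F) (f : T -> C^o) (l : C) :
  (f @ F --> (l : C^o)) <-> (forall e, 0 < e -> \forall t \near F, cabs (f t - l) < e).
Proof.
split=> [/cvgrPdist_lt h e e0|h].
  have : (0 < e%:C :> C) by rewrite ltcR.
  by move=> /h; apply: filterS => t; rewrite lec_cabs cabsBC.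
apply/cvgrPdist_lt => e /posC_real[-> e0].
by move: (h _ e0); apply: filterS => t; rewrite lec_cabs cabsBC.
Qed.

(* The same derivative as that of C^o, with real epsilons. *)
Definition cderiv (f : C -> C) (c l : C) := forall e, 0 < e ->
  exists2 d, 0 < d & forall h, cabs h < d ->
    cabs (f (c + h) - f c - h * l) <= e * cabs h.

Lemma derivableCP (f : C -> C) (c : C) :
  derivable (f : C^o -> C^o) c 1 <-> exists l, cderiv f c l.
Proof.
split.
  rewrite /derivable /= => /cvg_ex[/= l /cvgCP hl]; exists l => e e0.
  have /dnearCP[d d0 hd] := hl _ e0; exists d => // h hh.
  have [->|h0] := eqVneq h 0; first by rewrite addr0 subrr mul0r subrr cabs0 mulr0.
  have := hd h h0; rewrite subr0 => /(_ hh).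
  have -> : f (c + h) - f c - h * l = h * (h^-1 *: (f (h *: 1 + c) - f c) - l).
    by rewrite mulrBr -[_ *: 1]/(h * 1) mulr1 -[_ *: _]/(_ * _) mulrA divff// mul1r (addrC h).
  by rewrite cabsM mulrC => /ltW; apply: ler_wpM2r; rewrite cabs_ge0.
move=> [l hl]; rewrite /derivable; apply/cvg_ex; exists l; apply/cvgCP => e e0.
have e20 : 0 < e / 2 by lra.
have [d d0 hd] := hl _ e20; apply/dnearCP; exists d => // h h0; rewrite subr0 => hh.
have := hd h hh.
have -> : f (c + h) - f c - h * l = h * (h^-1 *: (f (h *: 1 + c) - f c) - l).
  by rewrite mulrBr -[_ *: 1]/(h * 1) mulr1 -[_ *: _]/(_ * _) mulrA divff// mul1r (addrC h).
rewrite cabsM mulrC ler_pM2r ?cabs_gt0// => /le_lt_trans; apply; lra.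
Qed.

End ComplexBasics.

(** * Unordered sums *)

Section UnorderedSums.
Variable R : realType.
Local Notation C := R[i].
Local Open Scope fset_scope.
Local Open Scope ring_scope.

Definition hasum (T : choiceType) (u : T -> C) (l : C) :=
  forall e : R, 0 < e -> exists A : {fset T}, forall B : {fset T}, A `<=` B ->
    cabs (\sum_(i <- B) u i - l) <= e.

(** A bound for all finite partial sums serves as a convergent majorant: it passes to subfamilies,
    multiples and products without naming the value of a sum. *)
Definition bounded_sums (T : choiceType) (M : T -> R) (K : R) :=
  forall A : {fset T}, \sum_(i <- A) M i <= K.

Definition absum (T : choiceType) (u : T -> C) :=
  exists K, bounded_sums (fun i => cabs (u i)) K.

Definition csum (T : choiceType) (u : T -> C) : C :=
  summability.sum (u : T -> C^o).

Section OneIndex.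
Variable T : choiceType.
Implicit Types (u v : T -> C) (M : T -> R) (A B : {fset T}).

Lemma hasum_csumE u l : hasum u l -> csum u = l.
Proof.
move=> h; rewrite /csum /summability.sum.
have FF : ProperFilter (@summability.totally T) by exact: summability.totally_filter.
suff H : (summability.partial_sum (u : T -> C^o) : _ -> C^o) @ summability.totally --> (l : C^o).
  exact: (@cvg_lim _ (@norm_hausdorff _ C^o) _ _ FF _ _ H).
apply/cvgCP => e e0; have e20 : 0 < e / 2 by lra.
have [A hA] := h _ e20; exists A => // B /= AB.
have -> : summability.partial_sum u B = \sum_(i <- B) u i by rewrite big_seq_fsetE.
by apply: le_lt_trans (hA B AB) _; lra.
Qed.

Lemma hasumD u v a b : hasum u a -> hasum v b -> hasum (fun i => u i + v i) (a + b).
Proof.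
move=> ha hb e e0; have e20 : 0 < e / 2 by lra.
have [A hA] := ha _ e20; have [B hB] := hb _ e20.
exists (A `|` B) => D; rewrite fsubUset => /andP[AD BD].
rewrite big_split /= opprD addrACA.
apply: le_trans (le_cabsD _ _) _.
have := hA _ AD; have := hB _ BD; lra.
Qed.

Lemma hasumZ u a c : hasum u a -> hasum (fun i => c * u i) (c * a).
Proof.
move=> ha e e0; have e20 : 0 < e / (cabs c + 1).
  by rewrite divr_gt0// ltr_wpDl// cabs_ge0.
have [A hA] := ha _ e20; exists A => D AD.
rewrite -mulr_sumr -mulrBr cabsM.
have := hA _ AD; set x := cabs (_ - _) => hx.
apply: (@le_trans _ _ ((cabs c + 1) * x)); first by apply: ler_wpM2r; rewrite ?cabs_ge0// lerDl.
by rewrite mulrC -ler_pdivlMr// ltr_wpDl// cabs_ge0.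
Qed.

Lemma hasumN u a : hasum u a -> hasum (fun i => - u i) (- a).
Proof.
move=> /(hasumZ (-1)); rewrite mulN1r.
by have -> : (fun i => -1 * u i) = (fun i => - u i) by apply/funext => i; rewrite mulN1r.
Qed.

Lemma hasumB u v a b : hasum u a -> hasum v b -> hasum (fun i => u i - v i) (a - b).
Proof. by move=> ha /hasumN; exact: hasumD. Qed.

Lemma hasum0 : hasum (fun _ : T => 0) 0.
Proof. by move=> e e0; exists fset0 => B _; rewrite big1// subr0 cabs0 ltW. Qed.

Lemma hasum_fin (I : Type) (r : seq I) (P : pred I) (u : I -> T -> C) (a : I -> C) :
  (forall i, P i -> hasum (u i) (a i)) ->
  hasum (fun t => \sum_(i <- r | P i) u i t) (\sum_(i <- r | P i) a i).
Proof.
move=> h; elim: r => [|i r IH].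
  under [X in hasum X]eq_fun do rewrite big_nil.
  by rewrite big_nil; exact: hasum0.
under [X in hasum X]eq_fun do rewrite big_cons.
rewrite big_cons; case: ifP => // Pi; exact: hasumD (h i Pi) IH.
Qed.

Lemma fsum_diff (V : zmodType) (u : T -> V) A B : A `<=` B ->
  \sum_(i <- B) u i - \sum_(i <- A) u i = \sum_(i <- B `\` A) u i.
Proof.
move=> AB; rewrite (perm_big (enum_fset A ++ enum_fset (B `\` A))) ?big_cat /=.
  by rewrite addrAC subrr add0r.
apply: uniq_perm; rewrite ?fset_uniq//.
  rewrite cat_uniq !fset_uniq /= andbT; apply/hasPn => x /=.
  by rewrite in_fsetD => /andP[].
move=> x; rewrite mem_cat in_fsetD; case: (boolP (x \in A)) => //=.
by move/(fsubsetP AB) ->.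
Qed.

Lemma fsum_le_sub M A B : (forall i, 0 <= M i) -> A `<=` B ->
  \sum_(i <- A) M i <= \sum_(i <- B) M i.
Proof. by move=> M0 /(fsum_diff M) h; rewrite -subr_ge0 h sumr_ge0. Qed.

Lemma hasum_ge0 M K : (forall i, 0 <= M i) -> bounded_sums M K ->
  exists2 S : R, hasum (fun i => (M i)%:C) S%:C & bounded_sums M S.
Proof.
move=> M0 MK; pose X := [set x | exists A, x = \sum_(i <- A) M i].
have supX : has_sup X.
  split; first by exists (\sum_(i <- fset0) M i), fset0.
  by exists K => _ [A ->]; exact: MK.
have Sup A : \sum_(i <- A) M i <= sup X by apply: ub_le_sup; [case: supX|exists A].
exists (sup X); last exact: Sup.
move=> e e0; have [_ [A ->] hA] := sup_adherent e0 supX.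
exists A => B AB; rewrite -rmorph_sum -rmorphB /= cabs_real.
have := Sup B; have := fsum_le_sub M0 AB.
rewrite ler_norml => h1 h2; lra.
Qed.

Lemma bounded_sumsW M M' K : (forall i, M i <= M' i) -> bounded_sums M' K -> bounded_sums M K.
Proof. by move=> h b A; apply: le_trans (b A); exact: ler_sum. Qed.

Lemma absum_dom u M K : (forall i, cabs (u i) <= M i) -> bounded_sums M K -> absum u.
Proof. by move=> uM hM; exists K; exact: bounded_sumsW hM. Qed.

Lemma absum_hasum u : absum u -> hasum u (csum u).
Proof.
move=> [K uK]; suff [l hl] : exists l, hasum u l by rewrite (hasum_csumE hl).
pose M i := cabs (u i); have M0 i : 0 <= M i by exact: cabs_ge0.
have [S hS _] := hasum_ge0 M0 uK.
(* A real function dominated by [M] is the difference of [f + M] and [M], both nonnegative with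
   bounded sums; this is applied to the real and imaginary parts of [u]. *)
have part (f : T -> R) : (forall i, `|f i| <= M i) -> exists s : C, hasum (fun i => (f i)%:C) s.
  move=> fM; have f0 i : 0 <= f i + M i by have := fM i; rewrite ler_norml; lra.
  have fK : bounded_sums (fun i => f i + M i) (K + K).
    move=> A; rewrite big_split /= lerD//; apply: le_trans (uK A).
    by apply: ler_sum => i _; apply: le_trans (ler_norm _) (fM i).
  have [S' hS' _] := hasum_ge0 f0 fK; exists (S'%:C - S%:C).
  have := hasumB hS' hS; congr hasum; apply/funext => i.
  by rewrite rmorphD /= addrK.
have [a ha] := part _ (fun i => le_cabs_Re (u i)).
have [b hb] := part _ (fun i => le_cabs_Im (u i)).
exists (a + 'i * b); have := hasumD ha (hasumZ 'i hb); congr hasum.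
by apply/funext => i; rewrite -complexE.
Qed.

Lemma hasum_bound u l K : bounded_sums (fun i => cabs (u i)) K -> hasum u l -> cabs l <= K.
Proof.
move=> uK ul; apply/ler_addgt0Pl => e e0; have [A hA] := ul _ e0.
have := hA A (fsubset_refl _); have := cabs_sum (enum_fset A) xpredT u.
have := uK A; rewrite cabsBC => h1 h2 h3.
have := le_cabs_tri (\sum_(i <- A) u i) l 0; rewrite !subr0; lra.
Qed.

Lemma csum_bound u M K : (forall i, cabs (u i) <= M i) -> bounded_sums M K -> cabs (csum u) <= K.
Proof.
move=> uM hM; apply: (@hasum_bound u); first exact: bounded_sumsW hM.
exact/absum_hasum/(absum_dom uM hM).
Qed.

(* The set A depends only on the majorant, which makes series of functions uniform. *)
Lemma unif_tail M K : (forall i, 0 <= M i) -> bounded_sums M K -> forall e : R, 0 < e ->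
  exists A, forall u, (forall i, cabs (u i) <= M i) -> forall B, A `<=` B ->
    cabs (csum u - \sum_(i <- B) u i) <= e.
Proof.
move=> M0 MK e e0; have [S hS SM] := hasum_ge0 M0 MK.
have e20 : 0 < e / 2 by lra.
have [A hA] := hS _ e20; exists A => u uM B AB.
have /absum_hasum hu := absum_dom uM MK.
have [D hD] := hu _ e20.
have h1 := hD _ (fsubsetUl D B); rewrite cabsBC in h1.
apply: le_trans (le_cabs_tri (\sum_(i <- D `|` B) u i) _ _) _.
rewrite (splitr e) lerD// fsum_diff ?fsubsetUr//.
apply: le_trans (cabs_sum _ _ _) _.
apply: (@le_trans _ _ (\sum_(i <- (D `|` B) `\` B) M i)); first exact: ler_sum.
rewrite -fsum_diff ?fsubsetUr//.
have := hA _ AB; rewrite -rmorph_sum -rmorphB /= cabs_real ler_norml.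
have := SM (D `|` B); lra.
Qed.

Lemma absumD u v : absum u -> absum v -> absum (fun i => u i + v i).
Proof.
move=> [K uK] [L vL]; exists (K + L) => A.
apply: le_trans (lerD (uK A) (vL A)); rewrite -big_split /=.
by apply: ler_sum => i _; exact: le_cabsD.
Qed.

Lemma absumZ u c : absum u -> absum (fun i => c * u i).
Proof.
move=> [K uK]; exists (cabs c * K) => A.
apply: le_trans (ler_wpM2l (cabs_ge0 _) (uK A)); rewrite mulr_sumr.
by apply: ler_sum => i _; rewrite cabsM.
Qed.

Lemma csumD u v : absum u -> absum v -> csum (fun i => u i + v i) = csum u + csum v.
Proof. by move=> hu hv; apply: hasum_csumE; apply: hasumD; exact: absum_hasum. Qed.

Lemma csumZ u c : absum u -> csum (fun i => c * u i) = c * csum u.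
Proof. by move=> hu; apply: hasum_csumE; apply: hasumZ; exact: absum_hasum. Qed.

(** Dominated convergence. By [unif_tail] a single finite index set approximates all the sums at
    once, which reduces the claim to the limit of a finite sum. *)
Lemma tannery (u : nat -> T -> C) (v : T -> C) M K :
  bounded_sums M K -> (forall n i, cabs (u n i) <= M i) ->
  (forall i, (fun n => u n i : C^o) @ \oo --> (v i : C^o)) ->
  (fun n => csum (u n) : C^o) @ \oo --> (csum v : C^o).
Proof.
move=> MK uM uv.
have M0 i : 0 <= M i by apply: le_trans (uM 0%N i); exact: cabs_ge0.
have vM i : cabs (v i) <= M i.
  apply/ler_addgt0Pl => e e0; have /cvgCP /(_ e e0) [N _ hN] := uv i.
  have := hN N (leqnn N); rewrite /= cabsBC => h1; have := uM N i.
  have := le_cabs_tri (u N i) (v i) 0; rewrite !subr0; lra.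
apply/cvgCP => e e0; have e30 : 0 < e / 4 by lra.
have [A hA] := unif_tail M0 MK e30.
have : (fun n => \sum_(i <- A) u n i : C^o) @ \oo --> (\sum_(i <- A) v i : C^o).
  elim: (enum_fset A) => [|i r IH].
    under eq_fun do rewrite big_nil.
    by rewrite big_nil; exact: cvg_cst.
  under eq_fun do rewrite big_cons.
  by rewrite big_cons; exact: (@cvgD _ C^o _ _ _ _ _ _ _ (uv i) IH).
move=> /cvgCP /(_ _ e30); apply: filterS => n hn.
have h1 := hA _ (uM n) A (fsubset_refl _); have h2 := hA _ vM A (fsubset_refl _).
have := le_cabs_tri (\sum_(i <- A) u n i) (csum (u n)) (csum v).
have := le_cabs_tri (\sum_(i <- A) v i) (\sum_(i <- A) u n i) (csum v).
rewrite (cabsBC (\sum_(i <- A) v i) (csum v)); lra.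
Qed.

End OneIndex.

Lemma fsum_img (T T' : choiceType) (f : T' -> T) (V : zmodType) (u : T -> V) (A : {fset T'}) :
  injective f -> \sum_(i <- [fset f x | x in A]) u i = \sum_(x <- A) u (f x).
Proof. by move=> finj; rewrite big_imfset //= => x y _ _; exact: finj. Qed.

Lemma bounded_sums_inj (T T' : choiceType) (f : T' -> T) M K :
  injective f -> bounded_sums M K -> bounded_sums (fun x => M (f x)) K.
Proof. by move=> finj MK A; rewrite -(fsum_img _ _ finj); exact: MK. Qed.

Lemma absum_inj (T T' : choiceType) (f : T' -> T) u :
  injective f -> absum u -> absum (fun x => u (f x)).
Proof. by move=> finj [K uK]; exists K; exact: (bounded_sums_inj finj uK). Qed.

Lemma hasum_reindex (T T' : choiceType) (f : T' -> T) (g : T -> T') u l :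
  cancel f g -> cancel g f -> hasum u l -> hasum (fun x => u (f x)) l.
Proof.
move=> fg gf h e e0; have [A hA] := h e e0; exists [fset g x | x in A] => B AB.
rewrite -(fsum_img u B (can_inj fg)); apply: hA; apply/fsubsetP => x xA.
apply/imfsetP; exists (g x); last by rewrite gf.
by apply: (fsubsetP AB); apply/imfsetP; exists x.
Qed.

Lemma csum_reindex (T T' : choiceType) (f : T' -> T) (g : T -> T') u :
  cancel f g -> cancel g f -> absum u -> csum (fun x => u (f x)) = csum u.
Proof. by move=> fg gf /absum_hasum h; apply: hasum_csumE; exact: hasum_reindex fg gf h. Qed.

Lemma sum_fsetX (T1 T2 : choiceType) (V : zmodType) (u : T1 * T2 -> V) (A : {fset T1})
    (B : {fset T2}) :
  \sum_(p <- A `*` B) u p = \sum_(i <- A) \sum_(j <- B) u (i, j).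
Proof.
rewrite -big_allpairs; apply: perm_big; apply: uniq_perm; rewrite ?fset_uniq//.
  by apply: allpairs_uniq; rewrite ?fset_uniq// => -[? ?] [? ?] _ _.
move=> [i j]; rewrite in_fsetM; apply/andP/allpairsP => /=.
  by move=> [iA jB]; exists (i, j).
by move=> [[i' j'] /= [iA jB [-> ->]]].
Qed.

Lemma csum_fubini (T1 T2 : choiceType) (u : T1 * T2 -> C) : absum u ->
  [/\ forall i, absum (fun j => u (i, j)), absum (fun i => csum (fun j => u (i, j))) &
      csum u = csum (fun i => csum (fun j => u (i, j)))].
Proof.
move=> au; have [K uK] := au.
have slice i : absum (fun j => u (i, j)).
  by apply: (@absum_inj _ _ (fun j => (i, j))) au => j j' [].
pose v i := csum (fun j => u (i, j)).
have hv i : hasum (fun j => u (i, j)) (v i) by exact: absum_hasum.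
(* Finitely many rows are approximated by common columns: each row is allowed an error [e / n],
   where [n] exceeds the number of rows by one so that it is never zero. *)
have approx (A1 : {fset T1}) (e : R) : 0 < e -> exists A2 : {fset T2},
    forall B, A2 `<=` B -> \sum_(i <- A1) cabs (v i - \sum_(j <- B) u (i, j)) <= e.
  move=> e0; pose n := (size (enum_fset A1)).+1.
  have en : 0 < e / n%:R by rewrite divr_gt0// ltr0n.
  pose F i := projT1 (cid (hv i _ en)).
  exists (\bigcup_(i <- A1) F i) => B hB.
  apply: (@le_trans _ _ (\sum_(i <- A1) e / n%:R)); last first.
    rewrite big_const_seq count_predT iter_addr_0 -[_ *+ #|`_|]mulr_natr mulrAC.
    by rewrite ler_pdivrMr ?ltr0n// ler_pM2l// ler_nat /n ltnW.
  rewrite !big_seq; apply: ler_sum => i iA; rewrite cabsBC.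
  apply: (projT2 (cid (hv i _ en))).
  by apply: fsubset_trans hB; exact: bigfcup_sup.
have av : absum v.
  exists K => A1; apply/ler_addgt0Pl => e e0; have [A2 hA2] := approx A1 e e0.
  apply: le_trans (lerD (hA2 A2 (fsubset_refl _)) (uK (A1 `*` A2))).
  rewrite sum_fsetX -big_split /=; apply: ler_sum => i _.
  apply: (@le_trans _ _ (cabs (v i - \sum_(j <- A2) u (i, j)) +
    cabs (\sum_(j <- A2) u (i, j)))); last by rewrite lerD2l cabs_sum.
  by apply: le_trans (le_cabsD _ _); rewrite subrK.
split=> //; symmetry; apply: hasum_csumE => e e0.
have e20 : 0 < e / 2 by lra.
have [A hA] := absum_hasum au e20.
exists [fset p.1 | p in A] => B1 hB1.
have [A2 hA2] := approx B1 _ e20.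
pose B2 := A2 `|` [fset p.2 | p in A].
have h1 := hA2 B2 (fsubsetUl _ _).
have AB : A `<=` B1 `*` B2.
  apply/fsubsetP => p pA; rewrite in_fsetM; apply/andP; split.
    by apply: (fsubsetP hB1); apply/imfsetP; exists p.
  by rewrite in_fsetU; apply/orP; right; apply/imfsetP; exists p.
have := hA _ AB; rewrite sum_fsetX => h2.
apply: le_trans (le_cabs_tri (\sum_(i <- B1) \sum_(j <- B2) u (i, j)) _ _) _.
rewrite (splitr e) lerD// -sumrB.
exact: le_trans (cabs_sum _ _ _) h1.
Qed.

Lemma absum_swap (T1 T2 : choiceType) (u : T1 * T2 -> C) :
  absum u -> absum (fun p : T2 * T1 => u (p.2, p.1)).
Proof. by apply: (@absum_inj _ _ (fun p => (p.2, p.1))) => -[? ?] [? ?] [-> ->]. Qed.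

Lemma csum_exchange (T1 T2 : choiceType) (u : T1 * T2 -> C) : absum u ->
  csum (fun i => csum (fun j => u (i, j))) = csum (fun j => csum (fun i => u (i, j))).
Proof.
move=> au; have [_ _ <-] := csum_fubini au.
have [_ _ <-] := csum_fubini (absum_swap au).
by rewrite -(@csum_reindex _ _ (fun p => (p.2, p.1)) (fun p => (p.2, p.1)))//; case.
Qed.

Lemma fset_nat_bound (A : {fset nat}) : exists N, forall n, (N <= n)%N -> A `<=` [fset i in iota 0 n].
Proof.
exists (\max_(i <- A) i.+1)%N => n hn; apply/fsubsetP => x xA.
rewrite in_fset /= mem_iota /= add0n; apply: leq_trans hn.
by apply: (@leq_bigmax_seq _ _ xpredT (fun i => i.+1)).
Qed.

Lemma sum_fset_iota (V : zmodType) (u : nat -> V) n :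
  \sum_(i <- [fset i in iota 0 n]) u i = \sum_(0 <= i < n) u i.
Proof.
rewrite (perm_big (iota 0 n)) /=; first by rewrite /index_iota subn0.
apply: uniq_perm; rewrite ?fset_uniq ?iota_uniq// => x.
by rewrite in_fset.
Qed.

Lemma hasum_series (u : nat -> C) l : hasum u l ->
  (fun n => \sum_(0 <= i < n) u i : C^o) @ \oo --> (l : C^o).
Proof.
move=> h; apply/cvgCP => e e0; have e20 : 0 < e / 2 by lra.
have [A hA] := h _ e20; have [N hN] := fset_nat_bound A.
exists N => // n /= Nn; rewrite -sum_fset_iota.
by apply: le_lt_trans (hA _ (hN _ Nn)) _; lra.
Qed.

Lemma bounded_sums_nat (M : nat -> R) K : (forall i, 0 <= M i) ->
  (forall n, \sum_(0 <= i < n) M i <= K) -> bounded_sums M K.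
Proof.
move=> M0 h A; have [N hN] := fset_nat_bound A.
by apply: le_trans (h N); rewrite -sum_fset_iota; exact: fsum_le_sub (hN _ (leqnn _)).
Qed.

End UnorderedSums.

(** * Complex exponential and logarithm *)

Section RealTrig.
Variable R : realType.
Implicit Types x y : R.

Lemma sin_mvt y : exists2 c, `|c| <= `|y| & sin y = cos c * y.
Proof.
wlog y0 : y / 0 <= y.
  move=> H; have [|/ltW y0] := leP 0 y; first exact: H.
  have [|c hc e] := H (- y); first by rewrite oppr_ge0.
  exists c; first by rewrite normrN in hc.
  by apply: oppr_inj; rewrite -sinN e mulrN.
have [|c /itvP cI] := @MVT_segment R sin cos 0 y y0 (fun x _ => is_derive_sin x).
  exact/continuous_subspaceT/continuous_sin.
by rewrite sin0 !subr0 => ->; exists c => //; rewrite !ger0_norm ?cI.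
Qed.

Lemma abs_sin_le y : `|sin y| <= `|y|.
Proof.
by have [c _ ->] := sin_mvt y; rewrite normrM ler_piMl// cos_max.
Qed.

Lemma cos_half y : cos y = 1 - 2 * sin (y / 2) ^+ 2.
Proof.
have -> : cos y = cos ((y / 2) *+ 2) by congr cos; rewrite mulr2n; lra.
by rewrite cos_mulr2n cos2sin2; ring.
Qed.

Lemma one_sub_cos y : 0 <= 1 - cos y <= y ^+ 2 / 2.
Proof.
rewrite subr_ge0 cos_le1 /= cos_half.
have := abs_sin_le (y / 2).
rewrite -ler_sqr ?nnegrE// !real_normK ?num_real//; lra.
Qed.

Lemma sin_sub_le y : `|y| <= 1 -> `|sin y - y| <= y ^+ 2.
Proof.
move=> y1; have [c hc ->] := sin_mvt y.
have /andP[h0 h] := one_sub_cos c.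
have -> : cos c * y - y = - ((1 - cos c) * y) by ring.
rewrite normrN normrM (ger0_norm h0).
have hcy : c ^+ 2 <= y ^+ 2 by rewrite -(real_normK (num_real c)) -(real_normK (num_real y)) ler_sqr ?nnegrE.
have y2 : y ^+ 2 <= 1 by rewrite -(real_normK (num_real y)) expr_le1.
apply: (@le_trans _ _ (y ^+ 2 / 2 * `|y|)); first by apply: ler_wpM2r => //; lra.
rewrite -mulrA ler_piMr ?sqr_ge0//; lra.
Qed.

Lemma expR_quad x : `|x| <= 1 / 2 -> 0 <= expR x - 1 - x <= 2 * x ^+ 2.
Proof.
move=> hx; have := expR_ge1Dx x; have := expR_ge1Dx (- x); rewrite expRN => h1 h2.
rewrite ler_norml in hx.
have e0 := expR_gt0 x.
have h3 : (1 - x) * expR x <= 1.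
  by rewrite -ler_pdivlMr// mul1r.
apply/andP; split; first lra.
have : (1 - x) * (expR x - 1 - x) <= x ^+ 2 by nra.
have : 0 <= expR x - 1 - x by lra.
nra.
Qed.

Lemma cos1_eq0 y : `|y| < 2 * pi -> cos y = 1 -> y = 0.
Proof.
rewrite cos_half => hy e; have /eqP : sin (y / 2) ^+ 2 = 0 by lra.
rewrite sqrf_eq0 => /eqP s0.
have hy2 : `|y / 2| < pi by rewrite normrM (ger0_norm (_ : 0 <= 2^-1))//; lra.
rewrite ltr_norml in hy2.
have [h|h|h] := ltgtP (y / 2) 0; last lra.
  have := @sin_gt0_pi R (- (y / 2)); rewrite sinN s0 oppr0 ltxx => H; suff : false by [].
  apply: H; lra.
have := @sin_gt0_pi R (y / 2); rewrite s0 ltxx => H; suff : false by [].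
apply: H; lra.
Qed.

End RealTrig.

(** * Exponential, principal logarithm and complex powers *)

Section ComplexExp.
Variable R : realType.
Local Notation C := R[i].
Implicit Types (z w s t : C).

Lemma cexpD z w : cexp (z + w) = cexp z * cexp w.
Proof.
by case: z w => a b [c d]; apply: eqCP => /=; rewrite ?cosD ?sinD expRD; ring.
Qed.

Lemma cexp0 : cexp 0 = 1 :> C.
Proof. by apply: eqCP; rewrite /= expR0 ?cos0 ?sin0 ?mulr1 ?mulr0. Qed.

Lemma cexpNK z : cexp (- z) * cexp z = 1.
Proof. by rewrite -cexpD addNr cexp0. Qed.

Lemma cexp_neq0 z : cexp z != 0.
Proof.
apply/eqP => h; have := cexpNK z; rewrite h mulr0 => /eqP.
by rewrite eq_sym oner_eq0.
Qed.

Lemma cexpN z : cexp (- z) = (cexp z)^-1.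
Proof. by apply: (mulIf (cexp_neq0 z)); rewrite cexpNK mulVf// cexp_neq0. Qed.

Lemma cexpB z w : cexp (z - w) = cexp z / cexp w.
Proof. by rewrite cexpD cexpN. Qed.

Lemma cexp_muln z n : cexp (n%:R * z) = cexp z ^+ n.
Proof.
elim: n => [|n IH]; first by rewrite mul0r cexp0.
by rewrite -natr1 mulrDl mul1r cexpD IH exprSr.
Qed.

Lemma cabs_cexp z : cabs (cexp z) = expR (complex.Re z).
Proof.
case: z => a b; apply: complexI; rewrite -normC_cabs normc_def /= !exprMn -mulrDr cos2Dsin2 mulr1.
by rewrite sqrtr_sqr ger0_norm// ltW// expR_gt0.
Qed.

Lemma cexp_eq1 z : `|complex.Im z| < 2 * pi -> cexp z = 1 -> z = 0.
Proof.
move=> hz e; have := cabs_cexp z; rewrite e cabs1 => /esym /(congr1 (@ln R)).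
rewrite expRK ln1 => x0; apply: eqCP => //=.
apply: cos1_eq0 => //; have := congr1 (@complex.Re R) e.
by rewrite /= x0 expR0 mul1r.
Qed.

Lemma cexp_inj z w : `|complex.Im z - complex.Im w| < 2 * pi -> cexp z = cexp w -> z = w.
Proof.
move=> h e; apply/eqP; rewrite -subr_eq0; apply/eqP/cexp_eq1; first by rewrite ImD ImN.
by rewrite cexpB e divff// cexp_neq0.
Qed.

Definition clog w : C := ln (cabs w) +i* carg w.

Lemma cpowE w t : cpow w t = cexp (t * clog w).
Proof. by []. Qed.

Lemma Re_div_cabs w : w != 0 -> -1 <= complex.Re w / cabs w <= 1.
Proof.
rewrite -cabs_gt0 => w0; rewrite ler_pdivlMr// ler_pdivrMr// mulN1r mul1r.
by rewrite -ler_norml le_cabs_Re.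
Qed.

Lemma carg_bound w : w != 0 -> - pi < carg w <= pi.
Proof.
move=> w0; have h := Re_div_cabs w0; rewrite /carg; case: (leP 0 (complex.Im w)) => hI.
  rewrite acos_lepi// andbT (lt_le_trans _ (acos_ge0 h))// oppr_lt0 pi_gt0//.
have cw : 0 < cabs w by rewrite cabs_gt0.
have pi0 := @pi_ge0 R.
rewrite ltrN2 acos_ltpi /=; first by have := acos_ge0 h; lra.
case/andP: h => _ ->; rewrite andbT ltr_pdivlMr// mulN1r ltrNl.
have := sqr_cabs w; have := le_cabs_Re w; rewrite ler_norml => /andP[hR _].
rewrite lt_neqAle; move: hR; rewrite lerNl => ->; rewrite andbT => e.
apply/eqP => e'; move: e; rewrite -e' sqrrN => /eqP.
rewrite -subr_eq0 opprD addrA subrr sub0r oppr_eq0 sqrf_eq0 => /eqP; lra.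
Qed.

Lemma clogK w : w != 0 -> cexp (clog w) = w.
Proof.
move=> w0; have h := Re_div_cabs w0.
have cw : 0 < cabs w by rewrite cabs_gt0.
have sq : cabs w * Num.sqrt (1 - (complex.Re w / cabs w) ^+ 2) = `|complex.Im w|.
  rewrite -[X in X * _](ger0_norm (ltW cw)) -sqrtr_sqr -sqrtrM ?sqr_ge0//.
  rewrite mulrBr mulr1 exprMn exprVn [_ * (_ * _)]mulrCA divff ?expf_neq0 ?lt0r_neq0//.
  by rewrite mulr1 sqr_cabs addrAC subrr add0r sqrtr_sqr.
apply: eqCP; rewrite /= lnK ?posrE// /carg; case: (leP 0 (complex.Im w)) => hI.
- by rewrite acosK ?itv_boundlr// mulrC divfK// lt0r_neq0.
- by rewrite cosN acosK ?itv_boundlr// mulrC divfK// lt0r_neq0.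
- by rewrite sin_acos// sq ger0_norm.
- by rewrite sinN sin_acos// mulrN sq ltr0_norm// opprK.
Qed.

(** [cexp] is injective on the half-open strip of the principal logarithm, so a preimage lying in
    that strip determines [clog]. Later evaluations of logarithms and arguments go through this
    criterion. *)
Lemma clog_unique l w : cexp l = w -> - pi < complex.Im l <= pi -> clog w = l.
Proof.
move=> e hl; have w0 : w != 0 by rewrite -e cexp_neq0.
apply: cexp_inj; last by rewrite clogK.
by rewrite ltr_norml /=; have := carg_bound w0; lra.
Qed.

Lemma clogM w v : w != 0 -> v != 0 -> - pi < carg w + carg v <= pi ->
  clog (w * v) = clog w + clog v.
Proof. by move=> w0 v0 h; apply: clog_unique => //; rewrite cexpD !clogK. Qed.

Lemma cpowM w v t : w != 0 -> v != 0 -> - pi < carg w + carg v <= pi ->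
  cpow (w * v) t = cpow w t * cpow v t.
Proof. by move=> w0 v0 h; rewrite !cpowE clogM// mulrDr cexpD. Qed.

Lemma cpowD w s t : cpow w (s + t) = cpow w s * cpow w t.
Proof. by rewrite !cpowE mulrDl cexpD. Qed.

Lemma cpowN w s : cpow w (- s) = (cpow w s)^-1.
Proof. by rewrite !cpowE mulNr cexpN. Qed.

Lemma cpow_neq0 w s : cpow w s != 0.
Proof. exact: cexp_neq0. Qed.

Lemma cpow_nat w n : w != 0 -> cpow w n%:R = w ^+ n.
Proof. by move=> w0; rewrite cpowE cexp_muln clogK. Qed.

Lemma cpow1 w : w != 0 -> cpow w 1 = w.
Proof. by move=> w0; rewrite -[1]/(1%:R) cpow_nat// expr1. Qed.

(** The definition of [carg] by [acos] with a case distinction hides its continuity; on the right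
    half plane the arctangent reveals it, and bounds the argument by pi / 2. *)
Lemma carg_Re_gt0 w : 0 < complex.Re w -> carg w = atan (complex.Im w / complex.Re w).
Proof.
move=> h; have w0 : w != 0 by apply: contraTneq h => ->; rewrite ltxx.
have cw : 0 < cabs w by rewrite cabs_gt0.
suff : clog w = ln (cabs w) +i* atan (complex.Im w / complex.Re w) by case.
have /andP[h1 h2] : - (pi / 2) < atan (complex.Im w / complex.Re w) < pi / 2.
  by rewrite atan_gtNpi2 atan_ltpi2.
apply: clog_unique; last by rewrite /=; have := @pi_gt0 R; lra.
set a := atan _ in h1 h2 *.
have ca : 0 < cos a by apply: cos_gt0_pihalf; rewrite h1 h2.
have ta : sin a = cos a * (complex.Im w / complex.Re w).
  by rewrite -(atanK (complex.Im w / complex.Re w)) -/a /tan mulrC divfK// lt0r_neq0.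
have : cabs w * cos a = complex.Re w.
  rewrite /a cos_atan -[X in X * _](ger0_norm (ltW cw)) -sqrtr_sqr.
  have -> : 1 + (complex.Im w / complex.Re w) ^+ 2 = cabs w ^+ 2 / complex.Re w ^+ 2.
    rewrite sqr_cabs mulrDl divff ?expf_neq0 ?lt0r_neq0//.
    by rewrite exprMn exprVn.
  rewrite -sqrtrV ?divr_ge0 ?sqr_ge0// -sqrtrM ?sqr_ge0// invf_div mulrCA divff.
    by rewrite mulr1 sqrtr_sqr gtr0_norm.
  by rewrite expf_neq0// lt0r_neq0.
move=> hr; apply: eqCP; rewrite /= lnK ?posrE//.
by rewrite ta mulrA hr mulrC divfK// lt0r_neq0.
Qed.

Lemma carg_Re_gt0_bound w : 0 < complex.Re w -> - (pi / 2) < carg w < pi / 2.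
Proof. by move=> h; rewrite carg_Re_gt0// atan_gtNpi2 atan_ltpi2. Qed.

Lemma cabs_cpow w s :
  cabs (cpow w s) = expR (complex.Re s * ln (cabs w) - complex.Im s * carg w).
Proof. by rewrite cpowE cabs_cexp ReM. Qed.

Lemma carg_pos (x : R) : 0 < x -> carg x%:C = 0.
Proof. by move=> x0; rewrite carg_Re_gt0//= mul0r atan0. Qed.

Lemma cabs_cpow_pos (x : R) s : 0 < x -> cabs (cpow x%:C s) = x `^ complex.Re s.
Proof.
move=> x0; rewrite cabs_cpow carg_pos// mulr0 subr0 cabs_real gtr0_norm//.
by rewrite /powR gt_eqF.
Qed.

Lemma cpow_posM (x : R) w s : 0 < x -> w != 0 -> cpow (x%:C * w) s = cpow x%:C s * cpow w s.
Proof.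
move=> x0 w0; apply: cpowM => //; first by rewrite -cabs_eq0 cabs_real normr_eq0 gt_eqF.
by rewrite carg_pos// add0r; exact: carg_bound.
Qed.

(** An explicit second-order bound takes the place of the exponential series. It yields the
    derivative of [cexp], by inversion that of [clog], and the limit of N (exp(a / N) - 1). *)
Lemma cexp_quad (h : C) : cabs h <= 1 / 2 -> cabs (cexp h - 1 - h) <= 4 * cabs h ^+ 2.
Proof.
move=> hh; case: h hh => x y hh.
have hx := le_trans (le_cabs_Re _) hh; have hy := le_trans (le_cabs_Im _) hh.
rewrite /= in hx hy; have hx' := hx.
have /andP[e1 e2] := expR_quad hx; have /andP[c1 c2] := one_sub_cos y.
have s1 : `|sin y - y| <= y ^+ 2 by apply: sin_sub_le; lra.
have s2 := abs_sin_le y.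
apply: le_trans (cabs_le_ReIm _) _; rewrite sqr_cabs /=.
rewrite ler_norml in hx.
have e3 : expR x <= 2 by nra.
have e0 := expR_gt0 x.
have h1 : `|expR x * cos y - 1 - x| <= 2 * x ^+ 2 + y ^+ 2.
  rewrite ler_norml; nra.
have h2 : `|expR x * sin y - 0 - y| <= 2 * `|x| * `|y| + y ^+ 2.
  have -> : expR x * sin y - 0 - y = (expR x - 1) * sin y + (sin y - y) by ring.
  apply: le_trans (ler_normD _ _) _; apply: lerD => //.
  rewrite normrM; apply: ler_pM => //; rewrite ler_norml.
  have : x ^+ 2 <= `|x| / 2.
    rewrite -(real_normK (num_real x)); have := normr_ge0 x; nra.
  have := ler_norm x; have := ler_norm (- x); rewrite normrN; lra.
have h3 : 2 * `|x| * `|y| <= x ^+ 2 + y ^+ 2.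
  rewrite -(real_normK (num_real x)) -(real_normK (num_real y)).
  have := sqr_ge0 (`|x| - `|y|); nra.
rewrite subr0 in h2 *; lra.
Qed.

Lemma cderiv_cexp z : cderiv (@cexp R) z (cexp z).
Proof.
move=> e e0; pose c := 4 * (cabs (cexp z) + 1).
have c0 : 0 < c by rewrite /c mulr_gt0// ltr_wpDl// cabs_ge0.
exists (Num.min (1 / 2) (e / c)); first by rewrite lt_min !divr_gt0.
move=> h; rewrite lt_min => /andP[/ltW h1 h2].
have -> : cexp (z + h) - cexp z - h * cexp z = cexp z * (cexp h - 1 - h).
  by rewrite cexpD; ring.
rewrite cabsM; have hq := cexp_quad h1.
apply: (@le_trans _ _ (c * cabs h * cabs h)).
  rewrite /c; have := cabs_ge0 (cexp z); have := cabs_ge0 h.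
  have := cabs_ge0 (cexp h - 1 - h); move: hq; rewrite expr2; nra.
apply: ler_wpM2r; first exact: cabs_ge0.
by move: h2; rewrite ltr_pdivlMr// => /ltW; rewrite mulrC.
Qed.

End ComplexExp.

(** * Rectangle integrals and Goursat's theorem *)

Section RectangleIntegral.
Variable R : realType.
Local Notation C := R[i].
Implicit Types (x y a b c K : R).

Definition cont_on (f : R -> C) a b := forall x, a <= x <= b -> forall e : R, 0 < e ->
  exists2 d, 0 < d & forall y, a <= y <= b -> `|y - x| < d -> cabs (f y - f x) < e.

Definition rint (f : R -> R) a b : R := (\int[@lebesgue_measure R]_(x in `[a, b]) f x)%R.

Definition cint (f : R -> C) a b : C :=
  rint (fun x => complex.Re (f x)) a b +i* rint (fun x => complex.Im (f x)) a b.

Lemma cont_on_integrable (g : C -> R) (f : R -> C) a b :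
  (forall z w, `|g z - g w| <= cabs (z - w)) -> cont_on f a b ->
  (@lebesgue_measure R).-integrable `[a, b] (EFin \o (fun x => g (f x))).
Proof.
move=> glip hf; apply: continuous_compact_integrable; first exact: segment_compact.
apply/subspace_continuousP => x /= xI; apply/cvgrPdist_lt => e e0.
have hx : a <= x <= b by move: xI; rewrite in_itv.
have [d d0 hd] := hf x hx e e0.
rewrite near_withinE /=; apply/nbhs_normP; exists d => //= y hy yI.
apply: le_lt_trans (glip _ _) _; rewrite cabsBC; apply: hd; last by rewrite distrC.
by move: yI; rewrite in_itv.
Qed.

Lemma Re_lip (z w : C) : `|complex.Re z - complex.Re w| <= cabs (z - w).
Proof. by rewrite -ReN -ReD le_cabs_Re. Qed.

Lemma Im_lip (z w : C) : `|complex.Im z - complex.Im w| <= cabs (z - w).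
Proof. by rewrite -ImN -ImD le_cabs_Im. Qed.

Lemma rint_split (f : R -> R) a c b :
  (@lebesgue_measure R).-integrable `[a, b] (EFin \o f) -> a <= c <= b ->
  rint f a b = rint f a c + rint f c b.
Proof.
move=> fi /andP[ac cb]; rewrite /rint.
have := @Rintegral_itvB R f (BLeft a) (BRight b) c fi.
rewrite !bnd_simp => /(_ ac cb) h.
have fi' : (@lebesgue_measure R).-integrable `]c, b] (EFin \o f).
  by apply: integrableS fi => //; apply: subset_itv; rewrite bnd_simp.
have h' := Rintegral_itv_obnd_cbnd fi'.
by rewrite -[X in _ = _ + X]h' -h addrC subrK.
Qed.

Lemma cint_split f a c b : cont_on f a b -> a <= c <= b ->
  cint f a b = cint f a c + cint f c b.
Proof.
move=> hf hc; apply: eqCP => /=; apply: rint_split => //.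
  exact: cont_on_integrable Re_lip hf.
exact: cont_on_integrable Im_lip hf.
Qed.

Lemma cintB f g a b : cont_on f a b -> cont_on g a b ->
  cint (fun x => f x - g x) a b = cint f a b - cint g a b.
Proof.
move=> hf hg; rewrite /cint; apply: eqCP => /=; rewrite /rint -RintegralB//.
- by apply: eq_Rintegral => x _; rewrite ReD ReN.
- exact: cont_on_integrable Re_lip hf.
- exact: cont_on_integrable Re_lip hg.
- by apply: eq_Rintegral => x _; rewrite ImD ImN.
- exact: cont_on_integrable Im_lip hf.
- exact: cont_on_integrable Im_lip hg.
Qed.

Lemma cintD f g a b : cont_on f a b -> cont_on g a b ->
  cint (fun x => f x + g x) a b = cint f a b + cint g a b.
Proof.
move=> hf hg; rewrite /cint; apply: eqCP => /=; rewrite /rint -RintegralD//.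
- by apply: eq_Rintegral => x _; rewrite ReD.
- exact: cont_on_integrable Re_lip hf.
- exact: cont_on_integrable Re_lip hg.
- by apply: eq_Rintegral => x _; rewrite ImD.
- exact: cont_on_integrable Im_lip hf.
- exact: cont_on_integrable Im_lip hg.
Qed.

Lemma rint_cst k a b : a <= b -> rint (fun=> k) a b = k * (b - a).
Proof.
move=> ab; rewrite /rint Rintegral_cst//=.
by rewrite lebesgue_measure_itv /= lte_fin; case: ltP => //= ba; rewrite (@le_anti _ _ a b) ?ab// subrr.
Qed.

Lemma cint_cst (k : C) a b : a <= b -> cint (fun=> k) a b = k * (b - a)%:C.
Proof.
by move=> ab; rewrite /cint !rint_cst//; apply: eqCP; rewrite /= ?ReM ?ImM /=; ring.
Qed.

Lemma integrable_cst k a b : (@lebesgue_measure R).-integrable `[a, b] (EFin \o (fun=> k)).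
Proof.
apply: continuous_compact_integrable; first exact: segment_compact.
by move=> x; exact: cvg_cst.
Qed.

Lemma rint_ge (f : R -> R) k a b : a <= b ->
  (@lebesgue_measure R).-integrable `[a, b] (EFin \o f) ->
  (forall x, a <= x <= b -> k <= f x) -> k * (b - a) <= rint f a b.
Proof.
move=> ab fi h; rewrite -rint_cst//; apply: le_Rintegral => //.
exact: integrable_cst.
Qed.

Lemma rint_le (f : R -> R) k a b : a <= b ->
  (@lebesgue_measure R).-integrable `[a, b] (EFin \o f) ->
  (forall x, a <= x <= b -> f x <= k) -> rint f a b <= k * (b - a).
Proof.
move=> ab fi h; rewrite -rint_cst//; apply: le_Rintegral => //.
exact: integrable_cst.
Qed.

(** The factor 2 comes from bounding the real and imaginary parts separately. It is harmless, since
    the estimates below only require some absolute constant. *)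
Lemma cint_bound f a b K : a <= b -> cont_on f a b ->
  (forall x, a <= x <= b -> cabs (f x) <= K) -> cabs (cint f a b) <= 2 * K * (b - a).
Proof.
move=> ab hf hK; apply: le_trans (cabs_le_ReIm _) _ => /=.
have fR := cont_on_integrable Re_lip hf; have fI := cont_on_integrable Im_lip hf.
have h1 x : a <= x <= b -> - K <= complex.Re (f x) <= K.
  by move=> /hK h; rewrite -ler_norml; apply: le_trans (le_cabs_Re _) h.
have h2 x : a <= x <= b -> - K <= complex.Im (f x) <= K.
  by move=> /hK h; rewrite -ler_norml; apply: le_trans (le_cabs_Im _) h.
rewrite -mulrA mulr2n mulrDl mul1r; apply: lerD; rewrite ler_norml -mulNr.
  by rewrite rint_ge ?rint_le// => x /h1 /andP[].
by rewrite rint_ge ?rint_le// => x /h2 /andP[].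
Qed.

Lemma cint_nil f a : cont_on f a a -> cint f a a = 0.
Proof.
move=> hf; have [K hK] : exists K, forall x, a <= x <= a -> cabs (f x) <= K.
  by exists (cabs (f a)) => x; rewrite -eq_le => /eqP ->.
have := cint_bound (lexx a) hf hK; rewrite subrr mulr0 => h.
by apply/eqP; rewrite -cabs_eq0 eq_le h cabs_ge0.
Qed.

Definition ccont_at (f : C -> C) (s : C) := forall e : R, 0 < e ->
  exists2 d : R, 0 < d & forall t, cabs (t - s) < d -> cabs (f t - f s) < e.

Lemma cderiv_cont f s l : cderiv f s l -> ccont_at f s.
Proof.
move=> h e e0; have [d d0 hd] := h 1 ltr01.
pose k := cabs l + 2; have k0 : 0 < k by rewrite /k ltr_wpDl// cabs_ge0.
exists (Num.min d (e / k)); first by rewrite lt_min d0 divr_gt0.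
move=> t; rewrite lt_min => /andP[h1 h2].
have := hd _ h1; rewrite mul1r (addrC s) subrK => h3.
have := le_cabsD (f t - f s - (t - s) * l) ((t - s) * l); rewrite subrK cabsM.
move: h2; rewrite ltr_pdivlMr// /k; have := cabs_ge0 (t - s); nra.
Qed.

Definition inrect x0 x1 y0 y1 (s : C) :=
  (x0 <= complex.Re s <= x1) && (y0 <= complex.Im s <= y1).

Definition cont_rect (f : C -> C) x0 x1 y0 y1 :=
  forall s, inrect x0 x1 y0 y1 s -> ccont_at f s.

(** The integral along the boundary in the positive direction, with opposite sides paired in one
    integrand: bottom minus top, then right minus left with dz = i dy. *)
Definition bdry (f : C -> C) x0 x1 y0 y1 : C :=
  cint (fun x => f (x +i* y0) - f (x +i* y1)) x0 x1 +
  'i * cint (fun y => f (x1 +i* y) - f (x0 +i* y)) y0 y1.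

Lemma cont_onB f g a b : cont_on f a b -> cont_on g a b -> cont_on (fun x => f x - g x) a b.
Proof.
move=> hf hg x hx e e0; have e20 : 0 < e / 2 by lra.
have [d d0 hd] := hf x hx _ e20; have [d' d'0 hd'] := hg x hx _ e20.
exists (Num.min d d'); first by rewrite lt_min d0.
move=> y hy; rewrite lt_min => /andP[h1 h2].
have -> : f y - g y - (f x - g x) = (f y - f x) - (g y - g x) by ring.
by apply: le_lt_trans (le_cabsB _ _) _; have := hd y hy h1; have := hd' y hy h2; lra.
Qed.

Lemma cont_on_hor f x0 x1 y0 y1 y : cont_rect f x0 x1 y0 y1 -> y0 <= y <= y1 ->
  cont_on (fun x => f (x +i* y)) x0 x1.
Proof.
move=> hf hy x hx e e0; have := hf (x +i* y); rewrite /inrect /= hx hy.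
move=> /(_ isT e e0) [d d0 hd]; exists d => // t _ ht; apply: hd.
have -> : (t +i* y) - (x +i* y) = (t - x)%:C by apply: eqCP; rewrite /= ?subrr.
by rewrite cabs_real.
Qed.

Lemma cont_on_ver f x0 x1 y0 y1 x : cont_rect f x0 x1 y0 y1 -> x0 <= x <= x1 ->
  cont_on (fun y => f (x +i* y)) y0 y1.
Proof.
move=> hf hx y hy e e0; have := hf (x +i* y); rewrite /inrect /= hx hy.
move=> /(_ isT e e0) [d d0 hd]; exists d => // t _ ht; apply: hd.
have -> : (x +i* t) - (x +i* y) = 'i * (t - y)%:C.
  by apply: eqCP; rewrite /= ?subrr; ring.
by rewrite cabsM cabs_i mul1r cabs_real.
Qed.

Lemma cont_rect_sub f x0 x1 y0 y1 x0' x1' y0' y1' :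
  x0 <= x0' -> x1' <= x1 -> y0 <= y0' -> y1' <= y1 ->
  cont_rect f x0 x1 y0 y1 -> cont_rect f x0' x1' y0' y1'.
Proof.
move=> h1 h2 h3 h4 hf s hs; apply: hf; move: hs; rewrite /inrect; lra.
Qed.

Lemma bdry_splitx f x0 c x1 y0 y1 : cont_rect f x0 x1 y0 y1 -> x0 <= c <= x1 -> y0 <= y1 ->
  bdry f x0 x1 y0 y1 = bdry f x0 c y0 y1 + bdry f c x1 y0 y1.
Proof.
move=> hf hc hy; rewrite /bdry (@cint_split _ x0 c x1)//; last first.
  by apply: cont_onB; apply: cont_on_hor hf _; lra.
have -> : cint (fun y => f (x1 +i* y) - f (x0 +i* y)) y0 y1 =
  cint (fun y => f (c +i* y) - f (x0 +i* y)) y0 y1 + cint (fun y => f (x1 +i* y) - f (c +i* y)) y0 y1.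
  rewrite -cintD; last 2 first.
  - by apply: cont_onB; apply: cont_on_ver hf _; lra.
  - by apply: cont_onB; apply: cont_on_ver hf _; lra.
  by congr cint; apply/funext => y; ring.
by rewrite mulrDr addrACA.
Qed.

Lemma bdry_splity f x0 x1 y0 c y1 : cont_rect f x0 x1 y0 y1 -> y0 <= c <= y1 -> x0 <= x1 ->
  bdry f x0 x1 y0 y1 = bdry f x0 x1 y0 c + bdry f x0 x1 c y1.
Proof.
move=> hf hc hx; rewrite /bdry (@cint_split _ y0 c y1)//; last first.
  by apply: cont_onB; apply: cont_on_ver hf _; lra.
have -> : cint (fun x => f (x +i* y0) - f (x +i* y1)) x0 x1 =
  cint (fun x => f (x +i* y0) - f (x +i* c)) x0 x1 + cint (fun x => f (x +i* c) - f (x +i* y1)) x0 x1.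
  rewrite -cintD; last 2 first.
  - by apply: cont_onB; apply: cont_on_hor hf _; lra.
  - by apply: cont_onB; apply: cont_on_hor hf _; lra.
  by congr cint; apply/funext => y; ring.
by rewrite mulrDr addrACA.
Qed.

(** Only boundary points are concerned, so that 1 / (s - p) qualifies when [p] is interior. *)
Definition cont_bdry f x0 x1 y0 y1 := forall s, inrect x0 x1 y0 y1 s ->
  (complex.Re s \in [:: x0; x1]) || (complex.Im s \in [:: y0; y1]) -> ccont_at f s.

Lemma cont_rect_bdry f x0 x1 y0 y1 : cont_rect f x0 x1 y0 y1 -> cont_bdry f x0 x1 y0 y1.
Proof. by move=> hf s hs _; exact: hf. Qed.

Lemma cont_bdry_hor f x0 x1 y0 y1 y : cont_bdry f x0 x1 y0 y1 -> y0 <= y <= y1 ->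
  y \in [:: y0; y1] -> cont_on (fun x => f (x +i* y)) x0 x1.
Proof.
move=> hf hy yy; apply: (@cont_on_hor f x0 x1 y y y); last by rewrite lexx.
move=> s; rewrite /inrect => /andP[hx]; rewrite -eq_le => /eqP e.
by apply: hf; rewrite /inrect ?hx -e ?hy// yy orbT.
Qed.

Lemma cont_bdry_ver f x0 x1 y0 y1 x : cont_bdry f x0 x1 y0 y1 -> x0 <= x <= x1 ->
  x \in [:: x0; x1] -> cont_on (fun y => f (x +i* y)) y0 y1.
Proof.
move=> hf hx xx; apply: (@cont_on_ver f x x y0 y1 x); last by rewrite lexx.
move=> s; rewrite /inrect => /andP[]; rewrite -eq_le => /eqP e hy.
by apply: hf; rewrite /inrect ?hy -e ?hx// xx.
Qed.

Lemma bdry_bound f x0 x1 y0 y1 K : x0 <= x1 -> y0 <= y1 -> cont_bdry f x0 x1 y0 y1 ->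
  (forall s, inrect x0 x1 y0 y1 s ->
    (complex.Re s \in [:: x0; x1]) || (complex.Im s \in [:: y0; y1]) -> cabs (f s) <= K) ->
  cabs (bdry f x0 x1 y0 y1) <= 4 * K * (x1 - x0 + (y1 - y0)).
Proof.
move=> hx hy hf hK; rewrite mulrDr; apply: le_trans (le_cabsD _ _) _.
have H x y : (x0 <= x <= x1) && (y0 <= y <= y1) -> (x \in [:: x0; x1]) || (y \in [:: y0; y1]) ->
  cabs (f (x +i* y)) <= K by move=> h1 h2; apply: hK.
apply: lerD; rewrite ?cabsM ?cabs_i ?mul1r; have -> : 4 * K = 2 * (2 * K) by ring.
  apply: cint_bound => //.
    by apply: cont_onB; apply: cont_bdry_hor hf _ _; rewrite ?lexx ?hy// !inE eqxx ?orbT.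
  move=> x hx'; apply: le_trans (le_cabsB _ _) _.
  have := H x y0; have := H x y1; rewrite hx' !inE !eqxx !orbT /= !lexx hy /=.
  by move=> /(_ isT isT) h1 /(_ isT isT); lra.
apply: cint_bound => //.
  by apply: cont_onB; apply: cont_bdry_ver hf _ _; rewrite ?lexx ?hx// !inE eqxx ?orbT.
move=> y hy'; apply: le_trans (le_cabsB _ _) _.
have := H x0 y; have := H x1 y; rewrite hy' !inE !eqxx /= ?orbT !lexx hx /=.
by move=> /(_ isT isT) h1 /(_ isT isT); lra.
Qed.

Lemma bdryB f g x0 x1 y0 y1 : x0 <= x1 -> y0 <= y1 ->
  cont_bdry f x0 x1 y0 y1 -> cont_bdry g x0 x1 y0 y1 ->
  bdry (fun s => f s - g s) x0 x1 y0 y1 = bdry f x0 x1 y0 y1 - bdry g x0 x1 y0 y1.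
Proof.
move=> hx hy hf hg; rewrite /bdry opprD addrACA -mulrBr.
have hor h y : cont_bdry h x0 x1 y0 y1 -> y \in [:: y0; y1] -> cont_on (fun x => h (x +i* y)) x0 x1.
  by move=> hh hyy; apply: cont_bdry_hor hh _ (hyy); move: hyy; rewrite !inE => /orP[] /eqP ->; rewrite lexx hy.
have ver h x : cont_bdry h x0 x1 y0 y1 -> x \in [:: x0; x1] -> cont_on (fun y => h (x +i* y)) y0 y1.
  by move=> hh hxx; apply: cont_bdry_ver hh _ (hxx); move: hxx; rewrite !inE => /orP[] /eqP ->; rewrite lexx hx.
rewrite -!cintB; first last.
- by apply: cont_onB; apply: hor => //; rewrite !inE eqxx ?orbT.
- by apply: cont_onB; apply: hor => //; rewrite !inE eqxx ?orbT.
- by apply: cont_onB; apply: ver => //; rewrite !inE eqxx ?orbT.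
- by apply: cont_onB; apply: ver => //; rewrite !inE eqxx ?orbT.
congr (cint _ _ _ + 'i * cint _ _ _); apply/funext => x; ring.
Qed.

Lemma bdry_affine (al be : C) x0 x1 y0 y1 : x0 <= x1 -> y0 <= y1 ->
  bdry (fun s => al + s * be) x0 x1 y0 y1 = 0.
Proof.
move=> hx hy; rewrite /bdry.
have -> : (fun x => al + (x +i* y0) * be - (al + (x +i* y1) * be)) = (fun=> 'i * (y0 - y1)%:C * be).
  apply/funext => x; have -> : forall u v : C, al + u * be - (al + v * be) = (u - v) * be by move=> u v; ring.
  by congr (_ * _); apply: eqCP => /=; ring.
have -> : (fun y => al + (x1 +i* y) * be - (al + (x0 +i* y) * be)) = (fun=> (x1 - x0)%:C * be).
  apply/funext => x; have -> : forall u v : C, al + u * be - (al + v * be) = (u - v) * be by move=> u v; ring.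
  by congr (_ * _); apply: eqCP => /=; ring.
rewrite !cint_cst// !rmorphB /=; ring.
Qed.

End RectangleIntegral.

(** * Bisection and Goursat's theorem *)

Section Goursat.
Variable R : realType.
Local Notation C := R[i].
Implicit Types (x y a b c K : R) (s z w p : C).

Section Bisection.
Variable P : R -> R -> R -> R -> Prop.
Hypothesis Psplit : forall x0 x1 y0 y1, x0 <= x1 -> y0 <= y1 ->
  let mx := (x0 + x1) / 2 in let my := (y0 + y1) / 2 in
  P x0 mx y0 my -> P mx x1 y0 my -> P x0 mx my y1 -> P mx x1 my y1 -> P x0 x1 y0 y1.


(** If [P] failed, it would fail on one quarter of each failing rectangle; the nested quarters
    shrink to a point, where the local hypothesis gives a contradiction. This replaces compactness,
    for Goursat's theorem as well as for the boundedness of continuous functions and a mean value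
    inequality. *)
Lemma bisection x0 x1 y0 y1 : x0 <= x1 -> y0 <= y1 ->
  (forall s, inrect x0 x1 y0 y1 s -> exists2 d : R, 0 < d &
     forall x0' x1' y0' y1', x0 <= x0' -> x1' <= x1 -> y0 <= y0' -> y1' <= y1 ->
     inrect x0' x1' y0' y1' s -> x1' - x0' < d -> y1' - y0' < d -> P x0' x1' y0' y1') ->
  P x0 x1 y0 y1.
Proof.
move=> hx hy hloc; apply: contrapT => nP.
pose T := (R * R * (R * R))%type.
pose PT (q : T) := P q.1.1 q.1.2 q.2.1 q.2.2.
pose q1 (q : T) : T := ((q.1.1, (q.1.1 + q.1.2) / 2), (q.2.1, (q.2.1 + q.2.2) / 2)).
pose q2 (q : T) : T := (((q.1.1 + q.1.2) / 2, q.1.2), (q.2.1, (q.2.1 + q.2.2) / 2)).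
pose q3 (q : T) : T := ((q.1.1, (q.1.1 + q.1.2) / 2), ((q.2.1 + q.2.2) / 2, q.2.2)).
pose q4 (q : T) : T := (((q.1.1 + q.1.2) / 2, q.1.2), ((q.2.1 + q.2.2) / 2, q.2.2)).
pose next (q : T) : T := if `[< ~ PT (q1 q) >] then q1 q else if `[< ~ PT (q2 q) >] then q2 q
  else if `[< ~ PT (q3 q) >] then q3 q else q4 q.
pose q n := iter n next ((x0, x1), (y0, y1)).
have nextP t : t.1.1 <= t.1.2 -> t.2.1 <= t.2.2 -> ~ PT t ->
  ~ PT (next t).
  move=> h1 h2 nPt; rewrite /next; case: asboolP => // /contrapT P1.
  case: asboolP => // /contrapT P2; case: asboolP => // /contrapT P3 P4.
  by apply: nPt; apply: Psplit.
have nextI t : t.1.1 <= t.1.2 -> t.2.1 <= t.2.2 ->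
  [/\ t.1.1 <= (next t).1.1, (next t).1.2 <= t.1.2, t.2.1 <= (next t).2.1, (next t).2.2 <= t.2.2 &
  (next t).1.2 - (next t).1.1 = (t.1.2 - t.1.1) / 2 /\
  (next t).2.2 - (next t).2.1 = (t.2.2 - t.2.1) / 2].
  move=> h1 h2; rewrite /next.
  by case: asboolP => _ /=; [|case: asboolP => _ /=; [|case: asboolP => _ /=]]; split; lra.
have qI n : [/\ (q n).1.1 <= (q n).1.2, (q n).2.1 <= (q n).2.2, ~ PT (q n) &
  (q n).1.2 - (q n).1.1 = (x1 - x0) / 2 ^+ n /\ (q n).2.2 - (q n).2.1 = (y1 - y0) / 2 ^+ n].
  elim: n => [|n [h1 h2 h3 [h4 h5]]]; first by split; rewrite ?expr0 ?divr1.
  have [i1 i2 i3 i4 [i5 i6]] := nextI _ h1 h2; rewrite /= -/(q n) i5 i6 h4 h5 exprSr invfM.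
  split; [lra|lra|exact: nextP|by rewrite !mulrA].
have mono n m : (n <= m)%N -> [/\ (q n).1.1 <= (q m).1.1, (q m).1.2 <= (q n).1.2,
  (q n).2.1 <= (q m).2.1 & (q m).2.2 <= (q n).2.2].
  move=> /subnK <-; elim: (m - n)%N => [|k [h1 h2 h3 h4]] //=.
  have [g1 g2 _ _] := qI (k + n)%N; have [i1 i2 i3 i4 _] := nextI _ g1 g2.
  rewrite -/(q (k + n)%N); split; lra.
have supI (f g : nat -> R) : (forall n, f n <= g n) ->
    (forall n m, (n <= m)%N -> f n <= f m /\ g m <= g n) ->
    exists x, forall n, f n <= x <= g n.
  move=> fg fgm; pose X := range f.
  have ub n : ubound X (g n).
    move=> _ [m _ <-]; apply: (@le_trans _ _ (f (maxn m n))); first by case: (fgm _ _ (leq_maxl m n)).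
    by apply: le_trans (fg _) _; case: (fgm _ _ (leq_maxr m n)).
  have sX : has_sup X by split; [exists (f 0%N), 0%N|exists (g 0%N); exact: ub].
  exists (sup X) => n; apply/andP; split; first by apply: ub_le_sup; [case: sX|exists n].
  by apply: sup_le_ub; [case: sX|exact: ub].
have [x hxx] := supI (fun n => (q n).1.1) (fun n => (q n).1.2) (fun n => let: And4 h _ _ _ := qI n in h)
  (fun n m nm => let: And4 h1 h2 _ _ := mono n m nm in conj h1 h2).
have [y hyy] := supI (fun n => (q n).2.1) (fun n => (q n).2.2) (fun n => let: And4 _ h _ _ := qI n in h)
  (fun n m nm => let: And4 _ _ h1 h2 := mono n m nm in conj h1 h2).
have [|d d0 hd] := hloc (x +i* y).
  by rewrite /inrect /=; have := hxx 0%N; have := hyy 0%N; rewrite /= => -> ->.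
have [n hn1 hn2] : exists2 n, (x1 - x0) / 2 ^+ n < d & (y1 - y0) / 2 ^+ n < d.
  pose w := x1 - x0 + (y1 - y0) + 1.
  have w0 : 0 < w by rewrite /w; lra.
  pose n := (Num.bound (w / d)).
  have : w / d < 2 ^+ n.
    apply: lt_le_trans (archi_boundP _) _; first by rewrite divr_ge0// ltW.
    by rewrite -natrX ler_nat ltnW// ltn_expl.
  rewrite ltr_pdivrMr// => h; exists n; rewrite ltr_pdivrMr ?exprn_gt0// mulrC;
    apply: le_lt_trans h; rewrite /w; lra.
have [h1 h2 h3 [h4 h5]] := qI n; apply: h3.
have [i1 i2 i3 i4] := mono 0%N n (leq0n n).
apply: hd => //; rewrite ?h4 ?h5//.
by rewrite /inrect /= hxx hyy.
Qed.

End Bisection.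

Definition cderivable (f : C -> C) s := exists l, cderiv f s l.

Lemma ccont_affine (al be : C) s : ccont_at (fun s => al + s * be) s.
Proof.
move=> e e0; exists (e / (cabs be + 1)); first by rewrite divr_gt0// ltr_wpDl// cabs_ge0.
move=> t; rewrite ltr_pdivlMr ?ltr_wpDl ?cabs_ge0// => h.
have -> : al + t * be - (al + s * be) = (t - s) * be by ring.
rewrite cabsM; have := cabs_ge0 (t - s); nra.
Qed.

Lemma ccontB f g s : ccont_at f s -> ccont_at g s -> ccont_at (fun s => f s - g s) s.
Proof.
move=> hf hg e e0; have e20 : 0 < e / 2 by lra.
have [d d0 hd] := hf _ e20; have [d' d'0 hd'] := hg _ e20.
exists (Num.min d d'); first by rewrite lt_min d0.
move=> y; rewrite lt_min => /andP[h1 h2].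
have -> : f y - g y - (f s - g s) = (f y - f s) - (g y - g s) by ring.
by apply: le_lt_trans (le_cabsB _ _) _; have := hd y h1; have := hd' y h2; lra.
Qed.

Lemma goursat0 f x0 x1 y0 y1 : x0 <= x1 -> y0 <= y1 ->
  (forall s, inrect x0 x1 y0 y1 s -> cderivable f s) -> bdry f x0 x1 y0 y1 = 0.
Proof.
move=> hx hy hf; have hc : cont_rect f x0 x1 y0 y1.
  by move=> s /hf [l hl]; exact: cderiv_cont hl.
pose w := x1 - x0 + (y1 - y0) + 1.
suff H e : 0 < e -> cabs (bdry f x0 x1 y0 y1) <= e * w ^+ 2.
  have w0 : 0 < w ^+ 2 by rewrite exprn_gt0// /w; lra.
  apply/eqP; rewrite -cabs_eq0 eq_le cabs_ge0 andbT; apply/ler_addgt0Pl => e e0.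
  by rewrite addr0; have := H (e / w ^+ 2); rewrite divfK ?lt0r_neq0//; apply; rewrite divr_gt0.
move=> e0.
(* The squared half perimeter is additive under quartering. Near a point [s], [f] is an affine
   function, whose boundary integral vanishes, up to an error of at most e / 4 times the distance to
   [s]; [bdry_bound] then gives this estimate. *)
pose P a b c d := x0 <= a -> b <= x1 -> y0 <= c -> d <= y1 ->
   cabs (bdry f a b c d) <= e * (b - a + (d - c)) ^+ 2.
suff /(_ (lexx _) (lexx _) (lexx _) (lexx _)) h : P x0 x1 y0 y1.
  apply: le_trans h _; rewrite ler_pM2l// ler_sqr ?nnegrE /w; lra.
apply: bisection => //.
  move=> a b c d ab cd mx my h1 h2 h3 h4 i1 i2 i3 i4.
  have cf : cont_rect f a b c d by exact: cont_rect_sub hc.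
  rewrite (@bdry_splitx _ f a mx b)//; last by rewrite /mx; lra.
  rewrite (@bdry_splity _ f a mx c my d)//; last 3 first.
  - by apply: cont_rect_sub cf; rewrite // /mx; lra.
  - by rewrite /my; lra.
  - by rewrite /mx; lra.
  rewrite (@bdry_splity _ f mx b c my d)//; last 3 first.
  - by apply: cont_rect_sub cf; rewrite // /mx; lra.
  - by rewrite /my; lra.
  - by rewrite /mx; lra.
  have -> : (b - a + (d - c)) ^+ 2 = (mx - a + (my - c)) ^+ 2 + (mx - a + (d - my)) ^+ 2 +
    ((b - mx + (my - c)) ^+ 2 + (b - mx + (d - my)) ^+ 2) by rewrite /mx /my; field.
  rewrite !mulrDr; apply: le_trans (le_cabsD _ _) _; apply: lerD;
    apply: le_trans (le_cabsD _ _) _; apply: lerD.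
  - by apply: h1 => //; rewrite /mx /my; lra.
  - by apply: h3 => //; rewrite /mx /my; lra.
  - by apply: h2 => //; rewrite /mx /my; lra.
  - by apply: h4 => //; rewrite /mx /my; lra.
move=> s hs; have [l hl] := hf s hs.
have e40 : 0 < e / 4 by lra.
have [d d0 hd] := hl _ e40; exists (d / 2); first by lra.
move=> a b c' d' i1 i2 i3 i4 hs' ad cd _ _ _ _.
have ab : a <= b by move: hs'; rewrite /inrect; lra.
have cd' : c' <= d' by move: hs'; rewrite /inrect; lra.
have cf : cont_rect f a b c' d' by exact: cont_rect_sub hc.
have -> : bdry f a b c' d' = bdry (fun t => f t - ((f s - s * l) + t * l)) a b c' d'.
  rewrite bdryB//; first by rewrite bdry_affine// subr0.
    exact: cont_rect_bdry.
  by move=> t _ _; exact: ccont_affine.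
have -> : e * (b - a + (d' - c')) ^+ 2 =
  4 * (e / 4 * (b - a + (d' - c'))) * (b - a + (d' - c')) by field.
apply: bdry_bound => //.
  by move=> t ht _; apply: ccontB; [exact: cf|exact: ccont_affine].
move=> t ht _; have hts : cabs (t - s) <= b - a + (d' - c').
  apply: le_trans (cabs_le_ReIm _) _; rewrite ReD ImD ReN ImN.
  by move: ht hs'; rewrite /inrect => h1 h2; apply: lerD; rewrite ler_norml; lra.
have := hd (t - s); rewrite (addrC s) subrK.
have -> : f t - f s - (t - s) * l = f t - (f s - s * l + t * l) by ring.
move=> H; apply: le_trans (H _) _; first by lra.
by rewrite ler_pM2l.
Qed.

Lemma bdry_degx f x y0 y1 : y0 <= y1 -> cont_rect f x x y0 y1 -> bdry f x x y0 y1 = 0.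
Proof.
move=> hy hf; rewrite /bdry cint_nil; last first.
  by apply: cont_onB; apply: cont_on_hor hf _; lra.
have -> : (fun y => f (x +i* y) - f (x +i* y)) = (fun=> 0) by apply/funext => y; rewrite subrr.
by rewrite cint_cst// mul0r mulr0 addr0.
Qed.

Lemma bdry_degy f x0 x1 y : x0 <= x1 -> cont_rect f x0 x1 y y -> bdry f x0 x1 y y = 0.
Proof.
move=> hx hf; rewrite /bdry [X in _ + _ * X]cint_nil; last first.
  by apply: cont_onB; apply: cont_on_ver hf _; lra.
have -> : (fun x => f (x +i* y) - f (x +i* y)) = (fun=> 0) by apply/funext => x; rewrite subrr.
by rewrite cint_cst// mul0r mulr0 addr0.
Qed.

(** Induction on the exceptional points. The next point [p] is enclosed in a rectangle of half side
    [e]; the pieces around it avoid [p], and the small rectangle contributes at most a multiple of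
    [e], because [f] is bounded near [p]. *)
Lemma goursat (E : seq C) f x0 x1 y0 y1 : x0 <= x1 -> y0 <= y1 ->
  cont_rect f x0 x1 y0 y1 ->
  (forall s, inrect x0 x1 y0 y1 s -> s \notin E -> cderivable f s) -> bdry f x0 x1 y0 y1 = 0.
Proof.
elim: E x0 x1 y0 y1 => [|p E IH] x0 x1 y0 y1 hx hy hc hf.
  by apply: goursat0 => // s hs; exact: hf.
have IHp a b c d : a <= b -> c <= d -> x0 <= a -> b <= x1 -> y0 <= c -> d <= y1 ->
    ~~ inrect a b c d p -> bdry f a b c d = 0.
  move=> ab cd h1 h2 h3 h4 np; apply: IH => //; first exact: cont_rect_sub hc.
  move=> s hs sE; apply: hf; first by move: hs; rewrite /inrect; lra.
  rewrite inE negb_or sE andbT; apply: contraNneq np => <-; exact: hs.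
have [pin|np] := boolP (inrect x0 x1 y0 y1 p); last exact: IHp np.
have [d d0 hd] := hc p pin 1 ltr01.
pose K := cabs (f p) + 1.
suff H e : 0 < e -> e < d / 2 -> cabs (bdry f x0 x1 y0 y1) <= 4 * K * (4 * e).
  have K0 : 0 < K by rewrite /K ltr_wpDl// cabs_ge0.
  apply/eqP; rewrite -cabs_eq0 eq_le cabs_ge0 andbT; apply/ler_addgt0Pl => e e0.
  rewrite addr0; pose e' := Num.min (e / (16 * K)) (d / 4).
  have h1 : 0 < e' by rewrite lt_min !divr_gt0// mulr_gt0.
  have h2 : e' <= d / 4 by rewrite /e' ge_min lexx orbT.
  have h3 : e' <= e / (16 * K) by rewrite /e' ge_min lexx.
  have h4 : e' < d / 2 by lra.
  apply: le_trans (H _ h1 h4) _; move: h3; rewrite ler_pdivlMr ?mulr_gt0//; nra.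
move=> e0 ed; set px := complex.Re p; set py := complex.Im p.
have hpx : x0 <= px <= x1 by case/andP: pin.
have hpy : y0 <= py <= y1 by case/andP: pin.
(* Clipping to the large rectangle allows [p] to lie on or near its boundary. Each of the four
   surrounding pieces is then either degenerate or free of [p]. *)
pose a := Num.max x0 (px - e); pose b := Num.min x1 (px + e).
pose c := Num.max y0 (py - e); pose c' := Num.min y1 (py + e).
have [a1 a3 a4] : [/\ x0 <= a, a <= px & px - e <= a].
  by rewrite /a; case: (leP x0 (px - e)) => h; split; lra.
have a2 : {a = x0} + {a < px} by rewrite /a; case: (leP x0 (px - e)) => h; [right; lra|left].
have [b1 b3 b4] : [/\ b <= x1, px <= b & b <= px + e].
  by rewrite /b; case: (leP x1 (px + e)) => h; split; lra.
have b2 : {b = x1} + {px < b} by rewrite /b; case: (leP x1 (px + e)) => h; [left|right; lra].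
have [c1 c3 c4] : [/\ y0 <= c, c <= py & py - e <= c].
  by rewrite /c; case: (leP y0 (py - e)) => h; split; lra.
have c2 : {c = y0} + {c < py} by rewrite /c; case: (leP y0 (py - e)) => h; [right; lra|left].
have [d1 d3 d4] : [/\ c' <= y1, py <= c' & c' <= py + e].
  by rewrite /c'; case: (leP y1 (py + e)) => h; split; lra.
have d2 : {c' = y1} + {py < c'} by rewrite /c'; case: (leP y1 (py + e)) => h; [left|right; lra].
move: a b c c' a1 a3 a4 a2 b1 b3 b4 b2 c1 c3 c4 c2 d1 d3 d4 d2 => a b c c'.
move=> a1 a3 a4 a2 b1 b3 b4 b2 c1 c3 c4 c2 d1 d3 d4 d2.
have ab : a <= b := le_trans a3 b3; have x0b : x0 <= b := le_trans a1 ab.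
have ax1 : a <= x1 := le_trans ab b1; have cc' : c <= c' := le_trans c3 d3.
have y0c' : y0 <= c' := le_trans c1 cc'; have cy1 : c <= y1 := le_trans cc' d1.
have sub := cont_rect_sub _ _ _ _ hc.
rewrite (@bdry_splitx _ f x0 a x1) ?a1//.
have -> : bdry f x0 a y0 y1 = 0.
  case: a2 => [e1|lt]; first by rewrite e1 bdry_degx//; apply: sub.
  by apply: IHp => //; rewrite /inrect -/px (leNgt px a) lt andbF.
rewrite add0r (@bdry_splitx _ f a b x1) ?ab//; last exact: sub.
have -> : bdry f b x1 y0 y1 = 0.
  case: b2 => [e1|lt]; first by rewrite e1 bdry_degx//; apply: sub.
  by apply: IHp => //; rewrite /inrect -/px (leNgt b px) lt.
rewrite addr0 (@bdry_splity _ f a b y0 c y1) ?c1//; last exact: sub.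
have -> : bdry f a b y0 c = 0.
  case: c2 => [e1|lt]; first by rewrite e1 bdry_degy//; apply: sub.
  by apply: IHp => //; rewrite /inrect -/py (leNgt py c) lt !andbF.
rewrite add0r (@bdry_splity _ f a b c c' y1) ?cc'//; last exact: sub.
have -> : bdry f a b c' y1 = 0.
  case: d2 => [e1|lt]; first by rewrite e1 bdry_degy//; apply: sub.
  by apply: IHp => //; rewrite /inrect -/py (leNgt c' py) lt andbF.
rewrite addr0.
apply: le_trans (bdry_bound (K := K) _ _ _ _) _ => //; first exact/cont_rect_bdry/sub.
  move=> s hs _; have : cabs (s - p) < d.
    apply: le_lt_trans (cabs_le_ReIm _) _; rewrite ReD ImD ReN ImN -/px -/py.
    have h1 : `|complex.Re s - px| <= e.
      by move: hs a4 b4 => /andP[/andP[? ?] _] ? ?; rewrite ler_norml; lra.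
    have h2 : `|complex.Im s - py| <= e.
      by move: hs c4 d4 => /andP[_ /andP[? ?]] ? ?; rewrite ler_norml; lra.
    by move: h1 h2 ed; clear; lra.
  move=> /hd h; rewrite /K; have := le_cabsD (f s - f p) (f p); rewrite subrK; lra.
have K0 : 0 < K by rewrite /K ltr_wpDl// cabs_ge0.
rewrite ler_pM2l ?mulr_gt0//; lra.
Qed.

End Goursat.

(** * Complex differentiability and Cauchy's estimate *)

Section ComplexDerivatives.
Variable R : realType.
Local Notation C := R[i].
Implicit Types (f g : C -> C) (s c p : C).

Lemma cderivableP f s : derivable (f : C^o -> C^o) s 1 <-> cderivable f s.
Proof. exact: derivableCP. Qed.

Lemma cderivable_cst (a : C) s : cderivable (fun=> a) s.
Proof.
exists 0 => e e0; exists 1 => // h _.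
by rewrite subrr mulr0 subrr cabs0 mulr_ge0 ?cabs_ge0// ltW.
Qed.

Lemma cderivable_id s : cderivable (fun s => s) s.
Proof.
exists 1 => e e0; exists 1 => // h _.
by rewrite mulr1 (addrAC s) subrr add0r subrr cabs0 mulr_ge0 ?cabs_ge0// ltW.
Qed.

Lemma cderivableD f g s : cderivable f s -> cderivable g s -> cderivable (fun s => f s + g s) s.
Proof. by move=> /cderivableP hf /cderivableP hg; apply/cderivableP; have := @derivableD C C^o C^o f g s 1 hf hg. Qed.

Lemma cderivableN f s : cderivable f s -> cderivable (fun s => - f s) s.
Proof. by move=> /cderivableP hf; apply/cderivableP; have := @derivableN C C^o C^o f s 1 hf. Qed.

Lemma cderivableB f g s : cderivable f s -> cderivable g s -> cderivable (fun s => f s - g s) s.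
Proof. by move=> hf /cderivableN; exact: cderivableD. Qed.

Lemma cderivableM f g s : cderivable f s -> cderivable g s -> cderivable (fun s => f s * g s) s.
Proof. by move=> /cderivableP hf /cderivableP hg; apply/cderivableP; have := @derivableM C C^o f g s 1 hf hg. Qed.

Lemma cderivableV f s : f s != 0 -> cderivable f s -> cderivable (fun s => (f s)^-1) s.
Proof. by move=> f0 /cderivableP hf; apply/cderivableP; have := @derivableV C C^o f s 1 f0 hf. Qed.

Lemma cderivableX f n s : cderivable f s -> cderivable (fun s => f s ^+ n) s.
Proof.
move=> hf; elim: n => [|n IH]; first exact: cderivable_cst.
under eq_fun do rewrite exprS; exact: cderivableM.
Qed.

Lemma cderivable_sum (I : Type) (r : seq I) (P : pred I) (F : I -> C -> C) s :
  (forall i, P i -> cderivable (F i) s) -> cderivable (fun s => \sum_(i <- r | P i) F i s) s.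
Proof.
move=> h; elim: r => [|i r IH].
  by under eq_fun do rewrite big_nil; exact: cderivable_cst.
under eq_fun do rewrite big_cons.
case Pi: (P i); [apply: cderivableD IH; exact: h|exact: IH].
Qed.

Lemma cderivable_prod (I : Type) (r : seq I) (P : pred I) (F : I -> C -> C) s :
  (forall i, P i -> cderivable (F i) s) -> cderivable (fun s => \prod_(i <- r | P i) F i s) s.
Proof.
move=> h; elim: r => [|i r IH].
  by under eq_fun do rewrite big_nil; exact: cderivable_cst.
under eq_fun do rewrite big_cons.
case Pi: (P i); [apply: cderivableM IH; exact: h|exact: IH].
Qed.

Lemma cderiv_comp f g s l m : cderiv g s l -> cderiv f (g s) m ->
  cderiv (fun s => f (g s)) s (l * m).
Proof.
move=> hg hf e e0.
pose k := cabs l + 1; have k0 : 0 < k by rewrite /k ltr_wpDl// cabs_ge0.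
pose n := cabs m + 1; have n0 : 0 < n by rewrite /n ltr_wpDl// cabs_ge0.
pose e1 := e / (2 * k); have e10 : 0 < e1 by rewrite divr_gt0// mulr_gt0.
pose e2 := Num.min 1 (e / (2 * n)).
have e20 : 0 < e2 by rewrite lt_min ltr01 divr_gt0// mulr_gt0.
have [d1 d10 hd1] := hf _ e10; have [d2 d20 hd2] := hg _ e20.
exists (Num.min d2 (d1 / k)); first by rewrite lt_min d20 divr_gt0.
move=> h; rewrite lt_min ltr_pdivlMr// => /andP[h1 h2].
have := hd2 h h1; set u := g (s + h) - g s => hu.
have e21 : e2 <= 1 by rewrite /e2 ge_min lexx.
have e22 : e2 * n <= e / 2.
  by apply: (@le_trans _ _ (e / (2 * n) * n)); [rewrite ler_pM2r// /e2 ge_min lexx orbT|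
   rewrite invfM mulrA divfK ?lt0r_neq0].
have h0 := cabs_ge0 h.
have uk : cabs u <= k * cabs h.
  have := le_cabsD (u - h * l) (h * l); rewrite subrK cabsM /k; nra.
have := hd1 u; rewrite /u (addrC (g s)) subrK -/u => /(_ (le_lt_trans uk _)).
rewrite (mulrC k) => /(_ h2) H.
have -> : f (g (s + h)) - f (g s) - h * (l * m) =
   (f (g (s + h)) - f (g s) - u * m) + (u - h * l) * m by ring.
apply: le_trans (le_cabsD _ _) _; rewrite cabsM.
have -> : e * cabs h = e / 2 * cabs h + e / 2 * cabs h by field.
apply: lerD.
  apply: le_trans H _; apply: (@le_trans _ _ (e1 * (k * cabs h))); first by rewrite ler_pM2l.
  by rewrite /e1 invfM !mulrA divfK ?lt0r_neq0.
have := cabs_ge0 m; have := cabs_ge0 (u - h * l); rewrite /n in e22.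
move=> x0 y0; apply: (@le_trans _ _ (e2 * cabs h * (cabs m + 1))).
  by apply: ler_pM => //; lra.
by rewrite mulrAC; apply: ler_wpM2r.
Qed.

Lemma cderivable_comp f g s : cderivable g s -> cderivable f (g s) ->
  cderivable (fun s => f (g s)) s.
Proof. by move=> [l hl] [m hm]; exists (l * m); exact: cderiv_comp hl hm. Qed.

Lemma cderivable_near f g c : (\forall s \near (c : C^o), f s = g s) ->
  cderivable f c -> cderivable g c.
Proof.
move=> /nearCP[d d0 hd] [l hl]; exists l => e e0; have [d' d'0 hd'] := hl _ e0.
exists (Num.min d d'); first by rewrite lt_min d0.
move=> h; rewrite lt_min => /andP[h1 h2].
by rewrite -!hd ?subrr ?cabs0//; [exact: hd'|rewrite addrAC subrr add0r].
Qed.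

Lemma cderivable_cexp f s : cderivable f s -> cderivable (fun s => cexp (f s)) s.
Proof. by move=> hf; apply: cderivable_comp hf _; exists (cexp (f s)); exact: cderiv_cexp. Qed.

Lemma cderivable_cpow w f s : cderivable f s -> cderivable (fun s => cpow w (f s)) s.
Proof. by move=> hf; apply: cderivable_cexp; apply: cderivableM => //; exact: cderivable_cst. Qed.

Lemma cderivable_cont f s : cderivable f s -> ccont_at f s.
Proof. by move=> [l /cderiv_cont]. Qed.

Lemma ccont_near f g c : (\forall s \near (c : C^o), f s = g s) -> ccont_at f c -> ccont_at g c.
Proof.
move=> /nearCP[d d0 hd] hf e e0; have [d' d'0 hd'] := hf _ e0.
exists (Num.min d d'); first by rewrite lt_min d0.
by move=> t; rewrite lt_min => /andP[h1 h2]; rewrite -!hd ?subrr ?cabs0//; exact: hd'.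
Qed.

Lemma ccontP f c : ccont_at f c <-> {for (c : C^o), continuous (f : C^o -> C^o)}.
Proof.
have H := @cvgCP R C (nbhs (c : C^o)) (nbhs_filter (c : C^o)) f (f c).
split=> [h|/H h]; last by move=> e e0; apply/nearCP; exact: h.
by apply/H => e e0; apply/nearCP; exact: h.
Qed.

Lemma ccontM f g s : ccont_at f s -> ccont_at g s -> ccont_at (fun s => f s * g s) s.
Proof.
move=> hf hg e e0; pose k := cabs (f s) + cabs (g s) + 2.
have k0 : 0 < k by rewrite /k ltr_wpDl// addr_ge0 ?cabs_ge0.
have e20 : 0 < Num.min 1 (e / (2 * k)) by rewrite lt_min ltr01 divr_gt0// mulr_gt0.
have [d d0 hd] := hf _ e20; have [d' d'0 hd'] := hg _ e20.
exists (Num.min d d'); first by rewrite lt_min d0.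
move=> t; rewrite lt_min => /andP[/hd h1 /hd' h2].
move: h1 h2; rewrite !lt_min !ltr_pdivlMr ?mulr_gt0// => /andP[h1 h1'] /andP[h2 h2'].
have -> : f t * g t - f s * g s = (f t - f s) * (g t - g s) + (f t - f s) * g s + f s * (g t - g s) by ring.
apply: le_lt_trans (le_cabsD _ _) _; rewrite cabsM.
apply: le_lt_trans (lerD (le_cabsD _ _) (lexx _)) _; rewrite !cabsM.
have i1 := cabs_ge0 (f t - f s); have i2 := cabs_ge0 (g t - g s).
have i3 := cabs_ge0 (f s); have i4 := cabs_ge0 (g s).
rewrite /k in h1' h2'; nra.
Qed.

Lemma near_neq (c p : C) : c != p -> \forall s \near (c : C^o), s != p.
Proof.
move=> cp; apply/nearCP; exists (cabs (c - p)); first by rewrite cabs_gt0 subr_eq0.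
by move=> s h; apply: contraTneq h => ->; rewrite cabsBC ltxx.
Qed.

(** The difference quotient, completed at [p] by a candidate for the derivative. Continuity at [p]
    is all that is derived there, so [p] joins the exceptional set when Goursat's theorem is
    applied. *)
Definition dquot f p (l : C) : C -> C := fun s => if s == p then l else (f s - f p) / (s - p).

Lemma dquot_cont f p l s : cderiv f p l -> ccont_at f s -> ccont_at (dquot f p l) s.
Proof.
move=> hl hf; have [->|sp] := eqVneq s p.
  move=> e e0; have e20 : 0 < e / 2 by lra.
  have [d d0 hd] := hl _ e20; exists d => // t ht; rewrite /dquot eqxx.
  case: eqVneq => [_|tp]; first by rewrite subrr cabs0.
  have tp0 : 0 < cabs (t - p) by rewrite cabs_gt0 subr_eq0.
  have := hd _ ht; rewrite (addrC p) subrK => H.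
  have -> : (f t - f p) / (t - p) - l = (f t - f p - (t - p) * l) / (t - p).
    by rewrite [RHS]mulrBl mulrAC divff ?mul1r// subr_eq0.
  by rewrite cabs_div ltr_pdivrMr//; nra.
apply: (@ccont_near (fun s => (f s - f p) * (s - p)^-1)).
  have := near_neq sp; apply: filterS => t tp; rewrite /dquot; by case: eqVneq tp.
apply: ccontM; first by apply: ccontB => //; apply: cderivable_cont; exact: cderivable_cst.
apply: cderivable_cont; apply: cderivableV; first by rewrite subr_eq0.
by apply: cderivableB; [exact: cderivable_id|exact: cderivable_cst].
Qed.

Lemma dquot_derivable f p l s : s != p -> cderivable f s -> cderivable (dquot f p l) s.
Proof.
move=> sp hf; apply: (@cderivable_near (fun s => (f s - f p) * (s - p)^-1)).
  have := near_neq sp; apply: filterS => t tp; rewrite /dquot; by case: eqVneq tp.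
apply: cderivableM; first by apply: cderivableB => //; exact: cderivable_cst.
apply: cderivableV; first by rewrite subr_eq0.
by apply: cderivableB; [exact: cderivable_id|exact: cderivable_cst].
Qed.

End ComplexDerivatives.

(** * Cauchy's estimate at the centre of a square *)

Section CauchyEstimates.
Variable R : realType.
Local Notation C := R[i].
Implicit Types (f g : C -> C) (s c p : C) (a M : R).

Definition sqr_dist (s p : C) : R :=
  Num.max `|complex.Re s - complex.Re p| `|complex.Im s - complex.Im p|.

Lemma sqr_dist_le s p : sqr_dist s p <= cabs (s - p).
Proof. by rewrite ge_max Re_lip Im_lip. Qed.

Lemma cabs_le_sqr_dist s p : cabs (s - p) <= 2 * sqr_dist s p.
Proof.
apply: le_trans (cabs_le_ReIm _) _; rewrite ReD ImD ReN ImN mulr2n mulrDl mul1r.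
by apply: lerD; rewrite /sqr_dist le_max lexx ?orbT.
Qed.

Lemma inrect_sqr p a s :
  inrect (complex.Re p - a) (complex.Re p + a) (complex.Im p - a) (complex.Im p + a) s =
  (sqr_dist s p <= a).
Proof. by rewrite /inrect ge_max !ler_norml; congr andb; lra. Qed.

Lemma bdry_sqr p a s : 0 <= a -> sqr_dist s p <= a ->
  (complex.Re s \in [:: complex.Re p - a; complex.Re p + a]) ||
  (complex.Im s \in [:: complex.Im p - a; complex.Im p + a]) -> sqr_dist s p = a.
Proof.
move=> a0 h h2; apply/eqP; rewrite eq_le h /= /sqr_dist le_max.
have E (x y : R) : (x = y - a) \/ (x = y + a) -> a <= `|x - y|.
  by case=> ->; [rewrite addrAC subrr add0r normrN|rewrite addrAC subrr add0r]; rewrite ler_norm.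
move: h2; rewrite !inE => /orP[/orP[]|/orP[]] /eqP e.
- by rewrite E//; left.
- by rewrite E//; right.
- by rewrite (E (complex.Im s))// ?orbT//; left.
- by rewrite (E (complex.Im s))// ?orbT//; right.
Qed.

(** On each side of a square of half side [a] about [p], a suitable component of 1 / (s - p) is at
    least 1 / (2 a). This keeps the winding integral away from 0 without evaluating it. *)
Lemma cinv_Re (x y a : R) : 0 < a -> x = a -> `|y| <= a -> (2 * a)^-1 <= complex.Re (x +i* y)^-1.
Proof.
move=> a0 -> hy; rewrite ReV sqr_cabs /= invfM ler_pdivlMr; last by rewrite ltr_wpDr ?exprn_gt0// sqr_ge0.
rewrite -invfM mulrC ler_pdivrMr ?mulr_gt0//.
have : y ^+ 2 <= a ^+ 2 by rewrite -(real_normK (num_real y)) ler_sqr ?nnegrE// ltW.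
by rewrite !expr2; lra.
Qed.

(* The exceptional set E allows f to be a difference quotient. *)
Lemma center_estimate (E : seq C) f p a M : 0 < a -> p \notin E ->
  (forall s, sqr_dist s p <= a -> ccont_at f s) ->
  (forall s, sqr_dist s p <= a -> s \notin E -> cderivable f s) ->
  (forall s, sqr_dist s p = a -> cabs (f s) <= M) -> cabs (f p) <= 4 * M.
Proof.
move=> a0 pE fc fd fM.
have spp : sqr_dist p p = 0 by rewrite /sqr_dist !subrr normr0 maxxx.
have M0 : 0 <= M.
  apply: le_trans (cabs_ge0 _) (fM (p + a%:C) _).
  by rewrite /sqr_dist ReD ImD /= addr0 addrAC subrr add0r subrr normr0 gtr0_norm// maxEge ltW.
have [->|fp0] := eqVneq (f p) 0; first by rewrite cabs0 mulr_ge0.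
have [l hl] := fd p (eq_ind_r (fun x => x <= a) (ltW a0) spp) pE.
pose g s := f s / f p.
have gc s : sqr_dist s p <= a -> ccont_at g s.
  by move=> h; apply: ccontM; [exact: fc|apply: cderivable_cont; exact: cderivable_cst].
have gd s : sqr_dist s p <= a -> s \notin E -> cderivable g s.
  by move=> h h'; apply: cderivableM; [exact: fd|exact: cderivable_cst].
have [m hm] := gd p (eq_ind_r (fun x => x <= a) (ltW a0) spp) pE.
set x0 := complex.Re p - a; set x1 := complex.Re p + a.
set y0 := complex.Im p - a; set y1 := complex.Im p + a.
have hx : x0 <= x1 by rewrite /x0 /x1; lra.
have hy : y0 <= y1 by rewrite /y0 /y1; lra.
(* As [g p] is 1, [q s + k s] equals g(s) / (s - p) on the boundary, and the integral of [q]
   vanishes. Hence the integral of [k] is that of g(s) / (s - p), which [M] bounds from above. *)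
pose q := dquot g p m; pose k s := (s - p)^-1.
have qc : cont_rect q x0 x1 y0 y1.
  by move=> s; rewrite inrect_sqr => h; apply: dquot_cont => //; exact: gc.
have q0 : bdry q x0 x1 y0 y1 = 0.
  apply: (@goursat _ (p :: E)) => // s; rewrite inrect_sqr => h.
  rewrite inE negb_or => /andP[sp sE]; exact/dquot_derivable/gd.
have np s : sqr_dist s p = a -> s != p.
  by move=> h; apply: contraTneq a0 => sp; rewrite -h sp spp ltxx.
have kc : cont_bdry k x0 x1 y0 y1.
  move=> s; rewrite inrect_sqr => h h2; have sp := np _ (bdry_sqr (ltW a0) h h2).
  apply: cderivable_cont; apply: cderivableV; first by rewrite subr_eq0.
  by apply: cderivableB; [exact: cderivable_id|exact: cderivable_cst].
have knc : cont_bdry (fun s => - k s) x0 x1 y0 y1.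
  move=> s h h2; have -> : (fun s => - k s) = (fun s => 0 - k s) by apply/funext => t; rewrite sub0r.
  apply: ccontB; [apply: cderivable_cont; exact: cderivable_cst|exact: kc].
have zc (u : C) : cont_bdry (fun=> u) x0 x1 y0 y1.
  by move=> s _ _; apply: cderivable_cont; exact: cderivable_cst.
have kN : bdry (fun s => - k s) x0 x1 y0 y1 = - bdry k x0 x1 y0 y1.
  have -> : (fun s => - k s) = (fun s => 0 - k s) by apply/funext => t; rewrite sub0r.
  rewrite bdryB//; have := @bdry_affine _ 0 0 x0 x1 y0 y1 hx hy.
  under [X in bdry X]eq_fun do rewrite mulr0 addr0.
  by move=> ->; rewrite sub0r.
have H1 : bdry (fun s => q s - - k s) x0 x1 y0 y1 = bdry k x0 x1 y0 y1.
  by rewrite bdryB//; [rewrite q0 kN opprK add0r|exact: cont_rect_bdry].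
have B1 : cabs (bdry k x0 x1 y0 y1) <= 4 * (M / (cabs (f p) * a)) * (4 * a).
  have -> : 4 * a = x1 - x0 + (y1 - y0) by rewrite /x1 /x0 /y1 /y0; lra.
  rewrite -H1; apply: bdry_bound => //.
    by move=> s h h2; apply: ccontB; [exact: qc|exact: knc].
  move=> s; rewrite inrect_sqr => h h2; have sa := bdry_sqr (ltW a0) h h2.
  have sp := np _ sa; have sp0 : s - p != 0 by rewrite subr_eq0.
  have -> : q s - - k s = g s / (s - p).
    rewrite /q /dquot (negPf sp) opprK /k -[X in _ + X]mul1r -mulrDl.
    by rewrite /g (divff fp0) subrK.
  rewrite cabs_div /g cabs_div -mulrA -invfM.
  have c0 : 0 < cabs (f p) by rewrite cabs_gt0.
  apply: ler_pM; rewrite ?cabs_ge0 ?invr_ge0 ?mulr_ge0 ?cabs_ge0//; first exact: fM.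
  rewrite lef_pV2 ?posrE ?mulr_gt0 ?cabs_gt0// ler_pM2l// -sa.
  exact: sqr_dist_le.
(* The lower bound 4 stands in for the exact value 2 pi: each pair of opposite sides has an
   integrand of at least 1 / a over a length 2 a. Compared with the upper bound 16 M / |f p| it
   gives the constant 4 of the lemma. *)
have half : complex.Im (bdry k x0 x1 y0 y1) >= 4.
  have E1 x y y' : complex.Re p - a <= x <= complex.Re p + a -> y = complex.Im p - a -> y' = complex.Im p + a ->
      a^-1 <= complex.Im (k (x +i* y) - k (x +i* y')).
    move=> hxx -> ->; rewrite /k ImD ImN.
    have -> : (x +i* (complex.Im p - a)) - p = 'i * ((- a) +i* (complex.Re p - x)) by case: (p) => u v; apply: eqCP => /=; ring.
    have -> : (x +i* (complex.Im p + a)) - p = 'i * (a +i* (complex.Re p - x)) by case: (p) => u v; apply: eqCP => /=; ring.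
    have hh : `|complex.Re p - x| <= a by rewrite ler_norml; lra.
    have i1 := cinv_Re a0 (erefl a) hh.
    have i2 : (2 * a)^-1 <= - complex.Re ((- a) +i* (complex.Re p - x))^-1.
      have -> : (- a) +i* (complex.Re p - x) = - (a +i* (x - complex.Re p)) by apply: eqCP => /=; ring.
      by rewrite invrN ReN opprK; apply: cinv_Re => //; rewrite distrC.
    rewrite !invfM -[('i : C)^-1]mulr1.
    have -> : ('i : C)^-1 * 1 = - 'i.
      by apply: (mulfI (_ : ('i : C) != 0)); rewrite ?mulr1 ?divff -?cabs_eq0 ?cabs_i ?oner_eq0// mulrN -expr2 sqr_i opprK.
    have -> : a^-1 = (2 * a)^-1 + (2 * a)^-1 by field; rewrite lt0r_neq0.
    move: i1 i2; set u := (_ +i* _)^-1; set v := (_ +i* _)^-1.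
    by rewrite !ImM /=; lra.
  have E2 x x' y : complex.Im p - a <= y <= complex.Im p + a -> x = complex.Re p - a -> x' = complex.Re p + a ->
      a^-1 <= complex.Re (k (x' +i* y) - k (x +i* y)).
    move=> hyy -> ->; rewrite /k ReD ReN.
    have -> : ((complex.Re p + a) +i* y) - p = a +i* (y - complex.Im p) by case: (p) => u v; apply: eqCP => /=; ring.
    have -> : ((complex.Re p - a) +i* y) - p = - (a +i* (complex.Im p - y)) by case: (p) => u v; apply: eqCP => /=; ring.
    have hh : `|y - complex.Im p| <= a by rewrite ler_norml; lra.
    have i1 := cinv_Re a0 (erefl a) hh.
    have i2 : (2 * a)^-1 <= complex.Re (a +i* (complex.Im p - y))^-1 by apply: cinv_Re => //; rewrite distrC.
    have -> : a^-1 = (2 * a)^-1 + (2 * a)^-1 by field; rewrite lt0r_neq0.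
    by rewrite invrN ReN opprK lerD.
  rewrite /bdry ImD [X in _ + X]ImM /= mul1r mul0r add0r.
  have -> : 4 = a^-1 * (x1 - x0) + a^-1 * (y1 - y0) :> R by rewrite /x1 /x0 /y1 /y0; field; rewrite lt0r_neq0.
  apply: lerD; apply: rint_ge => //.
  - apply: cont_on_integrable; first exact: Im_lip.
    by apply: cont_onB; apply: (cont_bdry_hor kc); rewrite ?lexx ?hy// !inE eqxx ?orbT.
  - by move=> x hxx; exact: E1.
  - apply: cont_on_integrable; first exact: Re_lip.
    by apply: cont_onB; apply: (cont_bdry_ver kc); rewrite ?lexx ?hx// !inE eqxx ?orbT.
  - by move=> y hyy; exact: E2.
have c0 : 0 < cabs (f p) by rewrite cabs_gt0.
have := le_trans half (le_trans (ler_norm _) (le_trans (le_cabs_Im _) B1)).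
have -> : 4 * (M / (cabs (f p) * a)) * (4 * a) = 16 * M / cabs (f p) by field; rewrite !lt0r_neq0.
rewrite ler_pdivlMr//; lra.
Qed.

End CauchyEstimates.

(** * Local identity theorem, second-order bounds and series of holomorphic functions *)

Section HolomorphicFunctions.
Variable R : realType.
Local Notation C := R[i].
Implicit Types (f g : C -> C) (s c p : C) (a M : R).

Lemma le_invr (a b : R) : 0 < a -> a <= b -> b^-1 <= a^-1.
Proof. by move=> a0 ab; rewrite lef_pV2 ?posrE// (lt_le_trans a0). Qed.

Lemma bounded_rect f x0 x1 y0 y1 : x0 <= x1 -> y0 <= y1 -> cont_rect f x0 x1 y0 y1 ->
  exists K, forall s, inrect x0 x1 y0 y1 s -> cabs (f s) <= K.
Proof.
move=> hx hy hc.
apply: (@bisection _ (fun x0 x1 y0 y1 => exists K, forall s, inrect x0 x1 y0 y1 s -> cabs (f s) <= K)) => //.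
  move=> u0 u1 v0 v1 h1 h2 mx my [K1 k1] [K2 k2] [K3 k3] [K4 k4].
  exists (Num.max (Num.max K1 K2) (Num.max K3 K4)) => s /andP[/andP[s1 s2] /andP[s3 s4]].
  rewrite !le_max; case: (leP (complex.Re s) mx) => a1; case: (leP (complex.Im s) my) => a2.
  - by rewrite k1// /inrect s1 s3 a1 a2.
  - by rewrite k3 ?orbT// /inrect s1 s4 a1 (ltW a2).
  - by rewrite k2 ?orbT// /inrect s2 s3 a2 (ltW a1).
  - by rewrite k4 ?orbT// /inrect s2 s4 (ltW a2) (ltW a1).
move=> s hs; have [d d0 hd] := hc s hs _ ltr01.
exists (d / 2); first by lra.
move=> u0 u1 v0 v1 _ _ _ _ /andP[/andP[s1 s2] /andP[s3 s4]] h1 h2.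
exists (cabs (f s) + 1) => t /andP[/andP[t1 t2] /andP[t3 t4]].
have : cabs (t - s) < d.
  apply: le_lt_trans (cabs_le_ReIm _) _; rewrite ReD ImD ReN ImN.
  have i1 : `|complex.Re t - complex.Re s| <= u1 - u0 by rewrite ler_norml; lra.
  have i2 : `|complex.Im t - complex.Im s| <= v1 - v0 by rewrite ler_norml; lra.
  by move: i1 i2 h1 h2; clear; lra.
by move=> /hd h; have := le_cabsD (f t - f s) (f s); rewrite subrK; lra.
Qed.

Lemma bounded_sqr f p a : 0 <= a -> (forall s, sqr_dist s p <= a -> ccont_at f s) ->
  exists2 K, 0 <= K & forall s, sqr_dist s p <= a -> cabs (f s) <= K.
Proof.
move=> a0 hc; have [|||K hK] := @bounded_rect f (complex.Re p - a) (complex.Re p + a)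
  (complex.Im p - a) (complex.Im p + a); try lra.
  by move=> s; rewrite inrect_sqr; exact: hc.
exists (Num.max 0 K); first by rewrite le_max lexx.
by move=> s hs; rewrite le_max hK ?orbT// inrect_sqr.
Qed.

Lemma geo_small (x e : R) : 0 <= x < 1 -> 0 < e -> exists n, x ^+ n < e.
Proof.
move=> /andP[x0 x1] e0.
have : (fun n => x ^+ n) @ \oo --> (0 : R) by apply: cvg_expr; rewrite ger0_norm.
by move=> /cvgrPdist_lt /(_ _ e0) [n _ /(_ n (leqnn n))]; rewrite /= sub0r normrN => h;
  exists n; apply: le_lt_trans h; exact: ler_norm.
Qed.

Definition cball (c : C) (r : R) s := cabs (s - c) < r.

(* g(s) / (s - p)^N is holomorphic for every N, and Cauchy's bound on a fixed square gives
   |g(s)| <= K x^N with x < 1. *)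
Lemma local_identity g c r p : 0 < r -> (forall s, cball c r s -> cderivable g s) ->
  cball c (r / 16) p -> (\forall s \near (p : C^o), g s = 0) ->
  forall s, cball c (r / 16) s -> g s = 0.
Proof.
move=> r0 hg hp /nearCP[d d0 hd] s hs; rewrite /cball in hp hs.
have [->|sp] := eqVneq s p; first by apply: hd; rewrite subrr cabs0.
have sp0 : 0 < cabs (s - p) by rewrite cabs_gt0 subr_eq0.
(* With this choice [p] is closer to [s] than a / 2, while the boundary of the square of half side
   [a] about [s] stays at distance at least a / 2 from [p]. The ratio of the two distances is the
   [x] below. *)
pose a := r / 4; have a0 : 0 < a by rewrite /a; lra.
have inball t : sqr_dist t s <= a -> cball c r t.
  rewrite /a /cball => h; have := cabs_le_sqr_dist t s; have := le_cabs_tri s t c; lra.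
have [||K K0 hK] := @bounded_sqr g s a; first exact: ltW.
  by move=> t /inball /hg; exact: cderivable_cont.
have hsp : cabs (s - p) < a / 2.
  by have := le_cabs_tri c s p; rewrite (cabsBC c p) /a; lra.
pose x := cabs (s - p) / (a / 2).
have x1 : 0 <= x < 1.
  by rewrite divr_ge0 ?cabs_ge0 ?ltr_pdivrMr ?mul1r//=; lra.
apply/eqP; rewrite -cabs_eq0 eq_le cabs_ge0 andbT; apply/ler_addgt0Pl => e e0; rewrite addr0.
have e1 : 0 < e / (4 * K + 1) by rewrite divr_gt0//; lra.
have [n hn] := geo_small x1 e1.
pose f t := g t / (t - p) ^+ n.
have fd t : sqr_dist t s <= a -> cderivable f t.
  move=> ht; have [->|tp] := eqVneq t p.
    apply: (@cderivable_near _ (fun=> 0)); last exact: cderivable_cst.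
    by apply/nearCP; exists d => // u hu; rewrite /f hd// mul0r.
  apply: cderivableM; first by apply: hg; exact: inball.
  apply: cderivableV; first by rewrite expf_neq0// subr_eq0.
  by apply: cderivableX; apply: cderivableB; [exact: cderivable_id|exact: cderivable_cst].
have := @center_estimate _ [::] f s a (K / (a / 2) ^+ n) a0 isT.
move=> /(_ (fun t ht => cderivable_cont (fd t ht)) (fun t ht _ => fd t ht)) H.
have {}H : cabs (f s) <= 4 * (K / (a / 2) ^+ n).
  apply: H => t ht; rewrite /f cabs_div cabsX; apply: ler_pM; rewrite ?cabs_ge0 ?invr_ge0 ?exprn_ge0 ?cabs_ge0//.
    by apply: hK; rewrite ht.
  have h1 : a / 2 <= cabs (t - p).
    have := le_cabs_tri p t s; have := sqr_dist_le t s; rewrite ht (cabsBC p s); lra.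
  rewrite lef_pV2 ?posrE ?exprn_gt0//; [|lra|lra].
  by apply: lerXn2r => //; rewrite nnegrE; lra.
have : cabs (g s) <= 4 * K * x ^+ n.
  have -> : g s = f s * (s - p) ^+ n by rewrite /f divfK// expf_neq0// subr_eq0.
  rewrite cabsM cabsX /x exprMn exprVn mulrCA mulrA mulrC.
  rewrite -mulrA (mulrA _ K) in H *.
  by apply: ler_wpM2l => //; rewrite exprn_ge0 ?cabs_ge0.
move=> /le_trans; apply.
move: hn; rewrite ltr_pdivlMr; last lra.
have := exprn_ge0 n (_ : 0 <= x); case/andP: x1 => x0 _ /(_ x0); nra.
Qed.

(** On the boundary of a square about [s] the denominator is at least r / 8, so the trivial bound 2
    M / (r / 8) holds; [center_estimate] carries it to [s], however close [s] is to [p]. *)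
Lemma dquot_bound f c r M p l s : 0 < r -> (forall s, cball c r s -> cderivable f s) ->
  (forall s, cball c r s -> cabs (f s) <= M) -> cabs (p - c) < r / 4 -> cderiv f p l ->
  cabs (s - p) < r / 8 -> s != p -> cabs (dquot f p l s) <= 64 * M / r.
Proof.
move=> r0 fd fM hp hl hs sp; pose a := r / 4.
have a0 : 0 < a by rewrite /a; lra.
have inball t : sqr_dist t s <= a -> cball c r t.
  rewrite /a /cball => h; have := cabs_le_sqr_dist t s; have := le_cabs_tri s t c.
  have := le_cabs_tri p s c; lra.
have -> : 64 * M / r = 4 * (2 * M / (r / 8)) by field; rewrite lt0r_neq0.
apply: (@center_estimate _ [:: p] _ _ a) => //; first by rewrite inE.
- by move=> t /inball /fd /cderivable_cont; exact: dquot_cont.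
- by move=> t /inball /fd ft; rewrite inE => tp; exact: dquot_derivable.
move=> t ht; have tp : r / 8 <= cabs (t - p).
  by have := le_cabs_tri p t s; have := sqr_dist_le t s; rewrite ht (cabsBC p s) /a; lra.
have tp0 : t != p by rewrite -subr_eq0 -cabs_gt0; apply: lt_le_trans tp; lra.
rewrite /dquot (negPf tp0) cabs_div.
apply: ler_pM; rewrite ?cabs_ge0 ?invr_ge0 ?cabs_ge0//.
  apply: le_trans (le_cabsB _ _) _; rewrite mulr2n mulrDl mul1r; apply: lerD; apply: fM.
    by apply: inball; rewrite ht.
  by rewrite /cball; lra.
by apply: le_invr tp; lra.
Qed.

Lemma deriv_bound f c r M p l : 0 < r -> (forall s, cball c r s -> cderivable f s) ->
  (forall s, cball c r s -> cabs (f s) <= M) -> cabs (p - c) < r / 4 -> cderiv f p l ->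
  cabs l <= 64 * M / r.
Proof.
move=> r0 fd fM hp hl; apply/ler_addgt0Pl => e e0.
have hpc : cball c r p by rewrite /cball; lra.
have qc : ccont_at (dquot f p l) p by apply: dquot_cont => //; exact: cderiv_cont hl.
have [d d0 hd] := qc _ e0.
pose t := Num.min (d / 2) (r / 16); have t0 : 0 < t by rewrite lt_min; lra.
have t1 : t <= d / 2 by rewrite /t ge_min lexx.
have t2 : t <= r / 16 by rewrite /t ge_min lexx orbT.
have E : cabs (p + t%:C - p) = t by rewrite addrAC subrr add0r cabs_real gtr0_norm.
have := hd (p + t%:C); rewrite E => /(_ ltac:(lra)).
rewrite {2}/dquot eqxx => h.
have := @dquot_bound f c r M p l (p + t%:C) r0 fd fM hp hl; rewrite E => /(_ ltac:(lra)) h2.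
have /h2 : p + t%:C != p by rewrite -subr_eq0 -cabs_gt0 E.
have := le_cabs_tri (dquot f p l (p + t%:C)) l 0; rewrite !subr0 (cabsBC l); lra.
Qed.

(** The estimate of difference quotients is applied to the quotient [q] itself. Since [q] has only
    been shown continuous at [p], its slope is measured from a point [p2] between [p] and [p + h],
    and [p2] is taken close enough to [p] for [q p2] to be within [e] of [l]. *)
Lemma second_order_bound f c r M p l h : 0 < r -> (forall s, cball c r s -> cderivable f s) ->
  (forall s, cball c r s -> cabs (f s) <= M) -> cabs (p - c) < r / 4 -> cderiv f p l ->
  cabs h < r / 16 -> cabs (f (p + h) - f p - h * l) <= 128 * (64 * M / r ^+ 2) * cabs h ^+ 2.
Proof.
move=> r0 fd fM hp hl hh; pose a := r / 4.
have a0 : 0 < a by rewrite /a; lra.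
have M0 : 0 <= M by apply: le_trans (cabs_ge0 _) (fM c _); rewrite /cball subrr cabs0.
have [->|h0] := eqVneq h 0.
  by rewrite addr0 subrr mul0r subrr cabs0 expr0n mulr0.
have hn0 : 0 < cabs h by rewrite cabs_gt0.
pose q := dquot f p l.
suff H : cabs (q (p + h) - l) <= 128 * (64 * M / r ^+ 2) * cabs h.
  have -> : f (p + h) - f p - h * l = (q (p + h) - l) * h.
    have ph : p + h - p = h by ring.
    by rewrite /q /dquot -subr_eq0 ph (negPf h0) mulrBl divfK// (mulrC l).
  by rewrite cabsM [cabs h ^+ 2]expr2 [X in _ <= X]mulrA ler_pM2r.
apply/ler_addgt0Pl => e e0.
have qc s : cball c r s -> ccont_at q s by move=> /fd /cderivable_cont; exact: dquot_cont.
have hpc : cball c r p by rewrite /cball; lra.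
have [d d0 hd] := qc p hpc e e0.
pose t := Num.min (1 / 2) (d / 2 / cabs h).
have t0 : 0 < t by rewrite lt_min !divr_gt0.
have t1 : t <= 1 / 2 by rewrite /t ge_min lexx.
have t2 : t * cabs h <= d / 2 by rewrite -ler_pdivlMr// /t ge_min lexx orbT.
pose p2 := p + t%:C * h.
have E1 : cabs (p2 - p) = t * cabs h by rewrite /p2 addrAC subrr add0r cabsM cabs_real gtr0_norm.
have E2 : cabs (p + h - p2) = (1 - t) * cabs h.
  have -> : p + h - p2 = (1 - t)%:C * h by rewrite /p2 rmorphB /=; ring.
  by rewrite cabsM cabs_real gtr0_norm//; lra.
have p2p : p2 != p by rewrite -subr_eq0 -cabs_gt0 E1 mulr_gt0.
have pp2 : p + h != p2 by rewrite -subr_eq0 -cabs_gt0 E2 mulr_gt0//; lra.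
have php : p + h != p by rewrite -subr_eq0 addrAC subrr add0r.
have hp2 : cabs (p2 - p) < r / 16.
  by rewrite E1; apply: le_lt_trans hh; rewrite ler_piMl ?(ltW hn0)//; lra.
have hph : cabs (p + h - p2) < r / 16.
  by rewrite E2; apply: le_lt_trans hh; rewrite ler_piMl ?(ltW hn0)//; lra.
have qp2 := @dquot_bound f c r M p l p2 r0 fd fM hp hl ltac:(lra) p2p.
have p2c : cball c r p2 by rewrite /cball; have := le_cabs_tri p p2 c; lra.
have [l2 hl2] := dquot_derivable l p2p (fd _ p2c).
have inball s : sqr_dist s (p + h) <= a -> cball c r s.
  rewrite /a /cball => hs; have := cabs_le_sqr_dist s (p + h); have := le_cabs_tri (p + h) s c.
  by have := le_cabs_tri p2 (p + h) c; have := le_cabs_tri p p2 c; move: hp2 hph hp hs r0; clear; lra.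
have H : cabs (dquot q p2 l2 (p + h)) <= 4 * (128 * M / r / (r / 8)).
  apply: (@center_estimate _ [:: p; p2] _ _ a) => //.
  - by rewrite !inE negb_or php pp2.
  - by move=> s /inball /qc; exact: dquot_cont.
  - move=> s /inball /fd ft; rewrite !inE negb_or => /andP[sp sp2].
    exact/dquot_derivable/dquot_derivable.
  move=> s hs; have tp : r / 8 <= cabs (s - p).
    have := le_cabs_tri p2 p (p + h); have := le_cabs_tri p s (p + h); have := sqr_dist_le s (p + h).
    by rewrite hs (cabsBC p p2) (cabsBC p2 (p + h)) /a; move: hp2 hph r0; clear; lra.
  have tp2 : r / 8 <= cabs (s - p2).
    by have := le_cabs_tri p2 s (p + h); have := sqr_dist_le s (p + h); rewrite hs (cabsBC p2) /a; move: hph r0; clear; lra.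
  have sp : s != p by rewrite -subr_eq0 -cabs_gt0; apply: lt_le_trans tp; lra.
  have sp2 : s != p2 by rewrite -subr_eq0 -cabs_gt0; apply: lt_le_trans tp2; lra.
  rewrite /dquot -/q (negPf sp2) cabs_div.
  apply: ler_pM; rewrite ?cabs_ge0 ?invr_ge0 ?cabs_ge0//; last first.
    by apply: le_invr tp2; lra.
  apply: le_trans (le_cabsB _ _) _; have -> : 128 * M / r = 64 * M / r + 64 * M / r by field; rewrite lt0r_neq0.
  apply: lerD => //; rewrite /q /dquot (negPf sp) cabs_div.
  apply: (@le_trans _ _ (2 * M / (r / 8))).
    apply: ler_pM; rewrite ?cabs_ge0 ?invr_ge0 ?cabs_ge0//.
      apply: le_trans (le_cabsB _ _) _; rewrite mulr2n mulrDl mul1r; apply: lerD; apply: fM => //.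
      by apply: inball; rewrite hs.
    by apply: le_invr tp; lra.
  have -> : 2 * M / (r / 8) = 16 * M / r by field; rewrite lt0r_neq0.
  by rewrite ler_pM2r ?invr_gt0//; lra.
have {}H : cabs (q (p + h) - q p2) <= 128 * (64 * M / r ^+ 2) * cabs h.
  move: H; rewrite {1}/dquot (negPf pp2) cabs_div ler_pdivrMr ?cabs_gt0 ?subr_eq0//.
  move=> /le_trans; apply.
  have -> : 4 * (128 * M / r / (r / 8)) = 64 * (64 * M / r ^+ 2) by field; rewrite lt0r_neq0.
  have X0 : 0 <= 64 * M / r ^+ 2 by apply: divr_ge0; [exact: mulr_ge0|exact: sqr_ge0].
  rewrite E2; move: X0; set X := 64 * M / _ => X0.
  have := mulr_ge0 (mulr_ge0 X0 (ltW hn0)) (ltW t0).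
  by have := mulr_ge0 X0 (ltW hn0); clear; lra.
have d2 : d / 2 < d by rewrite ltr_pdivrMr// ltr_pMr// ltr1n.
have := hd p2; rewrite E1 => /(_ (le_lt_trans t2 d2)).
rewrite {2}/q /dquot eqxx -/(dquot f p l) -/q => h2.
by have := le_cabs_tri (q p2) (q (p + h)) l; move: H h2; clear; lra.
Qed.

(** The first-order Taylor remainder of [F t] is at most a constant times [M t] times |h|^2, with
    the same constant for all [t]. These remainders can be summed, and their sum is o(h). *)
Lemma csum_cderiv (T : choiceType) (F : T -> C -> C) (M : T -> R) K c r (D : T -> C) : 0 < r ->
  bounded_sums M K -> (forall t s, cball c r s -> cderivable (F t) s) ->
  (forall t s, cball c r s -> cabs (F t s) <= M t) -> (forall t, cderiv (F t) c (D t)) ->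
  absum D /\ cderiv (fun s => csum (fun t => F t s)) c (csum D).
Proof.
move=> r0 MK Fd FM hD.
have cc : cball c r c by rewrite /cball subrr cabs0.
have M0 t : 0 <= M t by apply: le_trans (cabs_ge0 _) (FM t c cc).
have c4 : cabs (c - c) < r / 4 by rewrite subrr cabs0; lra.
have MZ k : 0 <= k -> bounded_sums (fun t => k * M t) (k * K).
  by move=> k0 A; rewrite -mulr_sumr ler_wpM2l.
have DM t : cabs (D t) <= 64 / r * M t.
  by rewrite mulrAC; apply: (@deriv_bound (F t) c r (M t) c (D t)) => //; [exact: Fd|exact: FM].
have aD : absum D by apply: absum_dom DM (MZ _ _); rewrite divr_ge0// ltW.
have aF s : cball c r s -> absum (fun t => F t s).
  by move=> hs; apply: absum_dom MK => t; exact: FM.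
split=> // e e0.
have K0 : 0 <= K by apply: le_trans (MK fset0); rewrite big_seq_fset0.
pose k := 128 * (64 / r ^+ 2); pose B := k * K; have X0 : 0 <= k by apply: mulr_ge0 => //; apply: divr_ge0 => //; exact: sqr_ge0.
have B0 : 0 <= B := mulr_ge0 X0 K0.
exists (Num.min (r / 16) (e / (B + 1))); first by rewrite lt_min !divr_gt0//; lra.
move=> h; rewrite lt_min => /andP[h1 h2].
have ch : cball c r (c + h) by rewrite /cball addrAC subrr add0r; lra.
have -> : csum (fun t => F t (c + h)) - csum (fun t => F t c) - h * csum D =
    csum (fun t => F t (c + h) - F t c - h * D t).
  symmetry; apply: hasum_csumE; apply: hasumB; last exact/hasumZ/absum_hasum.
  by apply: hasumB; apply: absum_hasum; exact: aF.
apply: (@le_trans _ _ (B * cabs h ^+ 2)).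
  have k0 : 0 <= k * cabs h ^+ 2 := mulr_ge0 X0 (sqr_ge0 _).
  rewrite /B mulrAC; apply: csum_bound (MZ _ k0) => t.
  have -> : k * cabs h ^+ 2 * M t = 128 * (64 * M t / r ^+ 2) * cabs h ^+ 2 by rewrite /k; ring.
  by apply: (@second_order_bound (F t) c r (M t) c (D t) h) => //; [exact: Fd|exact: FM].
move: h2; rewrite ltr_pdivlMr; last lra.
have := cabs_ge0 h; rewrite expr2; nra.
Qed.

Lemma csum_cderivable (T : choiceType) (F : T -> C -> C) (M : T -> R) K c r : 0 < r ->
  bounded_sums M K -> (forall t s, cball c r s -> cderivable (F t) s) ->
  (forall t s, cball c r s -> cabs (F t s) <= M t) ->
  cderivable (fun s => csum (fun t => F t s)) c.
Proof.
move=> r0 MK Fd FM; have cc : cball c r c by rewrite /cball subrr cabs0.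
pose D t := projT1 (cid (Fd t c cc)).
have hD t : cderiv (F t) c (D t) := projT2 (cid (Fd t c cc)).
by have [_ h] := csum_cderiv r0 MK Fd FM hD; exists (csum D).
Qed.

End HolomorphicFunctions.

(** * Meromorphic functions *)

Section MeromorphicFunctions.
Variable R : realType.
Local Notation C := R[i].
Implicit Types (f g : C -> C) (s c p : C).

Definition mero_at f c := exists (n : nat) (g : C -> C),
  holomorphic_at g c /\ \forall s \near (c : C^o)^', f s = g s / (s - c) ^+ n.

Lemma holomorphic_atP f c :
  holomorphic_at f c <-> exists2 r : R, 0 < r & forall s, cball c r s -> cderivable f s.
Proof.
split=> [/nearCP[r r0 h]|[r r0 h]]; first by exists r => // s /h /cderivableP.
by apply/nearCP; exists r => // s /h /cderivableP.
Qed.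

Lemma holomorphic_cderivable f c : holomorphic_at f c -> cderivable f c.
Proof. by move=> /holomorphic_atP[r r0]; apply; rewrite /cball subrr cabs0. Qed.

Lemma holomorphic_atD f g c : holomorphic_at f c -> holomorphic_at g c ->
  holomorphic_at (fun s => f s + g s) c.
Proof.
move=> /holomorphic_atP[r r0 h] /holomorphic_atP[r' r'0 h']; apply/holomorphic_atP.
exists (Num.min r r'); first by rewrite lt_min r0.
by move=> s; rewrite /cball lt_min => /andP[/h ? /h' ?]; exact: cderivableD.
Qed.

Lemma holomorphic_atM f g c : holomorphic_at f c -> holomorphic_at g c ->
  holomorphic_at (fun s => f s * g s) c.
Proof.
move=> /holomorphic_atP[r r0 h] /holomorphic_atP[r' r'0 h']; apply/holomorphic_atP.
exists (Num.min r r'); first by rewrite lt_min r0.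
by move=> s; rewrite /cball lt_min => /andP[/h ? /h' ?]; exact: cderivableM.
Qed.

Lemma entire_holomorphic f c : (forall s, cderivable f s) -> holomorphic_at f c.
Proof. by move=> h; apply/holomorphic_atP; exists 1. Qed.

Lemma mero_at_near f g c : (\forall s \near (c : C^o)^', f s = g s) -> mero_at f c -> mero_at g c.
Proof.
move=> /dnearCP[d d0 hd] [n [u [hu /dnearCP[d' d'0 hd']]]]; exists n, u; split=> //.
apply/dnearCP; exists (Num.min d d'); first by rewrite lt_min d0.
by move=> s sc; rewrite lt_min => /andP[h1 h2]; rewrite -hd// hd'.
Qed.

Lemma mero_at_holo f c : holomorphic_at f c -> mero_at f c.
Proof.
move=> hf; exists 0%N, f; split=> //; apply/dnearCP; exists 1 => // s _ _.
by rewrite expr0 divr1.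
Qed.

Lemma mero_at_entire f c : (forall s, cderivable f s) -> mero_at f c.
Proof. by move=> h; exact/mero_at_holo/entire_holomorphic. Qed.

Lemma holomorphic_at_pow c n : holomorphic_at (fun s => (s - c) ^+ n) c.
Proof.
apply: entire_holomorphic => s; apply: cderivableX.
by apply: cderivableB; [exact: cderivable_id|exact: cderivable_cst].
Qed.

Lemma mero_atM f g c : mero_at f c -> mero_at g c -> mero_at (fun s => f s * g s) c.
Proof.
move=> [n [u [hu /dnearCP[d d0 hd]]]] [m [v [hv /dnearCP[d' d'0 hd']]]].
exists (n + m)%N, (fun s => u s * v s); split; first exact: (holomorphic_atM hu hv).
apply/dnearCP; exists (Num.min d d'); first by rewrite lt_min d0.
move=> s sc; rewrite lt_min => /andP[h1 h2]; rewrite hd// hd'//.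
by rewrite mulrACA -invfM exprD.
Qed.

Lemma mero_atD f g c : mero_at f c -> mero_at g c -> mero_at (fun s => f s + g s) c.
Proof.
move=> [n [u [hu /dnearCP[d d0 hd]]]] [m [v [hv /dnearCP[d' d'0 hd']]]].
exists (n + m)%N, (fun s => u s * (s - c) ^+ m + v s * (s - c) ^+ n); split.
  exact: (holomorphic_atD (holomorphic_atM hu (holomorphic_at_pow c m)) (holomorphic_atM hv (holomorphic_at_pow c n))).
apply/dnearCP; exists (Num.min d d'); first by rewrite lt_min d0.
move=> s sc; rewrite lt_min => /andP[h1 h2]; rewrite hd// hd'//.
have s0 : s - c != 0 by rewrite subr_eq0.
have n0 : (s - c) ^+ n != 0 by exact: expf_neq0.
have m0 : (s - c) ^+ m != 0 by exact: expf_neq0.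
by rewrite exprD addf_div.
Qed.

Lemma mero_at_cst (a : C) c : mero_at (fun=> a) c.
Proof. by apply: mero_at_entire => s; exact: cderivable_cst. Qed.

Lemma mero_atN f c : mero_at f c -> mero_at (fun s => - f s) c.
Proof.
move=> h; have -> : (fun s => - f s) = (fun s => -1 * f s) by apply/funext => s; rewrite mulN1r.
exact: (mero_atM (mero_at_cst (-1) c) h).
Qed.

Lemma mero_atB f g c : mero_at f c -> mero_at g c -> mero_at (fun s => f s - g s) c.
Proof. by move=> hf /mero_atN; exact: mero_atD. Qed.

Lemma mero_at_sum (I : Type) (r : seq I) (P : pred I) (F : I -> C -> C) c :
  (forall i, P i -> mero_at (F i) c) -> mero_at (fun s => \sum_(i <- r | P i) F i s) c.
Proof.
move=> h; elim: r => [|i r IH].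
  by under eq_fun do rewrite big_nil; exact: mero_at_cst.
under eq_fun do rewrite big_cons.
case Pi: (P i); [exact: (mero_atD (h i Pi) IH)|exact: IH].
Qed.

Lemma mero_at_shift f (a : C) c : mero_at f (c + a) -> mero_at (fun s => f (s + a)) c.
Proof.
move=> [n [u [/holomorphic_atP[r r0 hr] /dnearCP[d d0 hd]]]].
have E s : s + a - (c + a) = s - c by ring.
exists n, (fun s => u (s + a)); split.
  apply/holomorphic_atP; exists r => // s hs; apply: cderivable_comp.
    by apply: cderivableD; [exact: cderivable_id|exact: cderivable_cst].
  by apply: hr; rewrite /cball E.
apply/dnearCP; exists d => // s sc hs; rewrite hd ?E//.
by rewrite (inj_eq (addIr a)).
Qed.

Lemma mero_at_punctured f c : mero_at f c ->
  exists2 r : R, 0 < r & forall s, s != c -> cball c r s -> holomorphic_at f s.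
Proof.
move=> [n [u [/holomorphic_atP[r r0 hr] /dnearCP[d d0 hd]]]].
exists (Num.min r d); first by rewrite lt_min r0.
move=> s sc; rewrite /cball lt_min => /andP[h1 h2]; apply/holomorphic_atP.
pose e := Num.min (cabs (s - c)) (Num.min (r - cabs (s - c)) (d - cabs (s - c))).
have e1 : e <= cabs (s - c) by rewrite /e ge_min lexx.
have e2 : e <= r - cabs (s - c) by rewrite /e !ge_min lexx orbT.
have e3 : e <= d - cabs (s - c) by rewrite /e !ge_min lexx !orbT.
have e0 : 0 < e by rewrite /e !lt_min cabs_gt0 subr_eq0 sc !subr_gt0 h1.
have good t : cball s e t -> [/\ t != c, cabs (t - c) < r & cabs (t - c) < d].
  rewrite /cball => ht; have := le_cabs_tri s t c; have := le_cabs_tri t s c.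
  rewrite (cabsBC s t) => i1 i2; split; [|lra|lra].
  by rewrite -subr_eq0 -cabs_gt0; lra.
exists e => // t ht; have [tc t1 t2] := good t ht.
apply: (@cderivable_near _ (fun s => u s * ((s - c) ^+ n)^-1)).
  apply/nearCP; exists (e - cabs (t - s)); first by rewrite subr_gt0.
  move=> v hv; have [|vc _ v2] := good v.
    by rewrite /cball; have := le_cabs_tri t v s; lra.
  by rewrite hd.
apply: cderivableM; first exact: hr.
apply: cderivableV; first by rewrite expf_neq0// subr_eq0.
by apply: cderivableX; apply: cderivableB; [exact: cderivable_id|exact: cderivable_cst].
Qed.

Definition eq_punctured f g c := \forall s \near (c : C^o)^', f s = g s.

Lemma eq_puncturedP f g c : eq_punctured f g c <->
  exists2 e : R, 0 < e & forall s, s != c -> cabs (s - c) < e -> f s = g s.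
Proof. exact: dnearCP. Qed.

Lemma eq_punctured_sym f g c : eq_punctured f g c -> eq_punctured g f c.
Proof. by move=> /eq_puncturedP[e e0 h]; apply/eq_puncturedP; exists e => // s sc /h ->. Qed.

Lemma eq_punctured_trans f g h c : eq_punctured f g c -> eq_punctured g h c -> eq_punctured f h c.
Proof.
move=> /eq_puncturedP[d d0 hd] /eq_puncturedP[d' d'0 hd']; apply/eq_puncturedP.
exists (Num.min d d'); first by rewrite lt_min d0.
by move=> s sc; rewrite lt_min => /andP[h1 h2]; rewrite hd// hd'.
Qed.

(** Clearing denominators turns the equality of [f] and [g] into the vanishing of a function [H]
    holomorphic at [c] as well, to which [local_identity] applies. *)
Lemma mero_identity_local f g c : mero_at f c -> mero_at g c ->
  exists2 r : R, 0 < r & forall p, cball c r p -> eq_punctured f g p ->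
    forall q, cball c r q -> eq_punctured f g q.
Proof.
move=> [n [u [/holomorphic_atP[r1 r10 hu] /dnearCP[d1 d10 hd1]]]].
move=> [m [v [/holomorphic_atP[r2 r20 hv] /dnearCP[d2 d20 hd2]]]].
pose r := Num.min (Num.min r1 d1) (Num.min r2 d2).
have r0 : 0 < r by rewrite !lt_min r10 d10 r20 d20.
have rr s : cball c r s -> [/\ cball c r1 s, cabs (s - c) < d1, cball c r2 s & cabs (s - c) < d2].
  by rewrite /cball !lt_min => /andP[/andP[-> ->] /andP[-> ->]].
pose H s := u s * (s - c) ^+ m - v s * (s - c) ^+ n.
have Hd s : cball c r s -> cderivable H s.
  move=> /rr[s1 _ s2 _]; have hX k : cderivable (fun s => (s - c) ^+ k) s.
    by apply: cderivableX; apply: cderivableB; [exact: cderivable_id|exact: cderivable_cst].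
  by apply: cderivableB; apply: cderivableM => //; [exact: hu|exact: hv].
have HE s : cball c r s -> s != c -> (H s == 0) = (f s == g s).
  move=> /rr[_ s1 _ s2] sc; rewrite (hd1 s sc s1) (hd2 s sc s2) /H subr_eq0.
  by rewrite eqr_div// expf_neq0// subr_eq0.
have r16 : 0 < r / 16 by lra.
exists (r / 16) => // p hp /eq_puncturedP[d d0 hd] q hq.
have lt16 s : cball c (r / 16) s -> cball c r s by rewrite /cball; lra.
suff H0 s : cball c (r / 16) s -> H s = 0.
  have [qc|qc] := eqVneq q c.
    apply/eq_puncturedP; exists (r / 16) => //; rewrite qc => s sc hs.
    by apply/eqP; rewrite -HE// ?H0//; exact: lt16.
  pose e := Num.min (cabs (q - c)) (r / 16 - cabs (q - c)).
  have e1 : e <= cabs (q - c) by rewrite /e ge_min lexx.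
  have e2 : e <= r / 16 - cabs (q - c) by rewrite /e ge_min lexx orbT.
  have e0 : 0 < e by rewrite lt_min cabs_gt0 subr_eq0 qc subr_gt0.
  apply/eq_puncturedP; exists e => // s _ hs.
  have sc : s != c.
    rewrite -subr_eq0 -cabs_gt0; have := le_cabs_tri s q c; rewrite (cabsBC q s); lra.
  have sr : cball c (r / 16) s by rewrite /cball; have := le_cabs_tri q s c; lra.
  by apply/eqP; rewrite -HE// ?H0//; exact: lt16.
(* The equality holds on a punctured neighbourhood of [p], and the quotient forms only away from
   [c]. A point distinct from both is found among two candidates, at most one of which is [c]. *)
have [p' [p'p hp'd p'c hp'r]] : exists p', [/\ p' != p, cabs (p' - p) < d, p' != c & cball c (r / 16) p'].
  pose t := Num.min (d / 2) ((r / 16 - cabs (p - c)) / 2).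
  have t0 : 0 < t by rewrite lt_min !divr_gt0// subr_gt0.
  have t1 : t <= d / 2 by rewrite /t ge_min lexx.
  have t2 : t <= (r / 16 - cabs (p - c)) / 2 by rewrite /t ge_min lexx orbT.
  pose p1 := p + t%:C; pose p2 := p + (t / 2)%:C.
  have c1 : cabs (p1 - p) = t by rewrite /p1 addrAC subrr add0r cabs_real gtr0_norm.
  have c2 : cabs (p2 - p) = t / 2 by rewrite /p2 addrAC subrr add0r cabs_real gtr0_norm// divr_gt0.
  have n1 : p1 != p by rewrite -subr_eq0 -cabs_gt0 c1.
  have n2 : p2 != p by rewrite -subr_eq0 -cabs_gt0 c2 divr_gt0.
  have b1 : cball c (r / 16) p1 by rewrite /cball; have := le_cabs_tri p p1 c; lra.
  have b2 : cball c (r / 16) p2 by rewrite /cball; have := le_cabs_tri p p2 c; lra.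
  have [e1|] := eqVneq p1 c; last by exists p1; split=> //; lra.
  exists p2; split=> //; first lra.
  rewrite -e1 /p1 /p2 (inj_eq (addrI p)) (inj_eq (@complexI R)); apply/eqP; lra.
apply: (@local_identity _ H c r p') => //.
pose e := Num.min (Num.min (cabs (p' - p)) (d - cabs (p' - p))) (Num.min (cabs (p' - c)) (r / 16 - cabs (p' - c))).
have e1 : e <= cabs (p' - p) by rewrite /e !ge_min lexx.
have e2 : e <= d - cabs (p' - p) by rewrite /e !ge_min lexx !orbT.
have e3 : e <= cabs (p' - c) by rewrite /e !ge_min lexx !orbT.
have e4 : e <= r / 16 - cabs (p' - c) by rewrite /e !ge_min lexx !orbT.
have e0 : 0 < e by rewrite /e !lt_min !cabs_gt0 !subr_eq0 p'p p'c !subr_gt0 hp'd.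
clear s; apply/nearCP; exists e => // s hs.
have sp : s != p.
  by rewrite -subr_eq0 -cabs_gt0; have := le_cabs_tri s p' p; rewrite (cabsBC p' s); lra.
have sc : s != c.
  by rewrite -subr_eq0 -cabs_gt0; have := le_cabs_tri s p' c; rewrite (cabsBC p' s); lra.
have sr : cball c (r / 16) s by rewrite /cball; have := le_cabs_tri p' s c; lra.
apply/eqP; rewrite HE//; last exact: lt16.
by apply/eqP/hd => //; have := le_cabs_tri p' s p; lra.
Qed.

(** Continuity method along the segment from [c0] to [c], which stays in the half plane by
    convexity: at the supremum of the parameters where the germs agree, the local identity theorem
    would extend the agreement further. *)
Lemma mero_identity f g (sigma : R) c0 :
  (forall c, sigma < complex.Re c -> mero_at f c /\ mero_at g c) ->
  sigma < complex.Re c0 -> eq_punctured f g c0 ->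
  forall c, sigma < complex.Re c -> eq_punctured f g c.
Proof.
move=> fg hc0 e0 c hc; pose ga (t : R) := c0 + t%:C * (c - c0).
have gaRe t : 0 <= t <= 1 -> sigma < complex.Re (ga t).
  move=> ht; rewrite /ga ReD ReZ ReD ReN.
  have -> : complex.Re c0 + t * (complex.Re c - complex.Re c0) = (1 - t) * complex.Re c0 + t * complex.Re c by ring.
  have [->|t1] := eqVneq t 1; first by rewrite subrr mul0r add0r mul1r.
  have t2 : t < 1 by rewrite lt_neqAle t1; case/andP: ht.
  by case/andP: ht => ht _; nra.
pose X := [set t : R | 0 <= t <= 1 /\ eq_punctured f g (ga t)].
have X0 : X 0 by split; [rewrite lexx ler01|rewrite /ga mul0r addr0].
have ubX : ubound X 1 by move=> t [/andP[]].
have supX : has_sup X by split; [exists 0|exists 1].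
pose T := sup X.
have T01 : 0 <= T <= 1.
  apply/andP; split; first by apply: ub_le_sup => //; exists 1.
  by apply: sup_le_ub => //; exists 0.
have [mf mg] := fg _ (gaRe T T01).
have [r r0 hr] := mero_identity_local mf mg.
pose k := cabs (c - c0) + 1; have k0 : 0 < k by rewrite ltr_wpDl// cabs_ge0.
have near t : `|t - T| < r / k -> cball (ga T) r (ga t).
  rewrite /cball ltr_pdivlMr// => h.
  have -> : ga t - ga T = (t - T)%:C * (c - c0) by rewrite /ga rmorphB /=; ring.
  by rewrite cabsM cabs_real; apply: le_lt_trans h; rewrite ler_wpM2l// /k; lra.
have rk : 0 < r / k by rewrite divr_gt0.
have [t [t01 Et] ht] := sup_adherent rk supX.
have tT : t <= T := ub_le_sup supX.2 (conj t01 Et).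
have H : forall q, cball (ga T) r q -> eq_punctured f g q.
  apply: (hr (ga t)) Et; apply: near; rewrite ltr_norml; rewrite -/T in ht.
  by move: ht tT rk; clear; lra.
have [T1|] := ltP T 1; last first.
  move=> T1; have -> : c = ga T.
    have -> : T = 1 by apply/eqP; rewrite eq_le T1; case/andP: T01 => _ ->.
    by rewrite /ga mul1r addrC subrK.
  by apply: H; rewrite /cball subrr cabs0.
pose t' := Num.min 1 (T + r / k / 2).
have t'1 : t' <= 1 by rewrite /t' ge_min lexx.
have t'2 : t' <= T + r / k / 2 by rewrite /t' ge_min lexx orbT.
have t'3 : T < t' by rewrite lt_min T1 ltrDl divr_gt0.
suff : X t' by move=> /(ub_le_sup supX.2); rewrite leNgt t'3.
split; first by rewrite t'1; case/andP: T01 => a _; rewrite andbT; lra.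
by apply/H/near; rewrite ltr_norml; lra.
Qed.

Lemma mero_identity_plane f g c0 : meromorphic f -> meromorphic g -> eq_punctured f g c0 ->
  forall c, eq_punctured f g c.
Proof.
move=> mf mg e c; pose sigma := Num.min (complex.Re c0) (complex.Re c) - 1.
have s1 : sigma < complex.Re c0.
  by rewrite /sigma ltrBlDr (le_lt_trans _ (_ : complex.Re c0 < _))// ?ge_min ?lexx// ltrDl.
have s2 : sigma < complex.Re c.
  by rewrite /sigma ltrBlDr (le_lt_trans _ (_ : complex.Re c < _))// ?ge_min ?lexx ?orbT// ltrDl.
apply: (@mero_identity _ _ sigma c0) => // c' _; split; [exact: mf|exact: mg].
Qed.

(** The continuation selected by [xget] must have its removable singularities removed, so [F] is
    replaced by its punctured limit wherever that limit exists. On the half plane this returns [f],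
    by continuity. *)
Lemma mero_continuationP (sigma : R) f F : meromorphic F ->
  (forall s, sigma < complex.Re s -> ccont_at f s) ->
  (forall s, sigma < complex.Re s -> F s = f s) ->
  is_mero_continuation sigma f (mero_continuation sigma f).
Proof.
move=> mF fc Ff; rewrite /mero_continuation.
suff [F' hF'] : exists F', is_mero_continuation sigma f F' by apply: (@xgetPex _ (fun=> 0) [set F | is_mero_continuation sigma f F]); exists F'.
pose F' c := if pselect (cvg ((F s : C^o) @[s --> (c : C^o)^'])) then lim ((F s : C^o) @[s --> (c : C^o)^']) else F c.
have limE c (l : C) : (forall e : R, 0 < e -> exists2 d : R, 0 < d & forall s, s != c -> cabs (s - c) < d -> cabs (F s - l) < e) ->
    F' c = l.
  move=> h; have H : (F s : C^o) @[s --> (c : C^o)^'] --> (l : C^o).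
    by apply/cvgCP => e e0; apply/dnearCP; exact: h.
  rewrite /F'; case: (pselect _) => [Q|[]]; last by apply/cvg_ex; exists l.
  exact: (@cvg_lim _ (@norm_hausdorff _ C^o) _ _ _ _ _ H).
have holoF' c : holomorphic_at F c -> F' c = F c.
  move=> /holomorphic_cderivable/cderivable_cont hc; apply: limE => e e0.
  by have [d d0 hd] := hc e e0; exists d => // t _; exact: hd.
have eqF c : eq_punctured F F' c.
  have [r r0 hr] := mero_at_punctured (mF c); apply/eq_puncturedP; exists r => // s sc hs.
  by rewrite holoF'//; exact: hr.
exists F'; split.
- by move=> c; apply: (@mero_at_near F) (mF c); exact: eqF.
- move=> c /cvg_ex[/= l hl]; have /eq_puncturedP[r r0 hr] := eqF c.
  have hl2 (e : R) : 0 < e -> exists2 d : R, 0 < d & forall s, s != c -> cabs (s - c) < d -> cabs (F' s - l) < e.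
    by move=> e0; apply/dnearCP; move/cvgCP: hl => /(_ e e0).
  have E : F' c = l.
    apply: limE => e e0; have [d d0 hd] := hl2 e e0.
    exists (Num.min d r); first by rewrite lt_min d0.
    by move=> s sc; rewrite lt_min => /andP[h1 h2]; rewrite hr//; exact: hd.
  apply/ccontP => e e0; have [d d0 hd] := hl2 e e0; exists d => // t ht.
  by have [->|tc] := eqVneq t c; [rewrite subrr cabs0|rewrite E; exact: hd].
move=> s hs; apply: limE => e e0; have [d d0 hd] := fc s hs e e0.
exists (Num.min d (complex.Re s - sigma)); first by rewrite lt_min d0 subr_gt0.
move=> t _; rewrite lt_min => /andP[h1 h2]; rewrite Ff; first exact: hd.
by have := Re_lip t s; rewrite ler_norml; lra.
Qed.

End MeromorphicFunctions.

(** * The binomial series *)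

Section BinomialSeries.
Variable R : realType.
Local Notation C := R[i].
Implicit Types (s w q y h : C).

(** A mean value inequality, by bisection of the segment from [c] to [w]: the second side of the
    rectangles in [bisection] is kept equal to the point 0. *)
Lemma zero_cderiv_const (f : C -> C) c r w : (forall s, cball c r s -> cderiv f s 0) ->
  cball c r w -> f w = f c.
Proof.
move=> hf hw; apply/eqP; rewrite -subr_eq0 -cabs_eq0 eq_le cabs_ge0 andbT.
have [->|wc] := eqVneq w c; first by rewrite subrr cabs0.
apply/ler_addgt0Pl => e e0; rewrite addr0.
have wc0 : 0 < cabs (w - c) by rewrite cabs_gt0 subr_eq0.
pose ga (t : R) := c + t%:C * (w - c).
have gaB t u : ga t - ga u = (t - u)%:C * (w - c) by rewrite /ga rmorphB /=; ring.
have : cabs (f (ga 1) - f (ga 0)) <= e * (1 - 0).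
  apply: (@bisection _ (fun a b _ _ => 0 <= a -> b <= 1 -> cabs (f (ga b) - f (ga a)) <= e * (b - a)) _ 0 1 0 0) => //.
    move=> a b _ _ ab _ m _ h1 h2 _ _ a0 b1.
    have hm1 : a <= m by rewrite /m; lra.
    have hm2 : m <= b by rewrite /m; lra.
    apply: le_trans (le_cabs_tri (f (ga m)) _ _) _.
    have -> : e * (b - a) = e * (b - m) + e * (m - a) by ring.
    by apply: lerD; [apply: h2 => //; exact: le_trans hm1|apply: h1 => //; exact: le_trans hm2 _].
  move=> s /andP[/andP[s0 s1] _]; set t := complex.Re s in s0 s1.
  have tin : cball c r (ga t).
    rewrite /cball /ga addrAC subrr add0r cabsM cabs_real ger0_norm//.
    by apply: le_lt_trans hw; rewrite ler_piMl// cabs_ge0.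
  have e1 : 0 < e / cabs (w - c) by rewrite divr_gt0.
  have [d d0 hd] := hf _ tin _ e1.
  exists (d / cabs (w - c)); first by rewrite divr_gt0.
  have near u : `|u - t| < d / cabs (w - c) -> cabs (f (ga u) - f (ga t)) <= e * `|u - t|.
    rewrite ltr_pdivlMr// => hu; have := hd (ga u - ga t).
    rewrite gaB cabsM cabs_real => /(_ hu); rewrite mulr0 subr0 -gaB (addrC (ga t)) subrK.
    by move=> /le_trans; apply; rewrite mulrCA mulrAC mulfK ?lt0r_neq0// mulrC.
  move=> a b _ _ _ _ _ _ /andP[/andP[h1 h2] _] hba _ _ _; rewrite -/t in h1 h2.
  apply: le_trans (le_cabs_tri (f (ga t)) _ _) _.
  have -> : e * (b - a) = e * `|b - t| + e * `|a - t|.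
    by rewrite ger0_norm ?ler0_norm; [ring|lra|lra].
  apply: lerD; [|rewrite cabsBC]; apply: near.
    by rewrite ger0_norm; lra.
  by rewrite ler0_norm; lra.
have -> : ga 1 = w by rewrite /ga mul1r addrC subrK.
have -> : ga 0 = c by rewrite /ga mul0r addr0.
by rewrite subr0 mulr1.
Qed.

Lemma cont_eps (f : R -> R) (x e : R) : {for x, continuous f} -> 0 < e ->
  exists2 d : R, 0 < d & forall t : R, `|t - x| < d -> `|f t - f x| < e.
Proof.
move=> /cvgrPdist_lt h e0; have /nbhs_normP[d d0 hd] := h e e0.
by exists d => // y hy; rewrite distrC; apply: hd; rewrite /= distrC.
Qed.

(** The quadratic bound for the exponential is inverted. With k = log(1 + h), continuity first gives
    |k| <= 1/8; then |k - h| <= 4 |k|^2 <= |k| / 2 forces |k| <= 2 |h|, whence the constant 16. *)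
Lemma clog_near1 : exists2 d : R, 0 < d & forall h, cabs h < d ->
  [/\ 0 < complex.Re (1 + h), cabs (clog (1 + h)) <= 1 / 8 & cabs (clog (1 + h) - h) <= 16 * cabs h ^+ 2].
Proof.
have e0 : 0 < 1 / 16 :> R by lra.
have [d1 d10 h1] := cont_eps (@continuous_ln R 1 ltr01) e0.
have [d2 d20 h2] := cont_eps (@continuous_atan R 0) e0.
pose d := Num.min (1 / 2) (Num.min d1 (d2 / 2)).
exists d; first by rewrite !lt_min d10 !divr_gt0.
move=> h; rewrite !lt_min => /andP[k1 /andP[k2 k3]].
have hR := le_cabs_Re h; have hI := le_cabs_Im h.
have Re0 : 1 / 2 < complex.Re (1 + h) by rewrite ReD /=; move: hR; rewrite ler_norml; lra.
have Rgt0 : 0 < complex.Re (1 + h) by lra.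
have lg : cabs (clog (1 + h)) <= 1 / 8.
  apply: le_trans (cabs_le_ReIm _) _ => /=.
  have a1 : `|ln (cabs (1 + h))| <= 1 / 16.
    have := h1 (cabs (1 + h)); rewrite ln1 subr0 => H; apply/ltW/H.
    have := le_cabs_dist (1 + h) 1; rewrite cabs1 addrAC subrr add0r; lra.
  have a2 : `|carg (1 + h)| <= 1 / 16.
    rewrite carg_Re_gt0//; have := h2 (complex.Im (1 + h) / complex.Re (1 + h)).
    rewrite atan0 !subr0 => H; apply/ltW/H.
    rewrite normrM normfV (gtr0_norm Rgt0) ltr_pdivrMr// ImD /= add0r.
    by apply: le_lt_trans hI _; nra.
  lra.
split=> //; set k := clog (1 + h) in lg *.
have hk : h = cexp k - 1.
  rewrite /k clogK; first by ring.
  by apply: contraTneq Rgt0 => ->; rewrite ltxx.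
have lg2 : cabs k <= 1 / 2 by lra.
have q := cexp_quad lg2.
rewrite -hk cabsBC in q.
have k0 := cabs_ge0 k.
have b : cabs k <= 2 * cabs h.
  have := le_cabsD (k - h) h; rewrite subrK => H.
  have : cabs k ^+ 2 <= 1 / 8 * cabs k by rewrite expr2 ler_wpM2r.
  lra.
have : cabs k ^+ 2 <= (2 * cabs h) ^+ 2 by rewrite ler_sqr ?nnegrE ?mulr_ge0 ?cabs_ge0.
rewrite exprMn; lra.
Qed.

Lemma Re_gt0_neq0 w : 0 < complex.Re w -> w != 0.
Proof. by move=> h; apply: contraTneq h => ->; rewrite ltxx. Qed.

Lemma cderiv_clog w : 0 < complex.Re w -> cderiv (@clog R) w w^-1.
Proof.
move=> w0 e e0; have wn0 := Re_gt0_neq0 w0.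
have cw : 0 < cabs w by rewrite cabs_gt0.
have [d d0 hd] := clog_near1.
exists (Num.min (d * cabs w) (e * cabs w ^+ 2 / 16)).
  by rewrite lt_min !mulr_gt0// exprn_gt0.
move=> h; rewrite lt_min => /andP[h1 h2].
have hw : cabs (h / w) < d by rewrite cabs_div ltr_pdivrMr.
have [r1 _ r3] := hd _ hw.
have -> : w + h = w * (1 + h / w) by rewrite mulrDr mulr1 mulrCA divff// mulr1.
rewrite clogM//; last 2 first.
- exact: Re_gt0_neq0.
- have := carg_Re_gt0_bound w0; have := carg_Re_gt0_bound r1; lra.
rewrite (addrAC (clog w)) subrr add0r; apply: le_trans r3 _.
rewrite cabs_div exprMn exprVn mulrA ler_pdivrMr ?exprn_gt0//.
move: h2; rewrite ltr_pdivlMr; last lra.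
by have := cabs_ge0 h; rewrite !expr2; nra.
Qed.

Lemma cderiv_ext (f g : C -> C) c l : (forall s, f s = g s) -> cderiv f c l -> cderiv g c l.
Proof. by move=> /funext ->. Qed.

Lemma cderivM f g s l m : cderiv f s l -> cderiv g s m ->
  cderiv (fun s => f s * g s) s (l * g s + f s * m).
Proof.
move=> hf hg e e0; have gc := cderiv_cont hg.
pose k := cabs (f s) + cabs (g s) + cabs l + 3.
have k0 : 0 < k by rewrite /k ltr_wpDl// !addr_ge0 ?cabs_ge0.
have e10 : 0 < Num.min 1 (e / (4 * k)) by rewrite lt_min ltr01 divr_gt0// mulr_gt0.
have [d1 d10 h1] := hf _ e10; have [d2 d20 h2] := hg _ e10; have [d3 d30 h3] := gc _ e10.
exists (Num.min d1 (Num.min d2 d3)); first by rewrite !lt_min d10 d20.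
move=> h; rewrite !lt_min => /andP[/h1 i1 /andP[/h2 i2 i3]].
have {}i3 : cabs (g (s + h) - g s) < Num.min 1 (e / (4 * k)) by apply: h3; rewrite addrAC subrr add0r.
set e1 := Num.min _ _ in i1 i2 i3.
have e11 : e1 <= 1 by rewrite /e1 ge_min lexx.
have e12 : e1 * (4 * k) <= e by rewrite -ler_pdivlMr ?mulr_gt0// /e1 ge_min lexx orbT.
have -> : f (s + h) * g (s + h) - f s * g s - h * (l * g s + f s * m) =
  (f (s + h) - f s - h * l) * g s + (f (s + h) - f s - h * l) * (g (s + h) - g s) +
  (h * l) * (g (s + h) - g s) + f s * (g (s + h) - g s - h * m) by ring.
have t1 : cabs ((f (s + h) - f s - h * l) * g s) <= e1 * cabs h * cabs (g s) by rewrite cabsM ler_wpM2r// cabs_ge0.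
have e1h : 0 <= e1 * cabs h by rewrite mulr_ge0 ?cabs_ge0// ltW.
have t2 : cabs ((f (s + h) - f s - h * l) * (g (s + h) - g s)) <= e1 * cabs h * 1.
  by rewrite cabsM; apply: ler_pM; rewrite ?cabs_ge0//; lra.
have t3 : cabs (h * l * (g (s + h) - g s)) <= cabs h * cabs l * e1.
  by rewrite !cabsM; apply: ler_wpM2l; rewrite ?mulr_ge0 ?cabs_ge0// ltW.
have t4 : cabs (f s * (g (s + h) - g s - h * m)) <= cabs (f s) * (e1 * cabs h).
  by rewrite cabsM ler_wpM2l// cabs_ge0.
apply: le_trans (le_trans (le_cabsD _ _) (lerD (le_trans (le_cabsD _ _) (lerD (le_trans (le_cabsD _ _) (lerD t1 t2)) t3)) t4)) _.
apply: (@le_trans _ _ (e1 * k * cabs h)); first by rewrite /k; nra.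
by apply: ler_wpM2r; rewrite ?cabs_ge0//; have := mulr_gt0 e10 k0; rewrite -/e1; lra.
Qed.

Lemma cderiv_affine (a b : C) s : cderiv (fun s => a + b * s) s b.
Proof.
move=> e e0; exists 1 => // h _.
have -> : a + b * (s + h) - (a + b * s) - h * b = 0 by ring.
by rewrite cabs0 mulr_ge0 ?cabs_ge0// ltW.
Qed.

Lemma cderivZ (a : C) f s l : cderiv f s l -> cderiv (fun s => a * f s) s (a * l).
Proof.
move=> hf; have := cderivM (@cderiv_affine a 0 s) hf; rewrite !mul0r add0r addr0 => h.
by apply: (cderiv_ext _ h) => t; rewrite mul0r addr0.
Qed.

Lemma cderiv_cexpM (a : C) f s l : cderiv f s l -> cderiv (fun s => cexp (a * f s)) s (a * l * cexp (a * f s)).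
Proof.
move=> hf; apply: cderiv_comp (cderiv_cexp _).
exact: cderivZ.
Qed.

(** The coefficient s (s + 1) ... (s + n - 1) / n! of q^n in (1 - q)^(-s). *)
Definition rbin s (n : nat) : C := \prod_(0 <= j < n) ((s + j%:R) / j.+1%:R).

Definition rbinR (x : R) (n : nat) : R := \prod_(0 <= j < n) ((x + j%:R) / j.+1%:R).

Lemma rbin0 s : rbin s 0 = 1. Proof. by rewrite /rbin big_nil. Qed.

Lemma rbinS s n : rbin s n.+1 * n.+1%:R = rbin s n * (s + n%:R).
Proof. by rewrite /rbin big_nat_recr//= -mulrA divfK// pnatr_eq0. Qed.

Lemma rbinR_ge0 x n : 0 <= x -> 0 <= rbinR x n.
Proof. by move=> x0; apply: prodr_ge0 => i _; rewrite divr_ge0// addr_ge0. Qed.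

Lemma cabs_rbin s n x : cabs s <= x -> cabs (rbin s n) <= rbinR x n.
Proof.
move=> sx; rewrite /rbin cabs_prod; apply: ler_prod => j _.
rewrite cabs_ge0 cabs_div cabs_nat ler_wpM2r ?invr_ge0//=.
by apply: le_trans (le_cabsD _ _) _; rewrite cabs_nat lerD2r.
Qed.

Lemma rbinR_growth (x b : R) : 0 <= x -> 1 < b -> exists2 K, 0 <= K & forall n, rbinR x n <= K * b ^+ n.
Proof.
move=> x0 b1; pose J := Num.bound (x / (b - 1)).
have hJ j : (J <= j)%N -> (x + j%:R) / j.+1%:R <= b.
  move=> Jj; rewrite ler_pdivrMr ?ltr0n//.
  have : x / (b - 1) <= j%:R.
    by apply: ltW (lt_le_trans (archi_boundP _) _); rewrite ?ler_nat// divr_ge0// subr_ge0 ltW.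
  rewrite ler_pdivrMr ?subr_gt0// => h; rewrite -natr1; lra.
(* Adding 1 to each factor makes these products increasing, so [P J] also dominates the coefficients
   of index at most [J], before the ratio bound [hJ] takes effect. *)
pose P n := \prod_(0 <= j < n) (1 + (x + j%:R) / j.+1%:R).
have c1 j : 1 <= 1 + (x + j%:R) / j.+1%:R by rewrite lerDl divr_ge0// addr_ge0.
have P1 n : 1 <= P n.
  elim: n => [|n IH]; first by rewrite /P big_nil.
  by rewrite /P big_nat_recr//=; apply: mulr_ege1.
exists (P J); first by apply: le_trans ler01 (P1 _).
have b0 : 0 < b by lra.
elim=> [|n IH]; first by rewrite /rbinR big_nil expr0 mulr1; exact: P1.
have bn n' : 1 <= b ^+ n' by apply: exprn_ege1; lra.
have [nJ|Jn] := ltnP n J; last first.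
  rewrite /rbinR big_nat_recr//= -/(rbinR x n) exprSr (mulrA (P J)); apply: ler_pM => //.
  - exact: rbinR_ge0.
  - by rewrite divr_ge0// addr_ge0.
  - exact: hJ.
apply: (@le_trans _ _ (P J)); last first.
  by rewrite ler_peMr//; apply: le_trans ler01 (P1 _).
have mono m k : P m <= P (m + k)%N.
  elim: k => [|k IHk]; first by rewrite addn0.
  rewrite addnS; apply: le_trans IHk _; rewrite /P big_nat_recr//= ler_peMr//.
  by apply: le_trans ler01 (P1 _).
apply: (@le_trans _ _ (P n.+1)); last by rewrite -(subnKC nJ); exact: mono.
by apply: ler_prod => j _; rewrite divr_ge0 ?addr_ge0//= lerDr.
Qed.

Lemma geo_partial (y : R) n : (1 - y) * \sum_(0 <= i < n) y ^+ i = 1 - y ^+ n.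
Proof.
elim: n => [|n IH]; first by rewrite big_nil mulr0 expr0 subrr.
by rewrite big_nat_recr//= mulrDr IH exprS; ring.
Qed.

Lemma geo_bounded (K y : R) : 0 <= K -> 0 <= y < 1 -> bounded_sums (fun n => K * y ^+ n) (K / (1 - y)).
Proof.
move=> K0 /andP[y0 y1]; apply: bounded_sums_nat => [i|n]; first by rewrite mulr_ge0// exprn_ge0.
rewrite -mulr_sumr ler_wpM2l// -[X in _ <= X]mul1r ler_pdivlMr ?subr_gt0// mulrC geo_partial.
by rewrite gerBl exprn_ge0.
Qed.

Lemma rbinR_bounded (x y : R) : 0 <= x -> 0 <= y < 1 ->
  exists K, bounded_sums (fun n => rbinR x n * y ^+ n) K.
Proof.
move=> x0 /andP[y0 y1]; pose b := 2 / (1 + y).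
have b1 : 1 < b by rewrite /b ltr_pdivlMr; lra.
have by1 : 0 <= b * y < 1.
  rewrite mulr_ge0//; last lra.
  by rewrite /b mulrAC ltr_pdivrMr ?mul1r; lra.
have [K K0 hK] := rbinR_growth x0 b1; exists (K / (1 - b * y)).
apply: bounded_sumsW (geo_bounded K0 by1) => n.
by rewrite exprMn mulrA ler_wpM2r// exprn_ge0.
Qed.

Lemma csum_natS (u : nat -> C) : absum u -> csum u = u 0%N + csum (fun n => u n.+1).
Proof.
move=> au; have aS : absum (fun n => u n.+1) by apply: (@absum_inj _ _ _ S) au => ? ? [].
have h1 := hasum_series (absum_hasum au); have h2 := hasum_series (absum_hasum aS).
apply/eqP; rewrite -subr_eq0 -cabs_eq0 eq_le cabs_ge0 andbT; apply/ler_addgt0Pl => e e0.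
have e20 : 0 < e / 2 by lra.
have /cvgCP /(_ _ e20) [N1 _ k1] := h1; have /cvgCP /(_ _ e20) [N2 _ k2] := h2.
have := k1 (maxn N1 N2).+1; rewrite /= leqW ?leq_maxl// => /(_ isT) i1.
have := k2 (maxn N1 N2); rewrite /= leq_maxr => /(_ isT) i2.
move: i1; rewrite big_nat_recl// => i1; rewrite addr0.
move: i1 i2; set X := \sum_(_ <= _ < _) _ => i1 i2.
have -> : csum u - (u 0%N + csum (fun n => u n.+1)) =
   (X - csum (fun n => u n.+1)) - (u 0%N + X - csum u) by ring.
by apply: le_trans (le_cabsB _ _) _; lra.
Qed.

(* G(q) = (sum_n a_n q^n) (1 - q)^s has derivative 0 because (n + 1) a_(n+1) = (s + n) a_n. *)
Lemma binomial_series s q : cabs q < 1 ->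
  absum (fun n => rbin s n * q ^+ n) /\ csum (fun n => rbin s n * q ^+ n) = cpow (1 - q) (- s).
Proof.
move=> q1; pose B q := csum (fun n => rbin s n * q ^+ n).
have dom (x : R) : 0 <= x < 1 -> exists K, bounded_sums (fun n => rbinR (cabs s) n * x ^+ n) K.
  by move=> x1; apply: rbinR_bounded => //; exact: cabs_ge0.
have bnd (x : R) (w : C) n : cabs w <= x -> cabs (rbin s n * w ^+ n) <= rbinR (cabs s) n * x ^+ n.
  move=> wx; rewrite cabsM cabsX; apply: ler_pM; rewrite ?cabs_ge0 ?exprn_ge0 ?cabs_ge0//.
    exact: cabs_rbin.
  by apply: lerXn2r => //; rewrite nnegrE ?cabs_ge0// (le_trans (cabs_ge0 w)).
have aB w : cabs w < 1 -> absum (fun n => rbin s n * w ^+ n).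
  move=> w1; have [|K hK] := dom (cabs w); first by rewrite cabs_ge0.
  by apply: absum_dom hK => n; exact: bnd.
split; first exact: aB.
pose D w n : C := rbin s n * (n%:R * w ^+ n.-1).
have dX (w : C) n : cderiv (fun w => rbin s n * w ^+ n) w (D w n).
  suff h : cderiv (fun w => w ^+ n) w (n%:R * w ^+ n.-1).
    exact: cderivZ.
  elim: n => [|n IH].
    by rewrite mul0r; have := @cderiv_affine 1 0 w => h; apply: (cderiv_ext _ h) => t; rewrite mul0r addr0 expr0.
  have := cderivM (@cderiv_affine 0 1 w) IH => h.
  have -> : n.+1%:R * w ^+ n.+1.-1 = 1 * w ^+ n + (0 + 1 * w) * (n%:R * w ^+ n.-1).
    rewrite add0r !mul1r mulrCA -natr1 mulrDl mul1r addrC /=.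
    by case: n {IH h} => [|n]; rewrite ?mul0r//= -exprS.
  by apply: (cderiv_ext _ h) => t; rewrite add0r mul1r -exprS.
have dB w : cabs w < 1 -> absum (D w) /\ cderiv B w (csum (D w)).
  move=> w1; have [|K hK] := dom ((1 + cabs w) / 2).
    by rewrite divr_ge0 ?addr_ge0 ?cabs_ge0//=; lra.
  have r0 : 0 < (1 - cabs w) / 2 by lra.
  apply: (csum_cderiv r0 hK) => [n t ht|n t ht|n]; last exact: dX.
    by exists (D t n); exact: dX.
  by apply: bnd; have := le_cabs_tri w t 0; rewrite !subr0; move: ht; rewrite /cball; lra.
have ode w : cabs w < 1 -> (1 - w) * csum (D w) = s * B w.
  move=> w1; have [aD _] := dB _ w1.
  have aDS : absum (fun n => D w n.+1) by apply: (@absum_inj _ _ _ S) aD => ? ? [].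
  have E : csum (D w) = csum (fun n => D w n.+1) by rewrite csum_natS// {1}/D mul0r mulr0 add0r.
  rewrite mulrBl mul1r {1}E /B -!csumZ//; last exact: aB.
  symmetry; apply: hasum_csumE.
  have := hasumB (absum_hasum aDS) (absum_hasum (absumZ w aD)).
  congr hasum; apply/funext => n; rewrite /D.
  have E2 : w * (rbin s n * (n%:R * w ^+ n.-1)) = rbin s n * n%:R * w ^+ n.
    by case: n => [|n]; rewrite ?mul0r ?mulr0 ?mul0r//= exprS; ring.
  by rewrite E2 mulrA rbinS /=; ring.
have Re1 w : cabs w < 1 -> 0 < complex.Re (1 - w).
  by move=> w1; rewrite ReD ReN /=; have := le_Re_cabs w; lra.
pose G w := B w * cexp (s * clog (1 - w)).
have dG w : cball 0 1 w -> cderiv G w 0.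
  rewrite /cball subr0 => w1; have [_ hB] := dB _ w1.
  have hl : cderiv (fun w => clog (1 - w)) w (-1 * (1 - w)^-1).
    have h := @cderiv_affine 1 (-1) w.
    have e t : 1 + -1 * t = 1 - t :> C by rewrite mulN1r.
    have h' : cderiv (fun t => 1 - t) w (-1) by apply: (cderiv_ext _ h) => t; rewrite e.
    by apply: (cderiv_comp h'); apply: cderiv_clog; exact: Re1.
  have := cderivM hB (cderiv_cexpM s hl).
  have n0 : 1 - w != 0 by exact/Re_gt0_neq0/Re1.
  have -> : csum (D w) * cexp (s * clog (1 - w)) + B w * (s * (-1 / (1 - w)) * cexp (s * clog (1 - w))) =
    (((1 - w) * csum (D w) - s * B w) / (1 - w)) * cexp (s * clog (1 - w)).
    by field.
  by rewrite ode// subrr mul0r mul0r.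
have G0 : G 0 = 1.
  rewrite /G /B csum_natS; last by apply: aB; rewrite cabs0.
  rewrite rbin0 expr0 mulr1.
  have -> : (fun n => rbin s n.+1 * 0 ^+ n.+1) = (fun _ : nat => 0 : C) by apply/funext => n; rewrite expr0n mulr0.
  rewrite (hasum_csumE (hasum0 _)) addr0 mul1r subr0.
  by rewrite -cpowE cpowE (_ : clog 1 = 0) ?mulr0 ?cexp0//; apply: clog_unique; rewrite ?cexp0//=; have := @pi_gt0 R; lra.
have Gq : G q = 1 by rewrite -G0; apply: (zero_cderiv_const dG); rewrite /cball subr0.
by rewrite -/(B q) cpowN cpowE; apply: (mulIf (cexp_neq0 (s * clog (1 - q)))); rewrite -/(G q) Gq mulVf// cexp_neq0.
Qed.

Lemma csum_nat_split (K : nat) (u : nat -> C) : absum u ->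
  csum u = \sum_(0 <= n < K) u n + csum (fun n => u (n + K)%N).
Proof.
elim: K u => [|K IH] u au.
  by rewrite big_nil add0r; congr csum; apply/funext => n; rewrite addn0.
have aS : absum (fun n => u n.+1) by apply: (@absum_inj _ _ _ S) au => ? ? [].
rewrite csum_natS// (IH _ aS) big_nat_recl// addrA; congr (_ + csum _).
by apply/funext => n; rewrite addnS.
Qed.

(** The tail of the binomial series loses [K] factors |y|, and the remaining powers are bounded by
    those of 1/2. Uniformity in [s] on a disc is what later makes sums of remainders holomorphic. *)
Lemma taylor_remainder (x : R) (K : nat) : 0 <= x ->
  exists2 c : R, 0 <= c & forall s y, cabs s <= x -> cabs y <= 1 / 2 ->
    cabs (cpow (1 + y) (- s) - \sum_(0 <= n < K) rbin s n * (- y) ^+ n) <= c * cabs y ^+ K.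
Proof.
move=> x0; have [|c hc] := @rbinR_bounded x (1 / 2) x0; first lra.
have hcK : bounded_sums (fun n => rbinR x (n + K) * (1 / 2) ^+ (n + K)) c.
  by apply: (@bounded_sums_inj _ _ _ (fun n => n + K)%N _ c) hc => m n /addIn.
have c0 : 0 <= c by apply: le_trans (hc fset0); rewrite big_seq_fset0.
exists (c * 2 ^+ K) => [|s y sx y1]; first by rewrite mulr_ge0// exprn_ge0.
have y1' : cabs (- y) < 1 by rewrite cabsN; lra.
have [aB] := binomial_series s y1'; rewrite opprK => <-.
rewrite (csum_nat_split K aB) addrAC subrr add0r.
apply: (@le_trans _ _ (cabs y ^+ K * 2 ^+ K * c)); last by rewrite [X in _ <= X]mulrC mulrA -mulrA [X in _ <= X]mulrAC mulrA.
have k0 : 0 <= cabs y ^+ K * 2 ^+ K by rewrite mulr_ge0 ?exprn_ge0 ?cabs_ge0.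
apply: (@csum_bound _ _ _ (fun n => cabs y ^+ K * 2 ^+ K * (rbinR x (n + K) * (1 / 2) ^+ (n + K)))); last first.
  by move=> A; rewrite -mulr_sumr ler_wpM2l.
move=> n; rewrite cabsM cabsX cabsN [X in _ <= X]mulrCA.
apply: ler_pM; rewrite ?cabs_ge0 ?exprn_ge0 ?cabs_ge0//; first exact: cabs_rbin.
have -> : cabs y ^+ K * 2 ^+ K * (1 / 2) ^+ (n + K) = cabs y ^+ K * (1 / 2) ^+ n.
  have E : 2 ^+ K * (1 / 2) ^+ K = 1 :> R.
    by rewrite -exprMn (_ : 2 * (1 / 2) = 1) ?expr1n//; field.
  by rewrite addnC exprD -mulrA (mulrA (2 ^+ K)) E mul1r.
rewrite exprD mulrC ler_wpM2l ?exprn_ge0 ?cabs_ge0//.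
by apply: lerXn2r; rewrite ?nnegrE ?cabs_ge0//; lra.
Qed.

End BinomialSeries.

(** * Lattice sums *)

Section LatticeSums.
Variable R : realType.
Local Notation C := R[i].

(** The integral test in telescoping form: with a = p - 1, the term a (n + 2)^(-p) is at most (n +
    1)^(-a) - (n + 2)^(-a). *)
Lemma pseries_bounded (p : R) : 1 < p -> exists K, bounded_sums (fun n : nat => n.+1%:R `^ (- p)) K.
Proof.
move=> p1; pose a := p - 1; have a0 : 0 < a by rewrite /a; lra.
pose q n : R := n.+1%:R `^ (- a).
have step n : a * n.+2%:R `^ (- p) <= q n - q n.+1.
  rewrite /q; have x0 : 0 < n.+1%:R :> R by rewrite ltr0n.
  have y0 : 0 < n.+2%:R :> R by rewrite ltr0n.
  have yx : n.+2%:R = n.+1%:R + 1 :> R by rewrite -natr1.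
  move: (n.+2%:R : R) (n.+1%:R : R) x0 y0 yx => y x x0 y0 yx.
  rewrite /powR !gt_eqF//; pose L := ln y - ln x.
  have L1 : 1 / y <= L.
    have := expR_ge1Dx (- L); rewrite /L opprB expRD expRN !lnK ?posrE//.
    have -> : x / y = 1 - 1 / y by rewrite yx; field; lra.
    lra.
  have -> : - a * ln x = - a * ln y + a * L by rewrite /L; ring.
  have -> : - p * ln y = - a * ln y + - ln y by rewrite /a; ring.
  rewrite !expRD [expR (- ln y)]expRN lnK ?posrE//.
  set e := expR (- a * ln y); have e0 : 0 < e by exact: expR_gt0.
  have := expR_ge1Dx (a * L) => h.
  have : a * (1 / y) <= a * L by rewrite ler_pM2l.
  rewrite mul1r; nra.
have tele N : a * \sum_(0 <= n < N) n.+2%:R `^ (- p) <= 1 - q N.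
  elim: N => [|N IH]; first by rewrite big_nil mulr0 /q powR1 subrr.
  by rewrite big_nat_recr//= mulrDr; have := step N; lra.
have q0 n : 0 <= q n by exact: powR_ge0.
exists (1 + 1 / a); apply: bounded_sums_nat => [i|[|N]]; first exact: powR_ge0.
  by rewrite big_nil addr_ge0// divr_ge0// ltW.
rewrite big_nat_recl// powR1 lerD2l ler_pdivlMr// mulrC.
by apply: le_trans (tele N) _; have := q0 N; lra.
Qed.

Lemma bounded_sums_prod (T1 T2 : choiceType) (M1 : T1 -> R) (M2 : T2 -> R) K1 K2 :
  (forall i, 0 <= M1 i) -> (forall j, 0 <= M2 j) -> bounded_sums M1 K1 -> bounded_sums M2 K2 ->
  bounded_sums (fun p : T1 * T2 => M1 p.1 * M2 p.2) (K1 * K2).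
Proof.
move=> M10 M20 h1 h2 A.
pose A1 := [fset p.1 | p in A]%fset; pose A2 := [fset p.2 | p in A]%fset.
apply: (@le_trans _ _ (\sum_(p <- (A1 `*` A2)%fset) M1 p.1 * M2 p.2)).
  apply: fsum_le_sub => [p|]; first by rewrite mulr_ge0.
  apply/fsubsetP => p pA; rewrite in_fsetM; apply/andP.
  by split; apply/imfsetP; exists p.
rewrite sum_fsetX /=; under eq_bigr do rewrite -mulr_sumr.
rewrite -mulr_suml; apply: ler_pM => //; exact: sumr_ge0.
Qed.

Definition mcons (r : nat) (p : nat * {ffun 'I_r -> nat}) : {ffun 'I_r.+1 -> nat} :=
  [ffun i => if unlift ord0 i is Some j then p.2 j else p.1].

Definition muncons (r : nat) (m : {ffun 'I_r.+1 -> nat}) : nat * {ffun 'I_r -> nat} :=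
  (m ord0, [ffun j => m (lift ord0 j)]).

Lemma mconsK r : cancel (@mcons r) (@muncons r).
Proof.
case=> n m; rewrite /muncons /mcons; congr pair; first by rewrite ffunE unlift_none.
by apply/ffunP => j; rewrite !ffunE liftK.
Qed.

Lemma munconsK r : cancel (@muncons r) (@mcons r).
Proof.
move=> m; apply/ffunP => i; rewrite ffunE /=.
by case: unliftP => [j ->|->]; rewrite ?ffunE.
Qed.

Lemma bounded_sums_bij (T T' : choiceType) (f : T' -> T) (g : T -> T') (M : T -> R) K :
  cancel f g -> cancel g f -> bounded_sums (fun x => M (f x)) K -> bounded_sums M K.
Proof.
move=> fg gf h; have := bounded_sums_inj (can_inj gf) h.
by under eq_fun do rewrite gf.
Qed.

Lemma bounded_sums_ffun (r : nat) (M : 'I_r -> nat -> R) (K : R) : 0 <= K ->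
  (forall j n, 0 <= M j n) -> (forall j, bounded_sums (M j) K) ->
  bounded_sums (fun m : {ffun 'I_r -> nat} => \prod_(j < r) M j (m j)) (K ^+ r).
Proof.
move=> K0; elim: r M => [|r IH] M M0 MK.
  move=> A; rewrite expr0; under eq_bigr do rewrite big_ord0.
  apply: (@le_trans _ _ (\sum_(m <- [fset [ffun=> 0%N]]%fset) 1)); last by rewrite big_seq_fset1.
  apply: fsum_le_sub => //; apply/fsubsetP => m _.
  by rewrite in_fset1; apply/eqP/ffunP; case.
apply: (bounded_sums_bij (@mconsK r) (@munconsK r)).
have P0 (m : {ffun 'I_r -> nat}) : 0 <= \prod_(j < r) M (lift ord0 j) (m j) by exact: prodr_ge0.
have := bounded_sums_prod (M0 ord0) P0 (MK ord0) (IH (fun j => M (lift ord0 j)) (fun j => M0 _) (fun j => MK _)).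
rewrite -exprS; apply: bounded_sumsW => -[n m].
rewrite big_ord_recl /= /mcons ffunE unlift_none.
by under eq_bigr do rewrite ffunE liftK.
Qed.

Definition msum (r : nat) (m : {ffun 'I_r -> nat}) : R := \sum_(j < r) (m j)%:R.

Lemma msum_ge0 r (m : {ffun 'I_r -> nat}) : 0 <= msum m.
Proof. by apply: sumr_ge0. Qed.

(** As 1 + m_1 + ... + m_r exceeds every 1 + m_j, the term is at most the product of the (1 +
    m_j)^(-p) with p = sigma / r > 1. For [r] equal to 0 the exponent 2 is a placeholder. *)
Lemma lattice_bounded (r : nat) (sigma : R) : r%:R < sigma ->
  exists K, bounded_sums (fun m : {ffun 'I_r -> nat} => (1 + msum m) `^ (- sigma)) K.
Proof.
move=> rs; pose p : R := if r == 0%N then 2 else sigma / r%:R.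
have p1 : 1 < p.
  rewrite /p; case: eqVneq => [_|r0]; first by rewrite ltr1n.
  by rewrite ltr_pdivlMr ?mul1r// ltr0n lt0n.
have [K hK] := pseries_bounded p1.
have K0 : 0 <= K by apply: le_trans (hK fset0); rewrite big_seq_fset0.
exists (K ^+ r); apply: bounded_sumsW (bounded_sums_ffun K0 (fun _ _ => powR_ge0 _ _) (fun _ => hK)) => m.
have pos : 0 < 1 + msum m by rewrite ltr_wpDr// msum_ge0.
have E : (1 + msum m) `^ (- sigma) = \prod_(j < r) (1 + msum m) `^ (- p).
  rewrite prodr_const card_ord -powR_mulrn ?powR_ge0// -powRrM /p.
  case: eqVneq => [r0|r0]; last by rewrite mulNr divfK// pnatr_eq0.
  have -> : msum m = 0 by rewrite /msum big1// => -[j jr]; exfalso; rewrite r0 in jr.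
  by rewrite addr0 !powR1.
rewrite E; apply: ler_prod => j _; rewrite powR_ge0/= !powRN lef_pV2 ?posrE ?powR_gt0//.
have pp : 0 <= p by lra.
apply: ge0_ler_powR; rewrite ?nnegrE ?(ltW pos) ?ler0n//.
rewrite -natr1 addrC lerD2l /msum (bigD1 j)//= lerDl; exact: sumr_ge0.
Qed.

(** The argument of [x] contributes at most the factor exp(pi S), so the size of the power is
    governed by |x| alone, uniformly for [s] in a disc. *)
Lemma cpow_decay (S sigma delta : R) : 0 < delta -> 0 <= sigma -> exists2 K, 0 <= K &
  forall (x s : C) (y : R), 1 <= y -> delta * y <= cabs x -> cabs s <= S -> sigma <= complex.Re s ->
    cabs (cpow x (- s)) <= K * y `^ (- sigma).
Proof.
move=> d0 s0; exists (expR (S * `|ln delta| + pi * S)); first exact: expR_ge0.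
move=> x s y y1 dy sS sr; have y0 : 0 < y by lra.
have dy0 : 0 < delta * y by rewrite mulr_gt0.
have x0 : x != 0 by rewrite -cabs_gt0; apply: lt_le_trans dy.
rewrite cabs_cpow /powR gt_eqF// -expRD ler_expR ReN ImN.
have argb : `|carg x| <= pi by rewrite ler_norml; have := carg_bound x0; lra.
have t1 : - (- complex.Im s * carg x) <= pi * S.
  rewrite mulNr opprK; apply: le_trans (ler_norm _) _; rewrite normrM mulrC.
  by apply: ler_pM => //; apply: le_trans (le_cabs_Im s) sS.
have sre := le_trans (le_cabs_Re s) sS.
have re0 : 0 <= complex.Re s by lra.
have ln1 : ln (delta * y) <= ln (cabs x) by rewrite ler_ln ?posrE// cabs_gt0.
rewrite lnM ?posrE// in ln1.
have ly : 0 <= ln y by exact: ln_ge0.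
have t2 : - complex.Re s * ln delta <= S * `|ln delta|.
  apply: le_trans (ler_norm _) _; rewrite normrM normrN; exact: ler_wpM2r.
have t3 : complex.Re s * (ln delta + ln y) <= complex.Re s * ln (cabs x) by exact: ler_wpM2l.
have t4 : sigma * ln y <= complex.Re s * ln y by exact: ler_wpM2r.
lra.
Qed.

(** The open half plane with inner normal [u]. When [u] has nonnegative real part it contains no
    negative real number, hence no point of the branch cut of [cpow]. *)
Definition halfplane (u x : C) : Prop := 0 < complex.Re (x * conjc u).

Lemma halfplaneD u x y : halfplane u x -> halfplane u y -> halfplane u (x + y).
Proof. by rewrite /halfplane mulrDl ReD; exact: addr_gt0. Qed.

Lemma halfplane_neq0 u x : halfplane u x -> x != 0.
Proof. by rewrite /halfplane; apply: contraTneq => ->; rewrite mul0r ltxx. Qed.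

Definition lat (r : nat) (z : C) (w : 'I_r -> C) (m : {ffun 'I_r -> nat}) : C :=
  z + \sum_(j < r) (m j)%:R * w j.

Lemma Re_natM (n : nat) (x : C) : complex.Re (n%:R * x) = n%:R * complex.Re x.
Proof. by rewrite -(rmorph_nat (real_complex R)) ReZ. Qed.

Lemma Im_natM (n : nat) (x : C) : complex.Im (n%:R * x) = n%:R * complex.Im x.
Proof. by rewrite -(rmorph_nat (real_complex R)) ImZ. Qed.

Lemma Re_lat u r z (w : 'I_r -> C) m : complex.Re (lat z w m * conjc u) =
  complex.Re (z * conjc u) + \sum_(j < r) (m j)%:R * complex.Re (w j * conjc u).
Proof.
rewrite /lat mulrDl ReD mulr_suml Re_sum; congr (_ + _); apply: eq_bigr => j _.
by rewrite -mulrA Re_natM.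
Qed.

Lemma lat_halfplane u r z (w : 'I_r -> C) m :
  halfplane u z -> (forall j, halfplane u (w j)) -> halfplane u (lat z w m).
Proof.
move=> hz hw; rewrite /halfplane Re_lat; apply: ltr_wpDr => //.
by apply: sumr_ge0 => j _; rewrite mulr_ge0// ltW// hw.
Qed.

(** The projections of [z] and of all [w j] onto [u] are at least some d > 0, so they add up without
    cancellation. *)
Lemma lat_lower_bound u r z (w : 'I_r -> C) : halfplane u z -> (forall j, halfplane u (w j)) ->
  exists2 delta : R, 0 < delta & forall m, delta * (1 + msum m) <= cabs (lat z w m).
Proof.
move=> hz hw; pose rho x := complex.Re (x * conjc u).
have u0 : 0 < cabs u.
  rewrite cabs_gt0; apply/eqP => u0; move: hz; rewrite /halfplane u0 (_ : conjc 0 = 0) ?mulr0 ?ltxx//.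
  by rewrite /conjc /= oppr0.
have [d d0 [dz dw]] : exists2 d : R, 0 < d & d <= rho z /\ forall j, d <= rho (w j).
  exists (\big[Num.min/rho z]_(j < r) rho (w j)).
    elim/big_ind: _ => // [x y x0 y0|j _]; [by rewrite lt_min x0|exact: hw].
  split; last by move=> j; exact: bigmin_le_cond.
  exact: bigmin_le_id.
exists (d / cabs u); first by rewrite divr_gt0.
move=> m; rewrite mulrAC ler_pdivrMr//.
apply: (@le_trans _ _ (complex.Re (lat z w m * conjc u))).
  rewrite Re_lat mulrDr mulr1; apply: lerD => //; rewrite /msum mulr_sumr.
  by apply: ler_sum => j _; rewrite [d * _]mulrC; apply: ler_wpM2l => //; exact: dw.
by apply: le_trans (le_Re_cabs _) _; rewrite cabsM [cabs (conjc u)](congr1 (@complex.Re R) (normcJ u)).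
Qed.

Lemma barnes_series_absum u r z (w : 'I_r -> C) s : halfplane u z -> (forall j, halfplane u (w j)) ->
  r%:R < complex.Re s -> absum (fun m => cpow (lat z w m) (- s)).
Proof.
move=> hz hw rs; have [d d0 hd] := lat_lower_bound hz hw.
have r0 : 0 <= complex.Re s by apply: le_trans (ltW rs); exact: ler0n.
have [K K0 hK] := cpow_decay (cabs s) d0 r0.
have [L hL] := lattice_bounded rs.
apply: (@absum_dom _ _ _ (fun m => K * (1 + msum m) `^ (- complex.Re s)) (K * L)).
  by move=> m; apply: hK => //; rewrite ?lerDl ?msum_ge0.
by move=> A; rewrite -mulr_sumr ler_wpM2l.
Qed.

Lemma barnes_seriesE r z (w : 'I_r -> C) s : barnes_series z w s = csum (fun m => cpow (lat z w m) (- s)).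
Proof. by []. Qed.

Lemma barnes_series_cderivable u r z (w : 'I_r -> C) s : halfplane u z -> (forall j, halfplane u (w j)) ->
  r%:R < complex.Re s -> cderivable (barnes_series z w) s.
Proof.
move=> hz hw rs; have [d d0 hd] := lat_lower_bound hz hw.
pose e := (complex.Re s - r%:R) / 2; have e0 : 0 < e by rewrite divr_gt0// subr_gt0.
pose sg := complex.Re s - e.
have rsg : r%:R < sg by rewrite /sg /e; lra.
have sg0 : 0 <= sg by apply: le_trans (ltW rsg); exact: ler0n.
have [K K0 hK] := cpow_decay (cabs s + e) d0 sg0.
have [L hL] := lattice_bounded rsg.
have MB : bounded_sums (fun m : {ffun 'I_r -> nat} => K * (1 + msum m) `^ (- sg)) (K * L).
  by move=> A; rewrite -mulr_sumr ler_wpM2l.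
apply: (csum_cderivable e0 MB) => [m t _|m t ht].
  by apply: cderivable_cpow; apply: cderivableN; exact: cderivable_id.
apply: hK => //; rewrite ?lerDl ?msum_ge0//.
  by have := le_cabsD (t - s) s; rewrite subrK; move: ht; rewrite /cball; lra.
by have := Re_lip t s; move: ht; rewrite /cball ler_norml /sg; lra.
Qed.

Lemma lat_mcons r z (w0 : C) (w : 'I_r -> C) n m :
  lat z (fcons w0 w) (mcons (n, m)) = lat (z + n%:R * w0) w m.
Proof.
rewrite /lat big_ord_recl /= {1}/fcons {1}/mcons ffunE !unlift_none addrA; congr (_ + _).
by apply: eq_bigr => j _; rewrite /fcons /mcons ffunE liftK.
Qed.

Lemma halfplane_fcons u r (w0 : C) (w : 'I_r -> C) : halfplane u w0 -> (forall j, halfplane u (w j)) ->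
  forall j, halfplane u (fcons w0 w j).
Proof. by move=> h0 h j; rewrite /fcons; case: unliftP. Qed.

Lemma barnes_series_fcons u r z (w0 : C) (w : 'I_r -> C) s : halfplane u z -> halfplane u w0 ->
  (forall j, halfplane u (w j)) -> r.+1%:R < complex.Re s ->
  absum (fun p : nat * {ffun 'I_r -> nat} => cpow (lat (z + p.1%:R * w0) w p.2) (- s)) /\
  barnes_series z (fcons w0 w) s =
  csum (fun p : nat * {ffun 'I_r -> nat} => cpow (lat (z + p.1%:R * w0) w p.2) (- s)).
Proof.
move=> hz h0 hw rs; have a := barnes_series_absum hz (halfplane_fcons h0 hw) rs.
have E : (fun p : nat * {ffun 'I_r -> nat} => cpow (lat (z + p.1%:R * w0) w p.2) (- s)) =
    (fun p => cpow (lat z (fcons w0 w) (mcons p)) (- s)).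
  by apply/funext => -[n m]; rewrite lat_mcons.
rewrite E; split; first exact: (absum_inj (can_inj (@mconsK r)) a).
by rewrite barnes_seriesE -(csum_reindex (@mconsK r) (@munconsK r) a).
Qed.

(** Separates the terms with multiplicity 0 of [w0]. This difference equation drives the
    continuation, and also moves the terms n = 0 between the two halves of a bilateral series. *)
Lemma barnes_series_shift u r z (w0 : C) (w : 'I_r -> C) s : halfplane u z -> halfplane u w0 ->
  (forall j, halfplane u (w j)) -> r.+1%:R < complex.Re s ->
  barnes_series z (fcons w0 w) s = barnes_series z w s + barnes_series (z + w0) (fcons w0 w) s.
Proof.
move=> hz h0 hw rs; have [a1 ->] := barnes_series_fcons hz h0 hw rs.
have [a2 ->] := barnes_series_fcons (halfplaneD hz h0) h0 hw rs.
have [_ b1 ->] := csum_fubini a1; have [_ b2 ->] := csum_fubini a2.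
rewrite (csum_natS b1) /=; congr (_ + _); first by rewrite mul0r addr0.
by congr csum; apply/funext => n; rewrite -addrA -[X in X + n%:R * _]mul1r -mulrDl nat1r.
Qed.

Lemma fcons_eta r (w : 'I_r.+1 -> C) : fcons (w ord0) (fun j => w (lift ord0 j)) = w.
Proof. by apply/funext => i; rewrite /fcons; case: unliftP => [j ->|->]. Qed.

Lemma barnes_series_perm u r z (w : 'I_r -> C) (f g : 'I_r -> 'I_r) s :
  cancel f g -> cancel g f -> halfplane u z -> (forall j, halfplane u (w j)) -> r%:R < complex.Re s ->
  barnes_series z (fun j => w (f j)) s = barnes_series z w s.
Proof.
move=> fg gf hz hw rs; rewrite !barnes_seriesE.
pose F (m : {ffun 'I_r -> nat}) : {ffun 'I_r -> nat} := [ffun j => m (g j)].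
pose G (m : {ffun 'I_r -> nat}) : {ffun 'I_r -> nat} := [ffun j => m (f j)].
have FG : cancel F G by move=> m; apply/ffunP => j; rewrite !ffunE fg.
have GF : cancel G F by move=> m; apply/ffunP => j; rewrite !ffunE gf.
rewrite -(csum_reindex FG GF (barnes_series_absum hz hw rs)); congr csum; apply/funext => m.
suff -> : lat z w (F m) = lat z (fun j => w (f j)) m by [].
rewrite /lat; congr (_ + _); rewrite (reindex f) /=; last first.
  by exists g => i _; rewrite ?fg ?gf.
by apply: eq_bigr => j _; rewrite ffunE fg.
Qed.

End LatticeSums.

(** * Continuation of the Barnes zeta function *)

Section BarnesContinuation.
Variable R : realType.
Local Notation C := R[i].
Implicit Types (u x s z v : C).

Lemma carg_Re_ge0 v : v != 0 -> 0 <= complex.Re v -> `|carg v| <= pi / 2.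
Proof.
move=> v0 hv; have := Re_div_cabs v0 => hb.
suff h : 0 <= acos (complex.Re v / cabs v) <= pi / 2.
  by rewrite /carg; case: ifP => _; rewrite ?normrN ger0_norm; case/andP: h.
have a0 := acos_ge0 hb; rewrite a0 /= leNgt; apply/negP => h.
have : cos (acos (complex.Re v / cabs v)) < cos (pi / 2).
  rewrite ltr_cos ?in_itv//= ?a0 ?acos_lepi//.
  by have := @pi_ge0 R; lra.
by rewrite acosK ?in_itv//= cos_pihalf ltNge divr_ge0// cabs_ge0.
Qed.

(** The argument of [u] is at most pi / 2 in absolute value and that of x / u is smaller than pi /
    2, so their sum stays in ]-pi, pi[ and is the argument of [x]. *)
Lemma carg_halfplane u x : 0 <= complex.Re u -> halfplane u x -> `|carg x - carg u| < pi / 2.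
Proof.
move=> u0 hx; have un0 : u != 0.
  apply/eqP => e; move: hx; rewrite /halfplane e (_ : conjc 0 = 0) ?mulr0 ?ltxx//.
  by rewrite /conjc /= oppr0.
have cu : 0 < cabs u by rewrite cabs_gt0.
have hq : 0 < complex.Re (x / u).
  have -> : complex.Re (x / u) = complex.Re (x * conjc u) / cabs u ^+ 2.
    rewrite ReM ReV ImV ReM; case: (u) => a b /=.
    by rewrite mulrBl !mulrA !mulrN !mulNr !opprK -?mulrA.
  by rewrite divr_gt0// exprn_gt0.
have h1 := carg_Re_ge0 un0 u0; have h2 := carg_Re_gt0_bound hq.
have E : clog x = clog u + clog (x / u).
  have {1}-> : x = u * (x / u) by rewrite mulrC divfK.
  apply: clogM => //; first exact: Re_gt0_neq0.
  by move: h1; rewrite ler_norml; lra.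
have -> : carg x = carg u + carg (x / u) by have := congr1 (@complex.Im R) E.
by rewrite addrAC subrr add0r ltr_norml.
Qed.

Lemma cpow_halfplane_mul u x v t : 0 <= complex.Re u -> halfplane u x -> halfplane u (x * v) ->
  cpow (x * v) t = cpow x t * cpow v t.
Proof.
move=> u0 hx hxv; have x0 := halfplane_neq0 hx; have xv0 := halfplane_neq0 hxv.
have E : clog v = clog (x * v) - clog x.
  apply: clog_unique; first by rewrite cexpB !clogK// mulrAC divff// mul1r.
  rewrite ImD ImN /=; have := carg_halfplane u0 hx; have := carg_halfplane u0 hxv.
  by rewrite !ltr_norml; lra.
by rewrite !cpowE E mulrBr cexpB [RHS]mulrC divfK// cexp_neq0.
Qed.

Lemma cpow_crude (S L : R) x s : cabs s <= S -> `|ln (cabs x)| <= L -> x != 0 ->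
  cabs (cpow x (- s)) <= expR (S * L + pi * S).
Proof.
move=> sS xL x0; rewrite cabs_cpow ler_expR ReN ImN.
have argb : `|carg x| <= pi by rewrite ler_norml; have := carg_bound x0; lra.
apply: le_trans (ler_norm _) _; apply: le_trans (ler_normB _ _) _.
rewrite !mulNr !normrN !normrM; apply: lerD.
  by apply: ler_pM => //; apply: le_trans (le_cabs_Re s) sS.
by rewrite mulrC; apply: ler_pM => //; apply: le_trans (le_cabs_Im s) sS.
Qed.

Lemma cpow_div_nat x s k : x != 0 -> cpow x (- (s + k%:R)) = cpow x (- s) / x ^+ k.
Proof. by move=> x0; rewrite opprD cpowD (cpowN x k%:R) cpow_nat. Qed.

(** The remainder of order [M] in the expansion of (x + w0)^(-s) in powers of w0 / x; its size is of
    order |x|^(- Re s - M). *)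
Definition taylor_error (w0 : C) (M : nat) x s : C :=
  cpow (x + w0) (- s) - cpow x (- s) * \sum_(0 <= k < M) rbin s k * (- (w0 / x)) ^+ k.

(** For |w0 / x| <= 1/2 the binomial remainder applies. Otherwise |x| < 2 |w0|: then all the terms
    are bounded, and so is [y], which makes [kap] a positive lower bound for the power of [y] on the
    right. The lower bound on |x + w0| controls the logarithm in that second case. *)
Lemma taylor_error_bound u w0 (M : nat) (S sg delta : R) : 0 <= complex.Re u -> halfplane u w0 ->
  0 < delta -> 0 <= sg -> 0 <= S ->
  exists2 K, 0 <= K & forall x s (y : R), halfplane u x -> 1 <= y -> delta * y <= cabs x ->
    delta <= cabs (x + w0) -> cabs s <= S -> sg <= complex.Re s + M%:R ->
    cabs (taylor_error w0 M x s) <= K * y `^ (- sg).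
Proof.
move=> u0 hw0 d0 sg0 S0.
have [K1 K10 hK1] := cpow_decay (S + M%:R) d0 sg0.
have [c c0 hc] := @taylor_remainder R S M S0.
pose W := cabs w0; have W0 : 0 < W by rewrite cabs_gt0; exact: halfplane_neq0 hw0.
pose L := `|ln delta| + `|ln (3 * W)|.
pose P := \sum_(0 <= k < M) rbinR S k * (W / delta) ^+ k.
have P0 : 0 <= P by apply: sumr_ge0 => k _; rewrite mulr_ge0 ?rbinR_ge0 ?exprn_ge0 ?divr_ge0// ltW.
pose B := expR (S * L + pi * S); have B0 : 0 < B by exact: expR_gt0.
pose kap := (2 * W / delta) `^ (- sg).
have kap0 : 0 < kap by rewrite powR_gt0// divr_gt0// mulr_gt0.
have BP0 : 0 <= B * (1 + P) := mulr_ge0 (ltW B0) (addr_ge0 ler01 P0).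
have K20 : 0 <= B * (1 + P) / kap := divr_ge0 BP0 (ltW kap0).
have K30 : 0 <= c * W ^+ M * K1 by rewrite !mulr_ge0// exprn_ge0// ltW.
exists (c * W ^+ M * K1 + B * (1 + P) / kap); first exact: addr_ge0.
move=> x s y hx y1 hdy hdw sS sM.
have x0 := halfplane_neq0 hx; have cx : 0 < cabs x by rewrite cabs_gt0.
have xw : x + w0 = x * (1 + w0 / x) by rewrite mulrDr mulr1 mulrCA divff// mulr1.
have yp : 0 <= y `^ (- sg) by exact: powR_ge0.
rewrite mulrDl.
have [small|big] := leP (cabs (w0 / x)) (1 / 2).
  apply: (@le_trans _ _ (c * W ^+ M * K1 * y `^ (- sg))); last by rewrite lerDl mulr_ge0.
  have -> : taylor_error w0 M x s = cpow x (- s) * (cpow (1 + w0 / x) (- s) - \sum_(0 <= k < M) rbin s k * (- (w0 / x)) ^+ k).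
    rewrite mulrBr /taylor_error xw (@cpow_halfplane_mul u)//.
    by rewrite -xw; exact: halfplaneD.
  rewrite cabsM; have := hc s (w0 / x) sS small; rewrite cabs_div => h.
  apply: (@le_trans _ _ (cabs (cpow x (- s)) * (c * (W / cabs x) ^+ M))).
    by rewrite ler_wpM2l// cabs_ge0.
  have -> : cabs (cpow x (- s)) * (c * (W / cabs x) ^+ M) = c * W ^+ M * cabs (cpow x (- (s + M%:R))).
    by rewrite cpow_div_nat// cabs_div cabsX exprMn exprVn; ring.
  rewrite -[X in _ <= X]mulrA; apply: ler_wpM2l; first by rewrite mulr_ge0// exprn_ge0// ltW.
  apply: hK1 => //; last by rewrite ReD -(rmorph_nat (real_complex R)).
  by apply: le_trans (le_cabsD _ _) _; rewrite cabs_nat lerD2r.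
apply: (@le_trans _ _ (B * (1 + P) / kap * y `^ (- sg))); last by rewrite lerDr mulr_ge0.
have xW : cabs x < 2 * W by move: big; rewrite cabs_div ltr_pdivlMr// -/W; lra.
have dx : delta <= cabs x by apply: le_trans hdy; rewrite ler_peMr// ltW.
have Lb t : delta <= t -> t <= 3 * W -> `|ln t| <= L.
  move=> t1 t2; have t0 : 0 < t by lra.
  have l1 : ln delta <= ln t by rewrite ler_ln ?posrE.
  have l2 : ln t <= ln (3 * W) by rewrite ler_ln ?posrE ?mulr_gt0.
  have := ler_norm (ln (3 * W)); have := ler_norm (- ln delta); rewrite normrN => i1 i2.
  have := normr_ge0 (ln delta); have := normr_ge0 (ln (3 * W)).
  by rewrite ler_norml /L; lra.
have b1 : cabs (cpow (x + w0) (- s)) <= B.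
  apply: cpow_crude => //; last by rewrite -cabs_gt0; lra.
  by apply: Lb => //; apply: le_trans (le_cabsD _ _) _; rewrite -/W; lra.
have b2 : cabs (cpow x (- s)) <= B by apply: cpow_crude => //; apply: Lb => //; lra.
have b3 : cabs (\sum_(0 <= k < M) rbin s k * (- (w0 / x)) ^+ k) <= P.
  apply: le_trans (cabs_sum _ _ _) _; apply: ler_sum => k _.
  rewrite cabsM cabsX cabsN cabs_div; apply: ler_pM; rewrite ?cabs_ge0 ?exprn_ge0 ?divr_ge0 ?cabs_ge0//.
    exact: cabs_rbin.
  apply: lerXn2r; rewrite ?nnegrE ?divr_ge0 ?cabs_ge0 ?(ltW d0)//.
  by rewrite ler_pM2l//; exact: le_invr.
have b4 : cabs (taylor_error w0 M x s) <= B * (1 + P).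
  apply: le_trans (le_cabsB _ _) _; rewrite mulrDr mulr1 cabsM; apply: lerD => //.
  by apply: ler_pM => //; exact: cabs_ge0.
apply: le_trans b4 _; rewrite -mulrA ler_peMr//.
rewrite mulrC ler_pdivlMr// mul1r /kap !powRN; apply: le_invr; first by rewrite powR_gt0//; lra.
apply: ge0_ler_powR => //; rewrite ?nnegrE; [lra|by apply: divr_ge0 (ltW d0); apply: mulr_ge0 (ltW W0)|].
by rewrite ler_pdivlMr// mulrC; lra.
Qed.

Lemma mero_at_invB (a c : C) : mero_at (fun s => (s - a)^-1) c.
Proof.
have [->|ca] := eqVneq c a.
  exists 1%N, (fun=> 1); split; first by apply: entire_holomorphic => s; exact: cderivable_cst.
  by apply/dnearCP; exists 1 => // s _ _; rewrite expr1 div1r.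
apply: mero_at_holo; apply/holomorphic_atP; exists (cabs (c - a)); first by rewrite cabs_gt0 subr_eq0.
move=> s hs; apply: cderivableV.
  by rewrite subr_eq0; apply: contraTneq hs => ->; rewrite /cball cabsBC ltxx.
by apply: cderivableB; [exact: cderivable_id|exact: cderivable_cst].
Qed.

Lemma halfplane_holomorphic (f : C -> C) (sg : R) c :
  (forall s, sg < complex.Re s -> cderivable f s) -> sg < complex.Re c -> holomorphic_at f c.
Proof.
move=> h hc; apply/holomorphic_atP; exists (complex.Re c - sg); first by rewrite subr_gt0.
by move=> s hs; apply: h; have := Re_lip s c; move: hs; rewrite /cball ler_norml; lra.
Qed.

Lemma rbin_cderivable k s : cderivable (fun s => rbin s k) s.
Proof.
apply: cderivable_prod => j _; apply: cderivableM; last exact: cderivable_cst.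
by apply: cderivableD; [exact: cderivable_id|exact: cderivable_cst].
Qed.

(** The identity theorem compares functions on punctured neighbourhoods, whereas a continuation has
    to agree with [f] at every point of the half plane; hence the values there are overwritten by
    those of [f]. Near any point this changes [F] at most at that point. *)
Lemma mero_patch (f F : C -> C) (sg : R) : meromorphic F ->
  (forall s, sg < complex.Re s -> cderivable f s) ->
  (forall c, sg < complex.Re c -> eq_punctured F f c) ->
  exists2 G, meromorphic G & forall s, sg < complex.Re s -> G s = f s.
Proof.
move=> mF hf e; pose G s := if sg < complex.Re s then f s else F s.
exists G => [c|s hs]; last by rewrite /G hs.
have [r r0 hr] := mero_at_punctured (mF c).
apply: (@mero_at_near _ F) (mF c); apply/dnearCP; exists r => // s sc hs.
rewrite /G; case: ifP => // sgs.
have cF : ccont_at F s by apply/cderivable_cont/holomorphic_cderivable/hr.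
have cf : ccont_at f s by apply/cderivable_cont/hf.
apply/eqP; rewrite -subr_eq0 -cabs_eq0 eq_le cabs_ge0 andbT; apply/ler_addgt0Pl => x x0; rewrite addr0.
have x20 : 0 < x / 2 by lra.
have [d d0 hd] := cF _ x20; have [d' d'0 hd'] := cf _ x20.
have /eq_puncturedP[d2 d20 hd2] := e s sgs.
pose t := Num.min d (Num.min d' d2) / 2.
have t0 : 0 < t by rewrite divr_gt0// !lt_min d0 d'0.
have tm : t < Num.min d (Num.min d' d2) by rewrite /t ltr_pdivrMr// ltr_pMr// ?ltr1n// !lt_min d0 d'0.
move: tm; rewrite !lt_min => /andP[t1 /andP[t2 t3]].
have E : cabs (s + t%:C - s) = t by rewrite addrAC subrr add0r cabs_real gtr0_norm.
have := hd (s + t%:C); have := hd' (s + t%:C); have := hd2 (s + t%:C); rewrite E t1 t2 t3.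
rewrite -subr_eq0 -cabs_gt0 E t0 => /(_ isT isT) -> /(_ isT) i1 /(_ isT) i2.
by have := le_cabs_tri (f (s + t%:C)) (F s) (f s); rewrite (cabsBC (F s) (f (s + t%:C))); lra.
Qed.

Lemma barnes_series0 z (w : 'I_0 -> C) s : barnes_series z w s = cpow z (- s).
Proof.
rewrite barnes_seriesE; apply: hasum_csumE => e e0.
pose m0 : {ffun 'I_0 -> nat} := [ffun=> 0%N].
have all0 m : m = m0 by apply/ffunP; case.
exists [fset m0]%fset => B hB.
have -> : B = [fset m0]%fset.
  by apply/eqP; rewrite eqEfsubset hB andbT; apply/fsubsetP => m _; rewrite in_fset1 (all0 m).
by rewrite big_seq_fset1 /lat big_ord0 addr0 subrr cabs0 ltW.
Qed.

(** * Continuation with one more period *)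

Section Step.
Variables (u z w0 : C) (r : nat) (w : 'I_r -> C).
Hypotheses (u0 : 0 <= complex.Re u) (hz : halfplane u z) (h0 : halfplane u w0)
  (hw : forall j, halfplane u (w j)).
Let w' := fcons w0 w.
Let hw' : forall j, halfplane u (w' j). Proof. exact: halfplane_fcons. Qed.
Let S := barnes_series z w'.
Let err M s := csum (fun m : {ffun 'I_r.+1 -> nat} => taylor_error w0 M (lat z w' m) s).

(** Each Taylor term gained improves the decay by one power of the lattice point, so the sum of the
    errors is holomorphic [M] units further left than the Barnes series. *)
Lemma taylor_error_sum_cderivable (M : nat) s : r.+1%:R < complex.Re s + M%:R -> cderivable (err M) s.
Proof.
move=> rs; have [d1 d10 hd1] := lat_lower_bound hz hw'.
have [d2 d20 hd2] := lat_lower_bound (halfplaneD hz h0) hw'.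
pose e := (complex.Re s + M%:R - r.+1%:R) / 2; have e0 : 0 < e by rewrite divr_gt0// subr_gt0.
pose sg := complex.Re s + M%:R - e.
have rsg : r.+1%:R < sg by rewrite /sg /e; lra.
have sg0 : 0 <= sg by apply: le_trans (ltW rsg); exact: ler0n.
pose d := Num.min d1 d2; have d0 : 0 < d by rewrite lt_min d10.
have S0 : 0 <= cabs s + e by rewrite addr_ge0 ?cabs_ge0// ltW.
have [K K0 hK] := taylor_error_bound M u0 h0 d0 sg0 S0.
have [L hL] := lattice_bounded rsg.
have MB : bounded_sums (fun m : {ffun 'I_r.+1 -> nat} => K * (1 + msum _ m) `^ (- sg)) (K * L).
  by move=> A; rewrite -mulr_sumr ler_wpM2l.
apply: (csum_cderivable e0 MB) => [m t _|m t ht].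
  have cp x : cderivable (fun s => cpow x (- s)) t.
    by apply: cderivable_cpow; apply: cderivableN; exact: cderivable_id.
  apply: cderivableB; first exact: cp.
  apply: cderivableM; first exact: cp.
  apply: cderivable_sum => k _; apply: cderivableM; first exact: rbin_cderivable.
  exact: cderivable_cst.
have m1 : 1 <= 1 + msum R m by rewrite lerDl msum_ge0.
apply: hK => //.
- exact: lat_halfplane.
- apply: le_trans (hd1 m); rewrite ler_wpM2r ?(le_trans ler01)// /d ge_min lexx//.
- have -> : lat z w' m + w0 = lat (z + w0) w' m by rewrite /lat addrAC.
  apply: le_trans (hd2 m); apply: (@le_trans _ _ d2); first by rewrite /d ge_min lexx orbT.
  by rewrite ler_peMr// ltW.
- by have := le_cabsD (t - s) s; rewrite subrK; move: ht; rewrite /cball; lra.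
- by have := Re_lip t s; move: ht; rewrite /cball ler_norml /sg; lra.
Qed.

Lemma taylor_error_sumE (M : nat) s : r.+1%:R < complex.Re s ->
  err M s = barnes_series (z + w0) w' s - \sum_(0 <= k < M) rbin s k * (- w0) ^+ k * S (s + k%:R).
Proof.
move=> rs.
have ak k : absum (fun m : {ffun 'I_r.+1 -> nat} => cpow (lat z w' m) (- (s + k%:R))).
  apply: (barnes_series_absum hz hw'); rewrite ReD -(rmorph_nat (real_complex R)) /=.
  by rewrite ltr_wpDr.
apply: hasum_csumE.
have H1 : hasum (fun m : {ffun 'I_r.+1 -> nat} => cpow (lat (z + w0) w' m) (- s)) (barnes_series (z + w0) w' s).
  exact: absum_hasum (barnes_series_absum (halfplaneD hz h0) hw' rs).
have H2 : hasum (fun m : {ffun 'I_r.+1 -> nat} => \sum_(0 <= k < M) rbin s k * (- w0) ^+ k * cpow (lat z w' m) (- (s + k%:R)))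
   (\sum_(0 <= k < M) rbin s k * (- w0) ^+ k * S (s + k%:R)).
  by apply: hasum_fin => k _; apply: hasumZ; apply: absum_hasum.
have := hasumB H1 H2; congr hasum; apply/funext => m; rewrite /taylor_error.
have x0 : lat z w' m != 0 by apply: halfplane_neq0; exact: lat_halfplane hz hw'.
have -> : lat (z + w0) w' m = lat z w' m + w0 by rewrite /lat addrAC.
congr (_ - _); rewrite mulr_sumr; apply: eq_bigr => k _.
by rewrite cpow_div_nat// -mulNr exprMn exprVn; ring.
Qed.

(** The Taylor expansion is summed over the lattice. Its term k = 0 combines with the shifted series
    into the Barnes series with one period fewer, by the difference equation, and the term k = 1 is
    the one solved for. *)
Lemma barnes_recursion (M : nat) s : r.+1%:R < complex.Re s -> (2 <= M)%N ->
  s * w0 * S (s + 1) = err M s + barnes_series z w s + \sum_(2 <= k < M) rbin s k * (- w0) ^+ k * S (s + k%:R).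
Proof.
move=> rs M2; rewrite taylor_error_sumE//.
rewrite (big_ltn (ltnW M2)) (big_ltn M2) rbin0 expr0 !mul1r addr0.
have -> : S s = barnes_series z w s + barnes_series (z + w0) w' s by exact: barnes_series_shift hz h0 hw rs.
have -> : rbin s 1 = s by rewrite /rbin big_nat1 addr0 divr1.
rewrite expr1 -[1%:R]/(1 : C); ring.
Qed.

Hypothesis (Z : C -> C).
Hypotheses (mZ : meromorphic Z) (hZ : forall s, r%:R < complex.Re s -> Z s = barnes_series z w s).

(** Each step gains a strip on the left but applies the recursion one unit further to the right, so
    agreement with [S] is recorded only far to the right; the identity theorem later compensates for
    this. *)
Lemma barnes_continuation_left (K : nat) : exists F : C -> C,
  (forall c, r.+1%:R - K%:R < complex.Re c -> mero_at F c) /\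
  (forall s, r.+1%:R + K%:R < complex.Re s -> F s = S s).
Proof.
elim: K => [|K [F [mF hF]]].
  exists S; split=> // c; rewrite subr0 => hc; apply: mero_at_holo.
  by apply: (halfplane_holomorphic _ hc) => s; exact: barnes_series_cderivable hz hw'.
pose M := K.+3.
(* [barnes_recursion] solved for S(t + 1), to be used at t = s - 1. The arguments t + k with k >= 2
   lie at least one unit to the right of [s], where [F] is already meromorphic. *)
pose G t := (err M t + Z t + \sum_(2 <= k < M) rbin t k * (- w0) ^+ k * F (t + k%:R)) * t^-1 / w0.
have w00 := halfplane_neq0 h0.
exists (fun s => G (s - 1)); split=> [c hc|s hs].
  apply: (@mero_at_shift _ G (-1)); set c' := c - 1.
  have hc' : r%:R - K.+1%:R < complex.Re c' by rewrite /c' ReD ReN /=; move: hc; rewrite -!natr1; lra.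
  apply: mero_atM; last exact: mero_at_cst.
  apply: mero_atM; last by have := @mero_at_invB 0 c'; under eq_fun do rewrite subr0.
  apply: mero_atD; first apply: mero_atD; last 2 first.
  - exact: mZ.
  - under eq_fun do rewrite big_seq.
    apply: mero_at_sum => k; rewrite mem_index_iota => /andP[k2 _]; apply: mero_atM.
      apply: mero_at_entire => t; apply: cderivableM; [exact: rbin_cderivable|exact: cderivable_cst].
    apply: mero_at_shift; apply: mF; rewrite ReD -(rmorph_nat (real_complex R)) /=.
    have : 2 <= k%:R :> R by rewrite (ler_nat _ 2).
    by move: hc'; rewrite -!natr1; lra.
  apply: mero_at_holo; apply: (@halfplane_holomorphic _ (r.+1%:R - M%:R)).
    by move=> t ht; apply: taylor_error_sum_cderivable; move: ht; lra.
  by move: hc'; rewrite /M -!natr1; lra.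
have rK : r.+1%:R <= r.+1%:R + K%:R :> R by rewrite lerDl.
have hs1 : r.+1%:R + K%:R < complex.Re (s - 1) by rewrite ReD ReN /=; move: hs; rewrite -natr1; lra.
have s1 : s - 1 != 0 by apply: Re_gt0_neq0; apply: le_lt_trans hs1; rewrite addr_ge0.
have hs2 : r.+1%:R < complex.Re (s - 1) by lra.
have E : G (s - 1) = ((s - 1) * w0 * S (s - 1 + 1)) * (s - 1)^-1 / w0.
  rewrite (@barnes_recursion M)//; congr (_ * _ / _); rewrite /G hZ; last by move: hs2; rewrite -natr1; lra.
  congr (_ + _); apply: eq_bigr => k _; rewrite hF// ReD -(rmorph_nat (real_complex R)) /=.
  by rewrite ltr_wpDr.
by rewrite E subrK; field; rewrite w00.
Qed.

Lemma barnes_continuation_step : exists2 F : C -> C, meromorphic F &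
  forall s, r.+1%:R < complex.Re s -> F s = S s.
Proof.
pose F K := projT1 (cid (barnes_continuation_left K)).
have hF K : (forall c, r.+1%:R - K%:R < complex.Re c -> mero_at (F K) c) /\
  (forall s, r.+1%:R + K%:R < complex.Re s -> F K s = S s) := projT2 (cid (barnes_continuation_left K)).
have FE (K L : nat) c : r.+1%:R - K%:R < complex.Re c -> r.+1%:R - L%:R < complex.Re c -> eq_punctured (F K) (F L) c.
  move=> cK cL; pose c0 : C := (r.+1%:R + K%:R + L%:R + 2)%:C.
  pose sg := Num.max (r.+1%:R - K%:R) (r.+1%:R - L%:R : R).
  have hc0 : complex.Re c0 = r.+1%:R + K%:R + L%:R + 2 by [].
  have K0 : 0 <= K%:R :> R by []. have L0 : 0 <= L%:R :> R by [].
  apply: (@mero_identity _ (F K) (F L) sg c0).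
  - move=> c1; rewrite gt_max => /andP[h1 h2]; split; [exact: (hF K).1|exact: (hF L).1].
  - by rewrite gt_max hc0; lra.
  - apply/eq_puncturedP; exists 1 => // s _ hs; have := Re_lip s c0; rewrite ler_norml hc0 => h.
    by rewrite (hF K).2 ?(hF L).2//; lra.
  by rewrite gt_max cK.
(* An index for which [s] lies well inside the domain of [F (N s)]; the margin 2 in [hN] exceeds the
   radius 1 used for neighbouring points. *)
pose N s := (Num.trunc (cabs s) + r + 5)%N.
have hN s : r.+1%:R - (N s)%:R < complex.Re s - 2.
  have := truncnS_gt (cabs s); have := le_cabs_Re s; rewrite ler_norml /N !natrD -!natr1; have : 0 <= r%:R :> R by []. lra.
pose G s := F (N s) s.
have GF K c : r.+1%:R - K%:R < complex.Re c -> eq_punctured G (F K) c.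
  move=> cK; pose B := (Num.trunc (cabs c + 1) + r + 6)%N.
  have : \forall s \near (c : C^o)^', forall k : 'I_B, r.+1%:R - k%:R < complex.Re c -> F k s = F K s.
    apply: filter_forall => k.
    have [h|h] := pselect (r.+1%:R - k%:R < complex.Re c); last by apply: nearW.
    by have := FE k K c h cK; apply: filterS.
  move=> /dnearCP[d d0 hd]; apply/eq_puncturedP; exists (Num.min 1 d); first by rewrite lt_min ltr01.
  move=> s sc; rewrite lt_min => /andP[s1 sd].
  have sB : (N s < B)%N.
    rewrite /N /B [(_ + 6)%N]addnS ltnS !leq_add2r; apply: le_truncn.
    by have := le_cabsD (s - c) c; rewrite subrK; lra.
  have := hd s sc sd (Ordinal sB); apply; have := Re_lip s c; rewrite ler_norml /=; have := hN s; lra.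
have mG : meromorphic G.
  move=> c; have h := lt_trans (hN c) (_ : complex.Re c - 2 < complex.Re c).
  apply: (@mero_at_near _ (F (N c))); last by apply: (hF _).1; apply: h; lra.
  by apply: eq_punctured_sym; apply: GF; apply: h; lra.
apply: (mero_patch mG) => [s|c hc]; first exact: barnes_series_cderivable hz hw'.
apply: eq_punctured_trans (GF 0%N c _) _; first by rewrite subr0.
apply/eq_puncturedP; exists (complex.Re c - r.+1%:R); first by rewrite subr_gt0.
move=> s _ hs; apply: (hF 0%N).2; rewrite addr0.
by have := Re_lip s c; rewrite ler_norml; lra.
Qed.

End Step.

Lemma barnes_continuation u r z (w : 'I_r -> C) : 0 <= complex.Re u -> halfplane u z ->
  (forall j, halfplane u (w j)) ->
  exists2 F : C -> C, meromorphic F & forall s, r%:R < complex.Re s -> F s = barnes_series z w s.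
Proof.
move=> u0 hz; elim: r w => [|r IH] w hw.
  exists (fun s => cpow z (- s)) => [c|s _]; last by rewrite barnes_series0.
  apply: mero_at_entire => s; apply: cderivable_cpow; apply: cderivableN; exact: cderivable_id.
have [Z mZ hZ] := IH (fun j => w (lift ord0 j)) (fun j => hw _).
have := barnes_continuation_step u0 hz (hw ord0) (fun j => hw _) mZ hZ.
by rewrite fcons_eta.
Qed.

Lemma barnes_zetaP u r z (w : 'I_r -> C) : 0 <= complex.Re u -> halfplane u z ->
  (forall j, halfplane u (w j)) ->
  meromorphic (barnes_zeta z w) /\
  forall s, r%:R < complex.Re s -> barnes_zeta z w s = barnes_series z w s.
Proof.
move=> u0 hz hw; have [F mF hF] := barnes_continuation u0 hz hw.
have [|m _ h] := mero_continuationP mF _ hF; last by split.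
by move=> s hs; apply/cderivable_cont/(barnes_series_cderivable hz hw hs).
Qed.

End BarnesContinuation.

(** * Bilateral zeta functions as sums of Barnes zeta functions *)

Section BilateralDecomposition.
Variable R : realType.
Local Notation C := R[i].
Implicit Types (x s z : C).

Lemma Im_polar x : x != 0 -> complex.Im x = cabs x * sin (carg x).
Proof.
move=> x0; have := congr1 (@complex.Im R) (clogK x0) => /= <-.
by rewrite lnK// posrE cabs_gt0.
Qed.

Lemma Im_gt0_neq0 x : 0 < complex.Im x -> x != 0.
Proof. by move=> h; apply: contraTneq h => ->; rewrite ltxx. Qed.

Lemma carg_Im_gt0 x : 0 < complex.Im x -> 0 < carg x < pi.
Proof.
move=> h; have x0 := Im_gt0_neq0 h; have := carg_bound x0 => /andP[_ b2].
have b1 : 0 <= carg x by rewrite /carg (ltW h) acos_ge0// Re_div_cabs.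
move: h; rewrite (Im_polar x0) => h.
rewrite !lt_neqAle b1 b2 !andbT; apply/andP; split; apply: contraTneq h => e.
  by rewrite -e sin0 mulr0 ltxx.
by rewrite e sinpi mulr0 ltxx.
Qed.

Lemma clogN_Im_gt0 x : 0 < complex.Im x -> clog (- x) = clog x - 'i * pi%:C.
Proof.
move=> h; have x0 := Im_gt0_neq0 h; apply: clog_unique.
  rewrite cexpB clogK// (_ : cexp ('i * pi%:C) = -1); first by rewrite invrN invr1 mulrN1.
  by apply: eqCP; rewrite /= !mul0r !mul1r subrr ?add0r expR0 ?cospi ?sinpi ?mul1r// oppr0.
rewrite ImD ImN ImM /=; have := carg_Im_gt0 h; have := @pi_gt0 R; lra.
Qed.

Lemma cpowN_Im_gt0 x s : 0 < complex.Im x -> cpow (- x) (- s) = cexp (pi%:C * 'i * s) * cpow x (- s).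
Proof.
move=> h; rewrite !cpowE clogN_Im_gt0// -cexpD; congr cexp; ring.
Qed.

(* The cross product of y and x; for x and y in the upper half plane it is negative when
   arg x < arg y. *)
Definition cross x y : R := complex.Im (x * conjc y).

Lemma crossN x y : cross (- x) y = - cross x y.
Proof. by rewrite /cross mulNr ImN. Qed.

Lemma crossZ (a : R) x y : cross (a%:C * x) y = a * cross x y.
Proof. by rewrite /cross -mulrA ImZ. Qed.

Lemma cross_sum (I : Type) (r : seq I) (P : pred I) (F : I -> C) y :
  cross (\sum_(i <- r | P i) F i) y = \sum_(i <- r | P i) cross (F i) y.
Proof. by rewrite /cross mulr_suml Im_sum. Qed.

Lemma crossxx x : cross x x = 0.
Proof. by rewrite /cross; case: x => a b /=; ring. Qed.

Lemma cross_sym x y : cross x y = - cross y x.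
Proof. by rewrite /cross; case: x => a b; case: y => c d /=; ring. Qed.

Lemma cross_div x y : complex.Im (x / y) = cross x y / cabs y ^+ 2.
Proof.
rewrite ImM ReV ImV /cross ImM; case: (y) => a b /=.
by rewrite mulrDl !mulrA !mulrN !mulNr.
Qed.

Lemma cross_lt0 x y : 0 < complex.Im x -> 0 < complex.Im y -> carg x < carg y -> cross x y < 0.
Proof.
move=> hx hy h; have x0 := Im_gt0_neq0 hx; have y0 := Im_gt0_neq0 hy.
have -> : cross x y = cabs x * cabs y * sin (carg x - carg y).
  have X := congr1 (@complex.Re R) (clogK x0); have X' := congr1 (@complex.Im R) (clogK x0).
  have Y := congr1 (@complex.Re R) (clogK y0); have Y' := congr1 (@complex.Im R) (clogK y0).
  move: X X' Y Y' => /=; rewrite !lnK ?posrE ?cabs_gt0// => X X' Y Y'.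
  rewrite /cross ImM; have -> : complex.Re (conjc y) = complex.Re y by case: (y).
  have -> : complex.Im (conjc y) = - complex.Im y by case: (y).
  by rewrite -X -X' -Y -Y' sinB; ring.
have s : 0 < sin (carg y - carg x).
  by apply: sin_gt0_pi; have := carg_Im_gt0 hx; have := carg_Im_gt0 hy; lra.
by rewrite -opprB sinN mulrN oppr_lt0 !mulr_gt0// cabs_gt0.
Qed.

(* The boundary of the half plane { cross x w < 0 } passes through w; tilting it slightly
   takes w or - w to the inside. *)
Lemma tilted_halfplane (I : finType) (X : I -> C) (w : C) (e : R) : e = 1 \/ e = -1 ->
  0 < complex.Im w -> (forall i, cross (X i) w < 0) ->
  exists u, [/\ 0 <= complex.Re u, halfplane u (e%:C * w) & forall i, halfplane u (X i)].
Proof.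
move=> he hw hX; have e2 : e * e = 1 by case: he => ->; rewrite ?mulr1// mulrNN mulr1.
have en : `|e| = 1 by case: he => ->; rewrite ?normrN normr1.
pose rho x := complex.Re (x * conjc w).
(* A tilt smaller than every [d i] keeps each [X i] inside the half plane; the starting value of the
   minimum [D] does the same for the condition that the normal have nonnegative real part. *)
pose d i := - cross (X i) w / (`|rho (X i)| + 1).
have den x : 0 < `|rho x| + 1 by rewrite ltr_wpDl.
have d0 i : 0 < d i by rewrite divr_gt0// oppr_gt0.
pose D := \big[Num.min/(complex.Im w / (`|complex.Re w| + 1))]_i d i.
have D0 : 0 < D.
  rewrite /D; elim/big_ind: _ => // [|x y x0 y0]; last by rewrite lt_min x0.
  by rewrite divr_gt0// ltr_wpDl.
have D1 : D <= complex.Im w / (`|complex.Re w| + 1) by exact: bigmin_le_id.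
have D2 i : D <= d i by exact: bigmin_le_cond.
(* The half plane where [cross x w] is negative has normal - i w. Adding a small multiple of [w],
   with the sign [e], tilts it towards e w. *)
pose t := e * D; exists (- 'i * w + t%:C * w).
have tn : `|t| = D by rewrite /t normrM en mul1r gtr0_norm.
have E x : complex.Re (x * conjc (- 'i * w + t%:C * w)) = - cross x w + t * rho x.
  by rewrite /cross /rho; case: x => a b; case: (w) => c d' /=; ring.
have bound (y q b : R) : 0 < y -> D <= y / (`|q| + 1) -> b = q -> 0 < y + t * b.
  move=> y0 + ->; rewrite ler_pdivlMr; last by rewrite ltr_wpDl.
  move=> h.
  have : `|t * q| <= D * `|q| by rewrite normrM tn.
  by rewrite ler_norml => /andP[h1 _]; lra.
split.
- have -> : complex.Re (- 'i * w + t%:C * w) = complex.Im w + t * complex.Re w.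
    by case: (w) => c d' /=; ring.
  by apply: ltW; apply: bound D1 _.
- rewrite /halfplane E crossZ crossxx mulr0 oppr0 add0r /rho -mulrA ReZ mulrA.
  have -> : t * e = D by rewrite /t mulrAC e2 mul1r.
  apply: mulr_gt0 => //; have -> : complex.Re (w * conjc w) = cabs w ^+ 2.
    by rewrite sqr_cabs; case: (w) => c d' /=; ring.
  by rewrite exprn_gt0// cabs_gt0; exact: Im_gt0_neq0.
- by move=> i; rewrite /halfplane E; apply: bound (D2 i) _; rewrite ?oppr_gt0.
Qed.

(** * Corners of the parallelepiped and the telescoping bilateral sums *)

Section Parallelepiped.
Variables (n : nat) (omega : 'I_n.+1 -> C) (z : C) (a : 'I_n.+1 -> R).
Hypotheses (n1 : (1 <= n)%N) (hupper : forall j, 0 < complex.Im (omega j))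
  (harg : forall j k : 'I_n.+1, (j < k)%N -> carg (omega j) < carg (omega k))
  (ha : forall k, 0 < a k < 1) (hz : z = \sum_(k < n.+1) (a k)%:C * omega k).

Definition mirror (j : nat) : 'I_n.+1 -> C := fun l => if (l < j)%N then omega l else - omega l.

Let zA (j : nat) : C := \sum_(l < n.+1 | (l < j)%N) omega l - z.
Let zB (j : nat) : C := z - \sum_(l < n.+1 | (j <= l)%N) omega l.
Let flip (k : 'I_n.+1) : 'I_n -> C := flip_from omega k.

Lemma zA_succ (k : 'I_n.+1) : zA k.+1 = zA k + omega k.
Proof.
rewrite /zA (bigD1 k) ?ltnS//= [omega k + _]addrC -addrA [omega k - z]addrC addrA.
congr (_ - z + _).
by apply: eq_bigl => l; rewrite ltnS ltn_neqAle andbC (inj_eq (@ord_inj _)).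
Qed.

Lemma zB_succ (k : 'I_n.+1) : zB k = zB k.+1 - omega k.
Proof.
rewrite /zB [in LHS](bigD1 k) ?leqnn//= opprD addrA addrAC; congr (_ - _ - _).
by apply: eq_bigl => l; rewrite [(k < l)%N]ltn_neqAle andbC (inj_eq (@ord_inj _)) eq_sym.
Qed.

Lemma cross_omega_lt (k l : 'I_n.+1) : (l < k)%N -> cross (omega l) (omega k) < 0.
Proof. by move=> lk; apply: cross_lt0 => //; exact: harg. Qed.

Lemma cross_omega_gt (k l : 'I_n.+1) : (k < l)%N -> 0 < cross (omega l) (omega k).
Proof. by move=> kl; rewrite cross_sym oppr_gt0; exact: cross_omega_lt. Qed.

Lemma cross_flip (k : 'I_n.+1) j : cross (flip k j) (omega k) < 0.
Proof.
rewrite /flip /flip_from; case: ltnP => h; first exact: cross_omega_lt.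
rewrite crossN oppr_lt0; apply: cross_omega_gt.
by rewrite ltn_neqAle h andbT; have := neq_lift k j; rewrite -(inj_eq (@ord_inj _)).
Qed.

Lemma exists_other (k : 'I_n.+1) : exists l : 'I_n.+1, l != k.
Proof.
have i0 : 'I_n by exact: (Ordinal n1).
by exists (lift k i0); rewrite eq_sym neq_lift.
Qed.

(** All terms l <> k push to the same side of the line through [omega k], and the term k contributes
    nothing. This covers two consecutive corners at once, since they differ only in the coefficient
    of [omega k]. *)
Lemma cross_comb_lt0 (k : 'I_n.+1) (t : 'I_n.+1 -> R) :
  (forall l : 'I_n.+1, (l < k)%N -> 0 < t l) -> (forall l : 'I_n.+1, (k < l)%N -> t l < 0) ->
  cross (\sum_l (t l)%:C * omega l) (omega k) < 0.
Proof.
move=> h1 h2; have neg (l : 'I_n.+1) : l != k -> t l * cross (omega l) (omega k) < 0.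
  rewrite -(inj_eq (@ord_inj _)); case: ltngtP => // lk _.
    by rewrite pmulr_rlt0 ?cross_omega_lt// h1.
  by rewrite nmulr_rlt0 ?cross_omega_gt// h2.
rewrite cross_sum (bigD1 k)//= crossZ crossxx mulr0 add0r.
have [l lk] := exists_other k.
rewrite (bigD1 l)//= crossZ ltr_wnDr//; last exact: neg.
by apply: sumr_le0 => i /andP[ik _]; rewrite crossZ ltW// neg.
Qed.

Lemma zA_comb (j : nat) : zA j = \sum_(l < n.+1) (((l < j)%N)%:R - a l)%:C * omega l.
Proof.
rewrite /zA hz big_mkcond -sumrB; apply: eq_bigr => l _.
by rewrite rmorphB mulrBl; case: (l < j)%N; rewrite ?mul1r ?mul0r.
Qed.

Lemma zB_comb (j : nat) : zB j = \sum_(l < n.+1) (a l - ((j <= l)%N)%:R)%:C * omega l.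
Proof.
rewrite /zB hz [X in _ - X]big_mkcond -sumrB; apply: eq_bigr => l _.
by rewrite rmorphB mulrBl; case: (j <= l)%N; rewrite ?mul1r ?mul0r.
Qed.

Lemma cross_corners (k : 'I_n.+1) : [/\ cross (zA k) (omega k) < 0, cross (zA k.+1) (omega k) < 0,
  cross (zB k) (omega k) < 0 & cross (zB k.+1) (omega k) < 0].
Proof.
rewrite !zA_comb !zB_comb; split; apply: cross_comb_lt0 => l lk; have := ha l.
- by rewrite lk mulr1n; lra.
- by rewrite ltnNge ltnW//= mulr0n; lra.
- by rewrite (ltnS l) ltnW//= mulr1n; lra.
- by rewrite (ltnS l) leqNgt lk mulr0n; lra.
- by rewrite leqNgt lk mulr0n; lra.
- by rewrite ltnW//= mulr1n; lra.
- by rewrite ltnNge ltnW//= mulr0n; lra.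
- by rewrite lk mulr1n; lra.
Qed.

Definition compatible (k : 'I_n.+1) u := [/\ 0 <= complex.Re u, forall j, halfplane u (flip k j),
  halfplane u (zA k) /\ halfplane u (zA k.+1) & halfplane u (zB k) /\ halfplane u (zB k.+1)].

(** The sign 1 serves the half of the bilateral series along [omega k], the sign -1 the half along
    [- omega k]; no half plane contains both directions. *)
Lemma compatible_halfplane (k : 'I_n.+1) (e : R) : e = 1 \/ e = -1 ->
  exists2 u, compatible k u & halfplane u (e%:C * omega k).
Proof.
move=> he; have [c1 c2 c3 c4] := cross_corners k.
pose X (i : 'I_n + 'I_4) := match i with inl j => flip k j
  | inr j => nth 0 [:: zA k; zA k.+1; zB k; zB k.+1] j end.
have [|u [u0 h hX]] := @tilted_halfplane _ X (omega k) e he (hupper k).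
  by move=> [j|[[|[|[|[|//]]]] hj]] //=; exact: cross_flip.
exists u => //; split=> //; first by move=> j; exact: (hX (inl j)).
  by split; [exact: (hX (inr (@Ordinal 4 0 isT)))|exact: (hX (inr (@Ordinal 4 1 isT)))].
by split; [exact: (hX (inr (@Ordinal 4 2 isT)))|exact: (hX (inr (@Ordinal 4 3 isT)))].
Qed.

(** [fcons] puts the [k]-th period first while [mirror] leaves it in place; this bijection and the
    next one translate between the two orders. *)
Let to_front (k i : 'I_n.+1) : 'I_n.+1 := oapp (lift k) k (unlift ord0 i).
Let from_front (k i : 'I_n.+1) : 'I_n.+1 := oapp (lift ord0) ord0 (unlift k i).

Lemma to_frontK k : cancel (to_front k) (from_front k).
Proof.
move=> i; rewrite /to_front; case: (unliftP ord0 i) => [j ->|->] /=.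
  by rewrite /from_front liftK.
by rewrite /from_front unlift_none.
Qed.

Lemma from_frontK k : cancel (from_front k) (to_front k).
Proof.
move=> i; rewrite /from_front; case: (unliftP k i) => [j ->|->] /=.
  by rewrite /to_front liftK.
by rewrite /to_front unlift_none.
Qed.

Lemma fcons_mirror_succ (k : 'I_n.+1) :
  fcons (omega k) (flip k) = (fun i => mirror k.+1 (to_front k i)).
Proof.
apply/funext => i; rewrite /fcons /to_front /mirror.
case: (unliftP ord0 i) => [j _|_]; rewrite [oapp _ _ _]/=; last by rewrite ltnSn.
have -> : (lift k j < k.+1)%N = (lift k j < k)%N; last by [].
by rewrite ltnS [RHS]ltn_neqAle (inj_eq (@ord_inj _)) eq_sym neq_lift.
Qed.

Lemma fcons_mirror (k : 'I_n.+1) :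
  fcons (- omega k) (flip k) = (fun i => mirror k (to_front k i)).
Proof.
apply/funext => i; rewrite /fcons /to_front /mirror.
by case: (unliftP ord0 i) => [j _|_] /=; rewrite ?ltnn.
Qed.

Lemma mirror_succ_halfplane (k : 'I_n.+1) u : halfplane u (omega k) ->
  (forall j, halfplane u (flip k j)) -> forall l, halfplane u (mirror k.+1 l).
Proof.
move=> h0 h l; rewrite -(from_frontK k l).
by rewrite -[mirror _ _]/((fun i => mirror k.+1 (to_front k i)) _) -fcons_mirror_succ; exact: halfplane_fcons.
Qed.

Lemma mirror_halfplane (k : 'I_n.+1) u : halfplane u (- omega k) ->
  (forall j, halfplane u (flip k j)) -> forall l, halfplane u (mirror k l).
Proof.
move=> h0 h l; rewrite -(from_frontK k l).
by rewrite -[mirror _ _]/((fun i => mirror k (to_front k i)) _) -fcons_mirror; exact: halfplane_fcons.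
Qed.

Let sA j := barnes_series (zA j) (mirror j).
Let sB j := barnes_series (zB j) (mirror j).

Lemma bilateral_zetaE (k : 'I_n.+1) x s : n.+1%:R < complex.Re s ->
  (x = zA k \/ x = zB k.+1) ->
  [/\ meromorphic (bilateral_zeta x (omega k) (flip k)),
  bilateral_zeta x (omega k) (flip k) s =
    barnes_series (x + omega k) (fcons (omega k) (flip k)) s + barnes_series x (fcons (- omega k) (flip k)) s,
  absum (fun p : nat * {ffun 'I_n -> nat} =>
    cpow (lat (x + omega k + p.1%:R * omega k) (flip k) p.2) (- s)) /\
  absum (fun p : nat * {ffun 'I_n -> nat} =>
    cpow (lat (x + p.1%:R * - omega k) (flip k) p.2) (- s)) &
  bilateral_zeta x (omega k) (flip k) s =
    csum (fun p : nat * {ffun 'I_n -> nat} => cpow (lat (x + omega k + p.1%:R * omega k) (flip k) p.2) (- s)) +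
    csum (fun p : nat * {ffun 'I_n -> nat} => cpow (lat (x + p.1%:R * - omega k) (flip k) p.2) (- s))].
Proof.
move=> rs hx.
have [u [u0 hf [hA hA'] [hB hB']]] := @compatible_halfplane k 1 (or_introl erefl); rewrite mul1r => hk.
have [v [v0 hf2 [hA2 hA2'] [hB2 hB2']]] := @compatible_halfplane k (-1) (or_intror erefl).
rewrite rmorphN mulN1r => hk2.
have hxu : halfplane u (x + omega k) by apply: halfplaneD => //; case: hx => ->.
have hxv : halfplane v x by case: hx => ->.
have [m1 e1] := barnes_zetaP u0 hxu (halfplane_fcons hk hf).
have [m2 e2] := barnes_zetaP v0 hxv (halfplane_fcons hk2 hf2).
have [a1 E1] := barnes_series_fcons hxu hk hf rs.
have [a2 E2] := barnes_series_fcons hxv hk2 hf2 rs.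
split=> //.
- by move=> c; apply: mero_atD; [exact: m1|exact: m2].
- by rewrite /bilateral_zeta e1// e2.
- by rewrite /bilateral_zeta e1// e2// E1 E2.
Qed.

Lemma bilateral_zA (k : 'I_n.+1) s : n.+1%:R < complex.Re s ->
  bilateral_zeta (zA k) (omega k) (flip k) s = sA k.+1 s + sA k s.
Proof.
move=> rs; have [_ -> _ _] := @bilateral_zetaE k (zA k) s rs (or_introl erefl).
have [u [u0 hf [hA hA'] _]] := @compatible_halfplane k 1 (or_introl erefl); rewrite mul1r => hk.
have [v [v0 hf2 [hA2 hA2'] _]] := @compatible_halfplane k (-1) (or_intror erefl).
rewrite rmorphN mulN1r => hk2.
rewrite fcons_mirror_succ fcons_mirror -zA_succ; congr (_ + _).
  exact: (barnes_series_perm (to_frontK k) (from_frontK k) hA' (mirror_succ_halfplane hk hf) rs).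
exact: (barnes_series_perm (to_frontK k) (from_frontK k) hA2 (mirror_halfplane hk2 hf2) rs).
Qed.

(** By definition the bilateral function splits the integers into n >= 1 and n <= 0. The corners
    [zB] correspond to n >= 0 and n < 0, so the terms n = 0 are moved across by the difference
    equation, used once for either direction. *)
Lemma bilateral_zB (k : 'I_n.+1) s : n.+1%:R < complex.Re s ->
  bilateral_zeta (zB k.+1) (omega k) (flip k) s = sB k.+1 s + sB k s.
Proof.
move=> rs; have [_ -> _ _] := @bilateral_zetaE k (zB k.+1) s rs (or_intror erefl).
have [u [u0 hf _ [hB hB']]] := @compatible_halfplane k 1 (or_introl erefl); rewrite mul1r => hk.
have [v [v0 hf2 _ [hB2 hB2']]] := @compatible_halfplane k (-1) (or_intror erefl).
rewrite rmorphN mulN1r => hk2.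
have E1 := barnes_series_shift hB' hk hf rs.
have E2 := barnes_series_shift hB2' hk2 hf2 rs.
rewrite -zB_succ in E2; rewrite E2 addrA -[_ + barnes_series _ (flip k) s]addrC -E1.
rewrite fcons_mirror_succ fcons_mirror; congr (_ + _).
  exact: (barnes_series_perm (to_frontK k) (from_frontK k) hB' (mirror_succ_halfplane hk hf) rs).
exact: (barnes_series_perm (to_frontK k) (from_frontK k) hB2 (mirror_halfplane hk2 hf2) rs).
Qed.

Lemma halfplane_iP (x : C) : halfplane 'i x = (0 < complex.Im x) :> Prop.
Proof.
rewrite /halfplane; suff -> : complex.Re (x * conjc 'i) = complex.Im x by [].
by case: x => b c /=; ring.
Qed.

Lemma omega_halfplane j : halfplane 'i (omega j).
Proof. by rewrite halfplane_iP. Qed.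

Lemma positive_comb_halfplane (t : 'I_n.+1 -> R) : (forall l, 0 < t l) ->
  halfplane 'i (\sum_l (t l)%:C * omega l).
Proof.
move=> ht; rewrite /halfplane mulr_suml Re_sum big_ord_recl; apply: ltr_pwDl.
  by rewrite -mulrA ReZ mulr_gt0//; exact: omega_halfplane.
by apply: sumr_ge0 => l _; rewrite -mulrA ReZ mulr_ge0// ltW//; exact: omega_halfplane.
Qed.

Lemma barnes_series_opp (x : C) s : halfplane 'i x -> n.+1%:R < complex.Re s ->
  barnes_series (- x) (fun l => - omega l) s = cexp (pi%:C * 'i * s) * barnes_series x omega s.
Proof.
move=> hx rs; rewrite !barnes_seriesE -csumZ; last exact: barnes_series_absum hx omega_halfplane rs.
congr csum; apply/funext => m.
have -> : lat (- x) (fun l => - omega l) m = - lat x omega m.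
  by rewrite /lat opprD -sumrN; congr (_ + _); apply: eq_bigr => j _; rewrite mulrN.
by apply: cpowN_Im_gt0; rewrite -halfplane_iP; exact: lat_halfplane hx omega_halfplane.
Qed.

Lemma telescope_alt (V : nat -> C) (N : nat) :
  \sum_(k < N) (-1) ^+ k * (V k.+1 + V k) = V 0%N - (-1) ^+ N * V N.
Proof.
elim: N => [|N IH]; first by rewrite big_ord0 expr0 mul1r subrr.
by rewrite big_ord_recr /= IH exprS; ring.
Qed.

Lemma z_halfplane : halfplane 'i z.
Proof. by rewrite hz; apply: positive_comb_halfplane => l; case/andP: (ha l). Qed.

Lemma alternating_bilateral s : n.+1%:R < complex.Re s ->
  \sum_(k < n.+1) (-1) ^+ k * bilateral_zeta (zA k) (omega k) (flip k) s -
  \sum_(k < n.+1) (-1) ^+ (n.+1 - k.+1) * cexp (- (pi%:C * 'i * s)) * bilateral_zeta (zB k.+1) (omega k) (flip k) s =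
  (cexp (pi%:C * 'i * s) - cexp (- (pi%:C * 'i * s))) * barnes_series z omega s.
Proof.
move=> rs; under eq_bigr do rewrite bilateral_zA//.
rewrite (telescope_alt (fun j => sA j s)).
have -> : \sum_(k < n.+1) (-1) ^+ (n.+1 - k.+1) * cexp (- (pi%:C * 'i * s)) * bilateral_zeta (zB k.+1) (omega k) (flip k) s
   = cexp (- (pi%:C * 'i * s)) * ((-1) ^+ n * (sB 0%N s - (-1) ^+ n.+1 * sB n.+1 s)).
  rewrite -(telescope_alt (fun j => sB j s)) !mulr_sumr; apply: eq_bigr => k _.
  rewrite bilateral_zB// subSS; have kn : (k <= n)%N by rewrite -ltnS.
  have sq (m : nat) : (-1) ^+ m * (-1) ^+ m = 1 :> C by rewrite -exprMn mulrNN mulr1 expr1n.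
  have -> : (-1) ^+ n = (-1) ^+ (n - k) * (-1) ^+ k :> C by rewrite -exprD subnK.
  rewrite [RHS]mulrA.
  set E := cexp _; set p := (-1) ^+ (n - k); set q := (-1) ^+ k; set V := _ + _.
  have -> : E * (p * q) * (q * V) = p * E * V * (q * q) by ring.
  by rewrite /q sq mulr1.
have mir0 : mirror 0 = (fun l => - omega l) by apply/funext => l.
have mirn : mirror n.+1 = omega by apply/funext => l; rewrite /mirror ltn_ord.
have A0 : sA 0%N s = cexp (pi%:C * 'i * s) * barnes_series z omega s.
  rewrite /sA mir0 /zA big_pred0_eq sub0r; exact: barnes_series_opp z_halfplane rs.
have Bn : sB n.+1 s = barnes_series z omega s.
  by rewrite /sB mirn /zB big_pred0 ?subr0// => l; rewrite leqNgt ltn_ord.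
(* The corners [zB 0] and [zA n.+1] are opposite, and so are their periods. The resulting factor
   exp(pi i s) is undone by the exp(- pi i s) in the second alternating sum, which makes these two
   end terms cancel. *)
have B0 : sB 0%N s = cexp (pi%:C * 'i * s) * sA n.+1 s.
  rewrite /sA /sB mir0 mirn.
  have -> : zB 0 = - zA n.+1.
    by rewrite /zA /zB opprB; congr (_ - _); apply: eq_bigl => l; rewrite ltn_ord.
  apply: barnes_series_opp => //; rewrite zA_comb; apply: positive_comb_halfplane => l.
  by case/andP: (ha l) => h1 h2; rewrite (ltn_ord l : (l < n.+1)%N = true) /= subr_gt0.
rewrite A0 Bn B0 exprS; have sq : (-1) ^+ n * (-1) ^+ n = 1 :> C by rewrite -exprMn mulrNN mulr1 expr1n.
have e : cexp (- (pi%:C * 'i * s)) * cexp (pi%:C * 'i * s) = 1 by rewrite cexpNK.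
set E := cexp (- _) in e *; set E' := cexp _ in e *; set S := barnes_series _ _ _; set A := sA _ _.
have -> : E * ((-1) ^+ n * (E' * A - -1 * (-1) ^+ n * S)) = (-1) ^+ n * (E * E') * A + ((-1) ^+ n * (-1) ^+ n) * E * S by ring.
by rewrite e sq; ring.
Qed.

End Parallelepiped.
End BilateralDecomposition.

(** * The reciprocal Gamma function *)

Section EulerProduct.
Variable R : realType.
Local Notation C := R[i].
Implicit Types (s t z a b c l : C) (u v : nat -> C).

Definition seqcvg (u : nat -> C) (l : C) := (fun n => u n : C^o) @ \oo --> (l : C^o).

Lemma seqcvgP u l : seqcvg u l <-> forall e : R, 0 < e -> exists N, forall n, (N <= n)%N -> cabs (u n - l) < e.
Proof.
rewrite /seqcvg cvgCP; split=> h e /h.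
  by move=> [N _ hN]; exists N.
by move=> [N hN]; exists N.
Qed.

Lemma seqcvgM u v a b : seqcvg u a -> seqcvg v b -> seqcvg (fun n => u n * v n) (a * b).
Proof. exact: (@cvgM C nat \oo _ (fun n => u n : C^o) (fun n => v n : C^o) a b). Qed.

Lemma seqcvgD u v a b : seqcvg u a -> seqcvg v b -> seqcvg (fun n => u n + v n) (a + b).
Proof. exact: (@cvgD C C^o nat \oo _ (fun n => u n : C^o) (fun n => v n : C^o) a b). Qed.

Lemma seqcvgV u a : a != 0 -> seqcvg u a -> seqcvg (fun n => (u n)^-1) a^-1.
Proof. move=> a0 ua; exact: (@cvgV C nat \oo _ (fun n => u n : C^o) a a0 ua). Qed.

Lemma seqcvg_cst a : seqcvg (fun=> a) a.
Proof. exact: cvg_cst. Qed.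

Lemma seqcvgZ c u a : seqcvg u a -> seqcvg (fun n => c * u n) (c * a).
Proof. exact: seqcvgM (@seqcvg_cst c). Qed.

Lemma seqcvg_addl c u a : seqcvg u a -> seqcvg (fun n => c + u n) (c + a).
Proof. exact: seqcvgD (@seqcvg_cst c). Qed.

Lemma seqcvg_unique u a b : seqcvg u a -> seqcvg u b -> a = b.
Proof.
move=> /seqcvgP ha /seqcvgP hb; apply/eqP; rewrite -subr_eq0 -cabs_eq0 eq_le cabs_ge0 andbT.
apply/ler_addgt0Pl => e e0; have e20 : 0 < e / 2 by lra.
have [N hN] := ha _ e20; have [M hM] := hb _ e20.
have h1 := hN _ (leq_maxl N M); have h2 := hM _ (leq_maxr N M).
have := le_cabs_tri (u (maxn N M)) a b; rewrite (cabsBC a (u _)); lra.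
Qed.

Lemma seqcvg_shift u a k : seqcvg (fun n => u (n + k)%N) a <-> seqcvg u a.
Proof.
rewrite !seqcvgP; split=> h e /h [N hN].
  exists (N + k)%N => n hn; rewrite -(subnK (leq_trans (leq_addl _ _) hn)); apply: hN.
  by rewrite leq_subRL ?(leq_trans (leq_addl _ _) hn)// addnC.
by exists N => n hn; apply: hN; rewrite (leq_trans hn)// leq_addr.
Qed.

Lemma seqcvg_lim u l : seqcvg u l -> limn (fun n => u n : C^o) = l.
Proof. move=> h; apply: (cvg_lim _ h); exact: norm_hausdorff. Qed.

Lemma seqcvg_comp (f : C -> C) u a : ccont_at f a -> seqcvg u a -> seqcvg (fun n => f (u n)) (f a).
Proof.
move=> hf /seqcvgP hu; apply/seqcvgP => e /hf [d d0 hd]; have [N hN] := hu _ d0.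
by exists N => n /hN; exact: hd.
Qed.

Lemma seqcvg_inv_nat (k : nat) : seqcvg (fun n => (n + k).+1%:R^-1) 0.
Proof.
apply/seqcvgP => e e0; exists (Num.bound e^-1) => n hn.
rewrite subr0 cabsV cabs_nat invf_plt ?posrE//.
apply: lt_le_trans (archi_boundP _) _; first by rewrite invr_ge0 ltW.
by rewrite ler_nat (leq_trans hn)// -addSn leqW// leq_addr.
Qed.

(** Writes a product as a telescoping sum, so that convergence, holomorphy and dominated limits of
    infinite products follow from the corresponding facts on unordered sums. *)
Lemma prod_telescope (x : nat -> C) m :
  \prod_(0 <= j < m) (1 + x j) = 1 + \sum_(0 <= j < m) (x j * \prod_(0 <= i < j) (1 + x i)).
Proof.
elim: m => [|m IH]; first by rewrite !big_nil addr0.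
by rewrite big_nat_recr//= [in RHS]big_nat_recr//= addrA -IH; ring.
Qed.

Lemma prod_bound (x : nat -> C) (b : nat -> R) K m : (forall j, (j < m)%N -> cabs (x j) <= b j) ->
  (forall j, 0 <= b j) -> bounded_sums b K -> cabs (\prod_(0 <= j < m) (1 + x j)) <= expR K.
Proof.
move=> xb b0 bK; apply: (@le_trans _ _ (expR (\sum_(0 <= j < m) b j))).
  rewrite cabs_prod expR_sum big_seq [leRHS]big_seq; apply: ler_prod => j.
  rewrite mem_index_iota => /= jm; rewrite cabs_ge0 /=; apply: le_trans (le_cabsD _ _) _.
  by rewrite cabs1; apply: le_trans (expR_ge1Dx _); rewrite lerD2l xb.
by rewrite ler_expR -sum_fset_iota.
Qed.


Lemma natC_real (n : nat) : (n%:R : C) = (n%:R : R)%:C.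
Proof. by rewrite -(rmorph_nat (real_complex R)). Qed.

(* gamma_seq s (j + 1) / gamma_seq s j - 1, in a form that is visibly O(1 / j^2). *)
Definition gamma_ratio s (j : nat) : C :=
  (1 + s * j.+1%:R^-1) * cpow (1 + j.+1%:R^-1) (- s) - 1.

(** With N = m + 1 this is N^(1 - s) times the N-th binomial coefficient, the form in which the
    reciprocal of Euler's limit arises from the binomial series. *)
Definition gamma_seq s (m : nat) : C := rbin s m.+1 * m.+1%:R * cpow m.+1%:R (- s).

(** With y = 1 / (j + 1), the linear terms of (1 + s y) (1 + y)^(-s) cancel and a remainder of order
    y^2 is left. The index 0 has y = 1, outside the range of [taylor_remainder], and is bounded
    separately by [c2]. *)
Lemma gamma_ratio_bound (x : R) : 0 <= x -> exists2 c, 0 <= c &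
  forall s j, cabs s <= x -> cabs (gamma_ratio s j) <= c * j.+1%:R `^ (- 2).
Proof.
move=> x0; have [c c0 hc] := @taylor_remainder R x 2 x0.
pose c1 := x ^+ 2 + (1 + x) * c; pose c2 := (1 + x) * expR (x * ln 2) + 1.
have c10 : 0 <= c1 by rewrite addr_ge0 ?sqr_ge0// mulr_ge0// addr_ge0.
have c20 : 0 <= c2 by rewrite addr_ge0// mulr_ge0 ?expR_ge0// addr_ge0.
exists (c1 + c2); first exact: addr_ge0.
move=> s [|j] sx.
  rewrite powR1 mulr1; apply: (@le_trans _ _ c2); last by rewrite lerDr.
  rewrite /gamma_ratio; apply: le_trans (le_cabsB _ _) _; rewrite cabs1 lerD2r cabsM invr1.
  apply: ler_pM; rewrite ?cabs_ge0//.
    by apply: le_trans (le_cabsD _ _) _; rewrite cabs1 mulr1 lerD2l.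
  have -> : 1 + 1 = (2 : R)%:C by rewrite -(natC_real 2).
  rewrite cabs_cpow_pos// /powR ifF; last by apply/negbTE; rewrite pnatr_eq0.
  rewrite ler_expR ler_wpM2r ?ln_ge0 ?ler1n//.
  by apply: le_trans (ler_norm _) _; apply: le_trans (le_cabs_Re _) _; rewrite cabsN.
pose y : C := j.+2%:R^-1; have y2 : cabs y = j.+2%:R^-1 by rewrite /y cabsV cabs_nat.
have y12 : cabs y <= 1 / 2.
  by rewrite y2 div1r lef_pV2 ?posrE// ler_nat.
have -> : j.+2%:R `^ (- 2) = cabs y ^+ 2 :> R.
  by rewrite y2 powRN exprVn -powR_mulrn.
apply: (@le_trans _ _ (c1 * cabs y ^+ 2)); last by rewrite ler_wpM2r ?sqr_ge0// lerDl.
have := hc s y sx y12; rewrite big_ltn// big_ltn// big_geq// addr0 rbin0 expr0 mulr1 expr1.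
have -> : rbin s 1 = s by have := rbinS s 0; rewrite mulr1 rbin0 mul1r addr0.
move=> h; rewrite /gamma_ratio -/y.
set P := cpow _ _ in h *.
have -> : (1 + s * y) * P - 1 = - (s ^+ 2 * y ^+ 2) + (1 + s * y) * (P - (1 + s * - y)) by ring.
apply: le_trans (le_cabsD _ _) _; rewrite cabsN cabsM !cabsX /c1 [leRHS]mulrDl; apply: lerD.
  by apply: ler_wpM2r; rewrite ?sqr_ge0// lerXn2r ?nnegrE ?cabs_ge0.
rewrite cabsM -mulrA; apply: ler_pM; rewrite ?cabs_ge0//.
apply: le_trans (le_cabsD _ _) _; rewrite cabs1 lerD2l cabsM.
by rewrite -[leRHS]mulr1 ler_pM ?cabs_ge0//; move: y12; clear; lra.
Qed.

Lemma gamma_seq0 s : gamma_seq s 0 = s.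
Proof.
have -> : gamma_seq s 0 = rbin s 1 * 1%:R * cpow 1%:R (- s) by [].
rewrite rbinS rbin0 mul1r addr0 cpowE (_ : clog 1 = 0) ?mulr0 ?cexp0 ?mulr1//.
by apply: clog_unique; rewrite ?cexp0//= oppr_lt0 pi_gt0 pi_ge0.
Qed.

Lemma gamma_seqS s m : gamma_seq s m.+1 = gamma_seq s m * (1 + gamma_ratio s m).
Proof.
rewrite /gamma_ratio addrC subrK /gamma_seq rbinS.
have m0 : m.+1%:R != 0 :> C by rewrite pnatr_eq0.
have -> : (m.+2%:R : C) = m.+1%:R * (1 + m.+1%:R^-1).
  by rewrite mulrDr mulr1 divff// -natr1.
have E : 1 + m.+1%:R^-1 = (1 + m.+1%:R^-1 : R)%:C :> C.
  by rewrite rmorphD rmorph1 fmorphV rmorph_nat.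
rewrite (natC_real m.+1) cpow_posM ?ltr0Sn//; last first.
  by rewrite -(natC_real m.+1) E -cabs_eq0 cabs_real normr_eq0 gt_eqF// addr_gt0.
rewrite -(natC_real m.+1); set P := cpow _ _; set Q := cpow _ _.
have -> : rbin s m.+1 * m.+1%:R * P * ((1 + s * m.+1%:R^-1) * Q) =
   rbin s m.+1 * (m.+1%:R + s * (m.+1%:R / m.+1%:R)) * (P * Q) by ring.
by rewrite divff// mulr1 [s + _]addrC.
Qed.

Lemma gamma_seqE s m : gamma_seq s m = s * \prod_(0 <= j < m) (1 + gamma_ratio s j).
Proof.
elim: m => [|m IH]; first by rewrite big_nil mulr1 gamma_seq0.
by rewrite gamma_seqS IH big_nat_recr//= mulrA.
Qed.

Definition gamma_summand s (j : nat) : C :=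
  gamma_ratio s j * \prod_(0 <= i < j) (1 + gamma_ratio s i).

(* 1 / Gamma(s), as the telescoping series of the Euler product. *)
Definition rgamma s : C := s * (1 + csum (gamma_summand s)).

Lemma gamma_bounds (x : R) : 0 <= x -> exists M : nat -> R, exists K B : R, [/\ bounded_sums M K,
  forall s j, cabs s <= x -> cabs (gamma_summand s j) <= M j &
  forall s m, cabs s <= x -> cabs (gamma_seq s m) <= B].
Proof.
move=> x0; have [c c0 hc] := gamma_ratio_bound x0.
have [K hK] := @pseries_bounded R 2 ltac:(lra).
have b0 j : 0 <= c * j.+1%:R `^ (- 2) by rewrite mulr_ge0// powR_ge0.
have hK' : bounded_sums (fun j : nat => c * j.+1%:R `^ (- 2)) (c * K).
  by move=> A; rewrite -mulr_sumr ler_wpM2l.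
have hp s m : cabs s <= x -> cabs (\prod_(0 <= i < m) (1 + gamma_ratio s i)) <= expR (c * K).
  by move=> sx; apply: prod_bound b0 hK' => j _; exact: hc.
exists (fun j => expR (c * K) * (c * j.+1%:R `^ (- 2))), (expR (c * K) * (c * K)), (x * expR (c * K)).
split.
- by move=> A; rewrite -mulr_sumr ler_wpM2l ?expR_ge0.
- by move=> s j sx; rewrite cabsM mulrC; apply: ler_pM; rewrite ?cabs_ge0 ?hp ?hc.
- by move=> s m sx; rewrite gamma_seqE cabsM; apply: ler_pM; rewrite ?cabs_ge0 ?hp.
Qed.

Lemma gamma_seq_cvg s : seqcvg (gamma_seq s) (rgamma s).
Proof.
have [M [K [B [MK hM _]]]] := gamma_bounds (cabs_ge0 s).
have as_ : absum (gamma_summand s) by apply: (@absum_dom _ _ _ M K) => // j; exact: hM.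
have -> : gamma_seq s = (fun m => s * (1 + \sum_(0 <= j < m) gamma_summand s j)).
  by apply/funext => m; rewrite gamma_seqE prod_telescope.
apply: seqcvgZ; apply: seqcvg_addl.
exact/hasum_series/absum_hasum.
Qed.

Lemma rgamma_cderivable s : cderivable rgamma s.
Proof.
apply: cderivableM; first exact: cderivable_id.
apply: cderivableD; first exact: cderivable_cst.
have [|M [K [B [MK hM _]]]] := @gamma_bounds (cabs s + 1); first by rewrite addr_ge0// cabs_ge0.
apply: (@csum_cderivable _ _ (fun j s => gamma_summand s j) M K s 1) => //; last first.
  by move=> j t; rewrite /cball => h; apply: hM; have := le_cabsD (t - s) s; rewrite subrK; lra.
have dr j t : cderivable (fun s => gamma_ratio s j) t.
  apply: cderivableB; last exact: cderivable_cst.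
  apply: cderivableM; last by apply: cderivable_cpow; apply: cderivableN; exact: cderivable_id.
  apply: cderivableD; first exact: cderivable_cst.
  by apply: cderivableM; [exact: cderivable_id|exact: cderivable_cst].
move=> j t _; apply: cderivableM => //; apply: cderivable_prod => i _.
by apply: cderivableD => //; exact: cderivable_cst.
Qed.

Lemma rgamma_step s : rgamma s = s * rgamma (s + 1).
Proof.
have h1 : seqcvg (fun m => s * gamma_seq (s + 1) m) (s * rgamma (s + 1)).
  by apply: seqcvgZ; exact: gamma_seq_cvg.
have E m : s * gamma_seq (s + 1) m = gamma_seq s m * (1 + s * (m + 0).+1%:R^-1).
  have rb (k : nat) : s * rbin (s + 1) k = rbin s k.+1 * k.+1%:R.
    elim: k => [|k IH]; first by rewrite rbinS !rbin0 mulr1 mul1r addr0.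
    apply: (@mulIf _ (k.+1%:R : C)); first by rewrite pnatr_eq0.
    rewrite -[LHS]mulrA (rbinS (s + 1) k) [LHS]mulrA IH (rbinS s k.+1) -addrA (_ : 1 + k%:R = k.+1%:R :> C).
      by rewrite mulrAC.
    by rewrite addrC natr1.
  rewrite addn0 /gamma_seq mulrA mulrA rb rbinS opprD cpowD.
  have m0 : m.+1%:R != 0 :> C by rewrite pnatr_eq0.
  rewrite [cpow _ (- 1)]cpowN cpow1//.
  have -> : rbin s m.+1 * m.+1%:R * cpow m.+1%:R (- s) * (1 + s * m.+1%:R^-1) =
    rbin s m.+1 * (s * (m.+1%:R / m.+1%:R) + m.+1%:R) * cpow m.+1%:R (- s) by ring.
  rewrite divff// mulr1; set P := cpow _ _.
  have -> : rbin s m.+1 * (s + m.+1%:R) * m.+1%:R * (P / m.+1%:R) =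
    rbin s m.+1 * (s + m.+1%:R) * P * (m.+1%:R / m.+1%:R) by ring.
  by rewrite divff// mulr1.
apply: (@seqcvg_unique _ _ _ _ h1); under [X in seqcvg X]eq_fun do rewrite E.
rewrite -[rgamma s]mulr1; apply: seqcvgM; first exact: gamma_seq_cvg.
rewrite -[X in seqcvg _ X]addr0; apply: seqcvg_addl.
by rewrite -(mulr0 s); apply: seqcvgZ; exact: seqcvg_inv_nat.
Qed.

Lemma rgamma1 : rgamma 1 = 1.
Proof.
apply: (@seqcvg_unique (gamma_seq 1)); first exact: gamma_seq_cvg.
have -> : gamma_seq 1 = (fun=> 1); last exact: seqcvg_cst.
apply/funext => m; have m0 : m.+1%:R != 0 :> C by rewrite pnatr_eq0.
rewrite /gamma_seq cpowN cpow1// mulfK//.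
rewrite /rbin big1// => j _; by rewrite addrC natr1 divff// pnatr_eq0.
Qed.

Lemma cGamma_rgamma s : rgamma s != 0 -> cGamma s = (rgamma s)^-1.
Proof.
move=> g0; apply: seqcvg_lim; apply/(@seqcvg_shift _ _ 1).
have E m : (m + 1)`!%:R * cpow (m + 1)%:R s / \prod_(0 <= j < (m + 1).+1) (s + j%:R) =
   (gamma_seq s m * (1 + s * (m + 0).+1%:R^-1))^-1.
  rewrite addn1 addn0; have m0 : m.+1%:R != 0 :> C by rewrite pnatr_eq0.
  have -> : \prod_(0 <= j < m.+2) (s + j%:R) = rbin s m.+2 * (m.+2)`!%:R.
    rewrite /rbin fact_prod natr_prod -[\prod_(1 <= i < _) _]/(\prod_(0.+1 <= i < _) _) big_add1 /=.
    by rewrite -big_split /=; apply: eq_bigr => j _; rewrite divfK// pnatr_eq0.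
  rewrite (factS m.+1) natrM [rbin s m.+2 * _]mulrA (rbinS s m.+1) /gamma_seq cpowN !invfM !invrK.
  have f0 : (m.+1)`!%:R != 0 :> C by rewrite pnatr_eq0 -lt0n fact_gt0.
  have -> : 1 + s * m.+1%:R^-1 = (s + m.+1%:R) / m.+1%:R by rewrite mulrDl divff// addrC.
  rewrite invf_div.
  have -> : (m.+1)`!%:R * cpow m.+1%:R s * ((rbin s m.+1)^-1 * (s + m.+1%:R)^-1 / (m.+1)`!%:R)=
    ((m.+1)`!%:R / (m.+1)`!%:R) * (cpow m.+1%:R s * (rbin s m.+1)^-1 * (s + m.+1%:R)^-1) by ring.
  rewrite divff// mul1r.
  have -> : (rbin s m.+1)^-1 / m.+1%:R * cpow m.+1%:R s * (m.+1%:R / (s + m.+1%:R)) =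
     (m.+1%:R / m.+1%:R) * (cpow m.+1%:R s * (rbin s m.+1)^-1 * (s + m.+1%:R)^-1) by ring.
  by rewrite divff// mul1r.
under [X in seqcvg X]eq_fun do rewrite E.
apply: seqcvgV => //; rewrite -[rgamma s]mulr1; apply: seqcvgM; first exact: gamma_seq_cvg.
rewrite -[X in seqcvg _ X]addr0; apply: seqcvg_addl.
by rewrite -(mulr0 s); apply: seqcvgZ; exact: seqcvg_inv_nat.
Qed.

End EulerProduct.

(** * The sine product and the reflection formula *)

Section SineProduct.
Variable R : realType.
Local Notation C := R[i].
Implicit Types (s t z a : C).

(** Halving the angle gives sin y = y cos(c) cos(y / 2), with both cosines at least cos(3 pi / 8).
    The range 3 pi / 4, larger than pi / 2, leaves room for the real part of [t] in
    [cabs_lip_lower]. *)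
Lemma sin_lower : exists2 k : R, 0 < k & forall y, `|y| <= 3 * pi / 4 -> k * `|y| <= `|sin y|.
Proof.
have pi0 := @pi_gt0 R.
have c0 : 0 < cos (3 * pi / 8 : R) by apply: cos_gt0_pihalf; lra.
exists (cos (3 * pi / 8) ^+ 2); first exact: exprn_gt0.
move=> y hy.
have -> : sin y = sin (y / 2) * cos (y / 2) *+ 2 by rewrite [in RHS]mulrC -sin_mulr2n; congr sin; rewrite mulr2n; lra.
have [c hc ->] := sin_mvt (y / 2).
have mono u : `|u| <= `|y / 2| -> cos (3 * pi / 8) <= cos u.
  move=> hu; have -> : cos u = cos `|u| by case: (ler0P u) => _; rewrite ?cosN.
  have h2 : `|y / 2| = `|y| / 2 by rewrite normrM (@ger0_norm _ 2^-1)// invr_ge0.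
  rewrite h2 in hu; have := normr_ge0 u => u0.
  by rewrite leNgt ltr_cos ?in_itv /= -?leNgt; lra.
have h1 := mono c hc; have h2 := mono _ (lexx _).
have -> : cos c * (y / 2) * cos (y / 2) *+ 2 = cos c * cos (y / 2) * y by rewrite mulr2n; lra.
rewrite normrM; apply: ler_wpM2r => //; rewrite ger0_norm.
  by rewrite expr2; apply: ler_pM => //; exact: ltW.
by rewrite mulr_ge0// (le_trans (ltW c0)).
Qed.


Local Notation odd_nat n := (n.*2.+1).

Definition unit_root (N : nat) : C := cexp (2 * pi%:C * 'i / N%:R).

Lemma Re_2pii : complex.Re (2 * pi%:C * 'i : C) = 0.
Proof. by rewrite mulr2n mulrDl mul1r /=; ring. Qed.

Lemma Im_2pii : complex.Im (2 * pi%:C * 'i : C) = 2 * pi.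
Proof. by rewrite mulr2n mulrDl mul1r /=; ring. Qed.

Lemma unit_rootX N j : unit_root N ^+ j = cexp (2 * pi%:C * 'i * (j%:R / N%:R)).
Proof. by rewrite -cexp_muln; congr cexp; ring. Qed.

Lemma cexp_2pii : cexp (2 * pi%:C * 'i) = 1 :> C.
Proof.
rewrite /cexp Re_2pii Im_2pii expR0 !mul1r.
by have := @cos2pi R; have := @sin2pi R; rewrite -[pi *+ 2]mulr_natl => -> ->.
Qed.

Lemma unit_root_prim N : (0 < N)%N -> N.-primitive_root (unit_root N).
Proof.
move=> N0; have Nn : N%:R != 0 :> C by rewrite pnatr_eq0 -lt0n.
rewrite /primitive_root_of_unity N0 /=; apply/forallP => i; apply/eqP.
rewrite unity_rootE unit_rootX; have := ltn_ord i; rewrite leq_eqVlt => /orP[/eqP e|iN].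
  by rewrite e eqxx divff// mulr1 cexp_2pii eqxx.
rewrite (ltn_eqF iN); apply/eqP/eqP; apply: contraTneq isT => /cexp_eq1.
have -> : (i.+1%:R / N%:R : C) = (i.+1%:R / N%:R : R)%:C.
  by rewrite rmorphM fmorphV !rmorph_nat.
rewrite [2 * pi%:C * 'i * _]mulrC ImZ Im_2pii => h; have pi0 := @pi_gt0 R.
have : i.+1%:R / N%:R < 1 :> R by rewrite ltr_pdivrMr ?ltr0n// mul1r ltr_nat.
have q0 : 0 < i.+1%:R / N%:R :> R by rewrite divr_gt0 ?ltr0n.
move=> q1; have /h : `|i.+1%:R / N%:R * (2 * pi)| < 2 * pi :> R.
  by rewrite ger0_norm ?mulr_ge0 ?(ltW q0)// ?gtr_pMl//; lra.
move=> /(congr1 (@complex.Im R)); rewrite ImZ Im_2pii /= => /eqP.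
by rewrite mulf_eq0 gt_eqF//= gt_eqF//; lra.
Qed.

Lemma prod_unit_root N q : (0 < N)%N ->
  \prod_(1 <= j < N) (q - unit_root N ^+ j) = \sum_(0 <= i < N) q ^+ i.
Proof.
move=> N0; have h := factor_Xn_sub_1 (unit_root_prim N0).
have h2 : \prod_(1 <= j < N) ('X - (unit_root N ^+ j)%:P) = \sum_(0 <= i < N) 'X^i :> {poly C}.
  apply: (@mulfI _ ('X - 1)); first by rewrite -polyC1 polyXsubC_eq0.
  rewrite big_mkord -subrX1 -h (big_ltn N0) expr0 polyC1.
  by [].
have := congr1 (fun p => p.[q]) h2; rewrite /= horner_prod horner_sum.
under eq_bigr do rewrite !hornerE.
by under [X in _ = X -> _]eq_bigr do rewrite hornerXn.
Qed.

(** Equal to 4 sin(pi j / N)^2 for N = 2 n + 1. *)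
Definition root_gap (n j : nat) : C := (1 - unit_root (odd_nat n) ^+ j) * (1 - unit_root (odd_nat n) ^- j).

(** As the modulus is odd, the nontrivial exponents j and N - j pair off with none left in the
    middle. *)
Lemma odd_prod_pairs (n : nat) (F : nat -> C) :
  \prod_(1 <= j < odd_nat n) F j = \prod_(0 <= j < n) (F j.+1 * F (odd_nat n - j.+1)%N).
Proof.
rewrite big_split /= -[1%N]add0n big_addn subn1 /=.
rewrite -addnn (@big_cat_nat _ _ _ n) ?leq_addr//=; congr (_ * _).
  by apply: eq_bigr => j _; rewrite addn1.
rewrite -{1}[n]add0n big_addn addnK big_nat_rev /= !big_nat; apply: eq_bigr => j /andP[_ jn].
by congr F; rewrite add0n addnn; lia.
Qed.

Lemma unit_root_pow_opp (n j : nat) : (j < n)%N ->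
  unit_root (odd_nat n) ^+ (odd_nat n - j.+1) = unit_root (odd_nat n) ^- j.+1.
Proof.
move=> jn; set x := unit_root _.
have x0 : x ^+ j.+1 != 0 by rewrite expf_neq0// cexp_neq0.
apply: (mulIf x0); rewrite mulVf// -exprD subnK; first exact/prim_expr_order/unit_root_prim.
by move: jn; lia.
Qed.

Lemma root_pair (n j : nat) q : (j < n)%N ->
  (q - unit_root (odd_nat n) ^+ j.+1) * (q - unit_root (odd_nat n) ^+ (odd_nat n - j.+1)) =
  root_gap n j.+1 * q + (q - 1) ^+ 2.
Proof.
move=> jn; rewrite unit_root_pow_opp// /root_gap; set x := _ ^+ j.+1.
have x0 : x != 0 by rewrite expf_neq0// cexp_neq0.
by field.
Qed.

Lemma root_gap_prod n : \prod_(0 <= j < n) root_gap n j.+1 = (odd_nat n)%:R.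
Proof.
have := @prod_unit_root (odd_nat n) 1 isT; rewrite odd_prod_pairs.
under [X in _ = X -> _]eq_bigr do rewrite expr1n.
rewrite sumr_const_nat subn0 => <-; rewrite !big_nat; apply: eq_bigr => j /andP[_ jn].
by rewrite root_pair// subrr expr0n addr0 mulr1.
Qed.

Lemma root_gap_neq0 (n j : nat) : (j < n)%N -> root_gap n j.+1 != 0.
Proof.
move=> jn; have := root_gap_prod n; apply: contra_eq_neq => e.
by rewrite (@big_nat_widen _ _ _ 0 n n) //= big_mkord (bigD1 (Ordinal jn)) //= e mul0r eq_sym pnatr_eq0.
Qed.

(* With q = E^2 the factor at j is 1 - sin^2(theta) / sin^2(pi j / N), where E = e^(i theta). *)
Lemma finite_sine_product n (E : C) : E != 0 ->
  E ^+ (odd_nat n) - E ^- (odd_nat n) = (odd_nat n)%:R * (E - E^-1) *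
    \prod_(0 <= j < n) (1 + (E - E^-1) ^+ 2 / root_gap n j.+1).
Proof.
move=> E0; set N := odd_nat n.
have EN0 : E ^+ N != 0 by rewrite expf_neq0.
apply: (mulfI EN0); rewrite mulrBr mulfV// -expr2 -exprM mulnC exprM.
rewrite -[1](expr1n _ N) subrXX expr1n.
have -> : \sum_(i < N) (E ^+ 2) ^+ (N.-1 - i) * 1 ^+ i = \prod_(1 <= j < N) (E ^+ 2 - unit_root N ^+ j).
  rewrite prod_unit_root// big_mkord (reindex_inj rev_ord_inj) /=; apply: eq_bigr => i _.
  by rewrite expr1n mulr1; congr (_ ^+ _); have := ltn_ord i; rewrite /N; lia.
rewrite /N odd_prod_pairs.
have -> : \prod_(0 <= j < n) ((E ^+ 2 - unit_root (odd_nat n) ^+ j.+1) *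
      (E ^+ 2 - unit_root (odd_nat n) ^+ (odd_nat n - j.+1))) =
   \prod_(0 <= j < n) root_gap n j.+1 * (E ^+ 2) ^+ n * \prod_(0 <= j < n) (1 + (E - E^-1) ^+ 2 / root_gap n j.+1).
  have -> : (E ^+ 2) ^+ n = \prod_(0 <= j < n) E ^+ 2 by rewrite prodr_const_nat subn0.
  rewrite -!big_split /= !big_nat; apply: eq_bigr => j /andP[_ jn].
  rewrite root_pair//; have g0 := root_gap_neq0 jn; set g := root_gap _ _ in g0 *.
  have -> : (E ^+ 2 - 1) ^+ 2 = E ^+ 2 * (E - E^-1) ^+ 2.
    by field.
  by field; rewrite g0.
rewrite root_gap_prod -exprM mulnC muln2 (exprS E n.*2).
set P : C := \prod_(_ <= _ < _) _.
have -> : E ^+ 2 - 1 = E * (E - E^-1) by rewrite mulrBr mulfV// expr2.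
by ring.
Qed.

Lemma scaled_cexp a : seqcvg (fun n => (odd_nat n)%:R * (cexp (a / (odd_nat n)%:R) - 1)) a.
Proof.
apply/seqcvgP => e e0; pose B := 2 * cabs a + 4 * cabs a ^+ 2 / e + 1.
have a0 := cabs_ge0 a.
have B2 : 0 <= 4 * cabs a ^+ 2 / e by rewrite divr_ge0 ?(ltW e0)// mulr_ge0// sqr_ge0.
have B0 : 0 <= B by rewrite /B; lra.
exists (Num.bound B) => n hn; set N := (odd_nat n)%:R : C; set x := ((odd_nat n)%:R : R).
have Bx : B < x.
  by apply: lt_le_trans (archi_boundP B0) _; rewrite ler_nat (leq_trans hn)// -addnn -addSn leq_addl.
have x0 : 0 < x by apply: le_lt_trans Bx.
have N0 : N != 0 by rewrite pnatr_eq0.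
have cN : cabs N = x by rewrite /N cabs_nat.
have ch : cabs (a / N) = cabs a / x by rewrite cabs_div cN.
have hh : cabs (a / N) <= 1 / 2.
  by rewrite ch ler_pdivrMr//; move: B2 Bx; rewrite /B; lra.
have := cexp_quad hh; rewrite ch => hq.
have -> : N * (cexp (a / N) - 1) - a = N * (cexp (a / N) - 1 - a / N) by field.
rewrite cabsM cN; apply: (@le_lt_trans _ _ (x * (4 * (cabs a / x) ^+ 2))).
  by rewrite ler_pM2l.
have -> : x * (4 * (cabs a / x) ^+ 2) = 4 * cabs a ^+ 2 / x by field; rewrite gt_eqF.
rewrite ltr_pdivrMr//; have -> : 4 * cabs a ^+ 2 = 4 * cabs a ^+ 2 / e * e by field; rewrite gt_eqF.
by rewrite mulrC ltr_pM2l//; move: Bx; rewrite /B; lra.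
Qed.

(** Rests on |1 - rho exp(2 i y)|^2 = (1 - rho)^2 + 4 rho sin(y)^2. The case rho = 1 bounds the root
    gaps; the case rho < 1 serves Lipschitz's formula. *)
Lemma cabs_one_subr_cexp (k y rho : R) : 0 <= k -> 0 <= rho -> (forall y, `|y| <= 3 * pi / 4 -> k * `|y| <= `|sin y|) ->
  `|y| <= 3 * pi / 4 -> 4 * rho * (k * `|y|) ^+ 2 <= cabs (1 - rho%:C * cexp ('i * (2 * y)%:C)) ^+ 2.
Proof.
move=> k0 rho0 hk hy; rewrite sqr_cabs.
have -> : complex.Re (1 - rho%:C * cexp ('i * (2 * y)%:C)) = 1 - rho * cos (2 * y).
  by rewrite ReD ReN ReZ /= !mul0r !mul1r subrr add0r expR0 mul1r.
have -> : complex.Im (1 - rho%:C * cexp ('i * (2 * y)%:C)) = - (rho * sin (2 * y)).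
  by rewrite ImD ImN ImZ /= !mul0r !mul1r subrr !add0r expR0 mul1r.
have cs := cos2Dsin2 (2 * y); have hc := cos_half (2 * y).
have -> : (1 - rho * cos (2 * y)) ^+ 2 + (- (rho * sin (2 * y))) ^+ 2 =
   (1 - rho) ^+ 2 + 2 * rho * (1 - cos (2 * y)).
  transitivity (1 - 2 * rho * cos (2 * y) + rho ^+ 2 * (cos (2 * y) ^+ 2 + sin (2 * y) ^+ 2)); first by ring.
  by rewrite cs; ring.
rewrite hc (_ : 2 * y / 2 = y); last by lra.
have := hk y hy => h; have h2 : (k * `|y|) ^+ 2 <= sin y ^+ 2.
  by rewrite -[leRHS]real_normK ?num_real// lerXn2r ?nnegrE// mulr_ge0.
have -> : 2 * rho * (1 - (1 - 2 * sin y ^+ 2)) = 4 * rho * sin y ^+ 2 by ring.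
apply: ler_wpDl; first exact: sqr_ge0.
by rewrite ler_wpM2l// mulr_ge0.
Qed.

(** The factors of the finite sine product differ from 1 by at most a constant over (j + 1)^2,
    uniformly in [n]: this provides the majorant for the passage to the limit. *)
Lemma root_gap_lower : exists2 c : R, 0 < c &
  forall n j, (j < n)%N -> c * j.+1%:R ^+ 2 <= (odd_nat n)%:R ^+ 2 * cabs (root_gap n j.+1).
Proof.
have [k k0 hk] := sin_lower; have pi0 := @pi_gt0 R.
exists (4 * (k * pi) ^+ 2); first by rewrite mulr_gt0// exprn_gt0// mulr_gt0.
move=> n j jn; set N := (odd_nat n)%:R : R; have N0 : 0 < N by rewrite /N ltr0n.
have key (e : R) : e = 1 \/ e = -1 -> 2 * (k * pi) * j.+1%:R <= N * cabs (1 - cexp ('i * (2 * (e * (pi * j.+1%:R / N)))%:C)).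
  move=> he; set y := pi * j.+1%:R / N.
  have y0 : 0 <= y by rewrite /y divr_ge0 ?(ltW N0)// mulr_ge0// ltW.
  have ey : `|e * y| = y by case: he => ->; rewrite ?mul1r ?mulN1r ?normrN ger0_norm.
  have yl : y <= pi / 2.
    rewrite /y ler_pdivrMr// -mulrA ler_pM2l// /N ler_pdivlMl// -natrM ler_nat.
    by move: jn; lia.
  have := @cabs_one_subr_cexp k (e * y) 1 (ltW k0) ler01 hk; rewrite ey mulr1 mul1r => /(_ ltac:(lra)).
  rewrite (_ : 4 = 2 ^+ 2 :> R); last by ring.
  rewrite -exprMn ler_pXn2r ?nnegrE ?cabs_ge0 ?mulr_ge0 ?(ltW k0) ?invr_ge0 ?(ltW N0) ?(ltW pi0)//.
  move=> hc; suff -> : 2 * (k * pi) * j.+1%:R = N * (2 * (k * y)) by rewrite ler_pM2l.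
  by rewrite /y; field; rewrite gt_eqF.
have E1 : unit_root (odd_nat n) ^+ j.+1 = cexp ('i * (2 * (1 * (pi * j.+1%:R / N)))%:C).
  rewrite unit_rootX; congr cexp; rewrite mul1r !rmorphM fmorphV !rmorph_nat; ring.
have E2 : unit_root (odd_nat n) ^- j.+1 = cexp ('i * (2 * (-1 * (pi * j.+1%:R / N)))%:C).
  rewrite E1 -cexpN; congr cexp; rewrite mul1r mulN1r mulrN rmorphN mulrN //.
have k1 := key 1 (or_introl erefl); have k2 := key (-1) (or_intror erefl).
rewrite -E1 in k1; rewrite -E2 in k2.
rewrite /root_gap cabsM; set A := cabs _ in k1 *; set B := cabs _ in k2 *.
have -> : 4 * (k * pi) ^+ 2 * j.+1%:R ^+ 2 = (2 * (k * pi) * j.+1%:R) * (2 * (k * pi) * j.+1%:R) by ring.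
have -> : N ^+ 2 * (A * B) = (N * A) * (N * B) by ring.
by apply: ler_pM => //; rewrite !mulr_ge0// ltW.
Qed.

End SineProduct.

(** * The infinite sine product and the reflection formula *)

Section Reflection.
Variable R : realType.
Local Notation C := R[i].
Implicit Types (s t z a : C).
Local Notation odd_nat n := (n.*2.+1).

Lemma csum_finite (u : nat -> C) n : (forall j, (n <= j)%N -> u j = 0) ->
  absum u /\ csum u = \sum_(0 <= j < n) u j.
Proof.
move=> u0.
have tail (V : zmodType) (F : nat -> V) m : (forall j, (n <= j)%N -> F j = 0) ->
    \sum_(0 <= j < n + m) F j = \sum_(0 <= j < n) F j.
  move=> F0; rewrite (@big_cat_nat _ _ _ n) ?leq_addr//= [X in _ + X]big1_seq ?addr0// => j /andP[_].
  rewrite mem_index_iota => /andP[nj _].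
  exact: F0.
have au : absum u.
  exists (\sum_(0 <= j < n) cabs (u j)); apply: bounded_sums_nat => [i|m]; first exact: cabs_ge0.
  rewrite -(tail _ (fun j => cabs (u j)) m); last by move=> j /u0 ->; rewrite cabs0.
  rewrite addnC [leRHS](@big_cat_nat _ _ _ m) ?leq_addr//= lerDl; apply: sumr_ge0 => j _; exact: cabs_ge0.
split=> //; apply: (@seqcvg_unique R (fun m => \sum_(0 <= i < m) u i)).
  exact/hasum_series/absum_hasum.
apply/(@seqcvg_shift R _ _ n); have -> : (fun m => \sum_(0 <= i < m + n) u i) = (fun=> \sum_(0 <= i < n) u i).
  by apply/funext => m; rewrite addnC tail.
exact: seqcvg_cst.
Qed.

Lemma seqcvg_ext (u v : nat -> C) a : (forall n, u n = v n) -> seqcvg v a -> seqcvg u a.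
Proof. by move=> /funext ->. Qed.

Lemma seqcvg_prod (F : nat -> nat -> C) (f : nat -> C) m : (forall j, seqcvg (fun n => F n j) (f j)) ->
  seqcvg (fun n => \prod_(0 <= j < m) F n j) (\prod_(0 <= j < m) f j).
Proof.
have E0 (g : nat -> C) : \prod_(0 <= j < 0) g j = 1 by rewrite big_nil.
move=> h; elim: m => [|m IH].
  have e n : \prod_(0 <= j < 0) F n j = \prod_(0 <= j < 0) f j by rewrite !E0.
  have h0 := @seqcvg_cst R (\prod_(0 <= j < 0) f j).
  have h1 := @seqcvg_ext (fun n => \prod_(0 <= j < 0) F n j) (fun=> \prod_(0 <= j < 0) f j) (\prod_(0 <= j < 0) f j) e.
  have h2 := h1 h0.
  exact h2.
have ES (g : nat -> C) : \prod_(0 <= j < m.+1) g j = \prod_(0 <= j < m) g j * g m by rewrite big_nat_recr.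
rewrite (ES f); have e n : \prod_(0 <= j < m.+1) F n j = \prod_(0 <= j < m) F n j * F n m by rewrite ES.
have h1 := @seqcvg_ext (fun n => \prod_(0 <= j < m.+1) F n j) (fun n => \prod_(0 <= j < m) F n j * F n m)
  (\prod_(0 <= j < m) f j * f m) e.
have h2 := h1 (@seqcvgM R _ _ _ _ IH (h m)).
exact h2.
Qed.

Definition sine_factor s (j : nat) : C := - s ^+ 2 / j.+1%:R ^+ 2.

Lemma sine_productE s : absum (fun j => sine_factor s j * \prod_(0 <= i < j) (1 + sine_factor s i)) /\
  cexp ('i * (pi%:C * s)) - cexp (- ('i * (pi%:C * s))) =
  2 * ('i * (pi%:C * s)) *
   (1 + csum (fun j => sine_factor s j * \prod_(0 <= i < j) (1 + sine_factor s i))).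
Proof.
set a : C := 'i * (pi%:C * s).
pose E n : C := cexp (a / (odd_nat n)%:R); pose w n : C := E n - (E n)^-1.
have Nn0 n : (odd_nat n)%:R != 0 :> C by rewrite pnatr_eq0.
pose X n : C := (odd_nat n)%:R * w n.
have hX : seqcvg X (2 * a).
  have -> : X = (fun n => (odd_nat n)%:R * (cexp (a / (odd_nat n)%:R) - 1) + (-1) * ((odd_nat n)%:R * (cexp ((- a) / (odd_nat n)%:R) - 1))).
    by apply/funext => n; rewrite /X /w /E !mulNr cexpN; ring.
  have -> : 2 * a = a + -1 * - a by ring.
  by apply: seqcvgD; [exact: scaled_cexp|apply: seqcvgZ; exact: scaled_cexp].
(* Extension by 0 turns the finite product of length [n] into a full series. *)
pose x n j : C := if (j < n)%N then w n ^+ 2 / root_gap R n j.+1 else 0.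
have xE n j : (j < n)%N -> x n j = X n ^+ 2 / ((odd_nat n)%:R ^+ 2 * root_gap R n j.+1).
  move=> jn; rewrite /x jn /X; have := Nn0 n; have := root_gap_neq0 R jn.
  move: (w n) (root_gap R n j.+1) (_%:R) => W g N g0 N0; field; by rewrite g0 N0.
have xl j : seqcvg (fun n => x n j) (sine_factor s j).
  apply/(@seqcvg_shift R _ _ j.+1).
  pose b : C := 2 * pi%:C * 'i * j.+1%:R.
  pose Y n : C := ((odd_nat n)%:R * (cexp (b / (odd_nat n)%:R) - 1)) * ((odd_nat n)%:R * (cexp ((- b) / (odd_nat n)%:R) - 1)).
  have j0 : j.+1%:R != 0 :> C by rewrite pnatr_eq0.
  have p0 : pi%:C != 0 :> C by rewrite -cabs_eq0 cabs_real normr_eq0 gt_eqF// pi_gt0.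
  have i0 : 'i != 0 :> C by rewrite -cabs_eq0 cabs_i oner_eq0.
  have b0 : b != 0 by rewrite /b !mulf_neq0// pnatr_eq0.
  have hY : seqcvg Y (b * - b) by apply: seqcvgM; exact: scaled_cexp.
  have -> : (fun n => x (n + j.+1)%N j) = (fun n => X (n + j.+1)%N ^+ 2 * (Y (n + j.+1)%N)^-1).
    apply/funext => n; rewrite xE ?leq_addl//; congr (_ * _^-1).
    rewrite /root_gap unit_rootX -cexpN /Y mulNr -![2 * pi%:C * 'i * (_ / _)]mulrA; rewrite /b !mulrA; ring.
  have -> : sine_factor s j = (2 * a) * (2 * a) * (b * - b)^-1.
    rewrite /sine_factor /a /b; move: p0 i0 j0; clear.
    move: (pi%:C) (j.+1%:R : C) => p k p0 i0 k0; field; rewrite k0 p0 andbT; exact: i0.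
  apply: seqcvgM.
    under [Z in seqcvg Z]eq_fun do rewrite expr2.
    by apply: seqcvgM; apply/(@seqcvg_shift R _ _ j.+1).
  by apply: seqcvgV; [rewrite mulf_neq0// oppr_eq0|apply/(@seqcvg_shift R _ _ j.+1)].
have [c c0 hc] := root_gap_lower R.
(* From the index [k] on, [X n] is bounded by [B]. The sequences are shifted by [k] below so that
   one majorant holds for all their members. *)
have [k hk] := proj1 (@seqcvgP R _ _) hX _ ltr01.
pose B := cabs (2 * a) + 1; have B0 : 0 <= B by rewrite addr_ge0// cabs_ge0.
have hB n : (k <= n)%N -> cabs (X n) <= B.
  by move=> /hk; have := le_cabsD (X n - 2 * a) (2 * a); rewrite subrK /B; lra.
pose b j := B ^+ 2 / c * j.+1%:R `^ (- 2) : R.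
have b0 j : 0 <= b j by rewrite mulr_ge0 ?powR_ge0// divr_ge0 ?sqr_ge0 ?ltW.
have xb n j : (k <= n)%N -> cabs (x n j) <= b j.
  move=> kn; case: (ltnP j n) => jn; last by rewrite /x ltnNge jn /= cabs0.
  rewrite xE// cabs_div cabsX cabsM cabsX cabs_nat /b -mulrA.
  apply: ler_pM; rewrite ?sqr_ge0 ?invr_ge0 ?mulr_ge0 ?sqr_ge0 ?cabs_ge0//.
    by rewrite lerXn2r ?nnegrE ?cabs_ge0// hB.
  have -> : j.+1%:R `^ (- 2) = (j.+1%:R ^+ 2)^-1 :> R by rewrite powRN powR_mulrn.
  rewrite -invfM; apply: le_invr; last exact: hc.
  by rewrite mulr_gt0// exprn_gt0.
have [K hK] := @pseries_bounded R 2 ltac:(lra).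
have bK : bounded_sums b (B ^+ 2 / c * K).
  by move=> A; rewrite -mulr_sumr ler_wpM2l// divr_ge0 ?sqr_ge0 ?ltW.
set K' := B ^+ 2 / c * K in bK.
pose v n j : C := x (n + k)%N j * \prod_(0 <= i < j) (1 + x (n + k)%N i).
pose v0 j : C := sine_factor s j * \prod_(0 <= i < j) (1 + sine_factor s i).
have vb n j : cabs (v n j) <= b j * expR K'.
  rewrite cabsM; apply: ler_pM; rewrite ?cabs_ge0 ?xb ?leq_addl//.
  by apply: prod_bound bK => // i _; rewrite xb ?leq_addl.
have bK2 : bounded_sums (fun j => b j * expR K') (K' * expR K').
  by move=> A; rewrite -mulr_suml ler_wpM2r// expR_ge0.
have vl j : seqcvg (fun n => v n j) (v0 j).
  have h1 := @seqcvg_prod (fun n i => 1 + x n i) (fun i => 1 + sine_factor s i) j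
    (fun i => @seqcvg_addl R 1 _ _ (xl i)).
  have h2 := @seqcvgM R _ _ _ _ (xl j) h1.
  exact (proj2 (@seqcvg_shift R (fun n => x n j * \prod_(0 <= i < j) (1 + x n i)) (v0 j) k) h2).
have T := tannery bK2 vb vl.
have av0 : absum v0.
  apply: (@absum_dom _ _ _ (fun j => b j * expR K')) bK2 => j.
  apply/ler_addgt0Pl => e e0; have [m hm] := proj1 (@seqcvgP R _ _) (vl j) _ e0.
  by have := hm m (leqnn m); have := vb m j; have := le_cabs_tri (v m j) (v0 j) 0; rewrite !subr0 (cabsBC (v0 j)); lra.
split=> //; pose D := cexp a - cexp (- a).
have hD n : D = X (n + k)%N * (1 + csum (v n)).
  have vf j : (n + k <= j)%N -> v n j = 0 by move=> h; rewrite /v /x ltnNge h /= mul0r.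
  have [_ ->] := csum_finite vf; rewrite -prod_telescope.
  have := @finite_sine_product R (n + k) (E (n + k)%N) (cexp_neq0 _).
  have e1 : E (n + k)%N ^+ odd_nat (n + k) = cexp a.
    by rewrite /E -cexp_muln; congr cexp; rewrite mulrC divfK.
  rewrite e1 -cexpN -/D => ->; congr (_ * _); rewrite !big_nat; apply: eq_bigr => j /andP[_ jn].
  by rewrite /x jn.
have h1 := @seqcvg_addl R 1 (fun n => csum (v n)) (csum v0) T.
have h2 := @seqcvgM R _ _ _ _ (proj2 (@seqcvg_shift R X _ k) hX) h1.
exact (@seqcvg_unique R (fun=> D) _ _ (@seqcvg_cst R D) (@seqcvg_ext (fun=> D) _ _ hD h2)).
Qed.

(** In the product of the factors for s and -s the powers of 1 + 1 / (j + 1) are inverse to each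
    other, and only the sine factor 1 - s^2 / (j + 1)^2 remains. The functional equation then
    replaces -s by 1 - s. *)
Lemma rgamma_reflection s : rgamma s * rgamma (1 - s) = csin (pi%:C * s) / pi%:C.
Proof.
have p0 : pi%:C != 0 :> C by rewrite -cabs_eq0 cabs_real normr_eq0 gt_eqF// pi_gt0.
have [av E] := sine_productE s; set P := 1 + csum _ in E.
have i0 : 'i != 0 :> C by rewrite -cabs_eq0 cabs_i oner_eq0.
have -> : csin (pi%:C * s) / pi%:C = s * P.
  rewrite /csin E; move: p0 i0; clear; move: (pi%:C) P => p Q p0 i0; field; rewrite p0 /=; exact: i0.
have [->|s0] := eqVneq s 0; first by rewrite /rgamma !mul0r.
apply: (mulfI (_ : - s != 0)); first by rewrite oppr_eq0.
have -> : - s * (rgamma s * rgamma (1 - s)) = rgamma s * rgamma (- s).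
  by rewrite (rgamma_step (- s)) [- s + 1]addrC; ring.
apply: (@seqcvg_unique R (fun n => gamma_seq s n * gamma_seq (- s) n)).
  by apply: seqcvgM; exact: gamma_seq_cvg.
have -> : (fun n => gamma_seq s n * gamma_seq (- s) n) = (fun n => (- s * s) * (1 + \sum_(0 <= j < n) (sine_factor s j * \prod_(0 <= i < j) (1 + sine_factor s i)))).
  apply/funext => n; rewrite !gamma_seqE -prod_telescope.
  have -> : \prod_(0 <= j < n) (1 + sine_factor s j) =
     \prod_(0 <= j < n) (1 + gamma_ratio s j) * \prod_(0 <= j < n) (1 + gamma_ratio (- s) j).
    rewrite -big_split /=; apply: eq_bigr => j _; rewrite /gamma_ratio ![1 + (_ - 1)]addrC !subrK.
    rewrite opprK cpowN /sine_factor; set c := cpow _ _.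
    have c0 : c != 0 by rewrite cpow_neq0.
    have j0 : j.+1%:R != 0 :> C by rewrite pnatr_eq0.
    move: c0 j0; clear; move: c (j.+1%:R : C) => c k c0 k0; field; by rewrite ?c0 ?k0.
  by ring.
rewrite mulrA; apply: seqcvgZ; apply: seqcvg_addl.
exact/hasum_series/absum_hasum.
Qed.

End Reflection.

(** * Lipschitz's formula *)

Section Lipschitz.
Variable R : realType.
Local Notation C := R[i].
Implicit Types (s t z a : C).
Local Notation odd_nat n := (n.*2.+1).

(** Half of the geometric decay absorbs the power: (e x)^T <= exp(e T x), with [e] chosen so that e
    T = - ln(r) / 2. *)
Lemma powR_geo_bounded (S r : R) : 0 < r < 1 ->
  exists K, bounded_sums (fun k : nat => k.+1%:R `^ S * r ^+ k) K.
Proof.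
move=> /andP[r0 r1]; pose T := Num.max S 0 + 1.
have T0 : 0 < T by rewrite /T ltr_wpDl// le_max lexx orbT.
have ST : S <= T by rewrite /T ler_wpDr// le_max lexx.
pose e := - ln r / (2 * T).
have lr : 0 < - ln r by rewrite oppr_gt0 ln_lt0// r0.
have e0 : 0 < e by rewrite /e divr_gt0// mulr_gt0.
pose q := expR (ln r / 2); have q0 : 0 < q := expR_gt0 _.
have q1 : q < 1 by rewrite expR_lt1; move: lr; clear; lra.
pose c := (e^-1) `^ T * expR (e * T).
have c0 : 0 <= c by rewrite mulr_ge0 ?powR_ge0 ?expR_ge0.
exists (c / (1 - q)).
apply: (@bounded_sumsW _ _ _ (fun k => c * q ^+ k)); last by apply: geo_bounded; rewrite ?(ltW q0).
move=> k; set x := k.+1%:R : R; have x1 : 1 <= x by rewrite /x ler1n.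
have x0 : 0 < x by apply: lt_le_trans x1.
have h1 : x `^ S <= x `^ T by rewrite ler_powR.
have ex0 : 0 < e * x by rewrite mulr_gt0.
have h2 : x `^ T <= (e^-1) `^ T * expR (e * T * x).
  have E : x = e^-1 * (e * x) by rewrite mulKf// gt_eqF.
  rewrite {1}E powRM ?invr_ge0 ?(ltW e0) ?(ltW ex0)//.
  apply: ler_wpM2l; first exact: powR_ge0.
  have -> : expR (e * T * x) = expR (e * x) `^ T.
    rewrite /powR gt_eqF ?expR_gt0// expRK; congr expR; ring.
  apply: ge0_ler_powR; rewrite ?nnegrE ?expR_ge0 ?(ltW T0) ?(ltW ex0)//.
  by apply: le_trans (expR_ge1Dx _); rewrite lerDr.
have eT : e * T = - ln r / 2 by rewrite /e; field; rewrite gt_eqF.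
have h3 : expR (e * T * x) * r ^+ k = expR (e * T) * q ^+ k.
  have -> : e * T * x = e * T + k%:R * (e * T) by rewrite /x -natr1; ring.
  rewrite expRD -mulrA; congr (_ * _); rewrite expRM_natl -exprMn; congr (_ ^+ _).
  by rewrite -{1}(@lnK _ r) ?posrE// -expRD eT /q; congr expR; field.
apply: (@le_trans _ _ ((e^-1) `^ T * expR (e * T * x) * r ^+ k)).
  by rewrite ler_wpM2r ?exprn_ge0 ?(ltW r0)// (le_trans h1).
by rewrite -mulrA h3 mulrA.
Qed.

Lemma csum_multiples (F : nat -> C) (N : nat) : (0 < N)%N -> absum F ->
  (forall n, ~~ (N %| n)%N -> F n = 0) ->
  absum (fun k => F (k * N)%N) /\ csum F = csum (fun k => F (k * N)%N).
Proof.
move=> N0 aF F0; have aG : absum (fun k => F (k * N)%N).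
  apply: (@absum_inj _ _ _ (fun k : nat => (k * N)%N)) aF => i j /eqP.
  by rewrite eqn_pmul2r// => /eqP.
split=> //; have hG := hasum_series (absum_hasum aG).
apply: (@seqcvg_unique R (fun M => \sum_(0 <= k < M) F (k * N)%N)) hG.
have /seqcvgP hF : seqcvg (fun n => \sum_(0 <= i < n) F i) (csum F) := hasum_series (absum_hasum aF).
apply/seqcvgP => e /hF [M0 hM]; exists M0 => M MM.
have -> : \sum_(0 <= k < M) F (k * N)%N = \sum_(0 <= i < M * N) F i.
  rewrite big_nat_mul; apply: eq_bigr => i _.
  rewrite big_ltn ?ltn_mul2r ?N0 ?ltnSn// big1_seq => [|j /andP[_]]; first exact/esym/addr0.
  rewrite mem_index_iota => /andP[j1 j2]; apply: F0; apply/negP => /dvdnP[q e'].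
  by move: j1 j2; rewrite e' !ltn_mul2r N0 /= ltnS => h1; rewrite leqNgt h1.
by apply: hM; rewrite (leq_trans MM)// leq_pmulr.
Qed.

Lemma geo_unit_root (N n : nat) : (0 < N)%N ->
  \sum_(0 <= l < N) (unit_root R N ^- n) ^+ l = if (N %| n)%N then N%:R else 0.
Proof.
move=> N0; have pN := unit_root_prim R N0; set w := unit_root R N ^- n.
case: ifPn => [dv|ndv].
  have -> : w = 1 by rewrite /w; have := prim_order_dvd pN n; rewrite dv => /esym/eqP ->; rewrite invr1.
  by under eq_bigr do rewrite expr1n; rewrite sumr_const_nat subn0.
have w1 : w != 1 by rewrite /w invr_eq1 -(prim_order_dvd pN).
have e : (w - 1) * \sum_(0 <= l < N) w ^+ l = 0.
  rewrite big_mkord -subrX1 /w -exprVn -exprM mulnC exprM exprVn (prim_expr_order pN).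
  by rewrite invr1 expr1n subrr.
by move/eqP: e; rewrite mulf_eq0 subr_eq0 (negbTE w1) => /eqP.
Qed.

(** For Im t < 0 it has modulus less than 1. Replacing t by t + l multiplies it by the -l-th power
    of [unit_root N], and N (1 - q) tends to 2 pi i t: the binomial series at these points thus
    approximates a sum over the shifts of t. *)
Definition lip_q (N : nat) t : C := cexp (- (2 * pi%:C * 'i * t / N%:R)).

Lemma lip_qX N t n : lip_q N t ^+ n = cexp (- (2 * pi%:C * 'i * t * (n%:R / N%:R))).
Proof. by rewrite /lip_q -cexp_muln; congr cexp; ring. Qed.

Lemma Re_2pii_mul t (x : R) : complex.Re (2 * pi%:C * 'i * t * x%:C) = - (2 * pi * complex.Im t * x).
Proof. by rewrite [_ * x%:C]mulrC ReZ ReM Re_2pii Im_2pii; ring. Qed.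

Lemma cabs_lip_q (N : nat) t : cabs (lip_q N t) = expR (2 * pi * complex.Im t / N%:R).
Proof.
rewrite /lip_q cabs_cexp ReN; congr expR.
have -> : (N%:R^-1 : C) = (N%:R^-1 : R)%:C by rewrite fmorphV rmorph_nat.
by rewrite Re_2pii_mul opprK.
Qed.

Lemma lip_filter (N : nat) t s : (0 < N)%N -> complex.Im t < 0 ->
  absum (fun k => rbin s (k * N) * cexp (- (2 * pi%:C * 'i * t * k%:R))) /\
  \sum_(0 <= l < N) cpow (1 - lip_q N (t + l%:R)) (- s) =
  N%:R * csum (fun k => rbin s (k * N) * cexp (- (2 * pi%:C * 'i * t * k%:R))).
Proof.
move=> N0 t0; have Nn0 : N%:R != 0 :> C by rewrite pnatr_eq0 -lt0n.
have NR0 : 0 < N%:R :> R by rewrite ltr0n.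
have q1 (l : nat) : cabs (lip_q N (t + l%:R)) < 1.
  rewrite cabs_lip_q expR_lt1 ImD (natC_real R l) /= addr0 pmulr_llt0 ?invr_gt0//.
  by rewrite pmulr_rlt0// mulr_gt0// pi_gt0.
have B (l : nat) := binomial_series s (q1 l).
have hs (l : nat) : hasum (fun n => rbin s n * lip_q N (t + l%:R) ^+ n) (cpow (1 - lip_q N (t + l%:R)) (- s)).
  by have [a <-] := B l; exact: absum_hasum.
pose F n := \sum_(0 <= l < N) rbin s n * lip_q N (t + l%:R) ^+ n.
have hF : hasum F (\sum_(0 <= l < N) cpow (1 - lip_q N (t + l%:R)) (- s)).
  by apply: hasum_fin => l _.
have FE n : F n = rbin s n * lip_q N t ^+ n * (if (N %| n)%N then N%:R else 0).
  rewrite /F -(geo_unit_root n N0) mulr_sumr; apply: eq_bigr => l _.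
  have e1 : (unit_root R N ^- n) ^+ l = cexp (- (2 * pi%:C * 'i * (n%:R / N%:R * l%:R))).
    rewrite unit_rootX -cexpN -cexp_muln; congr cexp.
    by rewrite mulrN; congr (- _); rewrite mulrC -!mulrA.
  have e2 : lip_q N (t + l%:R) ^+ n = lip_q N t ^+ n * cexp (- (2 * pi%:C * 'i * (n%:R / N%:R * l%:R))).
    rewrite (lip_qX N (t + _)) (lip_qX N t) -cexpD -opprD; congr (cexp (- _)).
    set c : C := 2 * pi%:C * 'i; set d : C := n%:R / N%:R; move: c d (l%:R : C); clear.
    by move=> c d x; ring.
  by rewrite e1 e2 mulrA.
have aF : absum F.
  have [K hK] := (B 0%N).1; rewrite addr0 in hK.
  apply: (@absum_dom _ _ _ (fun n => N%:R * cabs (rbin s n * lip_q N t ^+ n)) (N%:R * K)).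
    move=> n; rewrite FE cabsM mulrC; apply: ler_wpM2r; first exact: cabs_ge0.
    by case: ifP => _; rewrite ?cabs_nat ?cabs0.
  by move=> A; rewrite -mulr_sumr ler_wpM2l//; exact: hK.
have [aG E] : absum (fun k => F (k * N)%N) /\ csum F = csum (fun k => F (k * N)%N).
  by apply: csum_multiples => // n nd; rewrite FE (negbTE nd) mulr0.
have GE k : rbin s (k * N) * cexp (- (2 * pi%:C * 'i * t * k%:R)) = N%:R^-1 * F (k * N)%N.
  have e : (k * N)%:R / N%:R = k%:R :> C by rewrite natrM mulfK.
  by rewrite FE dvdn_mull// lip_qX e mulrCA mulVf// mulr1.
have aT : absum (fun k => rbin s (k * N) * cexp (- (2 * pi%:C * 'i * t * k%:R))).
  by under eq_fun do rewrite GE; exact: absumZ.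
split=> //; rewrite -(hasum_csumE hF) E -csumZ//; congr csum; apply/funext => k.
by rewrite GE mulVKf.
Qed.


Lemma powR_seqcvg0 (p : R) : 0 < p -> forall e : R, 0 < e ->
  exists N, forall n, (N <= n)%N -> n.+1%:R `^ (- p) < e.
Proof.
move=> p0 e e0; pose B := expR (- ln e / p).
exists (Num.bound B) => n hn; have B0 : 0 <= B by exact: expR_ge0.
have Bn : B < n.+1%:R.
  by apply: lt_le_trans (archi_boundP B0) _; rewrite ler_nat ltnW.
have lB : - ln e / p < ln n.+1%:R by rewrite -[ltLHS]expRK ltr_ln// posrE ?expR_gt0.
rewrite -[ltRHS](@lnK _ e) ?posrE// /powR pnatr_eq0 /= ltr_expR mulNr.
by move: lB; rewrite ltr_pdivrMr// mulrC; lra.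
Qed.

(** Both sides contain the binomial coefficient of index M = (k + 1) N, normalized by N^(1 - s) on
    the left and by M^(1 - s) on the right. Here the powers n^(s - 1) of the Lambert series
    originate. *)
Lemma gamma_seq_multiple s (k N : nat) : (0 < N)%N ->
  (N%:R * cpow N%:R (- s)) * rbin s (k.+1 * N) = cpow k.+1%:R (s - 1) * gamma_seq s (k.+1 * N).-1.
Proof.
move=> N0; have kN : (k.+1 * N).-1.+1 = (k.+1 * N)%N by rewrite prednK// muln_gt0.
rewrite /gamma_seq kN natrM; have k0 : k.+1%:R != 0 :> C by rewrite pnatr_eq0.
have Nn : N%:R != 0 :> C by rewrite pnatr_eq0 -lt0n.
have -> : cpow (k.+1%:R * N%:R) (- s) = cpow k.+1%:R (- s) * cpow N%:R (- s).
  by rewrite (natC_real R k.+1) cpow_posM.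
rewrite cpowD [cpow k.+1%:R (-1)]cpowN cpow1// [cpow k.+1%:R (- s)]cpowN.
have := cpow_neq0 k.+1%:R s; move: (cpow k.+1%:R s) (cpow N%:R (- s)) (rbin s _) => P Q B P0.
transitivity (B * N%:R * Q * (P * P^-1) * (k.+1%:R / k.+1%:R)); last by ring.
by rewrite !divff//; ring.
Qed.

(** The term k = 0 equals N^(1 - s), which vanishes in the limit since Re s > 1. In the others
    [gamma_seq] is bounded and tends to [rgamma s], so dominated convergence applies. *)
Lemma lip_right_limit t s : complex.Im t < 0 -> 1 < complex.Re s ->
  absum (fun k => cpow k.+1%:R (s - 1) * cexp (- (2 * pi%:C * 'i * t * k.+1%:R))) /\
  seqcvg (fun n => (odd_nat n)%:R * cpow (odd_nat n)%:R (- s) *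
      csum (fun k => rbin s (k * odd_nat n) * cexp (- (2 * pi%:C * 'i * t * k%:R))))
    (rgamma s * csum (fun k => cpow k.+1%:R (s - 1) * cexp (- (2 * pi%:C * 'i * t * k.+1%:R)))).
Proof.
move=> t0 s1; set E := fun k : nat => cexp (- (2 * pi%:C * 'i * t * k%:R)).
have [_ [_ [B [_ _ hB]]]] := gamma_bounds (cabs_ge0 s).
have B0 : 0 <= B by apply: le_trans (hB s 0%N (lexx _)); exact: cabs_ge0.
pose r := expR (2 * pi * complex.Im t).
have r1 : 0 < r < 1.
  by rewrite expR_gt0 expR_lt1 pmulr_rlt0// mulr_gt0// pi_gt0.
have cE k : cabs (E k) = r ^+ k.
  rewrite /E cabs_cexp ReN (natC_real R k) Re_2pii_mul opprK -expRM_natl; congr expR; ring.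
have [K hK] := @powR_geo_bounded (complex.Re s - 1) r r1.
have ck k : cabs (cpow k.+1%:R (s - 1) : C) = k.+1%:R `^ (complex.Re s - 1).
  by rewrite (natC_real R k.+1) cabs_cpow_pos// ReD ReN.
have bnd k : cabs (cpow k.+1%:R (s - 1) * E k.+1) <= r * (k.+1%:R `^ (complex.Re s - 1) * r ^+ k).
  by rewrite cabsM ck cE exprS mulrCA.
have r0 : 0 <= r by exact: expR_ge0.
have bK : bounded_sums (fun k : nat => r * (k.+1%:R `^ (complex.Re s - 1) * r ^+ k)) (r * K).
  by move=> A; rewrite -mulr_sumr ler_wpM2l.
have aE : absum (fun k => cpow k.+1%:R (s - 1) * E k.+1) by exact: absum_dom bnd bK.
split=> //.
pose v n k : C := gamma_seq s (k.+1 * odd_nat n).-1 * (cpow k.+1%:R (s - 1) * E k.+1).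
have vb n k : cabs (v n k) <= B * (r * (k.+1%:R `^ (complex.Re s - 1) * r ^+ k)).
  by rewrite cabsM; apply: ler_pM; rewrite ?cabs_ge0// hB.
have bK2 : bounded_sums (fun k : nat => B * (r * (k.+1%:R `^ (complex.Re s - 1) * r ^+ k))) (B * (r * K)).
  by move=> A; rewrite -mulr_sumr ler_wpM2l.
have vl k : seqcvg (fun n => v n k) (rgamma s * (cpow k.+1%:R (s - 1) * E k.+1)).
  have g1 : seqcvg (fun n => gamma_seq s (k.+1 * odd_nat n).-1) (rgamma s).
    apply/seqcvgP => e /(proj1 (@seqcvgP R _ _) (@gamma_seq_cvg R s)) [N hN]; exists N => n Nn.
    apply: hN; rewrite (leq_trans Nn)//; move: (k.+1 * odd_nat n)%N (leq_pmull (odd_nat n) (ltn0Sn k)) => u hu.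
    by rewrite -ltnS (leq_trans _ (leqSpred _))// (leq_trans _ hu)// ltnS -addnn leq_addl.
  have h2 := @seqcvgM R _ _ _ _ g1 (@seqcvg_cst R (cpow k.+1%:R (s - 1) * E k.+1)).
  exact h2.
have T := tannery bK2 vb vl; rewrite csumZ// in T.
have w0 : seqcvg (fun n => (odd_nat n)%:R * cpow (odd_nat n)%:R (- s)) 0.
  apply/seqcvgP => e e0; have p0 : 0 < complex.Re s - 1 by rewrite subr_gt0.
  have [N hN] := powR_seqcvg0 p0 e0; exists N => n Nn; rewrite subr0 cabsM cabs_nat.
  rewrite (natC_real R) cabs_cpow_pos// ReN.
  have := hN n.*2; rewrite (leq_trans Nn) -?addnn ?leq_addl// addnn => /(_ isT).
  by rewrite opprB powRD ?pnatr_eq0 ?implybT// powRr1.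
have TE n : (odd_nat n)%:R * cpow (odd_nat n)%:R (- s) * csum (fun k => rbin s (k * odd_nat n) * E k) =
   (odd_nat n)%:R * cpow (odd_nat n)%:R (- s) + csum (v n).
  have [aS _] := @lip_filter (odd_nat n) t s isT t0.
  have aS2 : absum (fun k => rbin s (k * odd_nat n) * E k) by exact: aS.
  rewrite csum_natS// mul0n rbin0 /E mulr0 oppr0 cexp0 mulr1 mulrDr mulr1; congr (_ + _).
  have aS3 : absum (fun k => rbin s (k.+1 * odd_nat n) * E k.+1) by apply: (@absum_inj _ _ _ S) aS2 => ? ? [].
  rewrite -csumZ//; congr csum; apply/funext => k.
  by rewrite mulrA gamma_seq_multiple// /v [RHS]mulrCA [RHS]mulrA.
have h1 := @seqcvgD R _ _ _ _ w0 T; rewrite add0r in h1.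
exact (@seqcvg_ext R _ _ _ TE h1).
Qed.


Lemma ccont_cpow s w : 0 < complex.Re w -> ccont_at (fun x : C => cpow x s) w.
Proof.
move=> w0; apply: (@cderiv_cont _ _ _ (s * w^-1 * cexp (s * clog w))).
exact: cderiv_cexpM (cderiv_clog w0).
Qed.

Lemma Re_one_sub_lip_q (N : nat) t : (0 < N)%N -> complex.Im t < 0 -> 0 < complex.Re (1 - lip_q N t).
Proof.
move=> N0 t0; rewrite ReD ReN subr_gt0; apply: (@le_lt_trans _ _ (cabs (lip_q N t))); first exact: le_Re_cabs.
rewrite cabs_lip_q expR_lt1 pmulr_llt0 ?invr_gt0 ?ltr0n//.
by rewrite pmulr_rlt0// mulr_gt0// pi_gt0.
Qed.

(** The majorant on the side of the shifted points, uniform in n for |x| <= n. The modulus of q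
    alone gives the constant bound [d1], its angle the bound linear in |X + x| with slope [d2]. *)
Lemma cabs_lip_lower t : complex.Im t < 0 -> exists2 d : R, 0 < d & exists k : nat, forall n (x : R), (k <= n)%N -> `|x| <= n%:R ->
  d * (1 + `|x|) <= (odd_nat n)%:R * cabs (1 - lip_q (odd_nat n) (t + x%:C)).
Proof.
move=> t0; have [k k0 hk] := sin_lower R; have pi0 := @pi_gt0 R.
pose y := - complex.Im t; have y0 : 0 < y by rewrite oppr_gt0.
pose X := complex.Re t; pose r0 := expR (- (2 * pi * y)); have r00 : 0 < r0 := expR_gt0 _.
pose d1 := 2 * pi * y * r0; have d10 : 0 < d1 by rewrite !mulr_gt0.
pose d2 := 2 * r0 * (k * pi); have d20 : 0 < d2 by rewrite !mulr_gt0.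
(* Combines the two bounds through 1 + |x| <= (1 + |X|) + |X + x|. *)
pose d := ((1 + `|X|) / d1 + d2^-1)^-1.
have X0 : 0 < 1 + `|X| by rewrite ltr_pwDl.
have dV : 0 < (1 + `|X|) / d1 + d2^-1 by rewrite addr_gt0// ?invr_gt0// divr_gt0.
exists d; first by rewrite invr_gt0.
exists (Num.bound (2 * `|X|)) => n x hn hx.
have XN : 2 * `|X| <= n%:R.
  by apply: le_trans (ltW (archi_boundP _)) _; rewrite ?mulr_ge0 ?ler_nat.
set N := (odd_nat n)%:R : R; have N0 : 0 < N by rewrite ltr0n.
have NE : N = 2 * n%:R + 1 by rewrite /N -addnn -natr1 natrD; lra.
have N1 : 1 <= N by rewrite ler1n.
pose rho := expR (- (2 * pi * y / N)).
have rhor : r0 <= rho.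
  by rewrite ler_expR lerN2 ler_pdivrMr// ler_peMr// !mulr_ge0// ?(ltW pi0) ?(ltW y0).
have rho0 : 0 < rho := expR_gt0 _.
have rho1 : rho < 1 by rewrite expR_lt1 oppr_lt0 divr_gt0// !mulr_gt0.
pose w := pi * (X + x) / N.
have qE : lip_q (odd_nat n) (t + x%:C) = rho%:C * cexp ('i * (2 * - w)%:C).
  have -> : rho%:C = cexp (- (2 * pi * y / N))%:C by apply: eqCP; rewrite /= ?cos0 ?sin0 ?mulr1 ?mulr0.
  rewrite -cexpD /lip_q; congr cexp.
  have -> : (odd_nat n)%:R^-1 = (N^-1)%:C :> C by rewrite fmorphV rmorph_nat.
  rewrite [_ * _%:C]mulrC; apply: eqCP.
    rewrite ReN ReZ ReM Re_2pii Im_2pii ReD !ImD /= /y; ring.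
  by rewrite ImN ImZ ImM Re_2pii Im_2pii ReD ImD /= /w /X; field; rewrite gt_eqF.
set V := cabs _.
have h1 : d1 <= N * V.
  have : 1 - rho <= V.
    have cq : cabs (lip_q (odd_nat n) (t + x%:C)) = rho.
      rewrite qE cabsM cabs_real (gtr0_norm rho0) cabs_cexp (_ : complex.Re _ = 0) ?expR0 ?mulr1//.
      by rewrite /=; ring.
    have := le_cabs_dist 1 (lip_q (odd_nat n) (t + x%:C)); rewrite -/V cabs1 cq.
    by apply: le_trans; exact: ler_norm.
  move=> h; apply: (@le_trans _ _ (N * (1 - rho))); last by rewrite ler_pM2l.
  have h2 : 1 + 2 * pi * y / N <= rho^-1 by rewrite /rho -expRN opprK expR_ge1Dx.
  have h3 : 2 * pi * y / N * rho <= 1 - rho.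
    by have := ler_wpM2r (ltW rho0) h2; rewrite mulVf ?(gt_eqF rho0)// mulrDl mul1r -lerBrDl.
  apply: (@le_trans _ _ (N * (2 * pi * y / N * rho))); last by rewrite ler_pM2l.
  have -> : N * (2 * pi * y / N * rho) = 2 * pi * y * rho by field; rewrite gt_eqF.
  by rewrite /d1 ler_pM2l// !mulr_gt0.
have h2 : d2 * `|X + x| <= N * V.
  have wl : `|- w| = pi * `|X + x| / N.
    by rewrite normrN /w !normrM normfV (gtr0_norm pi0) (gtr0_norm N0).
  have hXx : `|X + x| <= 3 * N / 4.
    by apply: le_trans (ler_normD _ _) _; rewrite NE; move: XN hx; clear; lra.
  have w34 : `|- w| <= 3 * pi / 4.
    rewrite wl ler_pdivrMr// -mulrA; have := ler_wpM2l (ltW pi0) hXx; lra.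
  have := cabs_one_subr_cexp (ltW k0) (ltW rho0) hk w34; rewrite -qE -/V => h.
  have h4 : (2 * r0 * (k * `|- w|)) ^+ 2 <= V ^+ 2.
    apply: le_trans h; rewrite exprMn; apply: ler_wpM2r; first exact: sqr_ge0.
    have -> : (2 * r0) ^+ 2 = 4 * (r0 * r0) by ring.
    rewrite ler_pM2l//; apply: le_trans rhor; rewrite ger_pMr//.
    by rewrite -expR0 ler_expR oppr_le0 !mulr_ge0// ltW.
  have h5 : 2 * r0 * (k * `|- w|) <= V.
    by rewrite -(@ler_pXn2r _ 2) ?nnegrE ?cabs_ge0// !mulr_ge0// ?(ltW r00) ?(ltW k0).
  apply: le_trans (ler_wpM2l (ltW N0) h5); rewrite wl /d2.
  by rewrite le_eqVlt; apply/orP; left; apply/eqP; field; rewrite gt_eqF.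
have V0 : 0 <= N * V by rewrite mulr_ge0 ?cabs_ge0 ?(ltW N0).
have hx2 : `|x| <= `|X| + `|X + x|.
  have -> : x = - X + (X + x) by lra.
  by apply: le_trans (ler_normD _ _) _; rewrite normrN addKr.
rewrite /d mulrC ler_pdivrMr//; apply: (@le_trans _ _ ((1 + `|X|) + `|X + x|)); first lra.
rewrite mulrDr; apply: lerD.
  by rewrite mulrCA ler_peMr ?(ltW X0)// ler_pdivlMr// mul1r.
by rewrite ler_pdivlMr// mulrC.
Qed.

End Lipschitz.

(** * Lipschitz's formula as the limit of the filtered binomial series *)

Section LipschitzFormula.
Variable R : realType.
Local Notation C := R[i].
Implicit Types (s t z a : C).
Local Notation odd_nat n := (n.*2.+1).

Lemma seqcvg_cabs_le (u : nat -> C) l B : seqcvg u l -> (forall n, cabs (u n) <= B) -> cabs l <= B.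
Proof.
move=> /seqcvgP h uB; apply/ler_addgt0Pl => e /h [m hm].
have := hm m (leqnn m); have := uB m; have := le_cabs_tri (u m) l 0; rewrite !subr0 (cabsBC l); lra.
Qed.

Lemma pi2i_neq0 : 2 * pi%:C * 'i != 0 :> C.
Proof. by rewrite -cabs_eq0 !cabsM cabs_i cabs_real (cabs_nat R 2) mulr1 mulf_neq0 ?pnatr_eq0// normr_eq0 gt_eqF// pi_gt0. Qed.

Lemma Re_pi2i_mul t : complex.Re (2 * pi%:C * 'i * t) = - (2 * pi * complex.Im t).
Proof. by have := Re_2pii_mul t 1; rewrite rmorph1 !mulr1. Qed.

Lemma lip_point_limit t s : complex.Im t < 0 ->
  seqcvg (fun n => cpow ((odd_nat n)%:R * (1 - lip_q (odd_nat n) t)) (- s)) (cpow (2 * pi%:C * 'i * t) (- s)).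
Proof.
move=> t0; apply: (@seqcvg_comp R (fun x => cpow x (- s))).
  by apply: ccont_cpow; rewrite Re_pi2i_mul oppr_gt0 pmulr_rlt0// mulr_gt0// pi_gt0.
set b := 2 * pi%:C * 'i * t.
have h := @seqcvgZ R (-1) _ _ (@scaled_cexp R (- b)); rewrite mulN1r opprK in h.
have e n : (odd_nat n)%:R * (1 - lip_q (odd_nat n) t) = -1 * ((odd_nat n)%:R * (cexp (- b / (odd_nat n)%:R) - 1)).
  by rewrite /lip_q -/b (mulNr b); ring.
exact (@seqcvg_ext R _ _ _ e h).
Qed.

(** As Im t < 0, the argument of t lies in ]-pi, 0], and adding the argument pi / 2 of 2 pi i stays
    within the principal range. *)
Lemma cpow_pi2i t s : complex.Im t < 0 -> cpow (2 * pi%:C * 'i * t) (- s) = cpow (2 * pi%:C * 'i) (- s) * cpow t (- s).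
Proof.
move=> t0; have pi0 := @pi_gt0 R.
have tn0 : t != 0 by apply: contraTneq t0 => ->; rewrite ltxx.
have h1 : clog (2 * pi%:C * 'i) = (ln (2 * pi)) +i* (pi / 2) :> C.
  apply: clog_unique; last by rewrite /=; lra.
  have p0 : 0 < 2 * pi :> R by lra.
  by apply: eqCP; rewrite ?Re_2pii ?Im_2pii /= ?cos_pihalf ?sin_pihalf ?mulr0// mulr1 lnK.
have h2 : carg t <= 0.
  by rewrite /carg (lt_geF t0) oppr_le0 acos_ge0// Re_div_cabs.
have /andP[b1 b2] := carg_bound tn0.
apply: cpowM => //; first exact: pi2i_neq0.
have -> : carg (2 * pi%:C * 'i : C) = pi / 2 by have := congr1 (@complex.Im R) h1.
by apply/andP; split; lra.
Qed.

Lemma lip_left_limit t s : complex.Im t < 0 -> 1 < complex.Re s ->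
  [/\ absum (fun p : nat => cpow (t + 1 + p%:R) (- s)), absum (fun p : nat => cpow (t - p%:R) (- s)) &
  seqcvg (fun n => \sum_(0 <= l < odd_nat n) cpow ((odd_nat n)%:R * (1 - lip_q (odd_nat n) (t - n%:R + l%:R))) (- s))
    (cpow (2 * pi%:C * 'i) (- s) *
      (csum (fun p : nat => cpow (t + 1 + p%:R) (- s)) + csum (fun p : nat => cpow (t - p%:R) (- s))))].
Proof.
move=> t0 s1; have [d d0 [k hk]] := cabs_lip_lower t0.
have s0 : 0 <= complex.Re s by apply: le_trans (ltW s1).
have [K K0 hK] := cpow_decay (cabs s) d0 s0.
have [Z hZ] := pseries_bounded s1.
pose f n (x : R) : C := cpow ((odd_nat n)%:R * (1 - lip_q (odd_nat n) (t + x%:C))) (- s).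
have fb n p (x : R) : (k <= n)%N -> `|x| <= n%:R -> p%:R <= `|x| -> cabs (f n x) <= K * p.+1%:R `^ (- complex.Re s).
  move=> kn xn px; apply: hK => //; first by rewrite ler1n.
  rewrite cabsM cabs_nat; apply: le_trans (hk n x kn xn); rewrite ler_pM2l//.
  by rewrite -natr1 addrC lerD2l.
(* The 2 n + 1 shifts from -n to n are cut into 0, -1, ..., -n and 1, ..., n, each part extended by
   0; the shift 0 belongs to [T1], which explains the two different ranges. *)
pose T1 n p := if (p <= n)%N then f n (- p%:R) else 0.
pose T2 n p := if (p < n)%N then f n (1 + p%:R) else 0.
pose M p := K * p.+1%:R `^ (- complex.Re s).
have M0 p : 0 <= M p by rewrite mulr_ge0// powR_ge0.
have MZ : bounded_sums M (K * Z) by move=> A; rewrite -mulr_sumr ler_wpM2l.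
have b1 n p : cabs (T1 (n + k)%N p) <= M p.
  rewrite /T1; case: ifP => pn; last by rewrite cabs0.
  by apply: fb; rewrite ?leq_addl// normrN ger0_norm// ler_nat.
have b2 n p : cabs (T2 (n + k)%N p) <= M p.
  rewrite /T2; case: ifP => pn; last by rewrite cabs0.
  have e : `|1 + p%:R| = p.+1%:R :> R by rewrite addrC natr1 ger0_norm.
  by apply: fb; rewrite ?leq_addl// e ler_nat// ltnW.
have Imr (x : R) : complex.Im (t + x%:C) < 0 by rewrite ImD /= addr0.
pose g (x : R) : C := cpow (2 * pi%:C * 'i) (- s) * cpow (t + x%:C) (- s).
have fl x : seqcvg (fun n => f n x) (g x).
  by rewrite /g -cpow_pi2i//; exact: lip_point_limit.
have l1 p : seqcvg (fun n => T1 n p) (g (- p%:R)).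
  apply: (proj1 (@seqcvg_shift R _ _ p)).
  have e n : T1 (n + p)%N p = f (n + p)%N (- p%:R) by rewrite /T1 leq_addl.
  exact (@seqcvg_ext R _ _ _ e (proj2 (@seqcvg_shift R _ _ p) (fl (- p%:R)))).
have l2 p : seqcvg (fun n => T2 n p) (g (1 + p%:R)).
  apply: (proj1 (@seqcvg_shift R _ _ p.+1)).
  have e n : T2 (n + p.+1)%N p = f (n + p.+1)%N (1 + p%:R) by rewrite /T2 leq_addl.
  exact (@seqcvg_ext R _ _ _ e (proj2 (@seqcvg_shift R _ _ p.+1) (fl (1 + p%:R)))).
have L1 p := proj2 (@seqcvg_shift R _ _ k) (l1 p).
have L2 p := proj2 (@seqcvg_shift R _ _ k) (l2 p).
have e1p (p : nat) : (1 + p%:R : R)%:C = 1 + p%:R :> C by rewrite rmorphD rmorph1 rmorph_nat.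
have E1 p : g (- p%:R) = cpow (2 * pi%:C * 'i) (- s) * cpow (t - p%:R) (- s).
  by rewrite /g rmorphN rmorph_nat.
have E2 p : g (1 + p%:R) = cpow (2 * pi%:C * 'i) (- s) * cpow (t + 1 + p%:R) (- s).
  by rewrite /g e1p addrA.
have c0 : cpow (2 * pi%:C * 'i) (- s) != 0 :> C by exact: cpow_neq0.
(* The common majorant passes to the limits, so the absolute convergence of both halves comes out of
   the same estimate. *)
have A1 : absum (fun p : nat => cpow (t - p%:R) (- s)).
  have -> : (fun p : nat => cpow (t - p%:R) (- s)) = (fun p : nat => (cpow (2 * pi%:C * 'i) (- s))^-1 * g (- p%:R)).
    by apply/funext => p; rewrite E1 mulKf.
  apply: absumZ; apply: (@absum_dom _ _ _ M) MZ => p.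
  exact: seqcvg_cabs_le (L1 p) (fun n => b1 n p).
have A2 : absum (fun p : nat => cpow (t + 1 + p%:R) (- s)).
  have -> : (fun p : nat => cpow (t + 1 + p%:R) (- s)) = (fun p : nat => (cpow (2 * pi%:C * 'i) (- s))^-1 * g (1 + p%:R)).
    by apply/funext => p; rewrite E2 mulKf.
  apply: absumZ; apply: (@absum_dom _ _ _ M) MZ => p.
  exact: seqcvg_cabs_le (L2 p) (fun n => b2 n p).
split=> //; apply: (proj1 (@seqcvg_shift R _ _ k)).
have C1 := tannery MZ b1 L1; have C2 := tannery MZ b2 L2.
have h := @seqcvgD R _ _ _ _ C2 C1.
have -> : cpow (2 * pi%:C * 'i) (- s) * (csum (fun p : nat => cpow (t + 1 + p%:R) (- s)) + csum (fun p : nat => cpow (t - p%:R) (- s)))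
   = csum (fun p : nat => g (1 + p%:R)) + csum (fun p : nat => g (- p%:R)).
  have -> : csum (fun p : nat => g (1 + p%:R)) = cpow (2 * pi%:C * 'i) (- s) * csum (fun p : nat => cpow (t + 1 + p%:R) (- s)).
    by rewrite -csumZ//; congr csum; apply/funext => p; exact: E2.
  have -> : csum (fun p : nat => g (- p%:R)) = cpow (2 * pi%:C * 'i) (- s) * csum (fun p : nat => cpow (t - p%:R) (- s)).
    by rewrite -csumZ//; congr csum; apply/funext => p; exact: E1.
  exact: mulrDr.
suff e n : \sum_(0 <= l < odd_nat (n + k)) cpow ((odd_nat (n + k))%:R * (1 - lip_q (odd_nat (n + k)) (t - (n + k)%:R + l%:R))) (- s) =
    csum (T2 (n + k)%N) + csum (T1 (n + k)%N) by exact (@seqcvg_ext R _ _ _ e h).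
move: (n + k)%N => {}n.
have [_ ->] : absum (T1 n) /\ csum (T1 n) = \sum_(0 <= p < n.+1) T1 n p.
  by apply: csum_finite => p np; rewrite /T1 leqNgt np.
have [_ ->] : absum (T2 n) /\ csum (T2 n) = \sum_(0 <= p < n) T2 n p.
  by apply: csum_finite => p np; rewrite /T2 ltnNge np.
have -> : (odd_nat n = n.+1 + n)%N by rewrite addSn addnn.
rewrite (@big_cat_nat _ _ _ n.+1) ?leq_addr//= addrC; congr (_ + _).
  rewrite -{1}[n.+1]add0n big_addn addKn !big_nat; apply: eq_bigr => p /andP[_ pn].
  rewrite /T2 pn /f; rewrite addSn addnn.
  suff -> : t - n%:R + (p + n.+1)%:R = t + (1 + p%:R : R)%:C by [].
  by rewrite e1p natrD -natr1; ring.
rewrite big_nat_rev /= !big_nat; apply: eq_bigr => p /andP[_ pn].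
rewrite add0n subSS /T1 -ltnS pn /f; rewrite addSn addnn.
suff -> : t - n%:R + (n - p)%:R = t + (- p%:R : R)%:C by [].
by rewrite rmorphN rmorph_nat natrB//; ring.
Qed.

Lemma lipschitz_formula t s : complex.Im t < 0 -> 1 < complex.Re s ->
  [/\ absum (fun p : nat => cpow (t + 1 + p%:R) (- s)), absum (fun p : nat => cpow (t - p%:R) (- s)) &
   csum (fun p : nat => cpow (t + 1 + p%:R) (- s)) + csum (fun p : nat => cpow (t - p%:R) (- s)) =
   cpow (2 * pi%:C * 'i) s * rgamma s *
     csum (fun k : nat => cpow k.+1%:R (s - 1) * cexp (- (2 * pi%:C * 'i * t * k.+1%:R)))].
Proof.
move=> t0 s1; have [A1 A2 L] := lip_left_limit t0 s1; have [_ Rt] := lip_right_limit t0 s1.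
split=> //; set X := csum _ + csum _ in L *; set Y := csum _ in Rt *.
suff E : cpow (2 * pi%:C * 'i) (- s) * X = rgamma s * Y.
  have c0 : cpow (2 * pi%:C * 'i) s != 0 :> C by exact: cpow_neq0.
  by rewrite -mulrA -E cpowN mulVKf.
(* The left side is centred at t - n to make the shifts symmetric. The right side does not change,
   since its exponentials have period 1 in t. *)
suff e n : \sum_(0 <= l < odd_nat n) cpow ((odd_nat n)%:R * (1 - lip_q (odd_nat n) (t - n%:R + l%:R))) (- s) =
    (odd_nat n)%:R * cpow (odd_nat n)%:R (- s) * csum (fun k => rbin s (k * odd_nat n) * cexp (- (2 * pi%:C * 'i * t * k%:R))).
  exact (@seqcvg_unique R _ _ _ L (@seqcvg_ext R _ _ _ e Rt)).
have Nn0 : (odd_nat n)%:R != 0 :> C by rewrite pnatr_eq0.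
have tn0 : complex.Im (t - n%:R) < 0 by rewrite ImD ImN (natC_real R n) /= oppr0 addr0.
have [_ F] := @lip_filter R (odd_nat n) (t - n%:R) s isT tn0.
have -> : csum (fun k => rbin s (k * odd_nat n) * cexp (- (2 * pi%:C * 'i * t * k%:R))) =
  csum (fun k => rbin s (k * odd_nat n) * cexp (- (2 * pi%:C * 'i * (t - n%:R) * k%:R))).
  congr csum; apply/funext => k; congr (_ * _).
  have -> : - (2 * pi%:C * 'i * (t - n%:R) * k%:R) = - (2 * pi%:C * 'i * t * k%:R) + (n * k)%:R * (2 * pi%:C * 'i) :> C.
    by rewrite natrM; ring.
  by rewrite cexpD cexp_muln cexp_2pii expr1n mulr1.
rewrite [RHS]mulrAC -F mulr_suml; apply: eq_bigr => l _.
have q0 : 1 - lip_q (odd_nat n) (t - n%:R + l%:R) != 0.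
  apply: Re_gt0_neq0; apply: Re_one_sub_lip_q => //.
  by rewrite ImD (natC_real R l) /= addr0.
by rewrite (natC_real R (odd_nat n)) cpow_posM// mulrC.
Qed.

End LipschitzFormula.

(** * Summation of Lipschitz's formula over the lattice *)

Section LatticeLipschitz.
Variable R : realType.
Local Notation C := R[i].
Implicit Types (s t z a q : C).

Lemma geometric_csum q : cabs q < 1 -> absum (fun n : nat => q ^+ n) /\ csum (fun n : nat => q ^+ n) = (1 - q)^-1.
Proof.
move=> q1; have r1 n : rbin 1 n = 1 :> C.
  by rewrite /rbin big1// => j _; rewrite addrC natr1 divff// pnatr_eq0.
have E : (fun n : nat => q ^+ n) = (fun n => rbin 1 n * q ^+ n) by apply/funext => n; rewrite r1 mul1r.
have [A S] := binomial_series 1 q1; rewrite E; split=> //; rewrite S cpowN cpow1//.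
apply: contraTneq q1 => /eqP; rewrite subr_eq0 => /eqP <-.
by rewrite cabs1 ltxx.
Qed.

Lemma geometric_lattice (r : nat) (q : 'I_r -> C) : (forall j, cabs (q j) < 1) ->
  absum (fun m : {ffun 'I_r -> nat} => \prod_(j < r) q j ^+ m j) /\
  csum (fun m : {ffun 'I_r -> nat} => \prod_(j < r) q j ^+ m j) = \prod_(j < r) (1 - q j)^-1.
Proof.
elim: r q => [|r IH] q q1.
  pose m0 : {ffun 'I_0 -> nat} := [ffun=> 0%N].
  have all0 m : m = m0 by apply/ffunP; case.
  have sub1 (B : {fset {ffun 'I_0 -> nat}}) : (B `<=` [fset m0])%fset.
    by apply/fsubsetP => m _; rewrite in_fset1 (all0 m).
  split.
    exists 1 => A; apply: le_trans (fsum_le_sub (fun=> cabs_ge0 _) (sub1 A)) _.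
    by rewrite big_seq_fset1 big_ord0 cabs1.
  apply: hasum_csumE => e e0; exists [fset m0]%fset => B hB.
  have -> : B = [fset m0]%fset by apply/eqP; rewrite eqEfsubset hB sub1.
  by rewrite big_seq_fset1 !big_ord0 subrr cabs0 ltW.
have [A0 S0] := geometric_csum (q1 ord0).
have [A1 S1] := IH (fun j => q (lift ord0 j)) (fun j => q1 _).
pose f (n : nat) := q ord0 ^+ n; pose g (m : {ffun 'I_r -> nat}) := \prod_(j < r) q (lift ord0 j) ^+ m j.
have E (p : nat * {ffun 'I_r -> nat}) : f p.1 * g p.2 = \prod_(j < r.+1) q j ^+ mcons p j.
  rewrite big_ord_recl /= /mcons ffunE unlift_none; congr (_ * _).
  by apply: eq_bigr => j _; rewrite ffunE liftK.
have Ap : absum (fun p : nat * {ffun 'I_r -> nat} => f p.1 * g p.2).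
  have [K0 hK0] := A0; have [K1 hK1] := A1; exists (K0 * K1).
  apply: bounded_sumsW (bounded_sums_prod (fun=> cabs_ge0 _) (fun=> cabs_ge0 _) hK0 hK1) => p.
  by rewrite cabsM.
have Am : absum (fun m : {ffun 'I_r.+1 -> nat} => \prod_(j < r.+1) q j ^+ m j).
  have H := absum_inj (can_inj (@munconsK r)) Ap.
  have -> // : (fun m : {ffun 'I_r.+1 -> nat} => \prod_(j < r.+1) q j ^+ m j) =
    (fun m => f (muncons m).1 * g (muncons m).2).
  by apply/funext => m; rewrite E munconsK.
split=> //; rewrite -(csum_reindex (@mconsK r) (@munconsK r) Am).
have -> : (fun p => \prod_(j < r.+1) q j ^+ mcons p j) = (fun p : nat * {ffun 'I_r -> nat} => f p.1 * g p.2).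
  by apply/funext => p; rewrite E.
have [_ B ->] := csum_fubini Ap; rewrite big_ord_recl -S0 -S1 mulrC -csumZ//.
by congr csum; apply/funext => n; rewrite csumZ// mulrC.
Qed.

Definition nexp t (n : nat) : C := cexp (- (2 * pi%:C * 'i * t * n%:R)).

Lemma cabs_nexp t n : cabs (nexp t n) = expR (2 * pi * complex.Im t) ^+ n.
Proof.
by rewrite /nexp cabs_cexp ReN (natC_real R n) Re_2pii_mul opprK -expRM_natl; congr expR; ring.
Qed.

Lemma expR_Im_lt1 t : complex.Im t < 0 -> expR (2 * pi * complex.Im t) < 1.
Proof. by move=> t0; rewrite expR_lt1 pmulr_rlt0// mulr_gt0// pi_gt0. Qed.

Section Twisted.
Variables (r : nat) (x : C) (w : 'I_r -> C).
Hypotheses (x0 : complex.Im x < 0) (w0 : forall j, complex.Im (w j) < 0).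

(** The Lambert term in variables already divided by the distinguished period. These lie in the
    lower half plane, where every [nexp] of positive index has modulus less than 1 and the geometric
    series converge. *)
Definition lambert_tau s (n : nat) : C :=
  cpow n%:R (s - 1) * nexp x n * \prod_(j < r) (1 - nexp (w j) n)^-1.

Lemma cabs_one_sub_nexp (j : 'I_r) n :
  cabs (1 - nexp (w j) n.+1)^-1 <= (1 - expR (2 * pi * complex.Im (w j)))^-1.
Proof.
have q1 := expR_Im_lt1 (w0 j); have q0 := expR_ge0 (2 * pi * complex.Im (w j)).
rewrite cabsV; apply: le_invr; first by rewrite subr_gt0.
have := le_cabs_dist 1 (nexp (w j) n.+1); rewrite cabs1 cabs_nexp exprS.
move: q1 q0; set e := expR _ => q1 q0 h.
have h1 : e ^+ n <= 1 by rewrite exprn_ile1// ltW.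
have h2 : e * e ^+ n <= e by rewrite ler_piMr.
by apply: le_trans h; apply: le_trans (ler_norm _); rewrite lerD2l lerN2.
Qed.

Lemma lambert_tau_bounds (S : R) : exists M : nat -> R, exists K, bounded_sums M K /\
  forall s n, cabs s <= S -> cabs (lambert_tau s n.+1) <= M n.
Proof.
pose e := expR (2 * pi * complex.Im x); have e1 : 0 < e < 1 by rewrite expR_gt0 expR_Im_lt1.
have [K hK] := @powR_geo_bounded R (S + 1) e e1.
pose P := \prod_(j < r) (1 - expR (2 * pi * complex.Im (w j)))^-1.
have P0 : 0 <= P.
  by apply: prodr_ge0 => j _; rewrite invr_ge0 subr_ge0 ltW// expR_Im_lt1.
exists (fun n => P * e * (n.+1%:R `^ (S + 1) * e ^+ n)), (P * e * K); split.
  by move=> A; rewrite -mulr_sumr ler_wpM2l// mulr_ge0// expR_ge0.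
move=> s n sS; rewrite /lambert_tau cabsM cabsM cabs_nexp -/e exprS.
have h1 : cabs (cpow n.+1%:R (s - 1)) <= n.+1%:R `^ (S + 1).
  rewrite (natC_real R n.+1) cabs_cpow_pos// ler_powR ?ler1n// ReD ReN /=.
  by have := le_Re_cabs s; lra.
have h2 : cabs (\prod_(j < r) (1 - nexp (w j) n.+1)^-1) <= P.
  rewrite cabs_prod; apply: ler_prod => j _; rewrite cabs_ge0; exact: cabs_one_sub_nexp.
have -> : P * e * (n.+1%:R `^ (S + 1) * e ^+ n) = n.+1%:R `^ (S + 1) * (e * e ^+ n) * P by ring.
by apply: ler_pM => //; rewrite ?mulr_ge0 ?cabs_ge0 ?exprn_ge0 ?expR_ge0// ler_wpM2r// mulr_ge0 ?exprn_ge0 ?expR_ge0.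
Qed.

Lemma lambert_tau_absum s : absum (fun n => lambert_tau s n.+1).
Proof.
have [M [K [MK h]]] := lambert_tau_bounds (cabs s).
by apply: absum_dom MK => n; exact: h.
Qed.

Lemma lambert_tau_entire s : cderivable (fun s => csum (fun n => lambert_tau s n.+1)) s.
Proof.
have [M [K [MK h]]] := lambert_tau_bounds (cabs s + 1).
apply: (@csum_cderivable _ _ (fun n s => lambert_tau s n.+1) M K s 1) => //; last first.
  by move=> n t; rewrite /cball => ht; apply: h; have := le_cabsD (t - s) s; rewrite subrK; lra.
move=> n t _; do 2 (apply: cderivableM; last exact: cderivable_cst).
by apply: cderivable_cpow; apply: cderivableB; [exact: cderivable_id|exact: cderivable_cst].
Qed.

Lemma Im_lat m : complex.Im (lat x w m) < 0.
Proof.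
rewrite /lat ImD Im_sum; apply: (@le_lt_trans _ _ (complex.Im x)) => //.
rewrite gerDl; apply: sumr_le0 => j _; rewrite Im_natM.
by rewrite mulr_ge0_le0// ltW.
Qed.

Lemma nexp_lat m n : nexp (lat x w m) n = nexp x n * \prod_(j < r) nexp (w j) n ^+ m j.
Proof.
have -> : \prod_(j < r) nexp (w j) n ^+ m j =
    cexp (\sum_(j < r) (m j)%:R * - (2 * pi%:C * 'i * w j * n%:R)).
  rewrite (big_morph _ (@cexpD R) (@cexp0 R)); apply: eq_bigr => j _.
  by rewrite /nexp -cexp_muln.
rewrite /nexp /lat -cexpD; congr cexp.
have -> : \sum_(j < r) (m j)%:R * - (2 * pi%:C * 'i * w j * n%:R) = - (2 * pi%:C * 'i * n%:R) * \sum_(j < r) (m j)%:R * w j.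
  by rewrite mulr_sumr; apply: eq_bigr => j _; ring.
by ring.
Qed.

(** Lipschitz's formula is applied at each lattice point. After exchanging the sums, the one over
    the lattice is a product of geometric series, whence the factors of [lambert_tau]. *)
Lemma csum_lipschitz s : 1 < complex.Re s ->
  csum (fun m : {ffun 'I_r -> nat} => csum (fun p : nat => cpow (lat x w m + 1 + p%:R) (- s)) +
    csum (fun p : nat => cpow (lat x w m - p%:R) (- s))) =
  cpow (2 * pi%:C * 'i) s * rgamma s * csum (fun n => lambert_tau s n.+1).
Proof.
move=> s1.
pose F (p : {ffun 'I_r -> nat} * nat) : C := cpow p.2.+1%:R (s - 1) * nexp (lat x w p.1) p.2.+1.
have -> : (fun m : {ffun 'I_r -> nat} => csum (fun p : nat => cpow (lat x w m + 1 + p%:R) (- s)) +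
    csum (fun p : nat => cpow (lat x w m - p%:R) (- s))) =
    (fun m => (cpow (2 * pi%:C * 'i) s * rgamma s) * csum (fun k => F (m, k))).
  by apply/funext => m; have [_ _ ->] := lipschitz_formula (Im_lat m) s1.
pose e := expR (2 * pi * complex.Im x); have e1 : 0 < e < 1 by rewrite expR_gt0 expR_Im_lt1.
have [K hK] := @powR_geo_bounded R (complex.Re s - 1) e e1.
pose rho j := expR (2 * pi * complex.Im (w j)).
have rho0 j : 0 <= rho j by exact: expR_ge0.
have q1 j : cabs ((rho j)%:C : C) < 1 by rewrite cabs_real ger0_norm// expR_Im_lt1.
have [[L hL] _] := geometric_lattice q1.
have aF : absum F.
  apply: (@absum_dom _ _ _ (fun p : {ffun 'I_r -> nat} * nat =>
     cabs (\prod_(j < r) (rho j)%:C ^+ p.1 j) * (e * (p.2.+1%:R `^ (complex.Re s - 1) * e ^+ p.2))) (L * (e * K))).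
    move=> [m k]; rewrite /F /= nexp_lat cabsM (natC_real R k.+1) cabs_cpow_pos// ReD ReN /=.
    rewrite cabsM cabs_nexp -/e !cabs_prod exprS.
    set A := _ `^ _; set B := \prod_(_ < _) _; set B' := \prod_(_ < _) _.
    have -> : B' * (e * (A * e ^+ k)) = A * (e * e ^+ k * B') by ring.
    apply: ler_wpM2l; first exact: powR_ge0.
    apply: ler_wpM2l; first by rewrite mulr_ge0 ?exprn_ge0 ?expR_ge0.
    apply: ler_prod => j _; rewrite cabs_ge0 /= !cabsX cabs_nexp -/(rho j) cabs_real ger0_norm//.
    apply: lerXn2r; rewrite ?nnegrE ?exprn_ge0// exprS ler_piMr// exprn_ile1// ltW// expR_Im_lt1//.
  have hK2 : bounded_sums (fun k : nat => e * (k.+1%:R `^ (complex.Re s - 1) * e ^+ k)) (e * K).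
    by move=> A; rewrite -mulr_sumr ler_wpM2l ?expR_ge0.
  apply: bounded_sumsW (bounded_sums_prod _ _ hL hK2) => // [m|k]; first exact: cabs_ge0.
  by rewrite !mulr_ge0 ?powR_ge0 ?exprn_ge0 ?expR_ge0.
have [_ aF2 _] := csum_fubini aF.
rewrite csumZ// (csum_exchange aF); congr (_ * csum _); apply/funext => k.
have q2 j : cabs (nexp (w j) k.+1) < 1.
  by rewrite cabs_nexp exprn_ilt1 ?expR_ge0 ?expR_Im_lt1.
have [G1 G2] := geometric_lattice q2.
rewrite /F /= /lambert_tau -G2 -csumZ//; congr csum; apply/funext => m.
by rewrite nexp_lat mulrA.
Qed.

End Twisted.

(* The sum over n in Z is taken first, after division by w0. *)
Lemma bilateral_csum (r : nat) (y w0 : C) (w : 'I_r -> C) s : 0 < complex.Im w0 -> 1 < complex.Re s ->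
  complex.Im (y / w0) < 0 -> (forall j, complex.Im (w j / w0) < 0) ->
  absum (fun p : nat * {ffun 'I_r -> nat} => cpow (lat (y + w0 + p.1%:R * w0) w p.2) (- s)) ->
  absum (fun p : nat * {ffun 'I_r -> nat} => cpow (lat (y + p.1%:R * - w0) w p.2) (- s)) ->
  csum (fun p : nat * {ffun 'I_r -> nat} => cpow (lat (y + w0 + p.1%:R * w0) w p.2) (- s)) +
  csum (fun p : nat * {ffun 'I_r -> nat} => cpow (lat (y + p.1%:R * - w0) w p.2) (- s)) =
  cpow w0 (- s) * (cpow (2 * pi%:C * 'i) s * rgamma s * csum (fun n => lambert_tau (y / w0) (fun j => w j / w0) s n.+1)).
Proof.
move=> hw0 s1 hy hw a1 a2; have wn0 := Im_gt0_neq0 hw0.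
have hcarg t : complex.Im t < 0 -> cpow (w0 * t) (- s) = cpow w0 (- s) * cpow t (- s).
  move=> t0; have tn0 : t != 0 by apply: contraTneq t0 => ->; rewrite ltxx.
  apply: cpowM => //; have /andP[c1 c2] := carg_Im_gt0 hw0; have /andP[b1 b2] := carg_bound tn0.
  have : carg t <= 0 by rewrite /carg (lt_geF t0) oppr_le0 acos_ge0// Re_div_cabs.
  by move: c1 c2 b1 b2; clear; lra.
pose T m := lat (y / w0) (fun j => w j / w0) m.
have T0 m : complex.Im (T m) < 0 by exact: Im_lat.
have TE m : lat y w m = w0 * T m.
  rewrite /T /lat mulrDr mulrCA divff// mulr1 mulr_sumr; congr (_ + _); apply: eq_bigr => j _.
  by rewrite mulrCA [w0 * _]mulrCA divff// mulr1.
have Imn (k : nat) : complex.Im (k%:R : C) = 0 by rewrite natC_real.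
have E1 (p : nat * {ffun 'I_r -> nat}) : cpow (lat (y + w0 + p.1%:R * w0) w p.2) (- s) = cpow w0 (- s) * cpow (T p.2 + 1 + p.1%:R) (- s).
  rewrite -hcarg; last by rewrite (ImD (T p.2 + 1)) (ImD (T p.2)) Imn (Imn 1) !addr0; exact: T0.
  suff -> : lat (y + w0 + p.1%:R * w0) w p.2 = w0 * (T p.2 + 1 + p.1%:R) by [].
  have := TE p.2; move: (T p.2) => t e; rewrite 2!mulrDr -e mulr1 /lat; ring.
have E2 (p : nat * {ffun 'I_r -> nat}) : cpow (lat (y + p.1%:R * - w0) w p.2) (- s) = cpow w0 (- s) * cpow (T p.2 - p.1%:R) (- s).
  rewrite -hcarg; last by rewrite (ImD (T p.2)) ImN Imn oppr0 addr0; exact: T0.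
  suff -> : lat (y + p.1%:R * - w0) w p.2 = w0 * (T p.2 - p.1%:R) by [].
  have := TE p.2; move: (T p.2) => t e; rewrite mulrDr -e /lat; ring.
have a1' := absum_swap a1; have a2' := absum_swap a2.
have swap (u : nat * {ffun 'I_r -> nat} -> C) : absum u -> csum u = csum (fun m => csum (fun p => u (p, m))).
  by move=> au; have [_ _ ->] := csum_fubini au; exact: csum_exchange.
rewrite (swap _ a1) (swap _ a2) /=.
have [_ b1 _] := csum_fubini a1'; have [_ b2 _] := csum_fubini a2'.
have := csum_lipschitz hy hw s1; rewrite -csumD//= => <-.
have c0 : cpow w0 (- s) != 0 by exact: cpow_neq0.
have sp m := lipschitz_formula (T0 m) s1.
have E m : csum (fun p : nat => cpow (lat (y + w0 + p%:R * w0) w m) (- s)) + csum (fun p : nat => cpow (lat (y + p%:R * - w0) w m) (- s)) =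
   cpow w0 (- s) * (csum (fun p : nat => cpow (T m + 1 + p%:R) (- s)) + csum (fun p : nat => cpow (T m - p%:R) (- s))).
  have [A1 A2 _] := sp m; rewrite mulrDr -!csumZ//.
  have -> : (fun p : nat => cpow (lat (y + w0 + p%:R * w0) w m) (- s)) = (fun p : nat => cpow w0 (- s) * cpow (T m + 1 + p%:R) (- s)).
    by apply/funext => p; exact: (E1 (p, m)).
  have -> // : (fun p : nat => cpow (lat (y + p%:R * - w0) w m) (- s)) = (fun p : nat => cpow w0 (- s) * cpow (T m - p%:R) (- s)).
  by apply/funext => p; exact: (E2 (p, m)).
have -> : (fun m : {ffun 'I_r -> nat} => csum (fun p : nat => cpow (lat (y + w0 + p%:R * w0) w m) (- s)) + csum (fun p : nat => cpow (lat (y + p%:R * - w0) w m) (- s)))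
  = (fun m => cpow w0 (- s) * (csum (fun p : nat => cpow (T m + 1 + p%:R) (- s)) + csum (fun p : nat => cpow (T m - p%:R) (- s)))).
  by apply/funext => m; exact: E.
rewrite csumZ//.
have -> : (fun m => csum (fun p : nat => cpow (T m + 1 + p%:R) (- s)) + csum (fun p : nat => cpow (T m - p%:R) (- s))) =
  (fun m => (cpow w0 (- s))^-1 * (csum (fun p : nat => cpow (lat (y + w0 + p%:R * w0) w m) (- s)) + csum (fun p : nat => cpow (lat (y + p%:R * - w0) w m) (- s)))).
  by apply/funext => m; rewrite E mulKf.
by apply: absumZ; exact: absumD b1 b2.
Qed.

End LatticeLipschitz.

(** * Meromorphy of the prefactors and identification of the Lambert series *)

Section MainTheorem.
Variable R : realType.
Local Notation C := R[i].
Implicit Types (s t a q : C).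

Lemma pi_neq0C : pi%:C != 0 :> C.
Proof. by rewrite -cabs_eq0 cabs_real normr_eq0 gt_eqF// pi_gt0. Qed.

Lemma i_neq0 : 'i != 0 :> C.
Proof. by rewrite -cabs_eq0 cabs_i oner_eq0. Qed.

Lemma csin_eq0_cexp s : csin (pi%:C * s) = 0 -> cexp (2 * pi%:C * 'i * s) = 1.
Proof.
move=> h; have : csin (pi%:C * s) * (2 * 'i) * cexp ('i * (pi%:C * s)) = 0 by rewrite h !mul0r.
have i2 : 2 * 'i != 0 :> C by rewrite mulf_neq0 ?i_neq0// pnatr_eq0.
rewrite /csin divfK//; set b : C := 'i * _; rewrite mulrBl (cexpNK b) -(cexpD b b) => /eqP.
rewrite subr_eq0 => /eqP e; have <- : b + b = 2 * pi%:C * 'i * s by rewrite /b; ring.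
exact: e.
Qed.

Lemma rgamma_neq0 s : 0 < complex.Re s -> rgamma s != 0.
Proof.
(* A zero in this strip would be a zero of sin(pi t) by reflection, so exp(2 pi i t) = 1 and t is 0
   or 1; the first has real part 0, and [rgamma 1] is 1. The functional equation moves other points
   into the strip. *)
have base t : 0 < complex.Re t <= 1 -> rgamma t != 0.
  move=> /andP[t0 t1]; apply/negP => /eqP g0.
  have h : csin (pi%:C * t) = 0.
    have := rgamma_reflection t; rewrite g0 mul0r => /esym /eqP.
    by rewrite mulf_eq0 invr_eq0 (negbTE pi_neq0C) orbF => /eqP.
  have e := csin_eq0_cexp h; have pi0 := @pi_gt0 R.
  have im u : complex.Im (2 * pi%:C * 'i * u) = 2 * pi * complex.Re u :> R.
    by rewrite ImM Re_2pii Im_2pii mul0r add0r.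
  have cancel u : 2 * pi%:C * 'i * u = 0 -> u = 0 :> C.
    by move=> /eqP; rewrite mulf_eq0 (negbTE (pi2i_neq0 R)) => /eqP.
  case: (ltP (complex.Re t) 1) => h1.
    have tz : t = 0.
      apply/cancel/cexp_eq1 => //; rewrite im ger0_norm ?mulr_ge0 ?(ltW t0) ?(ltW pi0)//.
      by rewrite gtr_pMr// mulr_gt0.
    by move: t0; rewrite tz /= ltxx.
  have tz : t - 1 = 0.
    apply/cancel/cexp_eq1.
      by rewrite im ReD ReN (le_anti (introT andP (conj t1 h1))) /= subrr mulr0 normr0 mulr_gt0.
    by rewrite mulrBr mulr1 cexpB e cexp_2pii divr1.
  by move/eqP: tz g0; rewrite subr_eq0 => /eqP ->; rewrite rgamma1 => /eqP; rewrite oner_eq0.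
move=> s0; have [N hN] : exists N : nat, complex.Re s <= N.+1%:R.
  by exists (Num.bound (complex.Re s)); apply: le_trans (ltW (archi_boundP (ltW s0))) _; rewrite ler_nat.
elim: N s s0 hN => [|N IH] s s0 hN; first by apply: base; rewrite s0.
case: (leP (complex.Re s) 1) => h1; first by apply: base; rewrite s0.
have := IH (s - 1); rewrite (rgamma_step (s - 1)) subrK mulf_eq0 negb_or.
rewrite ReD ReN /= subr_gt0 lerBlDr natr1 => /(_ h1 hN) /andP[_]; exact.
Qed.

(** Zeros of [rgamma] are simple. The explicit factorization shows directly that the inverse is
    meromorphic; it is carried leftwards by the functional equation, from the half plane where
    [rgamma] has no zeros. *)
Lemma rgamma_factor c : rgamma c != 0 \/
  exists h : C -> C, [/\ forall s, cderivable h s, h c != 0 & forall s, rgamma s = (s - c) * h s].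
Proof.
have [N hN] : exists N : nat, - complex.Re c < N%:R.
  exists (Num.bound `|complex.Re c|); apply: le_lt_trans (archi_boundP _) => //.
  by rewrite -normrN ler_norm.
elim: N c hN => [|N IH] c hN.
  by left; apply: rgamma_neq0; move: hN; rewrite oppr_lt0.
have [->|c0] := eqVneq c 0.
  right; exists (fun s => rgamma (s + 1)); split=> [s||s].
  - by apply: cderivable_comp (@rgamma_cderivable R _); apply: cderivableD; [exact: cderivable_id|exact: cderivable_cst].
  - by rewrite add0r rgamma1 oner_eq0.
  - by rewrite subr0 -rgamma_step.
have cN : - complex.Re (c + 1) < N%:R by rewrite ReD /=; move: hN; rewrite -natr1; lra.
have [h1|[h [hd hc hE]]] := IH (c + 1) cN; first by left; rewrite rgamma_step mulf_neq0.
right; exists (fun s => s * h (s + 1)); split=> [s||s].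
- apply: cderivableM; first exact: cderivable_id.
  by apply: cderivable_comp => //; apply: cderivableD; [exact: cderivable_id|exact: cderivable_cst].
- by rewrite mulf_neq0.
- by rewrite rgamma_step hE; ring.
Qed.

Lemma ccont_neq0 (f : C -> C) c : ccont_at f c -> f c != 0 ->
  exists2 d : R, 0 < d & forall s, cball c d s -> f s != 0.
Proof.
move=> hf f0; have [|d d0 hd] := hf (cabs (f c)); first by rewrite cabs_gt0.
exists d => // s /hd; apply: contraTneq => ->.
by rewrite sub0r cabsN ltxx.
Qed.

Lemma mero_at_inv_entire (f : C -> C) c : (forall s, cderivable f s) -> f c != 0 ->
  mero_at (fun s => (f s)^-1) c.
Proof.
move=> hf f0; apply: mero_at_holo; apply/holomorphic_atP.
have [d d0 hd] := ccont_neq0 (cderivable_cont (hf c)) f0.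
by exists d => // s /hd fs0; exact: cderivableV.
Qed.

Lemma mero_at_inv_factor (f h : C -> C) c : (forall s, cderivable h s) -> h c != 0 ->
  (forall s, f s = (s - c) * h s) -> mero_at (fun s => (f s)^-1) c.
Proof.
move=> hd hc fE; have -> : (fun s => (f s)^-1) = (fun s => (s - c)^-1 * (h s)^-1).
  by apply/funext => s; rewrite fE invfM.
by apply: mero_atM; [exact: mero_at_invB|exact: mero_at_inv_entire].
Qed.

Lemma rgamma_inv_mero c : mero_at (fun s => (rgamma s)^-1) c.
Proof.
case: (rgamma_factor c) => [h|[h [hd hc hE]]]; last exact: mero_at_inv_factor hE.
exact: mero_at_inv_entire (@rgamma_cderivable R) h.
Qed.

Lemma cderivable_1B s : cderivable (fun s => 1 - s) s.
Proof. by apply: cderivableB; [exact: cderivable_cst|exact: cderivable_id]. Qed.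

Lemma rgamma1B_inv_mero c : mero_at (fun s => (rgamma (1 - s))^-1) c.
Proof.
case: (rgamma_factor (1 - c)) => [h|[h [hd hc hE]]].
  apply: (@mero_at_inv_entire (fun s => rgamma (1 - s))) h => s.
  exact: cderivable_comp (@cderivable_1B s) (@rgamma_cderivable R _).
apply: (@mero_at_inv_factor (fun s => rgamma (1 - s)) (fun s => - h (1 - s))) => [s||s].
- by apply: cderivableN; exact: cderivable_comp (@cderivable_1B s) (hd _).
- by rewrite oppr_eq0.
- by rewrite hE; ring.
Qed.

Lemma csin_rgamma s : csin (pi%:C * s) = pi%:C * (rgamma s * rgamma (1 - s)).
Proof. by rewrite rgamma_reflection [RHS]mulrC divfK// pi_neq0C. Qed.

(** The reflection formula expresses the sine through two reciprocal Gamma values, so its zeros are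
    already covered by [rgamma_factor]. *)
Lemma csin_inv_mero c : mero_at (fun s => (2 * 'i * csin (pi%:C * s))^-1) c.
Proof.
have -> : (fun s => (2 * 'i * csin (pi%:C * s))^-1) =
    (fun s => (2 * 'i * pi%:C)^-1 * ((rgamma s)^-1 * (rgamma (1 - s))^-1)).
  by apply/funext => s; rewrite csin_rgamma -!invfM !mulrA.
apply: mero_atM; first exact: mero_at_cst.
by apply: mero_atM; [exact: rgamma_inv_mero|exact: rgamma1B_inv_mero].
Qed.

(* cGamma only differs from 1 / rgamma at its poles. *)
Lemma cGamma1B_mero c : mero_at (fun s => cGamma (1 - s)) c.
Proof.
apply: mero_at_near (rgamma1B_inv_mero c).
case: (rgamma_factor (1 - c)) => [h|[h [hd hc hE]]]; apply/dnearCP.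
  have hf s : cderivable (fun s => rgamma (1 - s)) s.
    exact: cderivable_comp (@cderivable_1B s) (@rgamma_cderivable R _).
  have [d d0 hd] := ccont_neq0 (cderivable_cont (hf c)) h.
  by exists d => // s _ /hd g0; rewrite cGamma_rgamma.
have hf s : cderivable (fun s => h (1 - s)) s.
  exact: cderivable_comp (@cderivable_1B s) (hd _).
have [d d0 hdd] := ccont_neq0 (cderivable_cont (hf c)) hc.
exists d => // s sc /hdd hs; rewrite cGamma_rgamma// hE mulf_neq0//.
by apply: contra_neq sc => e; apply/eqP; rewrite -subr_eq0 -oppr_eq0; apply/eqP; rewrite -e; ring.
Qed.

Lemma prod_neq_lift n (k : 'I_n.+1) (F : 'I_n.+1 -> C) :
  \prod_(j < n.+1 | j != k) F j = \prod_(j < n) F (lift k j).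
Proof.
rewrite big_mkcond /= (bigD1_ord k)//= eqxx /= mul1r; apply: eq_bigr => j _.
by rewrite eq_sym neq_lift.
Qed.

Lemma prod_if_lift n (k : 'I_n.+1) (P : pred 'I_n.+1) (F : 'I_n.+1 -> C) : ~~ P k ->
  \prod_(j < n.+1 | P j) F j = \prod_(j < n) (if P (lift k j) then F (lift k j) else 1).
Proof.
by move=> Pk; rewrite big_mkcond /= (bigD1_ord k)//= (negbTE Pk) mul1r.
Qed.

Lemma nexp_sum (I : finType) (P : pred I) (X : I -> C) n :
  nexp (\sum_(i | P i) X i) n = \prod_(i | P i) nexp (X i) n.
Proof.
rewrite /nexp mulr_sumr mulr_suml -sumrN (big_morph _ (@cexpD R) (@cexp0 R)).
by apply: eq_bigr.
Qed.

Lemma nexpD s t n : nexp (s + t) n = nexp s n * nexp t n.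
Proof. by rewrite /nexp -cexpD; congr cexp; ring. Qed.

Lemma nexpN t n : nexp (- t) n = (nexp t n)^-1.
Proof. by rewrite /nexp -cexpN; congr cexp; ring. Qed.

Lemma nexp_neq0 t n : nexp t n != 0.
Proof. exact: cexp_neq0. Qed.

Lemma inv_one_subV q : q != 0 -> (1 - q^-1)^-1 = - q * (1 - q)^-1.
Proof.
move=> q0; have -> : 1 - q^-1 = - (1 - q) * q^-1.
  by rewrite mulNr mulrBl mul1r mulfV// opprB.
by rewrite invfM invrK invrN mulrC mulrN mulNr.
Qed.

Section PeriodsAndPoint.
Variables (n : nat) (omega : 'I_n.+1 -> C) (z : C).

Lemma lambert_term_nexp e (k : 'I_n.+1) s m : e = 1 \/ e = -1 ->
  lambert_term (e * (2 * pi%:C * 'i)) z omega k s m =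
  cpow m%:R (s - 1) * nexp (- e * (z / omega k)) m *
    \prod_(j < n) (1 - nexp (- e * (omega (lift k j) / omega k)) m)^-1.
Proof.
move=> he; rewrite /lambert_term prod_neq_lift /nexp; congr (_ * cexp _ * _); first ring.
by apply: eq_bigr => j _; congr (1 - cexp _)^-1; ring.
Qed.

Lemma card_lift_lt (k : 'I_n.+1) : \prod_(j < n) (if (lift k j < k)%N then -1 else 1 : C) = (-1) ^+ k.
Proof.
rewrite -(prod_if_lift (P := fun j => (j < k)%N) (fun=> -1)) ?ltnn//.
rewrite prodr_const; congr (_ ^+ _).
rewrite -sum1_card -(big_ord_widen_cond n.+1 xpredT (fun=> 1%N)) ?sum1_card ?card_ord//; exact: ltnW.
Qed.

Lemma card_lift_gt (k : 'I_n.+1) : \prod_(j < n) (if (lift k j < k)%N then 1 else -1 : C) = (-1) ^+ (n - k).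
Proof.
have kn : (k <= n)%N by rewrite -ltnS.
have : \prod_(j < n) (if (lift k j < k)%N then -1 else 1 : C) * \prod_(j < n) (if (lift k j < k)%N then 1 else -1 : C) = (-1) ^+ n.
  rewrite -big_split /= (eq_bigr (fun=> -1)); first by rewrite prodr_const card_ord.
  by move=> j _; case: ifP; rewrite ?mulr1 ?mul1r.
rewrite card_lift_lt => h; apply: (@mulfI _ ((-1) ^+ k)); first by rewrite signr_eq0.
by rewrite h -exprD subnKC.
Qed.

(** With q_l standing for [nexp (omega l / omega k) m]: for l < k the shift of the point brings a
    factor q_l, which turns 1 / (1 - q_l) into - 1 / (1 - 1 / q_l); for l > k the flipped period
    gives 1 / (1 - 1 / q_l) at once. So k signs are left. In [lambert_tau_B] the roles of the two
    index ranges are exchanged. *)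
Lemma lambert_tau_A (k : 'I_n.+1) s m :
  lambert_tau ((\sum_(l < n.+1 | (l < k)%N) omega l - z) / omega k) (fun j => flip_from omega k j / omega k) s m =
  (-1) ^+ k * lambert_term (2 * pi%:C * 'i) z omega k s m.
Proof.
have := @lambert_term_nexp 1 k s m (or_introl erefl); rewrite mul1r => ->.
pose Q (j : 'I_n) := nexp (omega (lift k j) / omega k) m.
have -> : nexp (-1 * (z / omega k)) m = (nexp (z / omega k) m)^-1 by rewrite mulN1r nexpN.
have -> : \prod_(j < n) (1 - nexp (-1 * (omega (lift k j) / omega k)) m)^-1 = \prod_(j < n) (1 - (Q j)^-1)^-1.
  by apply: eq_bigr => j _; rewrite mulN1r nexpN.
rewrite /lambert_tau mulrBl nexpD nexpN mulr_suml nexp_sum.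
rewrite (@prod_if_lift n k (fun l : 'I_n.+1 => (l < k)%N) (fun l => nexp (omega l / omega k) m)) ?ltnn//.
rewrite -card_lift_lt; set P := cpow _ _; set Z := (nexp _ _)^-1.
transitivity (P * Z * \prod_(j < n) ((if (lift k j < k)%N then Q j else 1) * (1 - nexp (flip_from omega k j / omega k) m)^-1)).
  by rewrite big_split /=; ring.
transitivity (P * Z * \prod_(j < n) ((if (lift k j < k)%N then -1 else 1) * (1 - (Q j)^-1)^-1)); last first.
  by rewrite big_split /=; ring.
congr (_ * _); apply: eq_bigr => j _; rewrite /flip_from -/(Q j).
case: ifP => _; rewrite ?mul1r; last by rewrite mulNr nexpN.
have q0 : Q j != 0 by exact: nexp_neq0.
by rewrite (inv_one_subV q0) mulN1r mulNr opprK.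
Qed.

Lemma lambert_tau_B (k : 'I_n.+1) s m :
  lambert_tau ((z - \sum_(l < n.+1 | (k < l)%N) omega l) / omega k) (fun j => flip_from omega k j / omega k) s m =
  (-1) ^+ (n - k) * lambert_term (- (2 * pi%:C * 'i)) z omega k s m.
Proof.
have := @lambert_term_nexp (-1) k s m (or_intror erefl); rewrite mulN1r opprK => ->.
pose Q (j : 'I_n) := nexp (omega (lift k j) / omega k) m.
have -> : nexp (1 * (z / omega k)) m = nexp (z / omega k) m by rewrite mul1r.
have -> : \prod_(j < n) (1 - nexp (1 * (omega (lift k j) / omega k)) m)^-1 = \prod_(j < n) (1 - Q j)^-1.
  by apply: eq_bigr => j _; rewrite mul1r.
rewrite /lambert_tau mulrBl nexpD nexpN mulr_suml nexp_sum.
rewrite (@prod_if_lift n k (fun l : 'I_n.+1 => (k < l)%N) (fun l => nexp (omega l / omega k) m)) ?ltnn//.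
rewrite -card_lift_gt; set P := cpow _ _; set Z := nexp (z / omega k) m.
pose B (j : 'I_n) := if (k < lift k j)%N then Q j else 1.
have eB : \prod_(j < n) (B j)^-1 = (\prod_(j < n) B j)^-1 by rewrite prodfV.
transitivity (P * Z * \prod_(j < n) ((B j)^-1 * (1 - nexp (flip_from omega k j / omega k) m)^-1)).
  by rewrite big_split /= eB -!mulrA.
transitivity (P * Z * \prod_(j < n) ((if (lift k j < k)%N then 1 else -1) * (1 - Q j)^-1)); last first.
  by rewrite big_split /=; ring.
congr (_ * _); apply: eq_bigr => j _; rewrite /flip_from.
have q0 : Q j != 0 by exact: nexp_neq0.
have klj : (lift k j < k)%N = ~~ (k < lift k j)%N.
  rewrite -leqNgt ltn_neqAle; have := neq_lift k j; rewrite -(inj_eq (@ord_inj _)) eq_sym => ->.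
  by [].
rewrite klj /B; case: (k < lift k j)%N => /=; last by rewrite invr1.
by rewrite (mulNr (omega _)) nexpN -/(Q j) (inv_one_subV q0) mulrA mulrN mulVf.
Qed.

Lemma sum_from1E (u : nat -> C) : absum (fun m => u m.+1) ->
  cvgn (series_from1 u) /\ sum_from1 u = csum (fun m => u m.+1).
Proof.
move=> au; have h : seqcvg (series_from1 u) (csum (fun m => u m.+1)).
  apply: (proj1 (@seqcvg_shift R _ _ 1)).
  have e m : series_from1 u (m + 1)%N = \sum_(0 <= i < m) u i.+1.
    by rewrite /series_from1 addn1 big_add1.
  exact (@seqcvg_ext R _ _ _ e (hasum_series (absum_hasum au))).
split; last exact: seqcvg_lim h.
by apply/cvg_ex; exists (csum (fun m => u m.+1)); exact h.
Qed.

Variable a : 'I_n.+1 -> R.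
Hypotheses (n1 : (0 < n)%N) (hupper : forall j, 0 < complex.Im (omega j))
  (harg : forall j k : 'I_n.+1, (j < k)%N -> carg (omega j) < carg (omega k))
  (ha : forall k, 0 < a k < 1) (hz : z = \sum_(k < n.+1) (a k)%:C * omega k).

Let yA (k : 'I_n.+1) := \sum_(l < n.+1 | (l < k)%N) omega l - z.
Let yB (k : 'I_n.+1) := z - \sum_(l < n.+1 | (k < l)%N) omega l.
Let termA k s := lambert_term (2 * pi%:C * 'i) z omega k s.
Let termB k s := lambert_term (- (2 * pi%:C * 'i)) z omega k s.

Lemma Im_div_lt0 (k : 'I_n.+1) x : cross x (omega k) < 0 -> complex.Im (x / omega k) < 0.
Proof.
move=> h; rewrite cross_div pmulr_llt0// invr_gt0 exprn_gt0// cabs_gt0.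
exact: Im_gt0_neq0.
Qed.

Lemma Im_yA k : complex.Im (yA k / omega k) < 0.
Proof. by apply: Im_div_lt0; have [h _ _ _] := cross_corners n1 hupper harg ha hz k. Qed.

Lemma Im_yB k : complex.Im (yB k / omega k) < 0.
Proof. by apply: Im_div_lt0; have [_ _ _ h] := cross_corners n1 hupper harg ha hz k. Qed.

Lemma Im_flip k j : complex.Im (flip_from omega k j / omega k) < 0.
Proof. by apply: Im_div_lt0; exact: cross_flip. Qed.

(** The signs of the alternating sums cancel those created by [lambert_tau_A] and [lambert_tau_B],
    which leaves plain sums of Lambert series with a factor common to all [k]. *)
Lemma lambert_sums (k : 'I_n.+1) : [/\
  forall s, cvgn (series_from1 (termA k s)), forall s, cvgn (series_from1 (termB k s)),
  forall s, cderivable (fun s => sum_from1 (termA k s)) s &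
  forall s, cderivable (fun s => sum_from1 (termB k s)) s] /\
  forall s, n.+1%:R < complex.Re s ->
  (-1) ^+ k * bilateral_zeta (yA k) (omega k) (flip_from omega k) s =
    cpow (2 * pi%:C * 'i) s * rgamma s * (cpow (omega k) (- s) * sum_from1 (termA k s)) /\
  (-1) ^+ (n - k) * bilateral_zeta (yB k) (omega k) (flip_from omega k) s =
    cpow (2 * pi%:C * 'i) s * rgamma s * (cpow (omega k) (- s) * sum_from1 (termB k s)).
Proof.
have sq (m : nat) : (-1) ^+ m * (-1) ^+ m = 1 :> C by rewrite -exprMn mulrNN mulr1 expr1n.
pose w (j : 'I_n) := flip_from omega k j / omega k.
have EA s : (fun m => termA k s m.+1) = (fun m => (-1) ^+ k * lambert_tau (yA k / omega k) w s m.+1).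
  by apply/funext => m; rewrite lambert_tau_A mulrA sq mul1r.
have EB s : (fun m => termB k s m.+1) = (fun m => (-1) ^+ (n - k) * lambert_tau (yB k / omega k) w s m.+1).
  by apply/funext => m; rewrite lambert_tau_B mulrA sq mul1r.
have tA := lambert_tau_absum (Im_yA k) (@Im_flip k); have tB := lambert_tau_absum (Im_yB k) (@Im_flip k).
have aA s : absum (fun m => termA k s m.+1) by rewrite EA; exact: absumZ.
have aB s : absum (fun m => termB k s m.+1) by rewrite EB; exact: absumZ.
have SA s : sum_from1 (termA k s) = (-1) ^+ k * csum (fun m => lambert_tau (yA k / omega k) w s m.+1).
  by rewrite (proj2 (sum_from1E (aA s))) EA csumZ.
have SB s : sum_from1 (termB k s) = (-1) ^+ (n - k) * csum (fun m => lambert_tau (yB k / omega k) w s m.+1).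
  by rewrite (proj2 (sum_from1E (aB s))) EB csumZ.
split.
  split=> s; first exact: (proj1 (sum_from1E (aA s))); first exact: (proj1 (sum_from1E (aB s))).
    have -> : (fun s => sum_from1 (termA k s)) = (fun s => (-1) ^+ k * csum (fun m => lambert_tau (yA k / omega k) w s m.+1)) by apply/funext.
    by apply: cderivableM; [exact: cderivable_cst|exact: lambert_tau_entire (Im_yA k) (@Im_flip k) s].
  have -> : (fun s => sum_from1 (termB k s)) = (fun s => (-1) ^+ (n - k) * csum (fun m => lambert_tau (yB k / omega k) w s m.+1)) by apply/funext.
  by apply: cderivableM; [exact: cderivable_cst|exact: lambert_tau_entire (Im_yB k) (@Im_flip k) s].
move=> s hs; have s1 : 1 < complex.Re s by apply: le_lt_trans hs; rewrite ler1n.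
have [_ _ [b1 b2] EzA] := bilateral_zetaE n1 hupper harg ha hz hs (or_introl (erefl (yA k))).
have [_ _ [b3 b4] EzB] := bilateral_zetaE n1 hupper harg ha hz hs (or_intror (erefl (yB k))).
split.
  rewrite [bilateral_zeta _ _ _ _]EzA (bilateral_csum (hupper k) s1 (Im_yA k) (@Im_flip k) b1 b2) SA; ring.
rewrite [bilateral_zeta _ _ _ _]EzB (bilateral_csum (hupper k) s1 (Im_yB k) (@Im_flip k) b3 b4) SB; ring.
Qed.

End PeriodsAndPoint.

End MainTheorem.

(** * Constants and the starting point for the identity theorem *)

Section Conclusion.
Variable R : realType.
Local Notation C := R[i].
Implicit Types s : C.

Lemma cexp_iM (x : R) : cexp (x%:C * 'i) = cos x +i* sin x.
Proof. by rewrite /cexp ReZ ImZ /= mulr0 mulr1 expR0 !mul1r. Qed.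

Lemma cexp_pii : cexp (pi%:C * 'i) = -1 :> C.
Proof. by rewrite cexp_iM cospi sinpi; apply: eqCP; rewrite /= ?oppr0. Qed.

Lemma cpow_2pii s : cpow (2 * pi%:C * 'i) s / (2 * pi%:C * 'i) =
  cpow (2 * pi%:C) (s - 1) * cexp (pi%:C / 2 * 'i * (s - 1)) :> C.
Proof.
have p2 : 0 < 2 * pi :> R by rewrite mulr_gt0// pi_gt0.
have p2E : 2 * pi%:C = (2 * pi)%:C :> C by rewrite rmorphM rmorph_nat.
have i1 : clog 'i = (pi%:C / 2) * 'i :> C.
  have e : pi%:C / 2 = (pi / 2)%:C :> C by rewrite rmorphM fmorphV rmorph_nat.
  have pi0 := @pi_gt0 R.
  apply: clog_unique; rewrite e; last by rewrite ImZ /=; lra.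
  by rewrite cexp_iM cos_pihalf sin_pihalf.
have -> : cpow (2 * pi%:C * 'i) s / (2 * pi%:C * 'i) = cpow (2 * pi%:C * 'i) (s - 1).
  by rewrite cpowD [cpow _ (-1)]cpowN cpow1// pi2i_neq0.
rewrite p2E cpow_posM ?i_neq0//; congr (_ * _).
by rewrite cpowE i1 mulrC.
Qed.

Lemma csin_pi_cderivable s : cderivable (fun s => csin (pi%:C * s)) s.
Proof.
have -> : (fun s => csin (pi%:C * s)) = (fun s : C => pi%:C * (rgamma s * rgamma (1 - s))).
  by apply/funext => t; exact: csin_rgamma.
apply: cderivableM; first exact: cderivable_cst.
apply: cderivableM; first exact: rgamma_cderivable.
exact: cderivable_comp (@cderivable_1B R s) (@rgamma_cderivable R _).
Qed.

(** Supplies points of arbitrarily large real part where the prefactors can be cancelled. *)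
Lemma csin_half_integer (m : nat) : csin (pi%:C * (m%:R + 2^-1)) != 0 :> C.
Proof.
apply/negP => /eqP /csin_eq0_cexp.
have two0 : 2 != 0 :> C by rewrite pnatr_eq0.
have -> : 2 * pi%:C * 'i * (m%:R + 2^-1) = m%:R * (2 * pi%:C * 'i) + pi%:C * 'i * (2 / 2) :> C by ring.
rewrite divff// mulr1 cexpD cexp_muln cexp_2pii expr1n mul1r cexp_pii => /eqP.
by rewrite eq_sym -subr_eq0 opprK (_ : 1 + 1 = 2) ?(negbTE two0).
Qed.

End Conclusion.

Theorem theorem5p4 (R : realType) (r : nat) (hr : (2 <= r)%N)
    (omega : 'I_r -> R[i])
    (hupper : forall j : 'I_r, 0 < complex.Im (omega j))
    (harg : forall j k : 'I_r, (j < k)%N -> carg (omega j) < carg (omega k))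
    (z : R[i])
    (hz : exists a : 'I_r -> R,
        (forall k : 'I_r, 0 < a k < 1) /\ z = \sum_(k < r) (a k)%:C * omega k) :
  [/\ mero_eq (barnes_zeta z omega)
        (fun s : R[i] => (2 * 'i * csin (pi%:C * s))^-1 *
          (\sum_(k < r) (-1) ^+ k *
              bilateral_zeta (\sum_(l < r | (l < k)%N) omega l - z)
                (omega k) (flip_from omega k) s
           - \sum_(k < r) (-1) ^+ (r - k.+1) * cexp (- (pi%:C * 'i * s)) *
              bilateral_zeta (z - \sum_(l < r | (k < l)%N) omega l)
                (omega k) (flip_from omega k) s)),
      (forall (k : 'I_r) (s : R[i]),
        cvgn (series_from1 (lambert_term (2 * pi%:C * 'i) z omega k s)) /\
        cvgn (series_from1 (lambert_term (- (2 * pi%:C * 'i)) z omega k s))) &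
      mero_eq (barnes_zeta z omega)
        (fun s : R[i] => cpow (2 * pi%:C) (s - 1) * cGamma (1 - s) *
          (cexp (pi%:C / 2 * 'i * (s - 1)) *
             \sum_(k < r) cpow (omega k) (- s) *
               sum_from1 (lambert_term (2 * pi%:C * 'i) z omega k s)
           + cexp (- (pi%:C / 2 * 'i * (s - 1))) *
             \sum_(k < r) cpow (omega k) (- s) *
               sum_from1 (lambert_term (- (2 * pi%:C * 'i)) z omega k s)))].
Proof.
case: r hr omega hupper harg hz => [//|n] n1 {}omega {}hupper {}harg [a [ha hz]].
rewrite ltnS in n1.
have [mZ Z1] := barnes_zetaP (ltac:(by []) : 0 <= complex.Re ('i : R[i])) (z_halfplane hupper ha hz) (omega_halfplane hupper).
have LS (k : 'I_n.+1) := lambert_sums n1 hupper harg ha hz k.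
pose LA (s : R[i]) : R[i] := \sum_(k < n.+1) cpow (omega k) (- s) * sum_from1 (lambert_term (2 * pi%:C * 'i) z omega k s).
pose LB (s : R[i]) : R[i] := \sum_(k < n.+1) cpow (omega k) (- s) * sum_from1 (lambert_term (- (2 * pi%:C * 'i)) z omega k s).
have dpow (x : R[i]) s : cderivable (fun s => cpow x (- s)) s.
  by apply: cderivable_cpow; apply: cderivableN; exact: cderivable_id.
have dLA s : cderivable LA s.
  by apply: cderivable_sum => k _; apply: cderivableM => //; have [[_ _ h _] _] := LS k.
have dLB s : cderivable LB s.
  by apply: cderivable_sum => k _; apply: cderivableM => //; have [[_ _ _ h] _] := LS k.
(* [bilateral_zetaE] yields the meromorphy together with values at a point of convergence; [s2] is
   such a point. *)
pose s2 : R[i] := n.+2%:R.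
have hs2 : n.+1%:R < complex.Re s2 by rewrite /s2 natC_real /= ltr_nat.
have mA (k : 'I_n.+1) : meromorphic (bilateral_zeta (\sum_(l < n.+1 | (l < k)%N) omega l - z) (omega k) (flip_from omega k)).
  by have [] := bilateral_zetaE n1 hupper harg ha hz hs2 (or_introl (erefl (\sum_(l < n.+1 | (l < k)%N) omega l - z))).
have mB (k : 'I_n.+1) : meromorphic (bilateral_zeta (z - \sum_(l < n.+1 | (k < l)%N) omega l) (omega k) (flip_from omega k)).
  by have [] := bilateral_zetaE n1 hupper harg ha hz hs2 (or_intror (erefl (z - \sum_(l < n.+1 | (k < l)%N) omega l))).
have dexp (x : R[i]) s : cderivable (fun s => cexp (- (x * s))) s.
  apply: cderivable_cexp; apply: cderivableN; apply: cderivableM; first exact: cderivable_cst.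
  exact: cderivable_id.
have dB1 s : cderivable (fun s : R[i] => s - 1) s.
  by apply: cderivableB; [exact: cderivable_id|exact: cderivable_cst].
pose F1 (s : R[i]) : R[i] := (2 * 'i * csin (pi%:C * s))^-1 *
  (\sum_(k < n.+1) (-1) ^+ k *
      bilateral_zeta (\sum_(l < n.+1 | (l < k)%N) omega l - z) (omega k) (flip_from omega k) s
   - \sum_(k < n.+1) (-1) ^+ (n.+1 - k.+1) * cexp (- (pi%:C * 'i * s)) *
      bilateral_zeta (z - \sum_(l < n.+1 | (k < l)%N) omega l) (omega k) (flip_from omega k) s).
pose F2 (s : R[i]) : R[i] := cpow (2 * pi%:C) (s - 1) * cGamma (1 - s) *
  (cexp (pi%:C / 2 * 'i * (s - 1)) * LA s + cexp (- (pi%:C / 2 * 'i * (s - 1))) * LB s).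
have mF1 : meromorphic F1.
  move=> c; apply: mero_atM; first exact: csin_inv_mero.
  apply: mero_atB; apply: mero_at_sum => k _; apply: mero_atM.
  - exact: mero_at_cst.
  - exact: mA.
  - by apply: mero_atM; [exact: mero_at_cst|apply: mero_at_entire => s; exact: dexp].
  - exact: mB.
have mF2 : meromorphic F2.
  move=> c; apply: mero_atM.
    by apply: mero_atM; [apply: mero_at_entire => s; exact: cderivable_cpow|exact: cGamma1B_mero].
  apply: mero_atD; apply: mero_at_entire => s; apply: cderivableM => //.
    by apply: cderivable_cexp; apply: cderivableM => //; exact: cderivable_cst.
  by apply: cderivable_cexp; apply: cderivableN; apply: cderivableM => //; exact: cderivable_cst.
have key s : n.+1%:R < complex.Re s -> csin (pi%:C * s) != 0 ->
    barnes_zeta z omega s = F1 s /\ barnes_zeta z omega s = F2 s.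
  move=> hs sin0; have i2 : 2 * 'i != 0 :> R[i] by rewrite mulf_neq0 ?i_neq0// pnatr_eq0.
  have AB := alternating_bilateral n1 hupper harg ha hz hs; rewrite -Z1// in AB.
  have Dsin : cexp (pi%:C * 'i * s) - cexp (- (pi%:C * 'i * s)) = 2 * 'i * csin (pi%:C * s).
    rewrite /csin [RHS]mulrC divfK//.
    by have -> : 'i * (pi%:C * s) = pi%:C * 'i * s by ring.
  rewrite Dsin in AB; split.
    rewrite /F1; apply: (mulfI (mulf_neq0 i2 sin0)); rewrite -AB mulVKf//; exact: mulf_neq0.
  have SA : \sum_(k < n.+1) (-1) ^+ k * bilateral_zeta (\sum_(l < n.+1 | (l < k)%N) omega l - z) (omega k) (flip_from omega k) s
      = cpow (2 * pi%:C * 'i) s * rgamma s * LA s.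
    by rewrite mulr_sumr; apply: eq_bigr => k _; have [_ h] := LS k; have [] := h s hs.
  have SB : \sum_(k < n.+1) (-1) ^+ (n.+1 - k.+1) * cexp (- (pi%:C * 'i * s)) *
        bilateral_zeta (z - \sum_(l < n.+1 | (k < l)%N) omega l) (omega k) (flip_from omega k) s
      = cexp (- (pi%:C * 'i * s)) * (cpow (2 * pi%:C * 'i) s * rgamma s * LB s).
    rewrite !mulr_sumr; apply: eq_bigr => k _; have [_ h] := LS k; have [_ <-] := h s hs.
    by rewrite subSS mulrAC mulrC.
  rewrite SA SB csin_rgamma in AB.
  (* A nonzero sine forces both reciprocal Gamma values to be nonzero, which allows the
     cancellations and lets [cGamma (1 - s)] be read as an inverse. *)
  have [g0 g1] : rgamma s != 0 /\ rgamma (1 - s) != 0.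
    by move: sin0; rewrite csin_rgamma !mulf_eq0 !negb_or => /and3P[_ -> ->].
  set e := cexp (pi%:C / 2 * 'i * (s - 1)); set E := cexp (- (pi%:C * 'i * s)) in AB.
  (* The square of [e] is exp(pi i (s - 1)), so multiplying by [E] leaves exp(- pi i). Hence - e E
     is the inverse of [e], which accounts for the exponential in front of the second Lambert
     sum. *)
  have eE : e * e * E = -1.
    have two0 : 2 != 0 :> R[i] by rewrite pnatr_eq0.
    have ex : pi%:C / 2 * 'i * (s - 1) + pi%:C / 2 * 'i * (s - 1) + - (pi%:C * 'i * s) = - (pi%:C * 'i) :> R[i].
      by field.
    by rewrite /e /E -!cexpD ex cexpN cexp_pii invrN invr1.
  have e0 : e != 0 by exact: cexp_neq0.
  have eV : e^-1 = - (e * E) by apply: (mulfI e0); rewrite divff// mulrN mulrA eE opprK.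
  have cP := cpow_2pii s; rewrite -/e in cP; have p2 := pi2i_neq0 R.
  have {}cP : cpow (2 * pi%:C * 'i) s = cpow (2 * pi%:C) (s - 1) * e * (2 * pi%:C * 'i).
    by rewrite -cP divfK.
  have nz : 2 * 'i * (pi%:C * (rgamma s * rgamma (1 - s))) != 0 :> R[i].
    by apply: (mulf_neq0 i2); apply: mulf_neq0; [exact: pi_neq0C|exact: mulf_neq0].
  have -> : F2 s = cpow (2 * pi%:C) (s - 1) * (rgamma (1 - s))^-1 * (e * LA s + e^-1 * LB s).
    by rewrite /F2 cGamma_rgamma// -cexpN.
  apply: (mulfI nz); rewrite -AB cP eV.
  move: (cpow (2 * pi%:C) (s - 1)) (e) (E) (LA s) (LB s) (rgamma s) (rgamma (1 - s)) g1 => c e' E' A B g h h0.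
  transitivity (2 * 'i * pi%:C * g * c * (e' * A - e' * E' * B) * (h / h)); last by ring.
  by rewrite divff//; ring.
(* The identity theorem asks for agreement near one point only. At n + 5/2 the sine is nonzero, and
   the ball of radius 1 stays in the half plane Re s > n + 1. *)
have sin0 := csin_half_integer R n.+2.
have [d d0 hd] := ccont_neq0 (cderivable_cont (@csin_pi_cderivable R _)) sin0.
pose c0 : R[i] := n.+2%:R + 2^-1.
have near_c0 (F : R[i] -> R[i]) : (forall s, n.+1%:R < complex.Re s -> csin (pi%:C * s) != 0 -> barnes_zeta z omega s = F s) ->
    eq_punctured (barnes_zeta z omega) F c0.
  move=> h; apply/eq_puncturedP; exists (Num.min d 1); first by rewrite lt_min d0 ltr01.
  move=> s _; rewrite lt_min => /andP[s1 s3]; apply: h; last exact: hd.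
  have : `|complex.Re (s - c0)| < 1 by apply: le_lt_trans s3; exact: le_cabs_Re.
  have rc : n.+2%:R < complex.Re c0.
    have -> : c0 = (n.+2%:R + 2^-1 : R)%:C by rewrite rmorphD fmorphV !rmorph_nat.
    by rewrite /= ltrDl invr_gt0.
  by rewrite ReD ReN ltr_norml => /andP[h1 _]; move: rc h1; rewrite -(natr1 n.+1); lra.
split.
- split=> //; apply: (mero_identity_plane mZ mF1 (c0 := c0)); apply: near_c0 => s h1 h2.
  by have [] := key s h1 h2.
- by move=> k s; have [[h1 h2 _ _] _] := LS k; split; [exact: h1|exact: h2].
- split=> //; apply: (mero_identity_plane mZ mF2 (c0 := c0)); apply: near_c0 => s h1 h2.
  by have [] := key s h1 h2.
Qed.
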